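(* Suppose $\boldsymbol{f}\in L_2(0,T;[L_2(\Omega)]^d)$, $\boldsymbol{g}_N\in L_2(0,T;[L_2(\Gamma_N)]^d)$ and $\boldsymbol{w}_0\in\boldsymbol{V}$. Then there exists a unique family $(\boldsymbol{W}_h^n)_{n=0}^N\subset\boldsymbol{V}^h$ solving the fully discrete problem: for all $\boldsymbol{v}\in\boldsymbol{V}^h$, $$\Big(\rho\frac{\boldsymbol{W}_h^{n+1}-\boldsymbol{W}_h^n}{\Delta t},\boldsymbol{v}\Big)+a\Big(\frac{\boldsymbol{q}_{n+1}(\boldsymbol{W}_h)+\boldsymbol{q}_n(\boldsymbol{W}_h)}{2},\boldsymbol{v}\Big)=\frac12\big(F(t_{n+1};\boldsymbol{v})+F(t_n;\boldsymbol{v})\big),\quad n=0,\ldots,N-1,$$ $$a(\boldsymbol{W}_h^0,\boldsymbol{v})=a(\boldsymbol{w}_0,\boldsymbol{v}),$$ and it satisfies $$\max_{0\le n\le N}\|\boldsymbol{W}_h^n\|_{L_2(\Omega)}^2+\frac{\Delta t^{2-\alpha}}{\Gamma(3-\alpha)}\sum_{n=0}^{N-1}\|\boldsymbol{W}_h^{n+1}+\boldsymbol{W}_h^n\|_V^2\le CT\bigg(\|\boldsymbol{w}_0\|_V^2+\Delta t\sum_{n=0}^N\|\boldsymbol{f}(t_n)\|_{L_2(\Omega)}^2+\Delta t\sum_{n=0}^N h^{-1}\|\boldsymbol{g}_N(t_n)\|_{L_2(\Gamma_N)}^2\bigg),$$ where $C>0$ is independent of the solution, $\Delta t$ and $h$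.
   Context: Let $d\in\{1,2,3\}$, let $\Omega\subset\mathbb{R}^d$ be an open bounded convex polytopic domain, $\Gamma_D\subset\partial\Omega$ of positive measure (Dirichlet boundary), $\Gamma_N=\partial\Omega\setminus\Gamma_D$ (Neumann boundary). Let $T>0$, $\rho>0$ constant, $\alpha\in(0,1)$. $(\cdot,\cdot)$ is the $L_2(\Omega)$ inner product. $\boldsymbol{V}=\{\boldsymbol{v}\in[H^1(\Omega)]^d : \boldsymbol{v}=\boldsymbol{0}\text{ on }\Gamma_D\}$. $\boldsymbol{V}^h\subset\boldsymbol{V}$ is the conforming Lagrange finite element space of (vector-valued) piecewise polynomials of degree $k$ on a conforming mesh of mesh size $h$; the meshes are assumed quasi-uniform. The strain is $\varepsilon_{ij}(\boldsymbol{v})=\frac12(\partial v_i/\partial x_j+\partial v_j/\partial x_i)$. $\hat{\boldsymbol{D}}$ is a symmetric positive definite, piecewise constant fourth order tensor ($\hat D_{ijkl}=\hat D_{jikl}=\hat D_{ijlk}=\hat D_{klij}$). $a(\boldsymbol{w},\boldsymbol{v})=\int_\Omega\hat{\boldsymbol{D}}\boldsymbol{\varepsilon}(\boldsymbol{w}):\boldsymbol{\varepsilon}(\boldsymbol{v})\,d\Omega$ and $\|\boldsymbol{v}\|_V=\sqrt{a(\boldsymbol{v},\boldsymbol{v})}$. $F(t;\boldsymbol{v})=(\boldsymbol{f}(t),\boldsymbol{v})+(\boldsymbol{g}_N(t),\boldsymbol{v})_{L_2(\Gamma_N)}$, with the nodal values $\boldsymbol{f}(t_n),\boldsymbol{g}_N(t_n)$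 being those used in the scheme. Time grid: $\Delta t=T/N$, $N\in\mathbb{N}$, $t_n=n\Delta t$. The operator $\boldsymbol{q}_n$ approximates the fractional integral ${}_0I_t^{1-\alpha}\boldsymbol{w}(t_n)=\frac{1}{\Gamma(1-\alpha)}\int_0^{t_n}(t_n-s)^{-\alpha}\boldsymbol{w}(s)\,ds$ by replacing $\boldsymbol{w}$ with its piecewise linear interpolant on the time grid: for a sequence (or function evaluated at the nodes) $(\boldsymbol{W}^i)$ and $n\ge1$, $$\boldsymbol{q}_n(\boldsymbol{W})=\frac{\Delta t^{1-\alpha}}{\Gamma(3-\alpha)}\sum_{i=0}^nB_{n,i}\boldsymbol{W}^i,$$ $$B_{n,i}=\begin{cases}n^{1-\alpha}(2-\alpha-n)+(n-1)^{2-\alpha},&i=0,\\(n-i-1)^{2-\alpha}+(n-i+1)^{2-\alpha}-2(n-i)^{2-\alpha},&i=1,\ldots,n-1,\\1,&i=n,\end{cases}$$ and $\boldsymbol{q}_0(\boldsymbol{W})=\boldsymbol{0}$ (integral over the empty interval). *)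

(* Defs.v *)
From HB Require Import structures.
From mathcomp Require Import all_boot all_order all_algebra.
From mathcomp Require Import all_classical all_reals all_analysis.
From mathcomp Require Import measurable_realfun.

Set Implicit Arguments.
Unset Strict Implicit.
Unset Printing Implicit Defensive.

Import Order.TTheory GRing.Theory Num.Theory.
Import numFieldTopology.Exports numFieldNormedType.Exports.

Local Open Scope classical_set_scope.
Local Open Scope ring_scope.

Definition rV_display : measure_display. Proof. exact: default_measure_display. Qed.

(* The product sigma-algebra on R^n, which is the Borel one. *)
Section rV_measurable.
Context {R : realType} {n : nat}.

Definition rV_coord (i : 'I_n) (x : 'rV[R]_n) : R := x ord0 i.

Let rV_set0 : g_sigma_preimage rV_coord set0.
Proof. exact: sigma_algebra0. Qed.

Let rV_setC A : g_sigma_preimage rV_coord A -> g_sigma_preimage rV_coord (~` A).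
Proof. exact: sigma_algebraC. Qed.

Let rV_bigcup (F : (set 'rV[R]_n)^nat) :
  (forall i, g_sigma_preimage rV_coord (F i)) ->
  g_sigma_preimage rV_coord (\bigcup_i (F i)).
Proof. exact: sigma_algebra_bigcup. Qed.

HB.instance Definition _ := @isMeasurable.Build rV_display
  'rV[R]_n (g_sigma_preimage rV_coord) rV_set0 rV_setC rV_bigcup.

Lemma measurable_coord (i : 'I_n) :
  measurable_fun [set: 'rV[R]_n] (fun x : 'rV[R]_n => x ord0 i).
Proof.
move=> _ Y mY; rewrite setTI; apply: sub_sigma_algebra => /=.
rewrite -bigcup_seq/=; exists i => /=; first by rewrite mem_index_enum.
by exists Y => //; rewrite setTI.
Qed.

Lemma measurable_fun_rV d (T : measurableType d) (f : T -> 'rV[R]_n) :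
  (forall i, measurable_fun setT (fun x => f x ord0 i)) ->
  measurable_fun setT f.
Proof.
move=> mf; apply: measurability; first by [].
move=> _ [A HA <-].
move: HA => /=; rewrite -bigcup_seq => -[i _ [B mB <-]].
rewrite setTI; have := mf i measurableT B mB; rewrite setTI.
by rewrite setTI; exact.
Qed.

End rV_measurable.

(* Lebesgue measure on R^n, by recursion on n through product measures. *)
Section lebesgue_rV.
Context {R : realType}.

Definition rV_cons n (p : R * 'rV[R]_n) : 'rV[R]_n.+1 :=
  \row_j oapp (p.2 ord0) p.1 (unlift ord0 j).

Definition rV_uncons n (x : 'rV[R]_n.+1) : R * 'rV[R]_n :=
  (x ord0 ord0, \row_j x ord0 (lift ord0 j)).

Lemma rV_cons0 n (p : R * 'rV[R]_n) : rV_cons p ord0 ord0 = p.1.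
Proof. by rewrite mxE unlift_none. Qed.

Lemma rV_consS n (p : R * 'rV[R]_n) (j : 'I_n) :
  rV_cons p ord0 (lift ord0 j) = p.2 ord0 j.
Proof. by rewrite mxE liftK. Qed.

Lemma rV_consK n : cancel (@rV_cons n) (@rV_uncons n).
Proof.
move=> p; rewrite /rV_uncons rV_cons0 [RHS]surjective_pairing.
by congr pair; apply/rowP => j; rewrite mxE rV_consS.
Qed.

Lemma measurable_rV_cons n : measurable_fun setT (@rV_cons n).
Proof.
apply: measurable_fun_rV => i; case: (unliftP ord0 i) => [j ->|->].
  rewrite (_ : (fun p => _) = (fun y : 'rV[R]_n => y ord0 j) \o snd).
    exact: (measurableT_comp (measurable_coord j) measurable_snd).
  by apply/funext => p; rewrite rV_consS.
rewrite (_ : (fun p => _) = fst) //.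
by apply/funext => p; rewrite rV_cons0.
Qed.

Lemma measurable_rV_uncons n : measurable_fun setT (@rV_uncons n).
Proof.
apply/measurable_fun_pairP; split; first exact: measurable_coord.
apply: measurable_fun_rV => i.
rewrite (_ : (fun p => _) = (fun y : 'rV[R]_n.+1 => y ord0 (lift ord0 i))).
  exact: measurable_coord.
by apply/funext => p; rewrite /= mxE.
Qed.

Section step.
Variables (n : nat) (m : {sigma_finite_measure set 'rV[R]_n -> \bar R}).

Definition lebesgue_step : set 'rV[R]_n.+1 -> \bar R :=
  pushforward (lebesgue_measure \x m)%E (@rV_cons n).

Let ls0 : lebesgue_step set0 = 0%E.
Proof. by rewrite /lebesgue_step /pushforward preimage_set0 measure0. Qed.

Let ls_ge0 A : (0 <= lebesgue_step A)%E.
Proof. by rewrite /lebesgue_step /pushforward measure_ge0. Qed.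

Let ls_additive : semi_sigma_additive lebesgue_step.
Proof.
move=> F mF tF mUF.
have mc A : measurable A -> measurable (@rV_cons n @^-1` A).
  by move=> mA; rewrite -[X in measurable X]setTI; exact: measurable_rV_cons.
rewrite /lebesgue_step /pushforward preimage_bigcup.
apply: measure_semi_sigma_additive => [k||].
- exact: mc.
- apply/trivIsetP => /= i j _ _ ij; rewrite -preimage_setI.
  by move/trivIsetP : tF => /(_ _ _ _ _ ij) ->//; rewrite preimage_set0.
- by rewrite -preimage_bigcup; exact: mc.
Qed.

HB.instance Definition _ := isMeasure.Build _ _ _ lebesgue_step
  ls0 ls_ge0 ls_additive.

Let ls_sigma_finite : sigma_finite setT lebesgue_step.
Proof.
have /sigma_finiteP[F [TF ndF Foo]] := sigma_finiteT (@lebesgue_measure R).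
have /sigma_finiteP[G [TG ndG Goo]] := sigma_finiteT m.
exists (fun k => @rV_uncons n @^-1` (F k `*` G k)).
  rewrite -preimage_bigcup -[LHS](@preimage_setT _ _ (@rV_uncons n)).
  congr (_ @^-1` _); rewrite -setXTT TF TG predeqE => -[x y]; split.
    move=> [/= [k _ Fkx] [l _ Gly]]; exists (maxn k l) => //; split.
    - by move: x Fkx; exact/subsetPset/ndF/leq_maxl.
    - by move: y Gly; exact/subsetPset/ndG/leq_maxr.
  by move=> [k _ []/= ? ?]; split; exists k.
move=> k; have [mF Foo'] := Foo k; have [mG Goo'] := Goo k; split.
  rewrite -[X in measurable X]setTI; apply: measurable_rV_uncons => //.
  exact: measurableX.
rewrite /= /lebesgue_step /pushforward -comp_preimage.
rewrite (_ : _ \o _ = id); last by apply/funext => p; rewrite /= rV_consK.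
rewrite preimage_id product_measure1E//.
by rewrite lte_mul_pinfty// ge0_fin_numE.
Qed.

HB.instance Definition _ := Measure_isSigmaFinite.Build _ _ _ lebesgue_step
  ls_sigma_finite.

End step.

Fixpoint lebesgue_rV n : {sigma_finite_measure set 'rV[R]_n -> \bar R} :=
  match n with
  | 0%N => (\d_(0 : 'rV[R]_0))%R
  | n'.+1 => lebesgue_step (lebesgue_rV n')
  end.

End lebesgue_rV.

Definition dotv {R : realType} {d : nat} (x y : 'rV[R]_d) : R :=
  \sum_i x ord0 i * y ord0 i.
(* The library's norm on 'rV is the sup norm. *)
Definition enorm {R : realType} {d : nat} (x : 'rV[R]_d) : R :=
  Num.sqrt (dotv x x).

Definition open_halfspaces {R : realType} {d m : nat} (nu : 'I_m -> 'rV[R]_d)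
    (b : 'I_m -> R) : set 'rV[R]_d :=
  [set x | forall i, dotv (nu i) x < b i].

(* Every bounded convex open polytope has such a representation: unit outer
   normals, each used once. *)
Record polytopic_domain (R : realType) (d : nat) := PolytopicDomain {
  nfacets : nat;
  normal : 'I_nfacets -> 'rV[R]_d;
  offset : 'I_nfacets -> R;
  _ : forall i, enorm (normal i) = 1;
  _ : injective normal;
  _ : open_halfspaces normal offset !=set0;
  _ : bounded_set (open_halfspaces normal offset)
}.

Definition domain_set {R : realType} {d : nat} (P : polytopic_domain R d) :
  set 'rV[R]_d := open_halfspaces (normal (p := P)) (offset (p := P)).

Definition boundary {R : realType} {d : nat} (P : polytopic_domain R d) :
  set 'rV[R]_d := closure (domain_set P) `\` domain_set P.

Section surface_measure.
Context {R : realType} {d : nat} (P : polytopic_domain R d).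
Implicit Types (A : set 'rV[R]_d) (i : 'I_(nfacets P)).
Local Notation lam := (@lebesgue_rV R d).

Definition slab i : set 'rV[R]_d :=
  [set x | offset i <= dotv (normal i) x <= offset i + 1].
Definition facet_proj i (x : 'rV[R]_d) : 'rV[R]_d :=
  x - (dotv (normal i) x - offset i) *: normal i.
Definition facet i : set 'rV[R]_d :=
  [set x | dotv (normal i) x = offset i /\
           forall j : 'I_(nfacets P), dotv (normal j) x <= offset j].

Lemma measurable_dotv (v : 'rV[R]_d) : measurable_fun setT (dotv v).
Proof.
apply: measurable_sum => i; apply: measurable_funM; first exact: measurable_cst.
exact: measurable_coord.
Qed.

Lemma measurable_slab i : measurable (slab i).
Proof.
rewrite (_ : slab i = dotv (normal i) @^-1` `[offset i, offset i + 1]).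
  by rewrite -[X in measurable X]setTI; apply: measurable_dotv.
by apply/seteqP; split => x /=; rewrite in_itv.
Qed.

Lemma measurable_facet_proj i : measurable_fun setT (facet_proj i).
Proof.
apply: measurable_fun_rV => j.
rewrite (_ : (fun x => _) = (fun x : 'rV[R]_d => x ord0 j -
    (dotv (normal i) x - offset i) * normal i ord0 j)); last first.
  by apply/funext => x; rewrite !mxE.
apply: measurable_funB; first exact: measurable_coord.
apply: measurable_funM; last exact: measurable_cst.
by apply: measurable_funB; [exact: measurable_dotv|exact: measurable_cst].
Qed.

Lemma measurable_facet i : measurable (facet i).
Proof.
rewrite (_ : facet i = dotv (normal i) @^-1` [set offset i] `&`
  \bigcap_(j in [set: 'I_(nfacets P)]) (dotv (normal j) @^-1` `]-oo, offset j])).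
  apply: measurableI.
    by rewrite -[X in measurable X]setTI; apply: measurable_dotv.
  apply: fin_bigcap_measurable => // j _.
  by rewrite -[X in measurable X]setTI; apply: measurable_dotv.
apply/seteqP; split => x [/= xi H]; split => // j; have := H j; rewrite /= in_itv //=.
by apply.
Qed.

(* Surface measure on the boundary.  The area of a part A of facet i is the
   volume of the prism {x + s nu | x in A, 0 <= s <= 1} with nu = normal i,
   which is the intersection of slab i with the preimage of A under the
   orthogonal projection on the hyperplane of the facet.  In dimension one this
   is the counting measure on the two end points. *)
Definition surface A : \bar R := (\sum_(i < nfacets P)
  lam (slab i `&` facet_proj i @^-1` (A `&` facet i)))%E.

Let measurable_prism i A : measurable A ->
  measurable (slab i `&` facet_proj i @^-1` (A `&` facet i)).
Proof.
move=> mA; apply: measurableI; first exact: measurable_slab.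
rewrite -[X in measurable X]setTI; apply: measurable_facet_proj => //.
by apply: measurableI => //; exact: measurable_facet.
Qed.

Let surface0 : surface set0 = 0%E.
Proof.
by rewrite /surface big1// => i _; rewrite set0I preimage_set0 setI0 measure0.
Qed.

Let surface_ge0 A : (0 <= surface A)%E.
Proof. exact: sume_ge0. Qed.

Let surface_sigma_additive : semi_sigma_additive surface.
Proof.
move=> F mF tF mUF; rewrite [X in _ --> X](_ : _ =
    lim ((fun n => \sum_(0 <= i < n) surface (F i))%E @ \oo)).
  by apply: is_cvg_ereal_nneg_natsum => k _; exact: sume_ge0.
rewrite nneseries_sum//; apply: eq_bigr => /= i _.
rewrite setI_bigcupl preimage_bigcup setI_bigcupr.
apply: measure_semi_bigcup => //.
- by move=> k; apply: measurable_prism; exact: mF.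
- apply/trivIsetP => /= k l _ _ kl.
  rewrite setIACA setIid -preimage_setI setIACA.
  by move/trivIsetP : tF => /(_ _ _ _ _ kl) ->//; rewrite set0I preimage_set0 setI0.
- by apply: bigcup_measurable => k _; apply: measurable_prism; exact: mF.
Qed.

HB.instance Definition _ := isMeasure.Build _ _ _ surface
  surface0 surface_ge0 surface_sigma_additive.

End surface_measure.

Section L2_spaces.
Context {disp : measure_display} {T : measurableType disp} {R : realType}.
Variables (mu : {measure set T -> \bar R}) (A : set T).

Definition L2 (u : T -> R) : Prop :=
  measurable_fun A u /\ (\int[mu]_(x in A) ((u x) ^+ 2)%:E < +oo)%E.

Definition vL2 {n : nat} (u : T -> 'rV[R]_n) : Prop :=
  forall i, L2 (fun x => u x ord0 i).

Definition L2prod {n : nat} (u v : T -> 'rV[R]_n) : R :=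
  \int[mu]_(x in A) dotv (u x) (v x).

Definition L2norm {n : nat} (u : T -> 'rV[R]_n) : R := Num.sqrt (L2prod u u).

Definition L2_simple {n : nat} (s : R -> T -> 'rV[R]_n) : Prop :=
  exists (p : nat) (E : 'I_p -> set R) (c : 'I_p -> T -> 'rV[R]_n),
    (forall i, measurable (E i)) /\ (forall i, vL2 (c i)) /\
    forall t x, s t x = \sum_i (\1_(E i) t : R) *: c i x.

(* The Bochner space L_2(0,tmax; L_2(A)^n): the values f t are in L_2(A)^n for
   almost every t, t |-> f t is strongly measurable and its norm is square
   integrable. *)
Definition bochner_L2 {n : nat} (tmax : R) (f : R -> T -> 'rV[R]_n) : Prop :=
  {ae lebesgue_measure, forall t : R, 0 < t < tmax -> vL2 (f t)} /\
  (exists s : nat -> R -> T -> 'rV[R]_n,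
    (forall m, L2_simple (s m)) /\
    {ae lebesgue_measure, forall t : R, 0 < t < tmax ->
      (fun m => L2norm (fun x => s m t x - f t x)) @ \oo --> (0 : R)}) /\
  (\int[lebesgue_measure]_(t in [set t : R | (0 < t < tmax)%R])
     (L2norm (f t) ^+ 2)%:E < +oo)%E.

End L2_spaces.

Section sobolev.
Context {R : realType} {d : nat}.
Implicit Types (Om : set 'rV[R]_d) (P : polytopic_domain R d).
Implicit Types (u g phi : 'rV[R]_d -> R) (w v : 'rV[R]_d -> 'rV[R]_d).
Local Notation lam := (@lebesgue_rV R d).

Definition unit_vec (i : 'I_d) : 'rV[R]_d := delta_mx ord0 i.

Definition partial (i : 'I_d) phi : 'rV[R]_d -> R :=
  fun x => 'D_(unit_vec i) phi x.

Definition smooth phi : Prop := forall s : seq 'I_d,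
  continuous (foldr partial phi s) /\
  forall i x, derivable (foldr partial phi s) x (unit_vec i).

Definition test_function Om phi : Prop :=
  smooth phi /\ compact (closure [set x | phi x != 0]) /\
  closure [set x | phi x != 0] `<=` Om.

Definition is_weak_partial Om (i : 'I_d) u g : Prop :=
  L2 lam Om g /\ forall phi, test_function Om phi ->
    \int[lam]_(x in Om) (u x * partial i phi x) =
    - \int[lam]_(x in Om) (g x * phi x).

(* For u in H^1 this is a representative, unique up to a null set. *)
Definition weak_partial Om (i : 'I_d) u : 'rV[R]_d -> R :=
  xget (fun=> 0) [set g | is_weak_partial Om i u g].

Definition H1 Om u : Prop :=
  L2 lam Om u /\ forall i, exists g, is_weak_partial Om i u g.

Definition H1dist2 Om u phi : R :=
  \int[lam]_(x in Om) ((u x - phi x) ^+ 2) +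
  \sum_i \int[lam]_(x in Om) ((weak_partial Om i u x - partial i phi x) ^+ 2).

(* The trace operator is the continuous extension of phi |-> phi|_boundary from
   smooth functions to H^1. *)
Definition is_trace P u g : Prop :=
  L2 (surface P) (boundary P) g /\
  exists phi : nat -> 'rV[R]_d -> R,
    (forall n, smooth (phi n)) /\
    ((fun n => H1dist2 (domain_set P) u (phi n)) @ \oo --> (0 : R)) /\
    ((fun n => \int[surface P]_(x in boundary P) ((phi n x - g x) ^+ 2))
       @ \oo --> (0 : R)).

Definition Vspace P (GD : set 'rV[R]_d) v : Prop :=
  forall j, H1 (domain_set P) (fun x => v x ord0 j) /\
    exists g, is_trace P (fun x => v x ord0 j) g /\
      {ae surface P, forall x, GD x -> g x = 0}.

Definition strain Om v (x : 'rV[R]_d) (i j : 'I_d) : R :=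
  2^-1 * (weak_partial Om j (fun y => v y ord0 i) x +
          weak_partial Om i (fun y => v y ord0 j) x).

Definition tensor4 := 'I_d -> 'I_d -> 'I_d -> 'I_d -> R.

Definition tensor_symmetric (D : tensor4) : Prop := forall i j k l,
  [/\ D i j k l = D j i k l, D i j k l = D i j l k & D i j k l = D k l i j].

Definition tensor_posdef (D : tensor4) : Prop := forall e : 'M[R]_d,
  e^T = e -> e != 0 ->
  0 < \sum_i \sum_j (\sum_k \sum_l D i j k l * e k l) * e i j.

Definition piecewise_constant Om (D : 'rV[R]_d -> tensor4) : Prop :=
  exists (p : nat) (Q : 'I_p -> set 'rV[R]_d),
    [/\ forall a, measurable (Q a), Om `<=` \bigcup_(a in [set: 'I_p]) Q a &
        forall a x y, (Om `&` Q a) x -> (Om `&` Q a) y -> D x = D y].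

Definition aform Om (D : 'rV[R]_d -> tensor4) w v : R :=
  \int[lam]_(x in Om) (\sum_i \sum_j
    (\sum_k \sum_l D x i j k l * strain Om w x k l) * strain Om v x i j).

Definition Vnorm Om (D : 'rV[R]_d -> tensor4) v : R :=
  Num.sqrt (aform Om D v v).

(* Used for v in V^h only, whose trace is its pointwise boundary value. *)
Definition load P (GN : set 'rV[R]_d) (f g : 'rV[R]_d -> 'rV[R]_d) v : R :=
  L2prod lam (domain_set P) f v + L2prod (surface P) GN g v.

End sobolev.

Section finite_elements.
Context {R : realType} {d : nat}.

(* A d-simplex is given by the matrix of its d + 1 vertices (rows). *)
Definition mesh := seq 'M[R]_(d.+1, d).

(* The vertices are affinely independent. *)
Definition nondegenerate (K : 'M[R]_(d.+1, d)) : Prop :=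
  row_free (row_mx (const_mx 1 : 'cV[R]_d.+1) K).

(* The convex hull of the vertices selected by S (empty if there is none). *)
Definition face (K : 'M[R]_(d.+1, d)) (S : pred 'I_d.+1) : set 'rV[R]_d :=
  [set x | exists c : 'rV[R]_d.+1,
     [/\ forall i, 0 <= c ord0 i, \sum_i c ord0 i = 1,
         forall i, ~~ S i -> c ord0 i = 0 & x = c *m K]].

Definition simplex (K : 'M[R]_(d.+1, d)) : set 'rV[R]_d := face K predT.

Definition common_vertices (K L : 'M[R]_(d.+1, d)) : pred 'I_d.+1 :=
  [pred i | [exists j, row i K == row j L]].

Definition conforming (Om : set 'rV[R]_d) (Th : mesh) : Prop :=
  [/\ forall K, K \in Th -> nondegenerate K,
      \bigcup_(K in [set` Th]) simplex K = closure Om &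
      forall K L, K \in Th -> L \in Th ->
        simplex K `&` simplex L = face K (common_vertices K L)].

Definition diam (A : set 'rV[R]_d) : R :=
  sup [set enorm (z.1 - z.2) | z in A `*` A].

Definition mesh_size (Th : mesh) : R :=
  \big[Num.max/0]_(K <- Th) diam (simplex K).

(* Every element contains a ball of radius comparable to the mesh size,
   uniformly over the family M of meshes. *)
Definition quasi_uniform (M : set mesh) : Prop :=
  exists kappa : R, 0 < kappa /\
    forall Th, M Th -> forall K, K \in Th -> exists z : 'rV[R]_d,
      [set x | enorm (x - z) < kappa * mesh_size Th] `<=` simplex K.

Definition is_polynomial (k : nat) (p : 'rV[R]_d -> R) : Prop :=
  exists c : {ffun 'I_d -> 'I_k.+1} -> R, forall x,
    p x = \sum_(m : {ffun 'I_d -> 'I_k.+1} | (\sum_i m i <= k)%N)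
            c m * \prod_i x ord0 i ^+ m i.

(* Only the values on the closure of the domain matter. *)
Definition Vh (P : polytopic_domain R d) (GD : set 'rV[R]_d) (k : nat)
    (Th : mesh) (v : 'rV[R]_d -> 'rV[R]_d) : Prop :=
  [/\ Vspace P GD v,
      {within closure (domain_set P), continuous v} &
      forall K, K \in Th -> forall j, exists p,
        is_polynomial k p /\ {in simplex K, forall x, v x ord0 j = p x}].

End finite_elements.
Arguments mesh : clear implicits.
Arguments tensor4 : clear implicits.

Section scheme.
Context {R : realType} {d : nat}.

Definition Gamma (z : R) : R :=
  \int[lebesgue_measure]_(t in `]0, +oo[) (t `^ (z - 1) * expR (- t)).

(* Meant for i <= n and 0 < n, where the truncated subtractions are exact. *)
Definition Bcoef (alpha : R) (n i : nat) : R :=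
  if i == 0%N then
    n%:R `^ (1 - alpha) * (2 - alpha - n%:R) + n.-1%:R `^ (2 - alpha)
  else if (i < n)%N then
    (n - i - 1)%:R `^ (2 - alpha) + (n - i + 1)%:R `^ (2 - alpha)
    - 2 * (n - i)%:R `^ (2 - alpha)
  else 1.

Definition qop (alpha dt : R) (n : nat) (W : nat -> 'rV[R]_d -> 'rV[R]_d) :
    'rV[R]_d -> 'rV[R]_d := fun x =>
  if n == 0%N then 0
  else (dt `^ (1 - alpha) / Gamma (3 - alpha)) *:
         \sum_(i < n.+1) Bcoef alpha n i *: W i x.

(* V is the discrete space; only W 0, ..., W N are meaningful. *)
Definition fully_discrete_solution (P : polytopic_domain R d)
    (GN : set 'rV[R]_d) (D : 'rV[R]_d -> tensor4 R d) (rho alpha tmax : R)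
    (f g : R -> 'rV[R]_d -> 'rV[R]_d) (w0 : 'rV[R]_d -> 'rV[R]_d)
    (N : nat) (V : ('rV[R]_d -> 'rV[R]_d) -> Prop)
    (W : nat -> 'rV[R]_d -> 'rV[R]_d) : Prop :=
  let Om := domain_set P in
  let dt := tmax / N%:R in
  let t (n : nat) : R := n%:R * dt in
  let q := qop alpha dt in
  [/\ forall n, (n <= N)%N -> V (W n),
      forall n, (n < N)%N -> forall v, V v ->
        L2prod (@lebesgue_rV R d) Om
          (fun x => rho *: (dt^-1 *: (W n.+1 x - W n x))) v
        + aform Om D (fun x => 2^-1 *: (q n.+1 W x + q n W x)) v
        = 2^-1 * (load P GN (f (t n.+1)) (g (t n.+1)) v
                  + load P GN (f (t n)) (g (t n)) v) &
      forall v, V v -> aform Om D (W 0%N) v = aform Om D w0 v].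

End scheme.

(* Main.v *)
Require Import Defs.
From mathcomp Require Import all_boot all_order all_algebra.
From mathcomp Require Import all_classical all_reals all_analysis.
From mathcomp Require Import measurable_realfun ring lra.

Set Implicit Arguments.
Unset Strict Implicit.
Unset Printing Implicit Defensive.

Import Order.TTheory GRing.Theory Num.Theory.
Import numFieldTopology.Exports numFieldNormedType.Exports.

Local Open Scope classical_set_scope.
Local Open Scope ring_scope.

(* Writing Y^n = W^(n+1) + W^n, the sum q_(n+1) + q_n is a discrete convolution of
   the Y^i, plus a bounded multiple of W^0.  For m >= 1 its weights beta_m are second
   differences of x^(2 - alpha), hence nonnegative, decreasing and convex in m.
   Testing the scheme with Y^n, a kernel of this shape, continued to m = 0 by
   2 beta_1 - beta_2, bounds the convolution term from below by a telescoping
   nonnegative history energy; the excess 1 - (2 beta_1 - beta_2) of the diagonal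
   weight, increased by half of this continuation, is positive and gives the sum of
   the squares of the energy norms of the Y^n.

   The L_2 norm of W^0 is bounded by its energy norm through a Korn-Poincare
   inequality that needs no compactness.  On the segment from x to w = x + e the
   derivative of e . v is eps(v) e . e, so (e . v(x))^2 is controlled by the strain
   and the trace of v at w.  When w ranges over a subset of the boundary of positive
   measure, the directions w - x span the space, so the average of (e . v(x))^2 over w
   is coercive in v(x), uniformly in x.

   The Neumann load is absorbed with a discrete trace inequality, which costs the
   factor 1/h.  Existence and uniqueness follow from the definiteness of the linear
   system of each time step in a basis of V^h. *)

(** With p = 2 - alpha, 2 beta_1 - beta_2 equals 4 * 2^p - 3^p - 5, which tends to 2 as alpha tends
    to 0 and then exceeds beta_0 = 1: the kernel itself need not be convex at the origin, and the
    plain excess of its diagonal weight may be negative. The half returned by the telescoping step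
    repairs this. The total 1 - (2 beta_1 - beta_2) / 2 degenerates in the limit alpha = 0, so the
    constant depends on alpha. The multiple of W^0 is paid at every step by Young's inequality with
    the energy of W^0, which is at most that of w_0 because W^0 is its Ritz projection. The loads
    are absorbed into the largest L_2 norm over the grid, without a Gronwall argument. A strain
    along single segments makes sense for smooth fields, so the Korn-Poincare inequality is proved
    for them; the smooth sequences in the definition of a trace carry it over to V. Segments from
    the facet to points near it become tangential to it, hence two stages: v is controlled on a
    small box away from the facet, and from this box on the whole domain. *)

(** * Lebesgue measure on R^n: affine changes of variable, slices, Tonelli *)

Section lebesgue_affine.
Context {R : realType}.
Local Notation mu := (@lebesgue_measure R).
Variables (a b : R).
Hypothesis a0 : 0 < a.

Let affine (x : measurableTypeR R) : measurableTypeR R := a * x + b.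

Let maffine : measurable_fun setT affine.
Proof.
by apply: measurable_funD; [apply: measurable_funM|]; exact: measurable_cst || exact: measurable_id.
Qed.

Let scaled_affine (mf : measurable_fun setT affine) :
  {measure set (measurableTypeR R) -> \bar R} :=
  measure_function_pushforward__canonical__measure_function_Measure mu mf.

(** The rescaled pushforward is a measure with the right values on half-open intervals, and these
    determine Lebesgue measure. *)
Lemma lebesgue_measure_affine (A : set R) : measurable A ->
  mu A = (a%:E * mu (affine @^-1` A))%E.
Proof.
move=> mA.
pose m := mscale (NngNum (ltW a0)) (scaled_affine maffine).
transitivity (m A); last by [].
apply: lebesgue_measure_unique => //= _ [[c e]] _ <-.
rewrite /mscale/= /pushforward.
rewrite (_ : affine @^-1` _ = `](c - b) / a, (e - b) / a]%classic); last first.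
  apply/seteqP; split => x /=; rewrite !in_itv /= /affine.
    by rewrite ltr_pdivrMr// ler_pdivlMr// mulrC ltrBlDr lerBrDr.
  by rewrite ltr_pdivrMr// ler_pdivlMr// mulrC ltrBlDr lerBrDr.
rewrite !lebesgue_measure_itv/= !lte_fin ltr_pM2r ?invr_gt0// ltrD2r.
case: ifP => _; last by rewrite mule0.
by rewrite -!EFinB -EFinM; congr EFin; field; rewrite gt_eqF.
Qed.

Lemma ge0_integral_affine (f : R -> \bar R) :
  measurable_fun setT f -> (forall x, 0 <= f x)%E ->
  (\int[mu]_x f x = a%:E * \int[mu]_x f (a * x + b)%R)%E.
Proof.
move=> mf f0.
rewrite [in RHS](_ : \int[mu]_x f (a * x + b)%R = \int[pushforward mu affine]_x f x)%E; last first.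
  by rewrite ge0_integral_pushforward.
pose m := mscale (NngNum (ltW a0)) (scaled_affine maffine).
transitivity (\int[m]_x f x)%E; last first.
  by rewrite ge0_integral_mscale.
by apply: eq_measure_integral => A mA _; rewrite [LHS]lebesgue_measure_affine.
Qed.

End lebesgue_affine.

Lemma ge0_integral_shift (R : realType) (b : R) (f : R -> \bar R) :
  measurable_fun setT f -> (forall x, 0 <= f x)%E ->
  (\int[lebesgue_measure]_x f (x + b)%R = \int[lebesgue_measure]_x f x)%E.
Proof.
move=> mf f0; rewrite (@ge0_integral_affine R 1 b _ f)// mul1e.
by apply: eq_integral => x _; rewrite mul1r.
Qed.

Section lebesgue_rV_theory.
Context {R : realType}.
Local Notation lam n := (@lebesgue_rV R n).

Lemma ge0_integral_rVS n (f : 'rV[R]_n.+1 -> \bar R) :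
  measurable_fun setT f -> (forall x, 0 <= f x)%E ->
  (\int[lam n.+1]_x f x =
   \int[lebesgue_measure]_t \int[lam n]_y f (rV_cons (t, y)))%E.
Proof.
move=> mf f0.
rewrite [LHS](_ : _ = \int[(lebesgue_measure \x lam n)]_z f (rV_cons z))%E.
  apply: (@fubini_tonelli1 _ _ (measurableTypeR R) 'rV[R]_n R lebesgue_measure (lam n)
    (fun z => f (rV_cons z))) => //.
  by apply: (measurableT_comp mf); exact: measurable_rV_cons.
rewrite /= /lebesgue_step ge0_integral_pushforward//.
exact: measurable_rV_cons.
Qed.

Lemma ge0_integral_rV0 (f : 'rV[R]_0 -> \bar R) :
  measurable_fun setT f -> (\int[lam 0]_x f x = f 0%R)%E.
Proof. by move=> mf; rewrite /= integral_dirac// diracT mul1e. Qed.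

Lemma measurable_rV_add n (u : 'rV[R]_n) :
  measurable_fun setT (fun x : 'rV[R]_n => x + u).
Proof.
apply: measurable_fun_rV => i.
rewrite (_ : (fun x => _) = (fun x : 'rV[R]_n => x ord0 i + u ord0 i)).
  by apply: measurable_funD; [exact: measurable_coord|exact: measurable_cst].
by apply/funext => x; rewrite mxE.
Qed.

Lemma measurable_rV_cons_l n (t : R) :
  measurable_fun setT (fun y : 'rV[R]_n => rV_cons (t, y)).
Proof.
by apply: (measurableT_comp (@measurable_rV_cons R n)); exact: pair1_measurable.
Qed.

Lemma rV_consD n (t s : R) (x y : 'rV[R]_n) :
  rV_cons (t + s, x + y) = rV_cons (t, x) + rV_cons (s, y).
Proof.
apply/rowP => i; rewrite !mxE; case: unliftP => [j|] _ /=; by rewrite ?mxE.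
Qed.

Lemma rV_unconsK n : cancel (@rV_uncons R n) (@rV_cons R n).
Proof.
move=> x; apply/rowP => i; rewrite !mxE.
by case: unliftP => [j ->|->]//=; rewrite mxE.
Qed.

Lemma ge0_integral_rV_shift n (u : 'rV[R]_n) (f : 'rV[R]_n -> \bar R) :
  measurable_fun setT f -> (forall x, 0 <= f x)%E ->
  (\int[lam n]_x f (x + u)%R = \int[lam n]_x f x)%E.
Proof.
elim: n u f => [|n IH] u f mf f0.
  rewrite !ge0_integral_rV0//; first by congr f; apply/rowP => -[].
  by apply: (measurableT_comp mf); exact: measurable_rV_add.
rewrite !ge0_integral_rVS//; last first.
  by apply: (measurableT_comp mf); exact: measurable_rV_add.
pose g t := (\int[lam n]_y f (rV_cons (t, y)))%E.
rewrite -[RHS]/(\int[lebesgue_measure]_t g t)%E.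
have mg : measurable_fun setT g.
  apply: (@measurable_fun_fubini_tonelli_F _ _ _ _ R (lam n)
    (fun z : measurableTypeR R * 'rV[R]_n => f (rV_cons z))) => //.
  by apply: (measurableT_comp mf); exact: measurable_rV_cons.
rewrite -(@ge0_integral_shift R (u ord0 ord0) g)//; last first.
  by move=> t; exact: integral_ge0.
apply: eq_integral => t _; rewrite /g -[RHS](IH (rV_uncons u).2)//; last first.
  exact: (measurableT_comp mf (@measurable_rV_cons_l n _)).
by apply: eq_integral => y _; rewrite rV_consD (_ : rV_cons (u _ _, _) = u) // -[RHS]rV_unconsK.
Qed.

Lemma lebesgue_rVS n (A : set 'rV[R]_n.+1) : measurable A ->
  (lam n.+1 A = \int[lebesgue_measure]_t lam n [set y | A (rV_cons (t, y))])%E.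
Proof.
move=> mA; rewrite -[LHS]mul1e -integral_cst// integral_mkcond ge0_integral_rVS//.
- apply: eq_integral => t _.
  rewrite -[RHS]mul1e -integral_cst//; last first.
    rewrite -[X in measurable X]setTI.
    exact: (@measurable_rV_cons_l n t measurableT A mA).
  rewrite [RHS]integral_mkcond; apply: eq_integral => y _.
  by rewrite /patch/=; congr (if _ then _ else _); apply/idP/idP; rewrite !inE.
- by apply/(measurable_restrictT _ mA).
- by move=> x; rewrite /patch; case: ifP.
Qed.

Lemma rV_cons_eq0 n (v : 'rV[R]_n.+1) :
  (rV_uncons v).1 = 0 -> (rV_uncons v).2 = 0 -> v = 0.
Proof.
move=> h1 h2; rewrite -[v]rV_unconsK; apply/rowP => i; rewrite !mxE h1 h2.
by case: unliftP => //= j _; rewrite mxE.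
Qed.

Lemma dotv_cons n (v : 'rV[R]_n.+1) t y :
  dotv v (rV_cons (t, y)) = v ord0 ord0 * t + dotv (rV_uncons v).2 y.
Proof.
rewrite /dotv big_ord_recl rV_cons0; congr (_ + _).
by apply: eq_bigr => i _; rewrite rV_consS mxE.
Qed.

Lemma measurable_hyperplane n (v : 'rV[R]_n) (c : R) :
  measurable [set x | dotv v x = c].
Proof.
rewrite [X in measurable X](_ : _ = dotv v @^-1` [set c]) //.
by rewrite -[X in measurable X]setTI; apply: measurable_dotv.
Qed.

Lemma lebesgue_rVS_swap n (A : set 'rV[R]_n.+1) : measurable A ->
  (lam n.+1 A = \int[lam n]_y lebesgue_measure [set t | A (rV_cons (t, y))])%E.
Proof.
move=> mA; rewrite -[LHS]mul1e -integral_cst// integral_mkcond ge0_integral_rVS//.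
- transitivity (\int[lam n]_y \int[lebesgue_measure]_t
       ((cst 1%E) \_ A) (rV_cons (t, y)))%E.
    apply: (@fubini_tonelli _ _ (measurableTypeR R) 'rV[R]_n R lebesgue_measure (lam n)
      (fun z => ((cst 1%E) \_ A) (rV_cons z))).
  + apply: (@measurableT_comp _ _ _ _ _ _ ((cst 1%E) \_ A)); last exact: measurable_rV_cons.
    by apply/(measurable_restrictT _ mA).
  + by move=> x; rewrite /patch; case: ifP.
  apply: eq_integral => y _; rewrite -[RHS]mul1e -integral_cst//; last first.
    rewrite -[X in measurable X]setTI.
    by apply: (measurableT_comp (@measurable_rV_cons R n) (pair2_measurable y)) => //.
  rewrite [RHS]integral_mkcond; apply: eq_integral => t _.
  by rewrite /patch/=; congr (if _ then _ else _); apply/idP/idP; rewrite !inE.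
- by apply/(measurable_restrictT _ mA).
- by move=> x; rewrite /patch; case: ifP.
Qed.

(** If the first coefficient vanishes, the slices are hyperplanes of one dimension less. Otherwise
    each line in the first direction meets the hyperplane in one point, which asks for the other
    order of integration, [lebesgue_rVS_swap]. *)
Lemma lebesgue_rV_hyperplane n (v : 'rV[R]_n) (c : R) : v != 0 ->
  lam n [set x | dotv v x = c] = 0%E.
Proof.
elim: n v c => [|n IH] v c v0.
  by move/eqP : v0; case; apply/rowP => -[].
have [v00|v00] := eqVneq (v ord0 ord0) 0.
  rewrite lebesgue_rVS ?integral0_eq//; last exact: measurable_hyperplane.
  move=> t _; rewrite [X in lam n X](_ : _ = [set y | dotv (rV_uncons v).2 y = c]).
    apply: IH; apply: contra v0 => /eqP h; apply/eqP/rV_cons_eq0 => //.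
  by apply/seteqP; split => y /=; rewrite dotv_cons v00 mul0r add0r.
rewrite lebesgue_rVS_swap ?integral0_eq//; last exact: measurable_hyperplane.
move=> y _; rewrite [X in lebesgue_measure X](_ : _ =
  [set (c - dotv (rV_uncons v).2 y) / v ord0 ord0]) ?lebesgue_measure_set1//.
apply/seteqP; split => t /=; rewrite dotv_cons.
  by move=> <-; rewrite addrK mulrC mulKf.
by move=> ->; rewrite mulrC divfK// subrK.
Qed.

Definition rV_box n (a b : 'rV[R]_n) : set 'rV[R]_n :=
  [set x | forall i, a ord0 i <= x ord0 i <= b ord0 i].

Lemma measurable_rV_box n (a b : 'rV[R]_n) : measurable (rV_box a b).
Proof.
rewrite (_ : rV_box a b = \bigcap_(i in [set: 'I_n])
  ((fun x : 'rV[R]_n => x ord0 i) @^-1` `[a ord0 i, b ord0 i])).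
  apply: fin_bigcap_measurable => // i _.
  by rewrite -[X in measurable X]setTI; apply: measurable_coord.
apply/seteqP; split => x /= h i; have := h i; rewrite /= in_itv//=.
by move=> /(_ I).
Qed.

Lemma lebesgue_rV_box n (a b : 'rV[R]_n) : (forall i, a ord0 i <= b ord0 i) ->
  lam n (rV_box a b) = (\prod_i (b ord0 i - a ord0 i))%:E.
Proof.
elim: n a b => [|n IH] a b ab.
  rewrite big_ord0 /= diracE mem_set//; by move=> -[].
rewrite /= /lebesgue_step /pushforward.
rewrite (_ : _ @^-1` _ = `[a ord0 ord0, b ord0 ord0]%classic `*`
   rV_box (rV_uncons a).2 (rV_uncons b).2); last first.
  apply/seteqP; split => -[t y] /=; rewrite in_itv/=.
    move=> h; split; first by have := h ord0; rewrite rV_cons0.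
    by move=> i; have := h (lift ord0 i); rewrite rV_consS !mxE.
  move=> [h1 h2] i; case: (unliftP ord0 i) => [j ->|->]; rewrite ?rV_cons0 ?rV_consS//=.
  by have := h2 j; rewrite !mxE.
rewrite product_measure1E//; last exact: measurable_rV_box.
rewrite IH; last by move=> i; rewrite !mxE.
rewrite big_ord_recl EFinM; congr (_ * _)%E.
  rewrite [LHS]lebesgue_measure_itv/= lte_fin.
  have := ab ord0; rewrite le_eqVlt => /orP[/eqP ->|->]; last by rewrite EFinB.
  by rewrite ltxx subrr.
by congr EFin; apply: eq_bigr => i _; rewrite !mxE.
Qed.

Lemma cvg_rV n (T : Type) (F : set_system T) (FF : Filter F)
    (x : T -> 'rV[R]_n) (l : 'rV[R]_n) :
  (forall i, (fun k => x k ord0 i) @ F --> l ord0 i) -> x @ F --> l.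
Proof.
move=> h; apply/cvg_ballP => e e0.
have : \forall k \near F, forall i : 'I_n, ball (l ord0 i) e (x k ord0 i).
  by apply: filter_forall => i; apply: (cvg_ball (h i)).
apply: filterS => k hk; split => // i j; rewrite ord1; exact: hk.
Qed.

(** The sigma-algebra is generated by the coordinates, not by the open sets. A continuous [f] is the
    limit of its values at the rounded points [grid k x], and these functions are constant on
    countably many half-open cells. *)
Lemma continuous_measurable_rV n (f : 'rV[R]_n -> R) :
  continuous f -> measurable_fun setT f.
Proof.
move=> cf.
pose grid k (x : 'rV[R]_n) : 'rV[R]_n := \row_i ((Num.floor (x ord0 i * k.+1%:R))%:~R / k.+1%:R).
apply: (@measurable_fun_cvg _ _ _ _ (fun k x => f (grid k x))).
- move=> k _ Y mY; rewrite setTI.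
  pose pt (z : {ffun 'I_n -> int}) : 'rV[R]_n := \row_i ((z i)%:~R / k.+1%:R).
  rewrite (_ : _ @^-1` _ = \bigcup_(z in [set z | Y (f (pt z))])
     \bigcap_(i in [set: 'I_n]) ((fun x : 'rV[R]_n => x ord0 i) @^-1`
        `[(z i)%:~R / k.+1%:R, ((z i)%:~R + 1) / k.+1%:R[)); last first.
    apply/seteqP; split => x /=.
      move=> Yf; exists [ffun i => Num.floor (x ord0 i * k.+1%:R)].
        rewrite /= (_ : pt _ = grid k x)//; apply/rowP => i.
        by rewrite !mxE ffunE.
      move=> i _ /=; rewrite in_itv/= !ffunE ler_pdivrMr ?ltr0n// ltr_pdivlMr ?ltr0n//.
      by rewrite floor_le_tmp /= -[1]/(1%:~R) -intrD floorD1_gt.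
    move=> [z /= Yz zx]; rewrite (_ : grid k x = pt z)//.
    apply/rowP => i; rewrite !mxE; congr (_%:~R / _).
    have := zx i I; rewrite /= in_itv/= ler_pdivrMr ?ltr0n// ltr_pdivlMr ?ltr0n//.
    by move=> h; apply/floor_def; rewrite intrD.
  rewrite bigcup_mkcond; apply: countable_bigcupT_measurable => [|z].
    exact: countableP.
  case: ifP => // _; apply: fin_bigcap_measurable => // i _.
  by rewrite -[X in measurable X]setTI; apply: measurable_coord.
- move=> x _; apply: (@cvg_comp _ _ _ _ f _ (nbhs x)) => //; last exact: cf.
  apply: cvg_rV => i; apply/cvgrPdist_lt => e e0.
  near=> k; rewrite !mxE.
  have k0 : 0 < k.+1%:R :> R by rewrite ltr0n.
  have := floor_itv (x ord0 i * k.+1%:R); rewrite intrD => /andP[h1 h2].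
  rewrite ger0_norm; last by rewrite subr_ge0 ler_pdivrMr.
  rewrite ltrBlDr -ltrBlDl ltr_pdivlMr// mulrBl ltrBlDl.
  apply: (lt_le_trans h2); rewrite addrC lerD2r.
  apply: ltW; rewrite -ltr_pdivrMl// mulr1; apply: (@lt_trans _ _ k%:R); last by rewrite ltr_nat.
  by near: k; exact: nbhs_infty_gtr.
Unshelve. all: end_near. Qed.

End lebesgue_rV_theory.

Lemma measurable_patch d (T : measurableType d) (R : realType) (A : set T)
    (f : T -> \bar R) : measurable A -> measurable_fun setT f ->
  measurable_fun setT (f \_ A).
Proof. by move=> mA mf; apply/(measurable_restrictT _ mA); exact: measurable_funTS. Qed.

Section tonelli_on_sets.
Context {d1 d2 : measure_display} {T1 : measurableType d1} {T2 : measurableType d2}.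
Context {R : realType}.
Variables (m1 : {sigma_finite_measure set T1 -> \bar R}).
Variables (m2 : {sigma_finite_measure set T2 -> \bar R}).
Variables (A : set T1) (B : set T2) (f : T1 * T2 -> \bar R).
Hypotheses (mA : measurable A) (mB : measurable B).
Hypotheses (mf : measurable_fun setT f) (f0 : forall z, (0 <= f z)%E).

Lemma measurable_integral_snd :
  measurable_fun setT (fun x => \int[m2]_(y in B) f (x, y))%E.
Proof.
under eq_fun do rewrite integral_mkcond.
rewrite (_ : (fun x => _) = (fun x => \int[m2]_y (f \_ (setT `*` B)) (x, y))%E).
  apply: (@measurable_fun_fubini_tonelli_F _ _ T1 T2 R m2) => //.
  - by apply: measurable_patch => //; exact: measurableX.
  - by move=> z; rewrite /patch; case: ifP.
apply/funext => x; apply: eq_integral => y _; rewrite /patch.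
by congr (if _ then _ else _); apply/idP/idP; rewrite !inE//= => -[].
Qed.

Lemma tonelli_in :
  (\int[m1]_(x in A) \int[m2]_(y in B) f (x, y) =
   \int[m2]_(y in B) \int[m1]_(x in A) f (x, y))%E.
Proof.
rewrite [LHS]integral_mkcond [RHS]integral_mkcond.
transitivity (\int[m1]_x \int[m2]_y (f \_ (A `*` B)) (x, y))%E.
  apply: eq_integral => x _; rewrite {1}/patch; case: ifPn => xA.
    rewrite [LHS]integral_mkcond; apply: eq_integral => y _; rewrite /patch.
    congr (if _ then _ else _); apply/idP/idP; rewrite !inE//=; last by case.
    by split => //; exact: set_mem.
  rewrite integral0_eq// => y _; rewrite /patch; case: ifPn => //.
  by rewrite inE => -[/= /mem_set]; rewrite (negbTE xA).
rewrite (fubini_tonelli (f \_ (A `*` B))); first last.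
- by move=> z; rewrite /patch; case: ifP.
- by apply: measurable_patch => //; exact: measurableX.
apply: eq_integral => y _; rewrite [RHS]/patch; case: ifPn => yB.
  rewrite [RHS]integral_mkcond; apply: eq_integral => x _; rewrite /patch.
  congr (if _ then _ else _); apply/idP/idP; rewrite !inE//=; first by case.
  by split => //; exact: set_mem.
rewrite integral0_eq// => x _; rewrite /patch; case: ifPn => //.
by rewrite inE => -[_ /= /mem_set]; rewrite (negbTE yB).
Qed.

End tonelli_on_sets.

Lemma measurable_integral_fst {d1 d2 : measure_display} {T1 : measurableType d1}
    {T2 : measurableType d2} {R : realType}
    (m1 : {sigma_finite_measure set T1 -> \bar R}) (A : set T1)
    (f : T1 * T2 -> \bar R) : measurable A ->
  measurable_fun setT f -> (forall z, 0 <= f z)%E ->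
  measurable_fun setT (fun y => \int[m1]_(x in A) f (x, y))%E.
Proof.
move=> mA mf f0.
apply: (@measurable_integral_snd _ _ _ _ _ m1 A (fun z => f (z.2, z.1))) => //.
apply: (measurableT_comp mf); apply/measurable_fun_pairP.
by split; [exact: measurable_snd|exact: measurable_fst].
Qed.

Section rV_measurable_ops.
Context {R : realType} {n : nat} {disp : measure_display} {T : measurableType disp}.
Implicit Types f g : T -> 'rV[R]_n.

Lemma measurable_rV_addf f g : measurable_fun setT f -> measurable_fun setT g ->
  measurable_fun setT (fun x => f x + g x).
Proof.
move=> mf mg; apply: measurable_fun_rV => i; under eq_fun do rewrite mxE.
by apply: measurable_funD; exact: (measurableT_comp (measurable_coord i)).
Qed.

Lemma measurable_rV_scalef (a : T -> R) f : measurable_fun setT a ->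
  measurable_fun setT f -> measurable_fun setT (fun x => a x *: f x).
Proof.
move=> ma mf; apply: measurable_fun_rV => i; under eq_fun do rewrite mxE.
by apply: measurable_funM => //; exact: (measurableT_comp (measurable_coord i)).
Qed.

Lemma measurable_rV_subf f g : measurable_fun setT f -> measurable_fun setT g ->
  measurable_fun setT (fun x => f x - g x).
Proof.
move=> mf mg; apply: measurable_fun_rV => i; under eq_fun do rewrite !mxE.
by apply: measurable_funB; exact: (measurableT_comp (measurable_coord i)).
Qed.

End rV_measurable_ops.

Lemma dotvDr (R : realType) n (v x y : 'rV[R]_n) : dotv v (x + y) = dotv v x + dotv v y.
Proof. by rewrite /dotv -big_split; apply: eq_bigr => i _; rewrite mxE mulrDr. Qed.

Lemma dotvZr (R : realType) n (v : 'rV[R]_n) a x : dotv v (a *: x) = a * dotv v x.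
Proof. by rewrite /dotv mulr_sumr; apply: eq_bigr => i _; rewrite mxE mulrCA. Qed.

Lemma dotvC (R : realType) n (x y : 'rV[R]_n) : dotv x y = dotv y x.
Proof. by apply: eq_bigr => i _; rewrite mulrC. Qed.

Lemma dotvNr (R : realType) n (v x : 'rV[R]_n) : dotv v (- x) = - dotv v x.
Proof. by rewrite -scaleN1r dotvZr mulN1r. Qed.

Lemma dotvBr (R : realType) n (v x y : 'rV[R]_n) : dotv v (x - y) = dotv v x - dotv v y.
Proof. by rewrite dotvDr dotvNr. Qed.

(** * Integrals of a nonnegative field along families of segments *)

Section segments.
Context {R : realType} {n : nat}.
Local Notation lam := (@lebesgue_rV R n).
Local Notation leb := (@lebesgue_measure R).
Local Notation I01 := (`[0%R, 1%R]%classic : set R).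
Variable G : 'rV[R]_n -> \bar R.
Hypotheses (mG : measurable_fun setT G) (G0 : forall x, (0 <= G x)%E).

Definition segment_integral (x u : 'rV[R]_n) : \bar R :=
  (\int[leb]_(s in I01) G (x + s *: u))%E.

Lemma segment_integral_ge0 x u : (0 <= segment_integral x u)%E.
Proof. exact: integral_ge0. Qed.

Lemma measurable_segment_integral disp (T : measurableType disp)
    (f g : T -> 'rV[R]_n) : measurable_fun setT f -> measurable_fun setT g ->
  measurable_fun setT (fun z => segment_integral (f z) (g z)).
Proof.
move=> mf mg.
apply: (@measurable_integral_snd _ _ T (measurableTypeR R) R leb I01
  (fun z => G (f z.1 + z.2 *: g z.1))) => //.
apply: (measurableT_comp mG); apply: measurable_rV_addf.
  exact: (measurableT_comp mf).
by apply: measurable_rV_scalef => //; exact: (measurableT_comp mg).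
Qed.

Lemma ge0_integral_sub_shift (F : 'rV[R]_n -> \bar R) (X U : set 'rV[R]_n) a :
  measurable_fun setT F -> (forall x, 0 <= F x)%E ->
  measurable X -> measurable U -> (forall x, X x -> U (x - a)) ->
  (\int[lam]_(x in X) F (x - a)%R <= \int[lam]_(u in U) F u)%E.
Proof.
move=> mF F0 mX mU XU.
have mFa : measurable_fun setT (fun x : 'rV[R]_n => F (x - a)).
  by apply: (measurableT_comp mF); exact: measurable_rV_add.
rewrite [leLHS]integral_mkcond [leRHS]integral_mkcond.
rewrite -[leLHS](@ge0_integral_rV_shift _ _ a); last 2 first.
- exact: measurable_patch.
- by move=> x; rewrite /patch; case: ifP.
have r0 B (H : 'rV[R]_n -> \bar R) x : (forall x, 0 <= H x)%E -> (0 <= (H \_ B) x)%E.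
  by move=> H0; rewrite /patch; case: ifP.
apply: ge0_le_integral => //.
- by move=> x _; exact: r0.
- apply: (@measurableT_comp _ _ _ _ _ _ ((fun x => F (x - a)) \_ X)).
    exact: measurable_patch.
  exact: measurable_rV_add.
- exact: measurable_patch.
- move=> x _; rewrite /patch; case: ifPn => [|_]; last by case: ifP.
  by rewrite inE => /XU; rewrite addrK => /mem_set ->.
Qed.

(** In the variables x, u = y - x and s, the map x |-> x + s u is a translation, so the integral
    over x is at most that of [G]; u ranges over [U] and s over an interval of length one.
    Substituting x + s (y - x) for y instead would bring in a singular power of s. *)
Lemma integral_segments_le (X Y U : set 'rV[R]_n) :
  measurable X -> measurable Y -> measurable U ->
  (forall x y, X x -> Y y -> U (y - x)) ->
  (\int[lam]_(x in X) \int[lam]_(y in Y) segment_integral x (y - x)%R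
     <= lam U * \int[lam]_x G x)%E.
Proof.
move=> mX mY mU XYU.
have mseg x : measurable_fun setT (segment_integral x).
  by apply: measurable_segment_integral => //; exact: measurable_cst.
have mseg2 : measurable_fun setT (fun z => segment_integral z.1 z.2).
  exact: measurable_segment_integral.
apply: (@le_trans _ _ (\int[lam]_(x in X) \int[lam]_(u in U) segment_integral x u)%E).
  apply: ge0_le_integral; first by [].
  - by move=> x _; apply: integral_ge0 => y _; exact: segment_integral_ge0.
  - apply: measurable_funTS.
    apply: (@measurable_integral_snd _ _ _ _ _ lam Y
      (fun z => segment_integral z.1 (z.2 - z.1))) => //; last first.
      by move=> z; exact: segment_integral_ge0.
    by apply: measurable_segment_integral => //; exact: measurable_rV_subf.
  - apply: measurable_funTS.
    apply: (@measurable_integral_snd _ _ _ _ _ lam U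
      (fun z => segment_integral z.1 z.2)) => //.
    by move=> z; exact: segment_integral_ge0.
  - move=> x Xx; apply: ge0_integral_sub_shift => //.
      by move=> u; exact: segment_integral_ge0.
    by move=> y Yy; exact: XYU.
rewrite (@tonelli_in _ _ _ _ _ lam lam X U
   (fun z => segment_integral z.1 z.2))//; last first.
  by move=> z; exact: segment_integral_ge0.
rewrite muleC -integral_cst//; apply: ge0_le_integral => //.
- by move=> u _; apply: integral_ge0 => y _; exact: segment_integral_ge0.
- apply: measurable_funTS.
  apply: (@measurable_integral_fst _ _ _ _ _ lam X
      (fun z => segment_integral z.1 z.2)) => //.
  by move=> z; exact: segment_integral_ge0.
- move=> u _ /=; rewrite /segment_integral.
  rewrite (@tonelli_in _ _ _ (measurableTypeR R) _ lam leb X I01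
    (fun z => G (z.1 + z.2 *: u)))//; last first.
    apply: (measurableT_comp mG); apply: measurable_rV_addf => //.
    by apply: measurable_rV_scalef => //; exact: measurable_cst.
  apply: (@le_trans _ _ (\int[leb]_(s in I01) \int[lam]_x G x)%E); last first.
    rewrite integral_cst// [X in (_ * X)%E](_ : _ = 1%E) ?mule1//.
    by rewrite [LHS]lebesgue_measure_itv/= lte_fin ltr01 -EFinB subr0.
  apply: ge0_le_integral => //.
  + by move=> s _; exact: integral_ge0.
  + apply: measurable_funTS.
    apply: (@measurable_integral_fst _ _ _ (measurableTypeR R) _ lam X
      (fun z => G (z.1 + z.2 *: u))) => //.
    apply: (measurableT_comp mG); apply: measurable_rV_addf => //.
    by apply: measurable_rV_scalef => //; exact: measurable_cst.
  + move=> s _; rewrite -[leRHS](@ge0_integral_rV_shift _ _ (s *: u))//.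
    apply: ge0_subset_integral => //.
    apply: (measurableT_comp mG); exact: (measurable_rV_add (s *: u)).
Qed.

Section prism.
Variables (nu : 'rV[R]_n) (b delta : R).
Hypotheses (nu1 : dotv nu nu = 1) (delta0 : 0 < delta).
Let sl : set 'rV[R]_n := [set w | b <= dotv nu w <= b + 1].
Let pr (w : 'rV[R]_n) := w - (dotv nu w - b) *: nu.

Let msl : measurable sl.
Proof.
rewrite (_ : sl = dotv nu @^-1` `[b, b + 1]).
  by rewrite -[X in measurable X]setTI; apply: measurable_dotv.
by apply/seteqP; split => x /=; rewrite in_itv.
Qed.

Let mpr : measurable_fun setT pr.
Proof.
apply: measurable_rV_subf => //; apply: measurable_rV_scalef => //.
apply: measurable_funB => //; exact: measurable_dotv.
Qed.

(** As [pr w] differs from w by a multiple of nu, a shift of s replaces [pr w] by w, and a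
    translation along nu replaces w - s nu by a free point x. The parameters s with x + s nu in the
    slab then form an interval of length one, the width of the slab. *)
Let integral_normal_lines :
  (\int[leb]_(s in setT) \int[lam]_(w in sl) G (pr w - s *: nu)%R
     = \int[lam]_x G x)%E.
Proof.
have m1 : measurable_fun setT (fun z : 'rV[R]_n * measurableTypeR R => G (z.1 - z.2 *: nu)).
  apply: (measurableT_comp mG); apply: measurable_rV_subf => //.
  by apply: measurable_rV_scalef => //; exact: measurable_cst.
rewrite -(@tonelli_in _ _ _ (measurableTypeR R) _ lam leb sl setT
  (fun z => G (pr z.1 - z.2 *: nu)))//; last first.
  apply: (measurableT_comp mG); apply: measurable_rV_subf.
    exact: (measurableT_comp mpr).
  by apply: measurable_rV_scalef => //; exact: measurable_cst.
transitivity (\int[lam]_(w in sl) \int[leb]_s G (w - s *: nu)%R)%E.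
  apply: eq_integral => w _.
  rewrite -[RHS](@ge0_integral_shift R (dotv nu w - b))//.
    by apply: eq_integral => s _; congr G; apply/rowP => i; rewrite /pr /= !mxE; ring.
  exact: (measurableT_comp m1 (@pair1_measurable _ _ _ _ w)).
rewrite (@tonelli_in _ _ _ (measurableTypeR R) _ lam leb sl setT
  (fun z => G (z.1 - z.2 *: nu)))//.
pose h (z : measurableTypeR R * 'rV[R]_n) :=
  (G z.2 * (\1_[set z : measurableTypeR R * 'rV[R]_n | sl (z.2 + z.1 *: nu)] z)%:E)%E.
have msl2 : measurable [set z : measurableTypeR R * 'rV[R]_n | sl (z.2 + z.1 *: nu)].
  rewrite -[X in measurable X]setTI.
  apply: (_ : measurable_fun setT (fun z : measurableTypeR R * 'rV[R]_n => z.2 + z.1 *: nu)) => //.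
  apply: measurable_rV_addf => //.
  by apply: measurable_rV_scalef => //; exact: measurable_cst.
transitivity (\int[leb]_(s in setT) \int[lam]_(x in setT) h (s, x))%E.
  apply: eq_integral => s _.
  rewrite integral_mkcond -[LHS](@ge0_integral_rV_shift _ _ (s *: nu)).
  - apply: eq_integral => x _; rewrite /h/= /patch indicE addrK.
    rewrite (_ : (_ \in [set z | _]) = (x + s *: nu \in sl)); last by apply/idP/idP; rewrite !inE.
    by case: ifP => _; rewrite ?mule1 ?mule0.
  - apply: measurable_patch => //.
    apply: (measurableT_comp mG); apply: measurable_rV_subf.
      exact: measurable_id.
    by rewrite /=; exact: measurable_cst.
  - by move=> x; rewrite /patch; case: ifP.
rewrite (@tonelli_in _ _ (measurableTypeR R) _ _ leb lam setT setT h)//; last 2 first.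
- apply: emeasurable_funM; first exact: (measurableT_comp mG).
  apply: (@measurableT_comp _ _ _ _ _ _ EFin); first exact: EFin_measurable.
  exact: measurable_indic.
- by move=> z; rewrite /h mule_ge0// lee_fin.
apply: eq_integral => x _; rewrite /h/= ge0_integralZl//; last first.
- apply: (@measurableT_comp _ _ _ _ _ _ EFin); first exact: EFin_measurable.
  exact: (measurableT_comp (measurable_indic msl2) (@pair2_measurable _ _ _ _ x)).
rewrite [X in (_ * X)%E](_ : _ = 1%E) ?mule1//.
transitivity (\int[leb]_s (\1_(`[b - dotv nu x, b - dotv nu x + 1]%classic : set R) s)%:E)%E.
  apply: eq_integral => s _; rewrite !indicE; congr ((nat_of_bool _)%:R%:E).
  apply/idP/idP; rewrite !inE/= in_itv/= /sl/= dotvDr dotvZr nu1; lra.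
rewrite integral_indic// setIT [LHS]lebesgue_measure_itv/= lte_fin ltrDl ltr01.
by rewrite -EFinB; congr EFin; lra.
Qed.

Let pr_tangent w (u : 'rV[R]_n) : dotv nu u = 0 -> pr (w + u) = pr w + u.
Proof. by move=> h; rewrite /pr dotvDr h addr0 addrAC. Qed.

(** Split u = tau - be nu with tau tangent. A translation along tau preserves the slab and commutes
    with the projection; what remains is [integral_normal_lines] with s rescaled by be >= delta. *)
Let integral_prism_direction (u : 'rV[R]_n) : dotv nu u <= - delta ->
  (\int[leb]_(s in I01) \int[lam]_(w in sl) G (pr w + s *: u)%R
     <= delta^-1%:E * \int[lam]_x G x)%E.
Proof.
move=> hu; pose be := - dotv nu u; pose tau := u + be *: nu.
have be0 : 0 < be by rewrite /be oppr_gt0 (le_lt_trans hu)// oppr_lt0.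
have tau0 : dotv nu tau = 0 by rewrite /tau dotvDr dotvZr nu1 mulr1 subrr.
pose H s := (\int[lam]_(w in sl) G (pr w - s *: nu)%R)%E.
have mprs : measurable_fun setT (fun z : 'rV[R]_n * measurableTypeR R => G (pr z.1 - z.2 *: nu)).
  apply: (measurableT_comp mG); apply: measurable_rV_subf.
    exact: (measurableT_comp mpr).
  by apply: measurable_rV_scalef => //; exact: measurable_cst.
have mH : measurable_fun setT (H : measurableTypeR R -> _).
  exact: (@measurable_integral_fst _ _ _ (measurableTypeR R) _ lam sl
    (fun z => G (pr z.1 - z.2 *: nu))).
have H0 s : (0 <= H s)%E by exact: integral_ge0.
rewrite (_ : (\int[leb]_(s in I01) _ = \int[leb]_(s in I01) H (be * s + 0)%R)%E); last first.
  apply: eq_integral => s _; rewrite addr0 /H.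
  rewrite [LHS]integral_mkcond [RHS]integral_mkcond.
  rewrite -[RHS](@ge0_integral_rV_shift _ _ (s *: tau)); last 2 first.
  - apply: measurable_patch => //.
    by apply: (measurableT_comp mG); apply: measurable_rV_subf.
  - by move=> x; rewrite /patch; case: ifP.
  apply: eq_integral => w _; rewrite /patch.
  have -> : (w + s *: tau \in sl) = (w \in sl).
    by apply/idP/idP; rewrite !inE /sl/= dotvDr dotvZr tau0 mulr0 addr0.
  rewrite pr_tangent ?dotvZr ?tau0 ?mulr0// (_ : pr w + _ - _ = pr w + s *: u)//.
  by rewrite /tau scalerDr scalerA (mulrC be) -addrA addrK.
apply: (@le_trans _ _ (\int[leb]_s H (be * s + 0)%R)%E).
  apply: ge0_subset_integral => //.
  apply: (measurableT_comp mH).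
  by apply: measurable_funD => //; apply: measurable_funM.
have := @ge0_integral_affine R be 0 be0 H mH H0.
rewrite (_ : \int[leb]_x H x = \int[lam]_x G x)%E; last exact: integral_normal_lines.
move=> ->; rewrite muleA -EFinM lee_pemull//.
  by apply: integral_ge0 => s _.
by rewrite lee_fin -ler_pdivrMl ?invr_gt0// invrK mulr1 /be lerNr.
Qed.

(** Surface counterpart of [integral_segments_le]: volume in the prism stands for area on the facet,
    and the distance [delta] from [X] to the plane of the facet keeps all segments transversal to
    it. *)
Lemma integral_prism_segments_le (S X U : set 'rV[R]_n) :
  measurable S -> measurable X -> measurable U ->
  S `<=` sl -> (forall w x, S w -> X x -> U (x - pr w)) ->
  (forall x, X x -> dotv nu x <= b - delta) ->
  (\int[lam]_(w in S) \int[lam]_(x in X) segment_integral (pr w) (x - pr w)%R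
     <= lam U * (delta^-1%:E * \int[lam]_x G x))%E.
Proof.
move=> mS mX mU Ssl SXU Xdelta.
pose U' := U `&` [set u | dotv nu u <= - delta].
have mU' : measurable U'.
  apply: measurableI => //.
  rewrite (_ : [set u | _] = dotv nu @^-1` `]-oo, - delta]).
    by rewrite -[X in measurable X]setTI; apply: measurable_dotv.
  by apply/seteqP; split => x /=; rewrite in_itv.
have nupr w : dotv nu (pr w) = b by rewrite /pr dotvBr dotvZr nu1; lra.
have mseg2 : measurable_fun setT (fun z => segment_integral (pr z.1) z.2).
  by apply: measurable_segment_integral => //; exact: (measurableT_comp mpr).
have s0 x u := segment_integral_ge0 x u.
apply: (@le_trans _ _ (\int[lam]_(w in S) \int[lam]_(u in U') segment_integral (pr w) u)%E).
  apply: ge0_le_integral => //.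
  - by move=> x _; exact: integral_ge0.
  - apply: measurable_funTS.
    apply: (@measurable_integral_snd _ _ _ _ _ lam X
      (fun z => segment_integral (pr z.1) (z.2 - pr z.1))) => //.
    apply: measurable_segment_integral; first exact: (measurableT_comp mpr).
    by apply: measurable_rV_subf => //; exact: (measurableT_comp mpr).
  - apply: measurable_funTS.
    exact: (@measurable_integral_snd _ _ _ _ _ lam U'
      (fun z => segment_integral (pr z.1) z.2)).
  - move=> w Sw; apply: ge0_integral_sub_shift => //.
      by apply: measurable_segment_integral => //; exact: measurable_cst.
    move=> x Xx; split; first exact: SXU.
    by rewrite /= dotvBr nupr; have := Xdelta _ Xx; lra.
apply: (@le_trans _ _ (\int[lam]_(w in sl) \int[lam]_(u in U') segment_integral (pr w) u)%E).
  apply: ge0_subset_integral => //.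
  - apply: measurable_funTS; exact: (@measurable_integral_snd _ _ _ _ _ lam U'
      (fun z => segment_integral (pr z.1) z.2)).
  - by move=> x _; exact: integral_ge0.
rewrite (@tonelli_in _ _ _ _ _ lam lam sl U'
   (fun z => segment_integral (pr z.1) z.2))//.
apply: (@le_trans _ _ (\int[lam]_(u in U') cst (delta^-1%:E * \int[lam]_x G x) u)%E); last first.
  have C0 : (0 <= delta^-1%:E * \int[lam]_x G x)%E.
    by apply: mule_ge0; [rewrite lee_fin invr_ge0 ltW|exact: integral_ge0].
  rewrite integral_cst// muleC; apply: lee_wpmul2r => //.
  by apply: le_measure; rewrite ?inE//; exact: subIsetl.
apply: ge0_le_integral => //.
- by move=> u _; exact: integral_ge0.
- apply: measurable_funTS; exact: (@measurable_integral_fst _ _ _ _ _ lam sl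
      (fun z => segment_integral (pr z.1) z.2)).
- move=> u [_ /= hu]; rewrite /segment_integral.
  rewrite (@tonelli_in _ _ _ (measurableTypeR R) _ lam leb sl I01
    (fun z => G (pr z.1 + z.2 *: u)))//; first exact: integral_prism_direction.
  apply: (measurableT_comp mG); apply: measurable_rV_addf.
    exact: (measurableT_comp mpr).
  by apply: measurable_rV_scalef => //; exact: measurable_cst.
Qed.

End prism.
End segments.

(** * Directional derivatives and the strain of a smooth field along a segment *)

Lemma continuous_sumr (T : topologicalType) (R : realType) (I : Type) (r : seq I)
    (f : I -> T -> R) :
  (forall i, continuous (f i)) -> continuous (fun x => \sum_(i <- r) f i x).
Proof.
move=> cf; elim: r => [|i r IH] x.
  by under eq_fun do rewrite big_nil; exact: cvg_cst.
under eq_fun do rewrite big_cons.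
by apply: (@cvgD _ _ _ _ _ (f i) (fun x => \sum_(j <- r) f j x)); [exact: cf|exact: IH].
Qed.

Lemma sum_cauchy_schwarz (R : realType) (I : finType) (a b : I -> R) :
  (\sum_i a i * b i) ^+ 2 <= (\sum_i a i ^+ 2) * (\sum_i b i ^+ 2).
Proof.
set A := \sum_i a i ^+ 2; set B := \sum_i b i ^+ 2; set C := \sum_i a i * b i.
have B0 : 0 <= B by apply: sumr_ge0 => i _; exact: sqr_ge0.
have [/eqP|Bn0] := eqVneq B 0.
  rewrite psumr_eq0 => [/allP b0|i _]; last exact: sqr_ge0.
  rewrite /C big1 ?expr0n ?mulr_ge0// => [|i _].
    by apply: sumr_ge0 => i _; exact: sqr_ge0.
  by have := b0 i (mem_index_enum i); rewrite /= sqrf_eq0 => /eqP ->; rewrite mulr0.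
have : 0 <= \sum_i (a i * B - b i * C) ^+ 2 by apply: sumr_ge0 => i _; exact: sqr_ge0.
rewrite (_ : \sum_i _ = B * (A * B - C ^+ 2)).
  by rewrite pmulr_rge0 ?subr_ge0// lt_neqAle eq_sym Bn0.
rewrite (_ : \sum_i _ = \sum_i B ^+ 2 * a i ^+ 2 - \sum_i 2 * B * C * (a i * b i)
    + \sum_i C ^+ 2 * b i ^+ 2); last first.
  by rewrite -sumrB -big_split; apply: eq_bigr => i _ /=; ring.
by rewrite -!mulr_sumr -/A -/B -/C; ring.
Qed.

Lemma continuous_mulr (T : topologicalType) (R : realType) (f g : T -> R) :
  continuous f -> continuous g -> continuous (fun x => f x * g x).
Proof. by move=> cf cg x; apply: cvgM; [exact: cf|exact: cg]. Qed.

Lemma continuous_addr (T : topologicalType) (R : realType) (f g : T -> R) :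
  continuous f -> continuous g -> continuous (fun x => f x + g x).
Proof. by move=> cf cg x; apply: cvgD; [exact: cf|exact: cg]. Qed.

Lemma continuous_sqr (T : topologicalType) (R : realType) (f : T -> R) :
  continuous f -> continuous (fun x => f x ^+ 2).
Proof.
by move=> cf x; under eq_fun do rewrite expr2; apply: cvgM; exact: cf.
Qed.

Lemma dotv_sqr_le (R : realType) n (x y : 'rV[R]_n) :
  dotv x y ^+ 2 <= dotv x x * dotv y y.
Proof. by apply: le_trans (sum_cauchy_schwarz _ _) _; rewrite /dotv. Qed.

Lemma dotv_ge0 (R : realType) n (x : 'rV[R]_n) : 0 <= dotv x x.
Proof. by apply: sumr_ge0 => i _; rewrite -expr2 sqr_ge0. Qed.

Section directional_derivatives.
Context {R : realType} {n : nat}.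
Implicit Types f : 'rV[R]_n -> R.

Lemma is_derive_line f (y u : 'rV[R]_n) (t l : R) :
  is_derive (y + t *: u) u f l -> is_derive t 1 (fun s : R => f (y + s *: u)) l.
Proof.
move=> fl.
have E : (fun h : R => h^-1 *: (f (y + (h *: 1 + t) *: u) - f (y + t *: u))) =
   (fun h : R => h^-1 *: (f (h *: u + (y + t *: u)) - f (y + t *: u))).
  apply/funext => h; congr (_ *: (f _ - _)).
  by rewrite scalerDl addrCA [h *: 1]mulr1.
have fd : derivable f (y + t *: u) u by exact: ex_derive.
have fv : 'D_u f (y + t *: u) = l by exact: derive_val.
split; first by rewrite /derivable/= E.
by rewrite /derive/= E.
Qed.

Lemma mean_value_any (g g' : R -> R) (a b : R) :
  (forall t : R, is_derive t 1 g (g' t)) ->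
  exists2 c, `|c - a| <= `|b - a| & g b - g a = g' c * (b - a).
Proof.
move=> dg.
have cg : continuous g.
  by move=> t; apply: differentiable_continuous; apply/derivable1_diffP; exact: ex_derive.
have [ab|/ltW ba] := leP a b.
  have [c cab gc] := MVT_segment ab (fun t _ => dg t) (continuous_subspaceT cg).
  exists c => //; move: cab; rewrite in_itv/= => /andP[ac cb].
  by rewrite !ger0_norm ?subr_ge0// lerD2r.
have [c cab gc] := MVT_segment ba (fun t _ => dg t) (continuous_subspaceT cg).
exists c; last by rewrite -[LHS]opprB gc -mulrN opprB.
move: cab; rewrite in_itv/= => /andP[bc ca].
by rewrite !ler0_norm ?subr_le0// lerN2 lerD2r.
Qed.

(** Induction step of [is_derive_C1]: the mean value theorem writes the increment in the extra
    coordinate with [partial i f] at a point that tends to x, where this partial derivative is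
    continuous. *)
Lemma is_derive_add_unit f (x u : 'rV[R]_n) (l c : R) (i : 'I_n) :
  (forall y, derivable f y (unit_vec i)) -> {for x, continuous (partial i f)} ->
  is_derive x u f l -> is_derive x (u + c *: unit_vec i) f (l + c * partial i f x).
Proof.
move=> df cf ful.
have dfl y (t : R) : is_derive t 1 (fun s : R => f (y + s *: unit_vec i))
    (partial i f (y + t *: unit_vec i)).
  by apply: is_derive_line; exact: derivableP.
suff H : (fun h : R => h^-1 *: (f (h *: (u + c *: unit_vec i) + x) - f x)) @ 0^'
    --> l + c * partial i f x.
  split; first by apply/cvg_ex; exists (l + c * partial i f x).
  exact/cvg_lim.
have -> : (fun h : R => h^-1 *: (f (h *: (u + c *: unit_vec i) + x) - f x)) =
   (fun h : R => h^-1 *: (f (h *: u + x) - f x) +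
     h^-1 *: (f ((h *: u + x) + (h * c) *: unit_vec i) - f (h *: u + x))).
  apply/funext => h; rewrite -scalerDr addrC; congr (_ *: _).
  rewrite (_ : h *: u + x + _ = h *: (u + c *: unit_vec i) + x); last first.
    by rewrite scalerDr scalerA addrAC.
  by ring.
apply: cvgD.
  have : derivable f x u by exact: ex_derive.
  by rewrite -(@derive_val _ _ _ _ _ _ _ ful).
apply/cvgrPdist_lt => e e0.
have c1 : 0 < `|c| + 1 by rewrite ltr_wpDl.
have /cvgrPdist_lt/(_ (e / (`|c| + 1))) := cf.
rewrite divr_gt0// => /(_ isT)/nbhs_ballP[d /= d0 dB].
pose K := `|u| + `|c| * `|unit_vec i : 'rV[R]_n| + 1.
have K0 : 0 < K by rewrite /K ltr_wpDl// addr_ge0// mulr_ge0.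
near=> h.
have h0 : h != 0 by near: h; exact: nbhs_dnbhs_neq.
have hd : `|h| < d / K.
  by near: h; apply: dnbhs0_lt; exact: divr_gt0.
have [t] := mean_value_any 0 (h * c) (dfl (h *: u + x)).
rewrite !subr0 scale0r addr0 => tc ->.
rewrite (_ : h^-1 *: (partial i f (h *: u + x + t *: unit_vec i) * (h * c)) =
  c * partial i f (h *: u + x + t *: unit_vec i)); last by rewrite /GRing.scale/=; field.
rewrite -mulrBr normrM.
have : ball x d (h *: u + x + t *: unit_vec i).
  rewrite -ball_normE /= distrC addrAC addrK.
  rewrite (le_lt_trans (ler_normD _ _))// !normrZ.
  apply: (@le_lt_trans _ _ (`|h| * K)); last by rewrite -ltr_pdivlMr.
  rewrite /K mulrDr mulrDr mulr1 -addrA lerD2l.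
  rewrite -[leLHS]addr0 lerD// mulrA ler_wpM2r//.
  by rewrite -normrM.
move/dB => /=; rewrite ltr_pdivlMr// => H; apply: le_lt_trans H.
by rewrite mulrC ler_wpM2l// lerDl.
Unshelve. all: end_near. Qed.

Lemma is_derive_C1 f (x u : 'rV[R]_n) :
  (forall i y, derivable f y (unit_vec i)) -> (forall i, continuous (partial i f)) ->
  is_derive x u f (\sum_i u ord0 i * partial i f x).
Proof.
move=> df cf.
suff H (s : seq 'I_n) : is_derive x (\sum_(i <- s) u ord0 i *: unit_vec i) f
    (\sum_(i <- s) u ord0 i * partial i f x).
  by rewrite {1}(row_sum_delta u); exact: H.
elim: s => [|i s IH].
  by rewrite !big_nil; exact: is_derive0.
by rewrite !big_cons addrC [X in is_derive _ _ _ X]addrC; apply: is_derive_add_unit => //; exact: cf.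
Qed.

End directional_derivatives.

Section increments.
Context {R : realType}.
Local Notation leb := (@lebesgue_measure R).

(** With m the increment of [F], integrate 2 m f - m^2 <= f^2: the left-hand side has the primitive
    [H], whose own increment is m^2. *)
Lemma sqr_increment_le (F f : R -> R) :
  (forall t : R, is_derive t 1 F (f t)) -> continuous f ->
  (((F 1 - F 0) ^+ 2)%:E <= \int[leb]_(t in `[0%R, 1%R]) ((f t) ^+ 2)%:E)%E.
Proof.
move=> dF cf; set m := F 1 - F 0.
pose H t := 2 * m * F t - m ^+ 2 * t.
pose h t := 2 * m * f t - m ^+ 2.
have dH (t : R) : is_derive t 1 H (h t).
  rewrite /H /h; have := dF t => ?; apply: is_derive_eq.
  by rewrite /GRing.scale/=; ring.
have ch : continuous h.
  by move=> t; apply: cvgB; [apply: cvgM => //; [exact: cvg_cst|exact: cf]|exact: cvg_cst].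
have cH : continuous H.
  by move=> t; apply: differentiable_continuous; apply/derivable1_diffP; exact: ex_derive.
have := @continuous_FTC2 R h H 0 1 ltr01 (continuous_subspaceT ch).
rewrite -EFinB (_ : H 1 - H 0 = m ^+ 2); last by rewrite /H /m; ring.
move=> <-; last 2 first.
- split; last 2 first.
  + by apply: cvg_at_right_filter; exact: cH.
  + by apply: cvg_at_left_filter; exact: cH.
  by move=> t _; exact: ex_derive.
- by move=> t _; rewrite derive1E derive_val.
have int g : continuous g -> leb.-integrable `[0%R, 1%R] (EFin \o g).
  move=> cg; apply: continuous_compact_integrable; first exact: segment_compact.
  exact: continuous_subspaceT.
apply: le_integral => //.
- exact: int.
- exact: (int _ (continuous_sqr cf)).
- move=> t _; rewrite lee_fin -subr_ge0 /h.
  by rewrite (_ : _ - _ = (f t - m) ^+ 2) ?sqr_ge0//; ring.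
Qed.

End increments.

Section strain_along_segments.
Context {R : realType} {n : nat}.
Variable phi : 'I_n -> 'rV[R]_n -> R.
Hypothesis sphi : forall k, smooth (phi k).

Definition smooth_strain (x : 'rV[R]_n) (k j : 'I_n) : R :=
  2^-1 * (partial j (phi k) x + partial k (phi j) x).

Definition strain_sqr (x : 'rV[R]_n) : R := \sum_k \sum_j smooth_strain x k j ^+ 2.

Lemma continuous_partial k j : continuous (partial j (phi k)).
Proof. by have [/= + _] := sphi k [:: j]. Qed.

Lemma continuous_smooth_strain k j : continuous (fun x => smooth_strain x k j).
Proof.
rewrite /smooth_strain; apply: continuous_mulr; first exact: cst_continuous.
by apply: continuous_addr; exact: continuous_partial.
Qed.

Lemma continuous_strain_sqr : continuous strain_sqr.
Proof.
apply: continuous_sumr => k; apply: continuous_sumr => j; apply: continuous_sqr.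
exact: continuous_smooth_strain.
Qed.

Lemma strain_segment_le (x u : 'rV[R]_n) :
  (((\sum_k (phi k (x + u) - phi k x) * u ord0 k) ^+ 2)%:E <=
   \int[lebesgue_measure]_(s in `[0%R, 1%R])
     (dotv u u ^+ 2 * strain_sqr (x + s *: u)%R)%:E)%E.
Proof.
pose F t := \sum_k phi k (x + t *: u) * u ord0 k.
pose f t := \sum_k \sum_j smooth_strain (x + t *: u) k j * (u ord0 k * u ord0 j).
have cline (g : 'rV[R]_n -> R) : continuous g -> continuous (fun t : R => g (x + t *: u)).
  move=> cg t; apply: (@cvg_comp _ _ _ (fun t : R => x + t *: u) g); last exact: cg.
  by apply: cvgD; [exact: cvg_cst|apply: cvgZr_tmp; exact: cvg_id].
have fE t : f t = \sum_k (\sum_j u ord0 j * partial j (phi k) (x + t *: u)) * u ord0 k.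
  transitivity (2^-1 * (\sum_k \sum_j (partial j (phi k) (x + t *: u)) * (u ord0 k * u ord0 j)
     + \sum_k \sum_j (partial k (phi j) (x + t *: u)) * (u ord0 k * u ord0 j))).
    rewrite -big_split mulr_sumr; apply: eq_bigr => k _.
    rewrite -big_split mulr_sumr; apply: eq_bigr => j _.
    by rewrite /smooth_strain /=; ring.
  rewrite [X in _ + X]exchange_big /=.
  rewrite (eq_bigr (fun k => \sum_j (partial j (phi k) (x + t *: u)) * (u ord0 k * u ord0 j)));
    last by [].
  under [X in _ + X]eq_bigr do under eq_bigr do rewrite (mulrC (u ord0 _) (u ord0 _)).
  rewrite -mulr2n -[X in 2^-1 * X]mulr_natl mulrA mulVf ?mul1r// ?pnatr_eq0//.
  apply: eq_bigr => k _; rewrite mulr_suml; apply: eq_bigr => j _; ring.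
have dF (t : R) : is_derive t 1 F (f t).
  rewrite fE /F.
  have dphi k : is_derive t 1 (fun t => phi k (x + t *: u) * u ord0 k)
      ((\sum_j u ord0 j * partial j (phi k) (x + t *: u)) * u ord0 k).
    have : is_derive t 1 (fun t => phi k (x + t *: u)) (\sum_j u ord0 j * partial j (phi k) (x + t *: u)).
      apply: is_derive_line; apply: is_derive_C1 => [i y|i]; last exact: continuous_partial.
      by have [_] := sphi k [::]; exact.
    move=> h; apply: is_derive_eq.
    by rewrite scaler0 add0r /GRing.scale/= mulrC.
  have := @is_derive_sum R R R n (fun k t => phi k (x + t *: u) * u ord0 k) t 1 _ dphi.
  by rewrite (_ : \sum_k _ = fun t => \sum_k phi k (x + t *: u) * u ord0 k)//; apply/funext => s; rewrite fct_sumE.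
have cf : continuous f.
  apply: continuous_sumr => k; apply: continuous_sumr => j t; apply: cvgM; last exact: cvg_cst.
  have ct : continuous (fun s : R => smooth_strain (x + s *: u) k j).
    exact: (cline _ (@continuous_smooth_strain k j)).
  exact: ct.
have := sqr_increment_le dF cf.
rewrite (_ : F 1 - F 0 = \sum_k (phi k (x + u) - phi k x) * u ord0 k); last first.
  rewrite /F -sumrB; apply: eq_bigr => k _.
  by rewrite scale1r scale0r addr0 mulrBl.
move=> h; apply: (le_trans h).
apply: ge0_le_integral => //.
- by move=> t _; rewrite lee_fin sqr_ge0.
- apply: measurable_funTS; apply: (@measurableT_comp _ _ _ _ _ _ EFin) => //.
  by apply: continuous_measurable_fun; exact: continuous_sqr.
- apply: measurable_funTS; apply: (@measurableT_comp _ _ _ _ _ _ EFin) => //.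
  apply: continuous_measurable_fun => t; apply: cvgM; first exact: cvg_cst.
  exact: (cline _ continuous_strain_sqr t).
- move=> t _; rewrite lee_fin.
  (* Cauchy-Schwarz over pairs of indices, between the strain and the matrix of the products u_k
     u_j, whose squared norm is |u|^4. *)
  have := @sum_cauchy_schwarz R ('I_n * 'I_n)%type
    (fun p => smooth_strain (x + t *: u) p.1 p.2) (fun p => u ord0 p.1 * u ord0 p.2).
  rewrite -(pair_bigA _ (fun k j => smooth_strain (x + t *: u) k j * (u ord0 k * u ord0 j)))/=.
  rewrite -(pair_bigA _ (fun k j => smooth_strain (x + t *: u) k j ^+ 2))/=.
  rewrite -(pair_bigA _ (fun k j => (u ord0 k * u ord0 j) ^+ 2))/= => h'.
  apply: (le_trans h'); rewrite mulrC; apply: ler_wpM2r.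
    by apply: sumr_ge0 => k _; apply: sumr_ge0 => j _; exact: sqr_ge0.
  rewrite /dotv expr2 mulr_suml; apply: ler_sum => k _.
  rewrite mulr_sumr; apply: ler_sum => j _.
  by rewrite le_eqVlt; apply/orP; left; apply/eqP; ring.
Qed.

End strain_along_segments.

(** * Smooth bumps and the fundamental lemma of the calculus of variations *)

Lemma is_derive_compR (R : realType) (f g : R -> R) (x a b : R) :
  is_derive (g x) 1 f a -> is_derive x 1 g b -> is_derive x 1 (f \o g) (a * b).
Proof.
move=> fa gb.
have df : derivable f (g x) 1 by exact: ex_derive.
have dg : derivable g x 1 by exact: ex_derive.
apply: DeriveDef.
  apply/derivable1_diffP/differentiable_comp; exact/derivable1_diffP.
by rewrite -derive1E derive1_comp// !derive1E !derive_val.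
Qed.

Section flat_exponential.
Context {R : realType}.
Implicit Types P : {poly R}.

(** The classical flat function exp(-1/t), with a polynomial factor in 1/t so that the family is
    closed under differentiation. *)
Definition flat_exp P (t : R) : R := if 0 < t then P.[t^-1] * expR (- t^-1) else 0.

Lemma flat_exp_scale a P t : flat_exp (a *: P) t = a * flat_exp P t.
Proof. by rewrite /flat_exp; case: ifP => _; rewrite ?mulr0// hornerZ mulrA. Qed.

(** From x^(i + 1) <= (i + 1)! exp x at x = 1/t, monomial by monomial. Applied to ['X * P], it
    bounds the difference quotient at 0. *)
Lemma flat_exp_le P : exists2 C, 0 <= C & forall t, 0 < t -> `|flat_exp P t| <= C * t.
Proof.
exists (\sum_(i < size P) `|P`_i| * (i.+1)`!%:R).
  by apply: sumr_ge0 => i _; rewrite mulr_ge0.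
move=> t t0; rewrite /flat_exp t0 horner_coef mulr_suml mulr_suml.
apply: le_trans (ler_norm_sum _ _ _) _; apply: ler_sum => i _.
rewrite -!mulrA normrM ler_wpM2l// ger0_norm; last first.
  by rewrite mulr_ge0// ?expR_ge0// exprn_ge0// invr_ge0 ltW.
have x0 : 0 <= t^-1 by rewrite invr_ge0 ltW.
have := expR_ge1Dxn i x0 => h.
rewrite expRN ler_pdivrMr ?expR_gt0//.
have h2 : t^-1 ^+ i.+1 / (i.+1)`!%:R <= expR t^-1 by apply: le_trans h; rewrite lerDr.
have f0 : 0 < (i.+1)`!%:R :> R by rewrite ltr0n fact_gt0.
move: h2; rewrite ler_pdivrMr// exprS => h2.
have := ler_wpM2l (ltW t0) h2; rewrite mulrA divff ?gt_eqF// mul1r => h3.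
by apply: le_trans h3 _; rewrite le_eqVlt; apply/orP; left; apply/eqP; ring.
Qed.

Definition flat_exp_deriv P : {poly R} := 'X^2 * (P - P^`()).

Lemma is_derive_flat_exp P (t : R) :
  is_derive t 1 (flat_exp P) (flat_exp (flat_exp_deriv P) t).
Proof.
have [t0|t0|->] := ltgtP t 0.
- apply: (@near_eq_is_derive _ _ _ (cst 0)).
    near=> s; rewrite /flat_exp ifN// -leNgt.
    near: s; apply/nbhs_ballP; exists (- t) => /=; first by rewrite oppr_gt0.
    by move=> s; rewrite /ball/= ltr_norml => /andP[? ?]; lra.
  by rewrite /flat_exp ltNge (ltW t0)/=; exact: is_derive_cst.
- have dinv : is_derive t 1 (fun s : R => s^-1) (- t ^- 2).
    apply: is_derive_eq; first by apply: (@is_deriveV _ id); rewrite gt_eqF.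
    by rewrite /GRing.scale/= mulr1.
  have d1 := is_derive_compR (is_derive_poly P t^-1) dinv.
  have dneg : is_derive t 1 (fun s : R => - s^-1) (t ^- 2).
    by rewrite -[t ^- 2]opprK; exact: (is_deriveN dinv).
  have d2 := @is_derive_compR _ expR (fun s => - s^-1) t _ _ (is_derive_expR (- t^-1)) dneg.
  pose q : R -> R := fun s => P.[s^-1] * expR (- s^-1).
  apply: (@near_eq_is_derive _ _ _ q).
    near=> s; rewrite /flat_exp ifT//.
    near: s; apply/nbhs_ballP; exists t => //= s.
    by rewrite /ball/= ltr_norml => /andP[? ?]; lra.
  have dq : is_derive t 1 q _ := is_deriveM d1 d2.
  rewrite (_ : flat_exp _ t = P.[t^-1] *: (expR (- t^-1) * t ^- 2) +
    expR (- t^-1) *: (P^`().[t^-1] * - t ^- 2))//.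
  rewrite /flat_exp t0 /flat_exp_deriv !hornerE /GRing.scale/= !exprVn; ring.
- suff H : (fun h : R => h^-1 *: (flat_exp P (h *: 1 + 0) - flat_exp P 0)) @ 0^' --> flat_exp (flat_exp_deriv P) 0.
    split; first by apply/cvg_ex; exists (flat_exp (flat_exp_deriv P) 0).
    exact/cvg_lim.
  rewrite /flat_exp ltxx -/(flat_exp _).
  have [C C0 HC] := flat_exp_le ('X * P).
  apply/cvgrPdist_le => e e0; near=> h.
  rewrite sub0r normrN subr0 addr0 /GRing.scale/= mulr1.
  case: ifPn => h0; last by rewrite mulr0 normr0 ltW.
  have := HC h h0; rewrite /flat_exp h0 hornerM hornerX -mulrA.
  move=> H; apply: (le_trans H).
  have h1 : `|h| <= e / (C + 1).
    by near: h; apply: dnbhs0_le; rewrite divr_gt0// ltr_wpDl.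
  move: h1; rewrite gtr0_norm// ler_pdivlMr ?ltr_wpDl// mulrDr mulr1 mulrC => h1.
  by apply: le_trans h1; rewrite lerDl ltW.
Unshelve. all: end_near. Qed.

Lemma continuous_flat_exp P : continuous (flat_exp P).
Proof.
by move=> t; apply: differentiable_continuous; apply/derivable1_diffP;
  exact: (@ex_derive _ _ _ _ _ _ _ (is_derive_flat_exp P t)).
Qed.

End flat_exponential.

Section bumps.
Context {R : realType} {n : nat}.

(** [smooth] quantifies over all iterated partial derivatives; a class of continuous functions
    stable under each partial derivative reduces it to an induction on the list of indices. *)
Inductive bump_algebra : ('rV[R]_n -> R) -> Prop :=
| bump_cst c : bump_algebra (fun=> c)
| bump_atom P c e i : bump_algebra (fun x => flat_exp P (c * x ord0 i + e))
| bump_add f g : bump_algebra f -> bump_algebra g -> bump_algebra (fun x => f x + g x)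
| bump_mul f g : bump_algebra f -> bump_algebra g -> bump_algebra (fun x => f x * g x).

Lemma bump_continuous f : bump_algebra f -> continuous f.
Proof.
elim=> [c|P c e i|{}f g _ cf _ cg|{}f g _ cf _ cg].
- exact: cst_continuous.
- have ca : continuous (fun x : 'rV[R]_n => c * x ord0 i + e).
    apply: continuous_addr; last exact: cst_continuous.
    by apply: continuous_mulr; [exact: cst_continuous|exact: coord_continuous].
  move=> x; apply: (@cvg_comp _ _ _ (fun x : 'rV[R]_n => c * x ord0 i + e) (flat_exp P)).
    exact: ca.
  exact: continuous_flat_exp.
- exact: continuous_addr.
- exact: continuous_mulr.
Qed.

Lemma is_derive_from_line (f : 'rV[R]_n -> R) (x u : 'rV[R]_n) (l : R) :
  is_derive (0 : R) (1 : R) (fun s : R => f (s *: u + x)) l -> is_derive x u f l.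
Proof.
move=> fl.
have E : (fun h : R => h^-1 *: (f ((h *: 1 + 0) *: u + x) - f (0 *: u + x))) =
   (fun h : R => h^-1 *: (f (h *: u + x) - f x)).
  by apply/funext => h; rewrite addr0 [h *: 1]mulr1 scale0r add0r.
have fd : derivable (fun s : R => f (s *: u + x)) 0 1 by exact: ex_derive.
have fv : 'D_1 (fun s : R => f (s *: u + x)) 0 = l by exact: derive_val.
split; first by move: fd; rewrite /derivable/= E.
by move: fv; rewrite /derive/= E.
Qed.

Lemma bump_partial f (j : 'I_n) : bump_algebra f ->
  exists2 g, bump_algebra g & forall x, is_derive x (unit_vec j) f (g x).
Proof.
elim=> [c|P c e i|{}f g bf [f' bf' df] bg [g' bg' dg]|{}f g bf [f' bf' df] bg [g' bg' dg]].
- exists (fun=> 0); first exact: bump_cst.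
  by move=> x; exact: is_derive_cst.
- exists (fun x => flat_exp ((c * (i == j)%:R) *: flat_exp_deriv P) (c * x ord0 i + e)).
    exact: bump_atom.
  move=> x; apply: is_derive_from_line.
  rewrite (_ : (fun s : R => _) = flat_exp P \o (fun s : R => (c * (i == j)%:R) * s + (c * x ord0 i + e))); last first.
    apply/funext => s /=; congr flat_exp; rewrite !mxE eqxx /=; ring.
  rewrite flat_exp_scale [X in is_derive _ _ _ X]mulrC; apply: is_derive_compR => /=.
    by rewrite mulr0 add0r; exact: is_derive_flat_exp.
  apply: is_derive_eq.
  by rewrite /GRing.scale/=; ring.
- exists (fun x => f' x + g' x); first exact: bump_add.
  by move=> x; exact: is_deriveD.
- exists (fun x => f x * g' x + g x * f' x).
    by apply: bump_add; exact: bump_mul.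
  by move=> x; exact: is_deriveM.
Qed.

Lemma bump_smooth f : bump_algebra f -> smooth f.
Proof.
move=> bf s.
have H : bump_algebra (foldr partial f s).
  elim: s => //= j s IH; have [g bg dg] := bump_partial j IH.
  rewrite (_ : partial j _ = g)//; apply/funext => x.
  by rewrite /partial; exact: derive_val.
split; first exact: bump_continuous.
move=> i x; have [g _ dg] := bump_partial i H.
exact: (@ex_derive _ _ _ _ _ _ _ (dg x)).
Qed.

(** The arguments are stretched by k + 1, so that every factor tends to 1 inside the box and the
    bumps tend to the indicator of the open box. *)
Definition box_bump (a b : 'rV[R]_n) (k : nat) (x : 'rV[R]_n) : R :=
  \prod_i (flat_exp 1 (k.+1%:R * x ord0 i + - (k.+1%:R * a ord0 i)) *
           flat_exp 1 (- k.+1%:R * x ord0 i + k.+1%:R * b ord0 i)).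

Lemma box_bump_smooth a b k : smooth (box_bump a b k).
Proof.
apply: bump_smooth; rewrite /box_bump.
elim: (index_enum _) => [|i s IH].
  by under eq_fun do rewrite big_nil; exact: bump_cst.
by under eq_fun do rewrite big_cons; apply: bump_mul => //; apply: bump_mul; exact: bump_atom.
Qed.

Definition open_box (a b : 'rV[R]_n) : set 'rV[R]_n :=
  [set x | forall i, a ord0 i < x ord0 i < b ord0 i].

Lemma flat_exp1_bounds (t : R) : 0 <= flat_exp 1 t <= 1.
Proof.
rewrite /flat_exp; case: ifP => t0; last by rewrite lexx ler01.
rewrite hornerC mul1r expR_ge0/= -expR0 ler_expR oppr_le0 invr_ge0 ltW//.
Qed.

Lemma box_bump_bounds a b k x : 0 <= box_bump a b k x <= 1.
Proof.
have H (i : 'I_n) := flat_exp1_bounds (k.+1%:R * x ord0 i + - (k.+1%:R * a ord0 i)).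
have K (i : 'I_n) := flat_exp1_bounds (- k.+1%:R * x ord0 i + k.+1%:R * b ord0 i).
apply/andP; split.
  apply: prodr_ge0 => i _; have /andP[? _] := H i; have /andP[? _] := K i.
  exact: mulr_ge0.
apply: prodr_ile1 => i _; have /andP[h0 h1] := H i; have /andP[k0 k1] := K i.
by rewrite mulr_ge0//= mulr_ile1.
Qed.

Lemma box_bump0 a b k x : ~ open_box a b x -> box_bump a b k x = 0.
Proof.
move=> nx; have [i hi] : exists i, ~~ (a ord0 i < x ord0 i < b ord0 i).
  apply: contrapT => h; apply: nx => i; apply: contrapT => hi.
  by apply: h; exists i; exact/negP.
rewrite /box_bump (bigD1 i)//=; move: hi; rewrite negb_and -!leNgt => /orP[h|h].
  rewrite {1}/flat_exp ltNge (_ : _ <= 0) ?mul0r//.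
  by rewrite -mulrBr pmulr_rle0 ?ltr0n// subr_le0.
rewrite {2}/flat_exp ltNge (_ : _ <= 0) ?mulr0 ?mul0r//.
by rewrite mulNr addrC -mulrBr pmulr_rle0 ?ltr0n// subr_le0.
Qed.

Lemma flat_exp_cvg1 (t : R) : 0 < t -> flat_exp 1 (k.+1%:R * t) @[k --> \oo] --> (1 : R).
Proof.
move=> t0; rewrite (_ : (fun k => _) = fun k => expR (- (k.+1%:R^-1 * t^-1))); last first.
  apply/funext => k; rewrite /flat_exp pmulr_rgt0 ?ltr0n// t0 hornerC mul1r.
  by rewrite invfM.
rewrite -[X in _ --> X]expR0; apply: (@cvg_comp _ _ _ _ expR); last exact: continuous_expR.
rewrite -oppr0; apply: cvgN; rewrite -[X in _ --> X](mul0r t^-1); apply: cvgM.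
  exact: cvg_harmonic.
exact: cvg_cst.
Qed.

Lemma box_bump_cvg a b x :
  box_bump a b k x @[k --> \oo] --> (\1_(open_box a b) x : R).
Proof.
have [xab|xab] := pselect (open_box a b x); last first.
  rewrite indicE memNset//; under eq_fun do rewrite box_bump0//.
  exact: cvg_cst.
rewrite indicE mem_set// /box_bump -[true%:R]/(1 : R).
elim: (index_enum _) => [|i s IH].
  by under eq_fun do rewrite big_nil; exact: cvg_cst.
have /andP[ax xb] := xab i.
have A : flat_exp 1 (k.+1%:R * x ord0 i + - (k.+1%:R * a ord0 i)) @[k --> \oo] --> (1 : R).
  under eq_fun do rewrite -mulrBr.
  by apply: flat_exp_cvg1; rewrite subr_gt0.
have B : flat_exp 1 (- k.+1%:R * x ord0 i + k.+1%:R * b ord0 i) @[k --> \oo] --> (1 : R).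
  under eq_fun do rewrite mulNr addrC -mulrBr.
  by apply: flat_exp_cvg1; rewrite subr_gt0.
under eq_fun do rewrite big_cons.
have := cvgM (cvgM A B) IH; by rewrite !mulr1 => H; exact: H.
Qed.

Lemma closed_rV_box (a b : 'rV[R]_n) : closed (rV_box a b).
Proof.
rewrite (_ : rV_box a b = \bigcap_(i in [set: 'I_n])
  ((fun x : 'rV[R]_n => x ord0 i) @^-1` `[a ord0 i, b ord0 i])).
  apply: closed_bigI => i _; apply: closed_comp; last exact: itv_closed.
  by move=> x _; exact: coord_continuous.
apply/seteqP; split => x /= h i; have := h i; rewrite /= in_itv//=.
by move=> /(_ I).
Qed.

Lemma rV_norm_le (x : 'rV[R]_n) (c : R) : 0 <= c -> (forall i, `|x ord0 i| <= c) -> `|x| <= c.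
Proof.
move=> c0 h; rewrite /Num.norm/= mx_normrE; apply: bigmax_le => // -[i j] _ /=.
by rewrite ord1; exact: h.
Qed.

Lemma rV_coord_le (x : 'rV[R]_n) i : `|x ord0 i| <= `|x|.
Proof.
rewrite [leRHS]/Num.norm/= mx_normrE.
by apply/bigmax_geP; right; exists (ord0, i).
Qed.

Lemma compact_rV_box (a b : 'rV[R]_n) : compact (rV_box a b).
Proof.
apply: bounded_closed_compact; last exact: closed_rV_box.
exists (`|a| + `|b|); split; first exact: num_real.
move=> M /ltW aM x /= xab; apply: le_trans aM; apply: rV_norm_le => [|i].
  by rewrite addr_ge0.
have /andP[h1 h2] := xab i; have := rV_coord_le a i; have := rV_coord_le b i.
rewrite !ler_norml => /andP[_ hb] /andP[ha _]; apply/andP; split.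
  by have := normr_ge0 b; lra.
by have := normr_ge0 a; lra.
Qed.

Lemma test_function_box_bump Om a b k : rV_box a b `<=` Om ->
  test_function Om (box_bump a b k).
Proof.
move=> abOm; have H : closure [set x | box_bump a b k x != 0] `<=` rV_box a b.
  rewrite [X in _ `<=` X](iffLR (closure_id _) (@closed_rV_box a b)).
  apply: closureS => x /= nz i; apply: contrapT => hi; move/eqP : nz; apply.
  apply: box_bump0 => h; apply: hi; have /andP[h1 h2] := h i.
  by rewrite !ltW.
split; first exact: box_bump_smooth; split.
  apply: (subclosed_compact _ (@compact_rV_box a b) H); exact: closed_closure.
exact: subset_trans H abOm.
Qed.

End bumps.

Section box_generation.
Context {R : realType} {n : nat}.

Definition open_boxes : set (set 'rV[R]_n) := [set A | exists a b, A = open_box a b].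

Lemma measurable_open_box (a b : 'rV[R]_n) : measurable (open_box a b).
Proof.
rewrite (_ : open_box a b = \bigcap_(i in [set: 'I_n])
  ((fun x : 'rV[R]_n => x ord0 i) @^-1` `]a ord0 i, b ord0 i[)).
  apply: fin_bigcap_measurable => // i _.
  by rewrite -[X in measurable X]setTI; apply: measurable_coord.
apply/seteqP; split => x /= h i; have := h i; rewrite /= in_itv//=.
by move=> /(_ I).
Qed.

Lemma open_boxI (a b a' b' : 'rV[R]_n) :
  open_box a b `&` open_box a' b' =
  open_box (\row_i Num.max (a ord0 i) (a' ord0 i)) (\row_i Num.min (b ord0 i) (b' ord0 i)).
Proof.
apply/seteqP; split => x /=.
  by move=> [h h'] i; rewrite !mxE gt_max lt_min; have /andP[-> ->] := h i; exact: h'.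
by move=> h; split => i; have := h i; rewrite !mxE gt_max lt_min => /andP[/andP[? ?] /andP[? ?]]; apply/andP.
Qed.

(** Open boxes are stable under intersection; as generators they allow the Dynkin argument of
    [integral_subbox_eq0]. *)
Lemma rV_measurable_boxes : @measurable _ 'rV[R]_n = <<s open_boxes >>.
Proof.
apply/seteqP; split; last first.
  apply: smallest_sub; first exact: sigma_algebra_measurable.
  by move=> _ [a [b ->]]; exact: measurable_open_box.
apply: smallest_sub; first exact: smallest_sigma_algebra.
move=> A; rewrite -bigcup_seq => -[i _ [Y mY <-]]; rewrite setTI.
pose f : g_sigma_algebraType open_boxes -> measurableTypeR R := fun x => x ord0 i.
suff : measurable_fun setT f.
  by move=> /(_ measurableT Y mY); rewrite setTI.
apply: (@measurability _ _ _ _ setT f _ (RGenOInfty.measurableE R)) => _ [_ [c ->] <-].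
rewrite setTI (_ : _ @^-1` _ = \bigcup_k open_box
   (\row_j (if j == i then c else - k%:R)) (\row_j k%:R)); last first.
  apply/seteqP; split => x /=.
    rewrite in_itv/= andbT => cx; exists (Num.trunc `|x|).+1 => // j; rewrite !mxE.
    have := rV_coord_le x j; have := truncnS_gt `|x| => h1 h2.
    have := le_lt_trans h2 h1; rewrite ltr_norml => /andP[h3 ->]; rewrite andbT.
    by case: eqP => // ->.
  by move=> [k _ /(_ i)]; rewrite !mxE eqxx in_itv/= andbT => /andP[].
apply: bigcupT_measurable => k; apply: sub_sigma_algebra.
by exists (\row_j (if j == i then c else - k%:R)), (\row_j k%:R).
Qed.

End box_generation.

Section fundamental_lemma.
Context {R : realType} {n : nat}.
Local Notation lam := (@lebesgue_rV R n).
Variables (Om : set 'rV[R]_n) (g : 'rV[R]_n -> R).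
Hypotheses (mOm : measurable Om) (oOm : open Om).
Hypothesis ig : lam.-integrable Om (EFin \o g).

Let box_subset (a b : 'rV[R]_n) : rV_box a b `<=` Om -> open_box a b `<=` Om.
Proof.
by move=> h x xab; apply: h => i; have /andP[? ?] := xab i; rewrite !ltW.
Qed.

Lemma integral_box_eq0 (a b : 'rV[R]_n) :
  (forall phi, test_function Om phi -> \int[lam]_(x in Om) (g x * phi x) = 0) ->
  rV_box a b `<=` Om -> (\int[lam]_(x in open_box a b) (g x)%:E = 0)%E.
Proof.
move=> g0 abOm.
have mg : measurable_fun Om g by apply/measurable_EFinP; exact: (measurable_int lam ig).
have mbump k : measurable_fun Om (box_bump a b k).
  apply: measurable_funTS; apply: continuous_measurable_rV.
  by have [/=] := box_bump_smooth a b k [::].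
have [] := @dominated_convergence _ _ _ lam Om mOm
  (fun k x => (g x * box_bump a b k x)%:E) (fun x => (g x * \1_(open_box a b) x)%:E)
  (fun x => `|(g x)%:E|%E).
- by move=> k; apply/measurable_EFinP; exact: measurable_funM.
- apply/measurable_EFinP; apply: measurable_funM => //; apply: measurable_funTS.
  by apply: measurable_indic; exact: measurable_open_box.
- apply: aeW => x _; apply: cvg_EFin; first by near=> k.
  by apply: cvgM; [exact: cvg_cst|exact: box_bump_cvg].
- exact: integrable_abse.
- apply: aeW => x k _; rewrite /= lee_fin normrM ler_piMr//.
  by have /andP[? ?] := box_bump_bounds a b k x; rewrite ger0_norm.
move=> i1 _ /cvg_lim h.
rewrite integral_mkcond (_ : _ \_ _ = (fun x => (g x * \1_(open_box a b) x)%:E) \_ Om); last first.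
  apply/funext => x; rewrite /patch indicE; case: ifPn => xab.
    by rewrite mem_set ?mulr1//; apply: box_subset abOm _ _; exact: set_mem.
  by rewrite mulr0; case: ifP.
rewrite -integral_mkcond -h//; apply: lim_near_cst => //; near=> k.
have ik : lam.-integrable Om (fun x => (g x * box_bump a b k x)%:E).
  apply: le_integrable (ig) => //.
    by apply/measurable_EFinP; exact: measurable_funM.
  move=> x _; rewrite /= lee_fin normrM ler_piMr//.
  by have /andP[? ?] := box_bump_bounds a b k x; rewrite ger0_norm.
have := g0 _ (test_function_box_bump k abOm); rewrite /Rintegral => h'.
rewrite -[LHS]fineK; first by rewrite h'.
exact: integrable_fin_num.
Unshelve. all: end_near. Qed.

(** Dynkin induction on [S]. The passage to almost everywhere zero, [integral_ae_eq], tests all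
    measurable subsets of a box, whereas bump functions reach boxes only. *)
Lemma integral_subbox_eq0 (a b : 'rV[R]_n) (S : set 'rV[R]_n) :
  (forall a b, rV_box a b `<=` Om -> (\int[lam]_(x in open_box a b) (g x)%:E = 0)%E) ->
  rV_box a b `<=` Om -> measurable S ->
  (\int[lam]_(x in S `&` open_box a b) (g x)%:E = 0)%E.
Proof.
move=> g0 abOm mS; set B := open_box a b.
have mB : measurable B by exact: measurable_open_box.
have iB (T : set 'rV[R]_n) : measurable T -> lam.-integrable (T `&` B) (EFin \o g).
  move=> mT; apply: integrableS ig => //; first exact: measurableI.
  by move=> x [_]; exact: box_subset.
have mgT (T : set 'rV[R]_n) : measurable T -> measurable_fun (T `&` B) (EFin \o g).
  by move=> mT; exact: measurable_int (iB T mT).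
move: mS; rewrite rV_measurable_boxes => sS.
apply: (@dynkin_induction _ 'rV[R]_n open_boxes
  (fun S => \int[lam]_(x in S `&` B) (g x)%:E = 0)%E) sS => //.
- exact: rV_measurable_boxes.
- by move=> _ _ [c [e ->]] [c' [e' ->]]; rewrite open_boxI; do 2 eexists.
- by rewrite setTI; exact: g0.
- move=> _ [c [e ->]]; rewrite open_boxI; apply: g0 => x /= xab; apply: abOm => i.
  have := xab i; rewrite !mxE ge_max le_min => /andP[/andP[_ ->] /andP[_ ->]] //.
- move=> T mT T0; have := g0 _ _ abOm; rewrite -/B.
  have {1}-> : B = (T `&` B) `|` (~` T `&` B) by rewrite -setIUl setUv setTI.
  rewrite integral_setU//.
  + by rewrite T0 add0e.
  + exact: measurableI.
  + by apply: measurableI => //; exact: measurableC.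
  + by rewrite -setIUl; apply: mgT; rewrite setUv.
  + apply/disj_setPS => x [[]]. by move=> ? ? [].
- move=> F mF tF F0; rewrite setI_bigcupl integral_bigcup//.
  + by rewrite eseries0// => k _ _; exact: F0.
  + by apply: trivIset_setIr.
  + by move=> k; exact: measurableI.
  + by rewrite -setI_bigcupl; apply: iB; exact: bigcupT_measurable.
Qed.

(** The open set [Om] is covered by the boxes with rational corners whose closure it contains. They
    are enumerated through [pickle], and countably many null sets have a null union. *)
Lemma ae_zero_of_boxes :
  (forall a b, rV_box a b `<=` Om -> (\int[lam]_(x in open_box a b) (g x)%:E = 0)%E) ->
  {ae lam, forall x, Om x -> g x = 0}.
Proof.
move=> g0.
have nbox (a b : 'rV[R]_n) : rV_box a b `<=` Om ->
    lam.-negligible [set x | open_box a b x /\ g x != 0].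
  move=> abOm.
  have := @integral_ae_eq _ _ _ lam (open_box a b) (measurable_open_box a b) (cst 0%E) (EFin \o g).
  case.
  - apply: integrableS ig => //; first exact: measurable_open_box.
    exact: box_subset.
  - exact: measurable_cst.
  - move=> E Eab mE; rewrite [RHS]integral0.
    rewrite -[LHS](_ : \int[lam]_(x in E `&` open_box a b) (g x)%:E = _)%E.
      exact: integral_subbox_eq0.
    by rewrite (setIidl Eab).
  move=> N [mN N0 sN]; exists N; split => // x [/= xab gx]; apply: sN => /= h.
  by have [] := h xab => /eqP; rewrite (negbTE gx).
pose rbox (k : nat) : set 'rV[R]_n :=
  if unpickle k is Some p then
    let a := \row_i ratr ((p : {ffun 'I_n -> rat * rat}) i).1 in
    let b := \row_i ratr ((p : {ffun 'I_n -> rat * rat}) i).2 in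
    if `[<rV_box a b `<=` Om>] then [set x | open_box a b x /\ g x != 0] else set0
  else set0.
have nr k : lam.-negligible (rbox k).
  rewrite /rbox; case: unpickle => [p|]; last exact: negligible_set0.
  by case: asboolP => [h|_]; [exact: nbox|exact: negligible_set0].
rewrite /almost_everywhere; apply: (negligibleS _ (negligible_bigcup nr)).
move=> x /= /not_implyP[xOm gx].
have /nbhs_ballP[e /= e0 He] : nbhs x Om by exact: open_nbhs_nbhs.
have rl i : exists q : rat, x ord0 i - e < ratr q < x ord0 i.
  have : x ord0 i - e < x ord0 i by rewrite ltrBlDr ltrDl.
  by move=> /rat_in_itvoo[q]; rewrite in_itv/= => h; exists q.
have rr i : exists q : rat, x ord0 i < ratr q < x ord0 i + e.
  have : x ord0 i < x ord0 i + e by rewrite ltrDl.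
  by move=> /rat_in_itvoo[q]; rewrite in_itv/= => h; exists q.
pose p : {ffun 'I_n -> rat * rat} := [ffun i => (sval (cid (rl i)), sval (cid (rr i)))].
exists (pickle p) => //; rewrite /rbox pickleK.
case: asboolP => [_|[]].
  split; last exact/eqP.
  move=> i; rewrite !mxE ffunE/=.
  by have /andP[_ ->] := svalP (cid (rl i)); have /andP[-> _] := svalP (cid (rr i)).
move=> y /= yp; apply: He; split => // j i; rewrite ord1.
have := yp i; rewrite !mxE ffunE/= => /andP[h1 h2].
have /andP[h3 _] := svalP (cid (rl i)); have /andP[_ h4] := svalP (cid (rr i)).
rewrite /ball/= ltr_distl; apply/andP; split.
  by rewrite ltrBlDr (le_lt_trans h2).
by rewrite -ltrBlDr (lt_le_trans h3).
Qed.

Theorem ae_zero_of_test_functions :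
  (forall phi, test_function Om phi -> \int[lam]_(x in Om) (g x * phi x) = 0) ->
  {ae lam, forall x, Om x -> g x = 0}.
Proof. by move=> g0; apply: ae_zero_of_boxes => a b; exact: integral_box_eq0. Qed.

End fundamental_lemma.

(** * Square-integrable functions *)

Section L2_theory.
Context {disp : measure_display} {T : measurableType disp} {R : realType}.
Variables (mu : {measure set T -> \bar R}) (A : set T).
Hypothesis mA : measurable A.
Implicit Types u v : T -> R.

Lemma integrable_addr u v : mu.-integrable A (EFin \o u) ->
  mu.-integrable A (EFin \o v) -> mu.-integrable A (EFin \o (fun x => u x + v x)).
Proof. by move=> iu iv; exact: (integrableD mA iu iv). Qed.

Lemma integrable_scaler (a : R) u : mu.-integrable A (EFin \o u) ->
  mu.-integrable A (EFin \o (fun x => a * u x)).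
Proof. by move=> iu; exact: (integrableZl mA a iu). Qed.

Lemma L2_sqr_integrable u : L2 mu A u -> mu.-integrable A (EFin \o (fun x => u x ^+ 2)).
Proof.
move=> [mu_ u2]; apply/integrableP; split.
  by apply/measurable_EFinP; exact: measurable_funX.
by under eq_integral => x _ do rewrite /= ger0_norm ?sqr_ge0//.
Qed.

Lemma L2_mul_integrable u v : L2 mu A u -> L2 mu A v ->
  mu.-integrable A (EFin \o (fun x => u x * v x)).
Proof.
move=> Lu Lv.
apply: (@le_integrable _ _ _ _ A mA _ (EFin \o (fun x => u x ^+ 2 + v x ^+ 2))).
- by apply/measurable_EFinP; apply: measurable_funM; [case: Lu|case: Lv].
- move=> x _; rewrite /= lee_fin [leRHS]ger0_norm ?addr_ge0 ?sqr_ge0//.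
  rewrite ler_norml; apply/andP; split.
    have := sqr_ge0 (u x + v x); have := sqr_ge0 (u x); have := sqr_ge0 (v x); nra.
  have := sqr_ge0 (u x - v x); have := sqr_ge0 (u x); have := sqr_ge0 (v x); nra.
- by apply: integrable_addr; exact: L2_sqr_integrable.
Qed.

Lemma integrable_L2 u : measurable_fun A u ->
  mu.-integrable A (EFin \o (fun x => u x ^+ 2)) -> L2 mu A u.
Proof.
move=> mu_ /integrableP[_ u2]; split => //.
by apply: le_lt_trans u2; rewrite le_eqVlt; apply/orP; left; apply/eqP/eq_integral => x _;
  rewrite /= ger0_norm ?sqr_ge0.
Qed.

Lemma L2_lin (a : R) u v : L2 mu A u -> L2 mu A v -> L2 mu A (fun x => a * u x + v x).
Proof.
move=> Lu Lv; have [m1 _] := Lu; have [m2 _] := Lv.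
have m3 : measurable_fun A (fun x => a * u x + v x).
  by apply: measurable_funD => //; apply: measurable_funM => //; exact: measurable_cst.
apply: integrable_L2 => //.
rewrite (_ : EFin \o _ = (EFin \o (fun x => a ^+ 2 * u x ^+ 2 + ((2 * a) * (u x * v x) + v x ^+ 2)))); last first.
  by apply/funext => x /=; congr EFin; ring.
apply: integrable_addr; first by apply: integrable_scaler; exact: L2_sqr_integrable.
apply: integrable_addr; last exact: L2_sqr_integrable.
by apply: integrable_scaler; exact: L2_mul_integrable.
Qed.

Lemma L2_0 : L2 mu A (fun=> 0).
Proof.
split; first exact: measurable_cst.
by rewrite integral0_eq// => x _; rewrite expr0n.
Qed.

Lemma L2Z (a : R) u : L2 mu A u -> L2 mu A (fun x => a * u x).
Proof.
by move=> Lu; have := L2_lin a Lu L2_0; under eq_fun do rewrite addr0.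
Qed.

Lemma L2D u v : L2 mu A u -> L2 mu A v -> L2 mu A (fun x => u x + v x).
Proof.
by move=> Lu Lv; have := L2_lin 1 Lu Lv; under eq_fun do rewrite mul1r.
Qed.

Lemma L2B u v : L2 mu A u -> L2 mu A v -> L2 mu A (fun x => u x - v x).
Proof.
move=> Lu Lv; have := L2_lin (-1) Lv Lu.
by under eq_fun do rewrite mulN1r addrC.
Qed.

Lemma L2_sum (I : Type) (s : seq I) (u : I -> T -> R) :
  (forall i, L2 mu A (u i)) -> L2 mu A (fun x => \sum_(i <- s) u i x).
Proof.
move=> Lu; elim: s => [|i s IH]; first by under eq_fun do rewrite big_nil; exact: L2_0.
by under eq_fun do rewrite big_cons; exact: L2D.
Qed.

Lemma L2_bounded u (M : R) : (mu A < +oo)%E -> measurable_fun A u ->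
  (forall x, A x -> `|u x| <= M) -> L2 mu A u.
Proof.
move=> Aoo mu_ uM; split => //.
apply: (@le_lt_trans _ _ (\int[mu]_(x in A) (M ^+ 2)%:E)%E).
  apply: ge0_le_integral => //.
  - by move=> x _; rewrite lee_fin sqr_ge0.
  - by apply/measurable_EFinP; exact: measurable_funX.
  - by move=> x Ax; rewrite lee_fin -(real_normK (num_real (u x))) lerXn2r ?nnegrE// ?uM// (le_trans _ (uM x Ax)).
by rewrite integral_cst// lte_mul_pinfty// lee_fin sqr_ge0.
Qed.

Lemma L2_integrable u : (mu A < +oo)%E -> L2 mu A u -> mu.-integrable A (EFin \o u).
Proof.
move=> Aoo Lu; have L1 : L2 mu A (fun=> 1).
  by apply: (@L2_bounded _ 1) => // x _; rewrite normr1.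
by have := L2_mul_integrable Lu L1; under eq_fun do rewrite mulr1.
Qed.

Lemma ae_eq_Rintegral u v : measurable_fun A u -> measurable_fun A v ->
  {ae mu, forall x, A x -> u x = v x} ->
  \int[mu]_(x in A) u x = \int[mu]_(x in A) v x.
Proof.
move=> m1 m2 uv; congr fine; apply: ae_eq_integral => //.
- exact/measurable_EFinP.
- exact/measurable_EFinP.
- by apply: filterS uv => x h Ax; rewrite h.
Qed.

End L2_theory.

(** * The polytope, its closure and its surface measure *)

Lemma continuous_dotv (R : realType) n (v : 'rV[R]_n) : continuous (dotv v).
Proof.
apply: continuous_sumr => i; apply: continuous_mulr; first exact: cst_continuous.
exact: coord_continuous.
Qed.

Lemma dotv_coord_le (R : realType) n (x : 'rV[R]_n) i : x ord0 i ^+ 2 <= dotv x x.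
Proof.
rewrite /dotv (bigD1 i)//= -expr2 lerDl; apply: sumr_ge0 => j _.
by rewrite -expr2 sqr_ge0.
Qed.

Lemma dotv_le (R : realType) n (x : 'rV[R]_n) c : (forall i, `|x ord0 i| <= c) ->
  dotv x x <= n%:R * c ^+ 2.
Proof.
move=> h; rewrite /dotv mulr_natl -[X in _ *+ X]card_ord -sumr_const.
apply: ler_sum => i _; rewrite -expr2 -(real_normK (num_real (x ord0 i))).
by rewrite lerXn2r ?nnegrE// ?h// (le_trans _ (h i)).
Qed.

Lemma enorm_sqr (R : realType) n (x : 'rV[R]_n) : enorm x ^+ 2 = dotv x x.
Proof. by rewrite /enorm sqr_sqrtr// dotv_ge0. Qed.

Section polytope.
Context {R : realType} {d : nat} (P : polytopic_domain R d).
Local Notation Om := (domain_set P).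
Local Notation lam := (@lebesgue_rV R d).
Local Notation nu := (normal (p := P)).
Local Notation b := (offset (p := P)).

Definition closed_domain : set 'rV[R]_d :=
  [set x | forall i, dotv (nu i) x <= b i].

Lemma dotv_normal i : dotv (nu i) (nu i) = 1.
Proof.
have h : enorm (nu i) = 1 by case: P i.
by rewrite -enorm_sqr h expr1n.
Qed.

Lemma domain_nonempty : Om !=set0.
Proof. by rewrite /domain_set; case: P. Qed.

Lemma domain_bounded : exists2 M, 0 < M & forall x, Om x -> `|x| <= M.
Proof.
have : bounded_set Om by rewrite /domain_set; case: P.
move=> [M [_ hM]]; exists (`|M| + 1); first by rewrite ltr_wpDl.
move=> x xOm; apply: (hM (`|M| + 1)) => //.
by rewrite (le_lt_trans (ler_norm _))// ltrDl.
Qed.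

Lemma open_domain : open Om.
Proof.
rewrite openE => x xOm; rewrite /interior.
suff : nbhs x (fun y => forall i, dotv (nu i) y < b i) by [].
have hi (i : 'I_(nfacets P)) : nbhs x (dotv (nu i) @^-1` [set y | y < b i]).
  apply: open_nbhs_nbhs; split; last exact: xOm.
  by apply: open_comp; [move=> y _; exact: continuous_dotv|exact: open_lt].
exact: (@filter_forall _ _ (fun i y => dotv (nu i) y < b i) _ _ hi).
Qed.

Lemma closed_closed_domain : closed closed_domain.
Proof.
rewrite (_ : closed_domain = \bigcap_(i in [set: 'I_(nfacets P)])
    (dotv (nu i) @^-1` [set y | y <= b i])).
  apply: closed_bigI => i _; apply: closed_comp; last exact: closed_le.
  by move=> x _; exact: continuous_dotv.
by apply/seteqP; split => x /= h i; have := h i => //; apply.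
Qed.

Lemma measurable_domain : measurable Om.
Proof.
rewrite (_ : Om = \bigcap_(i in [set: 'I_(nfacets P)]) (dotv (nu i) @^-1` `]-oo, b i[)).
  apply: fin_bigcap_measurable => // i _.
  by rewrite -[X in measurable X]setTI; apply: measurable_dotv.
by apply/seteqP; split => x /= h i; have := h i; rewrite /= in_itv//=; apply.
Qed.

Lemma measurable_closed_domain : measurable closed_domain.
Proof.
rewrite (_ : closed_domain = \bigcap_(i in [set: 'I_(nfacets P)]) (dotv (nu i) @^-1` `]-oo, b i])).
  apply: fin_bigcap_measurable => // i _.
  by rewrite -[X in measurable X]setTI; apply: measurable_dotv.
by apply/seteqP; split => x /= h i; have := h i; rewrite /= in_itv//=; apply.
Qed.

Lemma segment_in_domain (x0 x : 'rV[R]_d) e : Om x0 -> closed_domain x -> 0 < e <= 1 ->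
  Om (x + e *: (x0 - x)).
Proof.
move=> x0Om xcl /andP[e0 e1] i; rewrite dotvDr dotvZr dotvBr.
have := x0Om i; have := xcl i => h1 h2.
rewrite (_ : _ + _ = (1 - e) * dotv (nu i) x + e * dotv (nu i) x0); last by ring.
rewrite -[ltRHS]mul1r -[X in X * b i](subrK e 1) [ltRHS]mulrDl ler_ltD//.
  by rewrite ler_wpM2l// subr_ge0.
by rewrite ltr_pM2l.
Qed.

Lemma closed_domain_convex (x y : 'rV[R]_d) e : closed_domain x -> closed_domain y ->
  0 <= e <= 1 -> closed_domain (x + e *: (y - x)).
Proof.
move=> xc yc /andP[e0 e1] i; rewrite dotvDr dotvZr dotvBr.
rewrite (_ : _ + _ = (1 - e) * dotv (nu i) x + e * dotv (nu i) y); last by ring.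
rewrite -[leRHS]mul1r -[X in X * b i](subrK e 1) [leRHS]mulrDl lerD//.
  by rewrite ler_wpM2l// ?subr_ge0//; exact: xc.
by rewrite ler_wpM2l//; exact: yc.
Qed.

(** Moving a point of [closed_domain] slightly towards an interior point makes all its inequalities
    strict. *)
Lemma closure_domain : closure Om = closed_domain.
Proof.
apply/seteqP; split.
  rewrite [X in _ `<=` X](iffLR (closure_id _) closed_closed_domain).
  by apply: closureS => x h i; exact/ltW/h.
move=> x xc B /nbhs_ballP[e /= e0 eB].
have [x0 x0Om] := domain_nonempty.
pose t := Num.min 1 (e / (2 * (`|x0 - x| + 1))).
have D0 : 0 < 2 * (`|x0 - x| + 1) by rewrite mulr_gt0// ltr_wpDl.
have t0 : 0 < t by rewrite /t lt_min ltr01 divr_gt0.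
have t1 : t <= 1 by rewrite /t ge_min lexx.
exists (x + t *: (x0 - x)); split.
  by apply: segment_in_domain => //; rewrite t0.
apply: eB; rewrite -ball_normE /ball_/= opprD addrA subrr add0r normrN normrZ gtr0_norm//.
have : t <= e / (2 * (`|x0 - x| + 1)) by rewrite /t ge_min lexx orbT.
rewrite ler_pdivlMr// => h; have := normr_ge0 (x0 - x) => h3.
have h4 : 0 <= t * `|x0 - x| by rewrite mulr_ge0// ltW.
lra.
Qed.

Lemma closed_domain_bounded : exists2 M, 0 < M & forall x, closed_domain x -> `|x| <= M.
Proof.
have [M M0 hM] := domain_bounded; exists M => // x; rewrite -closure_domain.
suff cl : closed [set x : 'rV[R]_d | `|x| <= M].
  move=> h; have : closure [set x : 'rV[R]_d | `|x| <= M] x by exact: closureS h.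
  by rewrite -(iffLR (closure_id _) cl).
apply: (@closed_comp _ _ _ [set y | y <= M]); last exact: closed_le.
by move=> y _; exact: norm_continuous.
Qed.

Lemma compact_closed_domain : compact closed_domain.
Proof.
apply: bounded_closed_compact; last exact: closed_closed_domain.
have [M M0 hM] := closed_domain_bounded.
exists M; split; first exact: num_real.
by move=> N MN x xc; apply: (le_trans (hM _ xc)); exact: ltW.
Qed.

Lemma bounded_finite_measure (A : set 'rV[R]_d) M : measurable A ->
  (forall x, A x -> `|x| <= M) -> (lam A < +oo)%E.
Proof.
move=> mA hA; pose N := `|M|.
apply: (@le_lt_trans _ _ (lam (rV_box (const_mx (- N)) (const_mx N)))).
  apply: le_measure; rewrite ?inE//; first exact: measurable_rV_box.
  move=> x /hA xM i; rewrite !mxE -ler_norml; apply: le_trans (rV_coord_le _ _) _.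
  exact: le_trans xM (ler_norm _).
rewrite lebesgue_rV_box ?ltry// => i; rewrite !mxE.
by have := normr_ge0 M; rewrite -/N; lra.
Qed.

Lemma lebesgue_domain_fin : (lam Om < +oo)%E.
Proof.
by have [M _ hM] := domain_bounded; apply: bounded_finite_measure hM; exact: measurable_domain.
Qed.

Lemma boundaryE : boundary P = closed_domain `\` Om.
Proof. by rewrite /boundary closure_domain. Qed.

Lemma measurable_boundary : measurable (boundary P).
Proof.
rewrite boundaryE; apply: measurableD; first exact: measurable_closed_domain.
exact: measurable_domain.
Qed.

Lemma domain_sub_closed : Om `<=` closed_domain.
Proof. by move=> x h i; exact/ltW/h. Qed.

Lemma lebesgue_boundary : lam (boundary P) = 0%E.
Proof.
apply/eqP; rewrite -measure_le0.
have : lam.-negligible (\big[setU/set0]_(i < nfacets P) [set x | dotv (nu i) x = b i]).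
  elim/big_ind : _ => [|A B|i _]; [exact: negligible_set0|exact: negligibleU|].
  exists [set x | dotv (nu i) x = b i].
  split => //; first exact: measurable_hyperplane.
  apply: lebesgue_rV_hyperplane; apply/eqP => h; have := dotv_normal i.
  by rewrite h /dotv big1 => [/esym/eqP|j _]; rewrite ?oner_eq0// mxE mul0r.
move=> [N [mN N0 sN]]; rewrite -N0.
apply: (@le_measure _ _ _ lam (boundary P) N); [apply/mem_set; exact: measurable_boundary|exact/mem_set|].
apply: subset_trans sN; rewrite boundaryE => x [xc /= /existsNP[i hi]].
rewrite -bigcup_seq; exists i => /=; first by rewrite mem_index_enum.
by apply/eqP; rewrite eq_le xc leNgt; apply/negP.
Qed.

Lemma facet_proj_id (i : 'I_(nfacets P)) x : slab i x ->
  x = facet_proj i x + (dotv (nu i) x - b i) *: nu i.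
Proof. by rewrite /facet_proj subrK. Qed.

Definition prism (i : 'I_(nfacets P)) (A : set 'rV[R]_d) : set 'rV[R]_d :=
  slab i `&` facet_proj i @^-1` (A `&` facet i).

Lemma measurable_prism i A : measurable A -> measurable (prism i A).
Proof.
move=> mA; apply: measurableI; first exact: measurable_slab.
rewrite -[X in measurable X]setTI; apply: measurable_facet_proj => //.
by apply: measurableI => //; exact: measurable_facet.
Qed.

Lemma normal_coord_le (i : 'I_(nfacets P)) j : `|nu i ord0 j| <= 1.
Proof.
have := dotv_coord_le (nu i) j; rewrite dotv_normal => h.
by rewrite -(@ler_pXn2r _ 2)// ?nnegrE// real_normK ?num_real// expr1n.
Qed.

Lemma surface_fin A : measurable A -> (surface P A < +oo)%E.
Proof.
move=> mA; rewrite /surface; apply: lte_sum_pinfty => i _.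
have [M M0 hM] := closed_domain_bounded.
apply: (@bounded_finite_measure _ (M + 1)); first exact: measurable_prism.
move=> x [xs [_ xf]]; rewrite (facet_proj_id xs).
apply: le_trans (ler_normD _ _) _; apply: lerD.
  by apply: hM; have [] := xf.
rewrite normrZ -[leRHS]mulr1; apply: ler_pM => //.
  by move: xs; rewrite /slab /= => /andP[h1 h2]; rewrite ger0_norm; lra.
by apply: rV_norm_le => // j; exact: normal_coord_le.
Qed.

Lemma continuous_domain_bounded (f : 'rV[R]_d -> R) : continuous f ->
  exists M, forall x, closed_domain x -> `|f x| <= M.
Proof.
move=> cf; have : bounded_set (f @` closed_domain).
  apply: compact_bounded; apply: continuous_compact; last exact: compact_closed_domain.
  exact: continuous_subspaceT.
move=> [M [_ hM]]; exists (`|M| + 1) => x xc; apply: (hM (`|M| + 1)); last by exists x.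
by rewrite (le_lt_trans (ler_norm _))// ltrDl.
Qed.

Lemma continuous_L2_domain (f : 'rV[R]_d -> R) : continuous f -> L2 lam Om f.
Proof.
move=> cf; have [M hM] := continuous_domain_bounded cf.
apply: (@L2_bounded _ _ _ _ _ measurable_domain _ M).
- exact: lebesgue_domain_fin.
- by apply: measurable_funTS; exact: continuous_measurable_rV.
- by move=> x /domain_sub_closed; exact: hM.
Qed.

Lemma continuous_L2_boundary (f : 'rV[R]_d -> R) : continuous f ->
  L2 (surface P) (boundary P) f.
Proof.
move=> cf; have [M hM] := continuous_domain_bounded cf.
apply: (@L2_bounded _ _ _ _ _ measurable_boundary _ M).
- apply: surface_fin; exact: measurable_boundary.
- by apply: measurable_funTS; exact: continuous_measurable_rV.
- by move=> x; rewrite boundaryE => -[+ _]; exact: hM.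
Qed.

Let prism1 (i : 'I_(nfacets P)) := slab i `&` facet_proj i @^-1` facet i.

Let mprism1 i : measurable (prism1 i).
Proof.
apply: measurableI; first exact: measurable_slab.
rewrite -[X in measurable X]setTI; apply: measurable_facet_proj => //.
exact: measurable_facet.
Qed.

Let facet_measure (i : 'I_(nfacets P)) : {measure set 'rV[R]_d -> \bar R} :=
  measure_function_pushforward__canonical__measure_function_Measure
    (mrestr lam (mprism1 i)) (@measurable_facet_proj R d P i).

Let facet_measureE i A : facet_measure i A = lam (prism i A).
Proof.
rewrite /facet_measure/= /pushforward /mrestr; congr (lam _).
rewrite /prism /prism1; apply/seteqP; split => x /=; first by move=> [? []].
by move=> [? []].
Qed.

(** [surface P] is the sum over the facets of the pushforwards, by [facet_proj], of Lebesgue measure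
    on the unit prisms; only the term of facet [i] is kept. *)
Lemma ge0_integral_prism_le i A (f : 'rV[R]_d -> \bar R) : measurable A ->
  measurable_fun setT f -> (forall x, 0 <= f x)%E ->
  (\int[lam]_(w in prism i A) f (facet_proj i w) <= \int[surface P]_(x in A) f x)%E.
Proof.
move=> mA mf f0.
(* [msum] takes a sequence of measures; past the last facet it is continued by zero. *)
pose m_ (k : nat) : {measure set 'rV[R]_d -> \bar R} :=
  if insub k is Some i then facet_measure i else mzero.
have -> : (\int[surface P]_(x in A) f x = \int[msum m_ (nfacets P)]_(x in A) f x)%E.
  apply: eq_measure_integral => B mB _; rewrite /= /msum /surface.
  apply: eq_bigr => j _; rewrite /m_ (_ : insub _ = Some j); last by rewrite valK.
  by rewrite facet_measureE.
rewrite ge0_integral_measure_sum//; last exact: measurable_funTS.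
rewrite (bigD1 i)//= {1}/m_ (_ : insub _ = Some i); last by rewrite valK.
rewrite -[leLHS]adde0; apply: leeD; last first.
  by apply: sume_ge0 => j _; exact: integral_ge0.
rewrite /facet_measure ge0_integral_pushforward//; last exact: measurable_funTS.
rewrite (_ : \int[lam]_(w in prism i A) _ =
    \int[mrestr lam (mprism1 i)]_(w in prism i A) f (facet_proj i w))%E; last first.
  apply: eq_measure_integral => B mB BA; rewrite /mrestr; congr (lam _).
  by apply/esym/setIidl => x /BA[? [? ?]]; split.
apply: ge0_subset_integral => //.
- exact: measurable_prism.
- by rewrite -[X in measurable X]setTI; exact: measurable_facet_proj.
- apply: measurable_funTS; apply: (measurableT_comp mf); exact: measurable_facet_proj.
- by move=> x [_ []].
exact: measurable_facet_proj.
Qed.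

End polytope.

(** * Coercive quadratic forms and inequalities between square integrals *)

Lemma dotvZZ (R : realType) n (a : R) (x : 'rV[R]_n) : dotv (a *: x) (a *: x) = a ^+ 2 * dotv x x.
Proof. by rewrite dotvZr dotvC dotvZr; ring. Qed.

Lemma dotv_eq0 (R : realType) n (x : 'rV[R]_n) : (dotv x x == 0) = (x == 0).
Proof.
apply/idP/eqP => [/eqP h|->]; last by rewrite /dotv big1// => i _; rewrite mxE mul0r.
apply/rowP => i; rewrite mxE; apply/eqP; rewrite -sqrf_eq0 eq_le sqr_ge0 andbT -h.
exact: dotv_coord_le.
Qed.

(** The constant is the minimum of [q] on the Euclidean unit sphere. This is the only compactness
    used for the anchor form on a facet, the elasticity tensor and the inverse inequality. *)
Lemma quadratic_coercive (R : realType) n (q : 'rV[R]_n -> R) : continuous q ->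
  (forall a v, q (a *: v) = a ^+ 2 * q v) -> (forall v, v != 0 -> 0 < q v) ->
  exists2 c, 0 < c & forall v, c * dotv v v <= q v.
Proof.
move=> cq hq pq; pose S := [set v : 'rV[R]_n | dotv v v = 1].
have cdot : continuous (fun v : 'rV[R]_n => dotv v v).
  apply: continuous_sumr => i; apply: continuous_mulr; exact: coord_continuous.
have q0 : q 0 = 0 by rewrite -[0](scale0r (0 : 'rV[R]_n)) hq expr0n/= mul0r.
(* If the sphere is empty, normalization shows that 0 is the only vector, and any constant will
   do. *)
have [[v0 v0S]|S0] := pselect (S !=set0); last first.
  exists 1 => // v; have [->|v0] := eqVneq v 0.
    by rewrite q0 /dotv big1 ?mulr0// => i _; rewrite mxE mul0r.
  have dv : 0 < dotv v v by rewrite lt_neqAle eq_sym dotv_eq0 v0 dotv_ge0.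
  exfalso; apply: S0; exists ((Num.sqrt (dotv v v))^-1 *: v).
  by rewrite /S/= dotvZZ exprVn sqr_sqrtr ?mulVf ?gt_eqF// ltW.
have cS : compact S.
  apply: bounded_closed_compact.
    exists 1; split; first exact: num_real.
    move=> M M1 x xS; apply: (le_trans _ (ltW M1)); apply: rV_norm_le => // i.
    rewrite -(@ler_pXn2r _ 2)// ?nnegrE// real_normK ?num_real// expr1n -xS.
    exact: dotv_coord_le.
  rewrite (_ : S = (fun v : 'rV[R]_n => dotv v v) @^-1` [set 1])//.
  by apply: closed_comp; [move=> x _; exact: cdot|exact: closed_eq].
have [c cS' hc] := compact_EVT_min (ex_intro _ v0 v0S) cS (continuous_subspaceT cq).
have c0 : c != 0.
  move: cS'; rewrite inE /S/= => h; apply/eqP => c0; move: h; rewrite c0 /dotv big1.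
    by move/esym/eqP; rewrite oner_eq0.
  by move=> i _; rewrite mxE mul0r.
exists (q c); first exact: pq.
move=> v; have [->|v0'] := eqVneq v 0.
  by rewrite q0 /dotv big1 ?mulr0// => i _; rewrite mxE mul0r.
have dv : 0 < dotv v v by rewrite lt_neqAle eq_sym dotv_eq0 v0' dotv_ge0.
have := hc ((Num.sqrt (dotv v v))^-1 *: v).
rewrite inE /S/= dotvZZ exprVn sqr_sqrtr ?(ltW dv)// mulVf ?gt_eqF// => /(_ erefl).
by rewrite hq exprVn sqr_sqrtr ?(ltW dv)// mulrC ler_pdivlMr.
Qed.

(** Common source of the Cauchy-Schwarz inequalities for the energy form and for the L_2 products. A
    negative r is contradictory, and r = 0 forces q = 0. *)
Lemma discriminant_le (R : realType) (p q r : R) :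
  (forall t, 0 <= p + 2 * t * q + t ^+ 2 * r) -> q ^+ 2 <= p * r.
Proof.
move=> h; have p0 : 0 <= p by have := h 0; rewrite mulr0 mul0r expr0n/= mul0r !addr0.
have [r0|r0|r0] := ltgtP r 0.
- have := h ((p + 1 + q ^+ 2) / - r + 1); set s := (p + 1 + q ^+ 2) / - r => h1.
  have sr : s * - r = p + 1 + q ^+ 2 by rewrite /s divfK// oppr_eq0 lt_eqF.
  have s0 : 0 <= s by rewrite /s divr_ge0// ?oppr_ge0 ?(ltW r0)// addr_ge0 ?sqr_ge0// addr_ge0.
  have := h (- (s + 1)) => h2.
  have : 0 <= p + (s + 1) ^+ 2 * r by lra.
  rewrite (_ : (s + 1) ^+ 2 * r = - (s * - r) * s - 2 * (s * - r) + r); last by ring.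
  rewrite sr => h3; have : 0 <= (p + 1 + q ^+ 2) * s.
    by rewrite mulr_ge0// addr_ge0 ?sqr_ge0// addr_ge0.
  have := sqr_ge0 q; lra.
- have := h (- q / r).
  rewrite (_ : _ + _ = (p * r - q ^+ 2) / r); last by field; rewrite gt_eqF.
  by rewrite pmulr_lge0 ?invr_gt0// subr_ge0.
- rewrite r0 mulr0; have [->|q0] := eqVneq q 0; first by rewrite expr0n.
  have := h (- (p + 1) / (2 * q)); rewrite r0 mulr0 addr0.
  rewrite (_ : 2 * _ * q = - (p + 1)); last by field.
  lra.
Qed.

Section L2_inequalities.
Context {disp : measure_display} {T : measurableType disp} {R : realType}.
Variables (mu : {measure set T -> \bar R}) (A : set T).
Hypothesis mA : measurable A.
Implicit Types u v : T -> R.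

Lemma Rintegral_sqr_lin (a : R) u v : L2 mu A u -> L2 mu A v ->
  \int[mu]_(x in A) (a * u x + v x) ^+ 2 = a ^+ 2 * \int[mu]_(x in A) u x ^+ 2 +
    2 * a * \int[mu]_(x in A) (u x * v x) + \int[mu]_(x in A) v x ^+ 2.
Proof.
move=> Lu Lv; have iu := L2_sqr_integrable Lu; have iv := L2_sqr_integrable Lv.
have iuv := L2_mul_integrable mA Lu Lv.
rewrite -!RintegralZl// -!RintegralD//.
- by apply: eq_Rintegral => x _; ring.
- by apply: integrable_addr => //; exact: integrable_scaler.
- exact: integrable_scaler.
- exact: integrable_scaler.
Qed.

Lemma Rintegral_sqr_ge0 u : 0 <= \int[mu]_(x in A) u x ^+ 2.
Proof. by apply: Rintegral_ge0 => x _; exact: sqr_ge0. Qed.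

Lemma Rintegral_sqr_lin_le (a : R) u v : L2 mu A u -> L2 mu A v ->
  \int[mu]_(x in A) (a * u x + v x) ^+ 2 <=
  2 * a ^+ 2 * \int[mu]_(x in A) u x ^+ 2 + 2 * \int[mu]_(x in A) v x ^+ 2.
Proof.
move=> Lu Lv; rewrite Rintegral_sqr_lin//.
have := Rintegral_sqr_ge0 (fun x => - a * u x + v x).
by rewrite Rintegral_sqr_lin// sqrrN; nra.
Qed.

Lemma L2_ae_sqr_le u v : {ae mu, forall x, A x -> u x = v x} ->
  measurable_fun A u -> measurable_fun A v ->
  \int[mu]_(x in A) u x ^+ 2 = \int[mu]_(x in A) v x ^+ 2.
Proof.
move=> uv m1 m2; apply: ae_eq_Rintegral => //; try exact: measurable_funX.
by apply: filterS uv => x h Ax; rewrite h.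
Qed.

Lemma L2_bounded_mul (M : R) u v : measurable_fun A u -> (forall x, A x -> `|u x| <= M) ->
  L2 mu A v -> L2 mu A (fun x => u x * v x).
Proof.
move=> mu_ uM Lv; have [mv v2] := Lv.
apply: integrable_L2 => //; first exact: measurable_funM.
apply: (le_integrable mA (g := EFin \o (fun x => M ^+ 2 * v x ^+ 2))).
- by apply/measurable_EFinP; apply: measurable_funX; exact: measurable_funM.
- move=> x Ax; rewrite /= lee_fin [leLHS]ger0_norm ?sqr_ge0//.
  rewrite [leRHS]ger0_norm ?(mulr_ge0 (sqr_ge0 _) (sqr_ge0 _))//.
  rewrite exprMn ler_wpM2r ?sqr_ge0// -(real_normK (num_real (u x))).
  by rewrite lerXn2r ?nnegrE// ?uM// (le_trans _ (uM x Ax)).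
- exact: (integrable_scaler mA (M ^+ 2) (L2_sqr_integrable Lv)).
Qed.

Lemma integrable_sumr (I : Type) (s : seq I) (f : I -> T -> R) :
  (forall i, mu.-integrable A (EFin \o f i)) ->
  mu.-integrable A (EFin \o (fun x => \sum_(i <- s) f i x)).
Proof.
move=> fi; elim: s => [|i s IH].
  by under eq_fun do rewrite big_nil; exact: integrable0.
under eq_fun do rewrite big_cons; exact: integrable_addr.
Qed.

Lemma Rintegral_sumr (I : Type) (s : seq I) (f : I -> T -> R) :
  (forall i, mu.-integrable A (EFin \o f i)) ->
  \int[mu]_(x in A) \sum_(i <- s) f i x = \sum_(i <- s) \int[mu]_(x in A) f i x.
Proof.
move=> fi; elim: s => [|i s IH].
  by under eq_Rintegral do rewrite big_nil; rewrite big_nil /Rintegral integral0.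
under eq_Rintegral do rewrite big_cons.
by rewrite big_cons RintegralD// ?IH//; exact: integrable_sumr.
Qed.

End L2_inequalities.

(** * Weak derivatives, traces and linearity of the space V *)

Section smooth_linear.
Context {R : realType} {d : nat}.
Implicit Types phi psi : 'rV[R]_d -> R.

Lemma foldr_partial_lin (a : R) phi psi s : smooth phi -> smooth psi ->
  foldr partial (fun x => a * phi x + psi x) s =
  (fun x => a * foldr partial phi s x + foldr partial psi s x).
Proof.
move=> sphi spsi; elim: s => [//|i s IH] /=; rewrite IH; apply/funext => x.
have [_ /(_ i x) d1] := sphi s; have [_ /(_ i x) d2] := spsi s.
have H := is_deriveD (is_deriveZ a (derivableP d1)) (derivableP d2).
exact: (@derive_val _ _ _ _ _ _ _ H).
Qed.

Lemma smooth_lin (a : R) phi psi : smooth phi -> smooth psi ->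
  smooth (fun x => a * phi x + psi x).
Proof.
move=> sphi spsi s; rewrite foldr_partial_lin//.
have [c1 d1] := sphi s; have [c2 d2] := spsi s; split.
  by apply: continuous_addr => //; apply: continuous_mulr => //; exact: cst_continuous.
by move=> i x; apply: derivableD; [apply: derivableZ; exact: d1|exact: d2].
Qed.

Lemma partial_lin (a : R) phi psi i : smooth phi -> smooth psi ->
  partial i (fun x => a * phi x + psi x) = (fun x => a * partial i phi x + partial i psi x).
Proof. exact: (@foldr_partial_lin a phi psi [:: i]). Qed.

Lemma smooth_continuous phi : smooth phi -> continuous phi.
Proof. by move=> /(_ [::])[]. Qed.

Lemma smooth_partial_continuous phi i : smooth phi -> continuous (partial i phi).
Proof. by move=> /(_ [:: i])[]. Qed.

End smooth_linear.

Section weak_partials.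
Context {R : realType} {d : nat} (P : polytopic_domain R d).
Local Notation Om := (domain_set P).
Local Notation lam := (@lebesgue_rV R d).
Local Notation mOm := (measurable_domain P).
Implicit Types u v g h : 'rV[R]_d -> R.

Lemma weak_partial_spec i u : H1 Om u -> is_weak_partial Om i u (weak_partial Om i u).
Proof. by move=> [_ /(_ i) hg]; exact: (xgetPex (fun=> 0) hg). Qed.

Lemma weak_partial_L2 i u : H1 Om u -> L2 lam Om (weak_partial Om i u).
Proof. by move=> /(weak_partial_spec i)[]. Qed.

Lemma smooth_L2 phi : smooth phi -> L2 lam Om phi.
Proof. by move=> /smooth_continuous; exact: continuous_L2_domain. Qed.

Lemma smooth_partial_L2 phi i : smooth phi -> L2 lam Om (partial i phi).
Proof. by move=> /(@smooth_partial_continuous _ _ _ i); exact: continuous_L2_domain. Qed.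

Lemma weak_partial_unique i u g h :
  is_weak_partial Om i u g -> is_weak_partial Om i u h ->
  {ae lam, forall x, Om x -> g x = h x}.
Proof.
move=> [Lg wg] [Lh wh].
have := @ae_zero_of_test_functions R d Om (fun x => g x - h x) mOm (@open_domain _ _ P).
move=> /(_ _ _)[].
- by apply: L2_integrable => //; [exact: mOm|exact: lebesgue_domain_fin|exact: (L2B mOm)].
- move=> phi tphi; have Lphi := smooth_L2 (proj1 tphi).
  under eq_Rintegral do rewrite mulrBl.
  rewrite RintegralB//; [|exact: mOm|exact: (L2_mul_integrable mOm)|exact: (L2_mul_integrable mOm)].
  by apply/eqP; rewrite subr_eq0; apply/eqP/oppr_inj; rewrite -wg// -wh.
- move=> N [mN N0 sN]; exists N; split => // x /= nx; apply: sN => /= hx; apply: nx => Ox.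
  by apply/eqP; rewrite -subr_eq0; apply/eqP; exact: hx.
Qed.

Lemma is_weak_partial_lin (a : R) i u v g h : L2 lam Om u -> L2 lam Om v ->
  is_weak_partial Om i u g -> is_weak_partial Om i v h ->
  is_weak_partial Om i (fun x => a * u x + v x) (fun x => a * g x + h x).
Proof.
move=> Lu Lv [Lg wg] [Lh wh]; split; first exact: (L2_lin mOm).
move=> phi tphi; have Lphi := smooth_L2 (proj1 tphi).
have Ldphi := smooth_partial_L2 i (proj1 tphi).
have lin p q r : L2 lam Om p -> L2 lam Om q -> L2 lam Om r ->
    \int[lam]_(x in Om) ((a * p x + q x) * r x) =
    a * \int[lam]_(x in Om) (p x * r x) + \int[lam]_(x in Om) (q x * r x).
  move=> Lp Lq Lr; under eq_Rintegral do rewrite mulrDl -mulrA.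
  rewrite RintegralD ?RintegralZl//; try exact: (L2_mul_integrable mOm); try exact: mOm.
  by apply: (integrable_scaler mOm); exact: (L2_mul_integrable mOm).
by rewrite !lin// wg// wh// mulrN opprD.
Qed.

Lemma H1_lin (a : R) u v : H1 Om u -> H1 Om v -> H1 Om (fun x => a * u x + v x).
Proof.
move=> [Lu wu] [Lv wv]; split; first exact: (L2_lin mOm).
move=> i; have [g wg] := wu i; have [h wh] := wv i.
by eexists; exact: is_weak_partial_lin wg wh.
Qed.

(** Almost everywhere only: [weak_partial] is a chosen representative, and nothing relates the
    choices made for different functions beyond [weak_partial_unique]. *)
Lemma weak_partial_lin (a : R) i u v : H1 Om u -> H1 Om v ->
  {ae lam, forall x, Om x -> weak_partial Om i (fun x => a * u x + v x) x =
     a * weak_partial Om i u x + weak_partial Om i v x}.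
Proof.
move=> hu hv; apply: (@weak_partial_unique i (fun x => a * u x + v x)).
  by apply: weak_partial_spec; exact: H1_lin.
apply: is_weak_partial_lin; [by case: hu|by case: hv|exact: weak_partial_spec|exact: weak_partial_spec].
Qed.

Lemma H1dist2_lin_le (a : R) u v phi psi : H1 Om u -> H1 Om v -> smooth phi -> smooth psi ->
  H1dist2 Om (fun x => a * u x + v x) (fun x => a * phi x + psi x) <=
  2 * a ^+ 2 * H1dist2 Om u phi + 2 * H1dist2 Om v psi.
Proof.
move=> hu hv sphi spsi; rewrite /H1dist2.
have [Lu _] := hu; have [Lv _] := hv.
have Lphi := smooth_L2 sphi; have Lpsi := smooth_L2 spsi.
set A0 := \int[lam]_(x in Om) _; set B0 := \int[lam]_(x in Om) _.
set C0 := \int[lam]_(x in Om) _.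
suff h : forall i, \int[lam]_(x in Om)
     ((weak_partial Om i (fun x => a * u x + v x) x - partial i (fun x => a * phi x + psi x) x) ^+ 2) <=
   2 * a ^+ 2 * \int[lam]_(x in Om) ((weak_partial Om i u x - partial i phi x) ^+ 2) +
   2 * \int[lam]_(x in Om) ((weak_partial Om i v x - partial i psi x) ^+ 2).
  have h0 : A0 <= 2 * a ^+ 2 * B0 + 2 * C0.
    rewrite /A0 (_ : \int[lam]_(x in Om) _ =
      \int[lam]_(x in Om) (a * (u x - phi x) + (v x - psi x)) ^+ 2).
      by apply: (Rintegral_sqr_lin_le mOm); exact: (L2B mOm).
    by apply: eq_Rintegral => x _; ring.
  rewrite !mulrDr addrACA; apply: lerD h0 _.
  by rewrite !mulr_sumr -big_split/=; apply: ler_sum => i _; exact: h.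
move=> i; rewrite partial_lin//.
rewrite (_ : \int[lam]_(x in Om) _ = \int[lam]_(x in Om)
   (a * (weak_partial Om i u x - partial i phi x) + (weak_partial Om i v x - partial i psi x)) ^+ 2).
  apply: (Rintegral_sqr_lin_le mOm); apply: (L2B mOm);
    by [exact: weak_partial_L2|exact: smooth_partial_L2].
have m (w : 'rV[R]_d -> R) : L2 lam Om w -> measurable_fun Om w by case.
apply: L2_ae_sqr_le; [exact: mOm| | |].
- apply: filterS (weak_partial_lin a i hu hv) => x h Ox; rewrite h//; ring.
- apply: m; apply: (L2B mOm); first by apply: weak_partial_L2; exact: H1_lin.
  by apply: (L2_lin mOm); exact: smooth_partial_L2.
- apply: m; apply: (L2_lin mOm); apply: (L2B mOm);
    by [exact: weak_partial_L2|exact: smooth_partial_L2].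
Qed.

Lemma squeeze_lin (f g h : nat -> R) (a b : R) : (forall n, 0 <= h n <= a * f n + b * g n) ->
  f n @[n --> \oo] --> (0 : R) -> g n @[n --> \oo] --> (0 : R) -> h n @[n --> \oo] --> (0 : R).
Proof.
move=> hfg f0 g0; apply: (@squeeze_cvgr _ _ _ _ (fun=> 0) (fun n => a * f n + b * g n)).
- by near=> n; exact: hfg.
- exact: cvg_cst.
- rewrite (_ : 0 = a * 0 + b * 0 :> R); last by rewrite !mulr0 addr0.
  by apply: cvgD; apply: cvgM => //; exact: cvg_cst.
Unshelve. all: end_near. Qed.

Lemma H1dist2_ge0 u phi : 0 <= H1dist2 Om u phi.
Proof.
by apply: addr_ge0; [|apply: sumr_ge0 => i _]; apply: Rintegral_ge0 => x _; exact: sqr_ge0.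
Qed.

Lemma is_trace_lin (a : R) u v g h : H1 Om u -> H1 Om v ->
  is_trace P u g -> is_trace P v h ->
  is_trace P (fun x => a * u x + v x) (fun x => a * g x + h x).
Proof.
move=> hu hv [Lg [phi [sphi [phiu phig]]]] [Lh [psi [spsi [psiv psih]]]].
have mB := measurable_boundary P.
split; first exact: (L2_lin mB).
exists (fun n x => a * phi n x + psi n x); split; first by move=> n; exact: smooth_lin.
split.
  apply: (squeeze_lin _ phiu psiv) => n; rewrite H1dist2_ge0/=.
  exact: H1dist2_lin_le.
apply: (@squeeze_lin _ _ _ (2 * a ^+ 2) 2 _ phig psih) => n.
rewrite Rintegral_sqr_ge0/=.
rewrite (_ : \int[_]_(x in _) _ =
  \int[surface P]_(x in boundary P) (a * (phi n x - g x) + (psi n x - h x)) ^+ 2).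
  apply: (Rintegral_sqr_lin_le mB); apply: (L2B mB) => //;
    by apply: continuous_L2_boundary; exact: smooth_continuous.
by apply: eq_Rintegral => x _; ring.
Qed.

Lemma Vspace_lin (GD : set 'rV[R]_d) (a : R) (w v : 'rV[R]_d -> 'rV[R]_d) :
  Vspace P GD w -> Vspace P GD v -> Vspace P GD (fun x => a *: w x + v x).
Proof.
move=> hw hv j; have [hw1 [g [tg g0]]] := hw j; have [hv1 [h [th h0]]] := hv j.
rewrite (_ : (fun x => _) = (fun x => a * w x ord0 j + v x ord0 j)); last first.
  by apply/funext => x; rewrite !mxE.
split; first exact: H1_lin.
exists (fun x => a * g x + h x); split; first exact: is_trace_lin.
by apply: filterS2 g0 h0 => x h1 h2 GDx; rewrite h1// h2// mulr0 addr0.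
Qed.

Lemma Vspace_H1 (GD : set 'rV[R]_d) (v : 'rV[R]_d -> 'rV[R]_d) j :
  Vspace P GD v -> H1 Om (fun x => v x ord0 j).
Proof. by move=> /(_ j)[]. Qed.

End weak_partials.

(** * The Korn-Poincare inequality *)

Lemma sqrrD_le (R : realType) (a b : R) : (a + b) ^+ 2 <= 2 * a ^+ 2 + 2 * b ^+ 2.
Proof. by have := sqr_ge0 (a - b); nra. Qed.

Lemma eq_le_refl (R : realType) (x y : \bar R) : x = y -> (x <= y)%E.
Proof. by move=> ->. Qed.

Lemma ge0_sume_const (R : realType) n (c : \bar R) : (0 <= c)%E ->
  (\sum_(j < n) c = n%:R%:E * c)%E.
Proof.
move=> c0; elim: n => [|n IH]; first by rewrite big_ord0 mul0e.
by rewrite big_ord_recr/= IH -[n.+1]addn1 natrD EFinD ge0_muleDl ?mul1e ?lee_fin.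
Qed.

Section nonnegative_combinations.
Context {disp : measure_display} {T : measurableType disp} {R : realType}.
Variables (mu : {measure set T -> \bar R}) (D : set T) (a b : R) (f g : T -> \bar R).
Hypotheses (mD : measurable D) (a0 : 0 <= a) (b0 : 0 <= b).
Hypotheses (mf : measurable_fun setT f) (mg : measurable_fun setT g).
Hypotheses (f0 : forall x, (0 <= f x)%E) (g0 : forall x, (0 <= g x)%E).

Lemma measurable_comb : measurable_fun setT (fun x => a%:E * f x + b%:E * g x)%E.
Proof. by apply: emeasurable_funD; apply: measurable_funeM. Qed.

Lemma comb_ge0 x : (0 <= a%:E * f x + b%:E * g x)%E.
Proof. by apply: adde_ge0; apply: mule_ge0; rewrite ?lee_fin. Qed.

Lemma ge0_integral_comb : (\int[mu]_(x in D) (a%:E * f x + b%:E * g x) =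
  a%:E * \int[mu]_(x in D) f x + b%:E * \int[mu]_(x in D) g x)%E.
Proof.
have aE : (0 <= a%:E)%E by rewrite lee_fin.
have bE : (0 <= b%:E)%E by rewrite lee_fin.
have maf : measurable_fun D (fun x => a%:E * f x)%E.
  by apply: measurable_funTS; apply: measurable_funeM.
have mbg : measurable_fun D (fun x => b%:E * g x)%E.
  by apply: measurable_funTS; apply: measurable_funeM.
rewrite (ge0_integralD mu mD (fun x _ => mule_ge0 aE (f0 x)) maf
  (fun x _ => mule_ge0 bE (g0 x)) mbg).
rewrite (ge0_integralZl mu mD (measurable_funTS mf) (fun x _ => f0 x) aE).
by rewrite (ge0_integralZl mu mD (measurable_funTS mg) (fun x _ => g0 x) bE).
Qed.

Lemma ge0_integral_scale : (\int[mu]_(x in D) (a%:E * f x) =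
  a%:E * \int[mu]_(x in D) f x)%E.
Proof.
have aE : (0 <= a%:E)%E by rewrite lee_fin.
exact: (ge0_integralZl mu mD (measurable_funTS mf) (fun x _ => f0 x) aE).
Qed.

End nonnegative_combinations.

Section korn_smooth.
Context {R : realType} {d : nat} (P : polytopic_domain R d).
Local Notation Om := (domain_set P).
Local Notation cOm := (closed_domain P).
Local Notation lam := (@lebesgue_rV R d).
Local Notation mOm := (measurable_domain P).
Local Notation mcOm := (measurable_closed_domain P).
Variables (D1 : R) (U : set 'rV[R]_d).
Hypothesis D1_ge : forall x y, cOm x -> cOm y -> dotv (y - x) (y - x) <= D1.
Hypothesis mU : measurable U.
Hypothesis U_ge : forall x y, cOm x -> cOm y -> U (y - x).

Variable phi : 'I_d -> 'rV[R]_d -> R.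
Hypothesis sphi : forall k, smooth (phi k).
Let Phi (x : 'rV[R]_d) : 'rV[R]_d := \row_k phi k x.
Let N2 (x : 'rV[R]_d) : R := dotv (Phi x) (Phi x).
(** Cut off outside the closed domain, because the translations in [integral_segments_le] leave it.
    The factor D1^2 bounds the |u|^4 of [strain_segment_le]. *)
Let G (x : 'rV[R]_d) : \bar R := (((fun z => (D1 ^+ 2 * strain_sqr phi z)%:E) \_ cOm) x)%E.

Let D1_ge0 : 0 <= D1.
Proof.
have [x0 /domain_sub_closed x0c] := domain_nonempty P.
exact: le_trans (dotv_ge0 _) (D1_ge x0c x0c).
Qed.

Let G0 x : (0 <= G x)%E.
Proof.
rewrite /G /patch; case: ifP => // _; rewrite lee_fin mulr_ge0 ?sqr_ge0//.
by apply: sumr_ge0 => k _; apply: sumr_ge0 => j _; exact: sqr_ge0.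
Qed.

Let mG : measurable_fun setT G.
Proof.
apply: measurable_patch; first exact: mcOm.
apply/measurable_EFinP; apply: continuous_measurable_rV.
by apply: continuous_mulr; [exact: cst_continuous|exact: (continuous_strain_sqr sphi)].
Qed.

Let continuous_Phi k : continuous (fun x => Phi x ord0 k).
Proof. by under eq_fun do rewrite mxE; exact: smooth_continuous. Qed.

Let continuous_N2 : continuous N2.
Proof. by apply: continuous_sumr => k; apply: continuous_mulr. Qed.

Let N2_ge0 x : 0 <= N2 x. Proof. exact: dotv_ge0. Qed.

Let mN2 : measurable_fun setT (EFin \o N2).
Proof. by apply/measurable_EFinP; exact: (continuous_measurable_rV continuous_N2). Qed.

Let continuous_pairing (x e : 'rV[R]_d) : continuous (fun y : 'rV[R]_d => dotv e (y - x) ^+ 2).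
Proof.
apply: continuous_sqr; apply: continuous_sumr => k; apply: continuous_mulr.
  exact: cst_continuous.
under eq_fun do rewrite !mxE.
by apply: continuous_addr; [exact: coord_continuous|exact: cst_continuous].
Qed.

Let segment_le x y : cOm x -> cOm y ->
  ((dotv (Phi y - Phi x) (y - x) ^+ 2)%:E <= segment_integral G x (y - x))%E.
Proof.
move=> xc yc; have := strain_segment_le sphi x (y - x).
rewrite (_ : \sum_k _ = dotv (Phi y - Phi x) (y - x)); last first.
  by apply: eq_bigr => k _; rewrite !mxE (addrC x) subrK.
move=> h; apply: (le_trans h); apply: ge0_le_integral => //.
- move=> s _; rewrite lee_fin mulr_ge0 ?sqr_ge0//.
  by apply: sumr_ge0 => k _; apply: sumr_ge0 => j _; exact: sqr_ge0.
- apply: measurable_funTS; apply/measurable_EFinP.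
  apply: measurable_funM; first exact: measurable_cst.
  apply: (measurableT_comp (continuous_measurable_rV (continuous_strain_sqr sphi))).
  apply: measurable_rV_addf; first exact: measurable_cst.
  by apply: measurable_rV_scalef => //; exact: measurable_cst.
- apply: measurable_funTS; apply: (measurableT_comp mG).
  apply: measurable_rV_addf; first exact: measurable_cst.
  by apply: measurable_rV_scalef => //; exact: measurable_cst.
- move=> s; rewrite /= in_itv/= => s01; rewrite /G patchT; last first.
    by rewrite inE; exact: closed_domain_convex.
  rewrite lee_fin ler_wpM2r//.
    by apply: sumr_ge0 => k _; apply: sumr_ge0 => j _; exact: sqr_ge0.
  by rewrite lerXn2r// ?nnegrE ?dotv_ge0//; exact: D1_ge.
Qed.

Let pairing_le x y : cOm x -> cOm y ->
  ((dotv (Phi x) (y - x) ^+ 2)%:E <=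
   2%:E * segment_integral G x (y - x) + (2 * D1 * N2 y)%:E)%E.
Proof.
move=> xc yc.
apply: (@le_trans _ _ (2 * dotv (Phi y - Phi x) (y - x) ^+ 2 + 2 * D1 * N2 y)%:E).
  rewrite lee_fin; have -> : dotv (Phi x) (y - x) = - dotv (Phi y - Phi x) (y - x) + dotv (Phi y) (y - x).
    by rewrite dotvC [dotv (Phi y - _) _]dotvC dotvBr [dotv (Phi y) _]dotvC; ring.
  apply: le_trans (sqrrD_le _ _) _; rewrite sqrrN lerD2l -mulrA ler_wpM2l//.
  by apply: le_trans (dotv_sqr_le _ _) _; rewrite [leLHS]mulrC; exact: (ler_wpM2r (N2_ge0 y) (D1_ge xc yc)).
rewrite EFinD leeD2r// EFinM; apply: lee_wpmul2l => //; exact: segment_le.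
Qed.

(** From the box to the domain. For y in the lower corner box [B], both y and y + r e_j lie in [B'],
    and r v_j(x) is the difference of the pairings of v(x) with (y + r e_j) - x and with y - x. Each
    pairing is controlled by the strain on a segment and by v at its end in [B']. *)
Let ball_integral_le r (x0 : 'rV[R]_d) : 0 < r ->
  rV_box (x0 - const_mx r) (x0 + const_mx r) `<=` cOm ->
  ((r ^+ 2 * r ^+ d)%:E * \int[lam]_(x in Om) (N2 x)%:E <=
    (4 * d%:R)%:E * (2%:E * (lam U * \int[lam]_x G x) +
      (2 * D1)%:E * lam Om * \int[lam]_(y in rV_box (x0 - const_mx r) (x0 + const_mx r)) (N2 y)%:E))%E.
Proof.
clearbody G; move=> r0 Bc; set B' := rV_box _ _; pose B := rV_box (x0 - const_mx r) x0.
have mB' : measurable B' by exact: measurable_rV_box.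
have mB : measurable B by exact: measurable_rV_box.
have lamB : lam B = (r ^+ d)%:E.
  rewrite lebesgue_rV_box => [|i]; last by rewrite !mxE gerBl ltW.
  by congr EFin; under eq_bigr do rewrite !mxE opprB addrCA subrr addr0; rewrite prodr_const card_ord.
have mseg x : measurable_fun setT (fun y : 'rV[R]_d => segment_integral G x (y - x)).
  by apply: measurable_segment_integral => //; exact: measurable_rV_add.
have s0 x y := @segment_integral_ge0 R d G G0 x y.
have D2 : 0 <= 2 * D1 by rewrite mulr_ge0.
have N2E x : (0 <= (EFin \o N2) x)%E by rewrite lee_fin.
pose IB := (\int[lam]_(y in B') (N2 y)%:E)%E.
have IB0 : (0 <= IB)%E by apply: integral_ge0 => y _; rewrite lee_fin.
pose h x (y : 'rV[R]_d) : \bar R := ((dotv (Phi x) (y - x) ^+ 2)%:E)%E.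
have mh x : measurable_fun setT (h x).
  by apply/measurable_EFinP; exact: (continuous_measurable_rV (@continuous_pairing x _)).
have h0 x y : (0 <= h x y)%E by rewrite lee_fin sqr_ge0.
have hB' x : cOm x -> (\int[lam]_(y in B') h x y <=
    2%:E * \int[lam]_(y in B') segment_integral G x (y - x)%R + (2 * D1)%:E * IB)%E.
  move=> xc.
  have E := ge0_integral_comb lam mB' (ler0n _ 2) D2 (mseg x) mN2 (fun y => s0 x _) N2E.
  apply: (le_trans _ (eq_le_refl E)).
  apply: ge0_le_integral; first by [].
  - by move=> y _; exact: h0.
  - exact: measurable_funTS.
  - by apply: measurable_funTS; exact: measurable_comb.
  - by move=> y yB; rewrite -EFinM; apply: pairing_le => //; exact: Bc.
have hj x j : ((r ^+ 2 * r ^+ d * Phi x ord0 j ^+ 2)%:E <= 4%:E * \int[lam]_(y in B') h x y)%E.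
  have e1 : ((r ^+ 2 * r ^+ d * Phi x ord0 j ^+ 2)%:E =
      \int[lam]_(y in B) (r ^+ 2 * Phi x ord0 j ^+ 2)%:E)%E.
    by rewrite integral_cst// [X in (_ * X)%E]lamB -EFinM; congr EFin; ring.
  rewrite e1.
  have mhj : measurable_fun setT (fun y : 'rV[R]_d => h x (y - (- r *: unit_vec j))).
    by apply: (measurableT_comp (mh x)); exact: measurable_rV_add.
  apply: (@le_trans _ _ (\int[lam]_(y in B) (2%:E * h x (y - (- r *: unit_vec j))%R + 2%:E * h x y))%E).
    apply: ge0_le_integral; first by [].
    - by move=> y _; rewrite lee_fin mulr_ge0 ?sqr_ge0.
    - exact: measurable_cst.
    - by apply: measurable_funTS; exact: measurable_comb.
    - move=> y _; rewrite /h -!EFinM -EFinD lee_fin.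
      rewrite (_ : r ^+ 2 * _ = (dotv (Phi x) (y - - r *: unit_vec j - x) - dotv (Phi x) (y - x)) ^+ 2).
        by apply: le_trans (sqrrD_le _ _) _; rewrite sqrrN.
      rewrite -dotvBr (_ : _ - _ - (_ - _) = r *: unit_vec j); last first.
        by apply/rowP => i; rewrite !mxE; ring.
      rewrite dotvZr exprMn; congr (_ * _ ^+ 2).
      rewrite /dotv (bigD1 j)//= /unit_vec !mxE !eqxx mulr1 big1 ?addr0// => i ij.
      by rewrite !mxE (negbTE ij) andbF mulr0.
  rewrite (ge0_integral_comb lam mB (ler0n _ 2) (ler0n _ 2) mhj (mh x) (fun y => h0 x _) (h0 x)).
  rewrite (_ : 4%:E = 2%:E + 2%:E)%E; last by rewrite -EFinD; congr EFin; ring.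
  rewrite ge0_muleDl//; apply: leeD; apply: lee_wpmul2l => //.
    apply: ge0_integral_sub_shift => // y yB i; have := yB i.
    rewrite !mxE !eqxx /= => /andP[h1 h2].
    have hr : 0 <= r * (i == j)%:R <= r by case: (i == j); rewrite ?mulr1 ?mulr0 ?lexx ?ltW.
    by rewrite mulNr opprK; lra.
  apply: ge0_subset_integral => //; first exact: measurable_funTS.
  move=> y yB i; have := yB i; rewrite !mxE => /andP[-> h2] /=.
  by apply: le_trans h2 _; rewrite lerDl ltW.
have hN x : cOm x -> ((r ^+ 2 * r ^+ d * N2 x)%:E <= (4 * d%:R)%:E *
   (2%:E * \int[lam]_(y in B') segment_integral G x (y - x)%R + (2 * D1)%:E * IB))%E.
  move=> xc; rewrite /N2 /dotv mulr_sumr -sumEFin.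
  rewrite (mulrC 4 d%:R) EFinM -muleA.
  apply: (@le_trans _ _ (\sum_(j < d) (4%:E * \int[lam]_(y in B') h x y))%E).
    by apply: lee_sum => j _; rewrite -expr2; exact: hj.
  rewrite ge0_sume_const ?mule_ge0 ?integral_ge0//; apply: lee_wpmul2l; first by rewrite lee_fin.
  by apply: lee_wpmul2l; [rewrite lee_fin|exact: hB'].
have mI : measurable_fun setT (fun x : 'rV[R]_d => \int[lam]_(y in B') segment_integral G x (y - x)%R)%E.
  apply: (@measurable_integral_snd _ _ _ _ _ lam B' (fun z => segment_integral G z.1 (z.2 - z.1))) => //.
  by apply: measurable_segment_integral => //; exact: measurable_rV_subf.
have r2 : 0 <= r ^+ 2 * r ^+ d by rewrite mulr_ge0// exprn_ge0// ltW.
have d4 : 0 <= 4 * d%:R :> R by rewrite mulr_ge0.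
have I0 x : (0 <= \int[lam]_(y in B') segment_integral G x (y - x)%R)%E by exact: integral_ge0.
rewrite -(ge0_integral_scale lam mOm r2 mN2 N2E).
have mc := measurable_comb 2 (2 * D1) mI (measurable_cst IB).
have c0 := comb_ge0 (ler0n _ 2) D2 I0 (fun x : 'rV[R]_d => IB0).
apply: (@le_trans _ _ (\int[lam]_(x in Om) ((4 * d%:R)%:E *
   (2%:E * \int[lam]_(y in B') segment_integral G x (y - x)%R + (2 * D1)%:E * IB)))%E).
  apply: ge0_le_integral; first exact: mOm.
  - by move=> x _; rewrite -EFinM lee_fin mulr_ge0.
  - by apply: measurable_funTS; apply: measurable_funeM; exact: mN2.
  - by apply: measurable_funTS; apply: measurable_funeM; exact: mc.
  - by move=> x /domain_sub_closed xc; rewrite -EFinM; exact: hN.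
rewrite (ge0_integral_scale lam mOm d4 mc c0).
rewrite (ge0_integral_comb lam mOm (ler0n _ 2) D2 mI (measurable_cst IB) I0 (fun x => IB0)).
apply: lee_wpmul2l; first by rewrite lee_fin.
apply: leeD.
  apply: lee_wpmul2l; first by rewrite lee_fin.
  apply: integral_segments_le => //; first exact: mOm.
  by move=> x y /domain_sub_closed xc yB; apply: U_ge => //; exact: Bc.
by rewrite integral_cst; [rewrite -/IB muleAC muleA|exact: mOm].
Qed.

(** From the facet to the box. The hypothesis with constant [c] says that the pairings with w - x,
    for w on the facet, determine v(x); each of them is controlled by the strain on a segment and by
    v at its end on [GD]. *)
Let facet_integral_le (i : 'I_(nfacets P)) (GD B : set 'rV[R]_d) (c delta : R) :
  measurable GD -> measurable B -> 0 <= c -> 0 < delta -> B `<=` cOm ->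
  (forall x, B x -> dotv (normal i) x <= offset i - delta) ->
  (forall x e, B x -> ((c * dotv e e)%:E <=
     \int[lam]_(w in prism i GD) (dotv e (facet_proj i w - x) ^+ 2)%:E)%E) ->
  (c%:E * \int[lam]_(x in B) (N2 x)%:E <=
    2%:E * (lam U * (delta^-1%:E * \int[lam]_x G x)) +
    (2 * D1)%:E * lam B * \int[surface P]_(x in GD) (N2 x)%:E)%E.
Proof.
clearbody G; move=> mGD mB c0 delta0 Bc Bdelta hc; set S := prism i GD.
have mS : measurable S by exact: measurable_prism.
have mpr := @measurable_facet_proj R d P i.
have Sc w : S w -> cOm (facet_proj i w) by move=> [_ [_ []]].
pose F (x w : 'rV[R]_d) := segment_integral G (facet_proj i w) (x - facet_proj i w).
have mF2 : measurable_fun setT (fun z => F z.1 z.2).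
  apply: measurable_segment_integral => //; first exact: (measurableT_comp mpr).
  by apply: measurable_rV_subf => //; exact: (measurableT_comp mpr).
have mF x : measurable_fun setT (F x).
  apply: measurable_segment_integral => //.
  by apply: measurable_rV_subf => //; exact: measurable_cst.
have F0 x w : (0 <= F x w)%E by exact: segment_integral_ge0.
have mNpr : measurable_fun setT (fun w => (N2 (facet_proj i w))%:E).
  exact: (measurableT_comp mN2 mpr).
have D2 : 0 <= 2 * D1 by rewrite mulr_ge0.
have N2E x : (0 <= (EFin \o N2) x)%E by rewrite lee_fin.
have NprE x : (0 <= (N2 (facet_proj i x))%:E)%E by rewrite lee_fin.
pose IS := (\int[lam]_(w in S) (N2 (facet_proj i w))%:E)%E.
have IS0 : (0 <= IS)%E by apply: integral_ge0 => y _; rewrite lee_fin.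
have hx x : B x -> (c%:E * (N2 x)%:E <= 2%:E * \int[lam]_(w in S) F x w + (2 * D1)%:E * IS)%E.
  move=> xB; rewrite -EFinM; apply: (le_trans (hc x (Phi x) xB)).
  have E := ge0_integral_comb lam mS (ler0n _ 2) D2 (mF x) mNpr (F0 x) NprE.
  apply: (le_trans _ (eq_le_refl E)).
  apply: ge0_le_integral; first by [].
  - by move=> w _; rewrite lee_fin sqr_ge0.
  - apply: measurable_funTS.
    have mp : measurable_fun setT (fun y : 'rV[R]_d => (dotv (Phi x) (y - x) ^+ 2)%:E).
      by apply/measurable_EFinP; exact: (continuous_measurable_rV (@continuous_pairing x _)).
    exact: (measurableT_comp mp mpr).
  - exact: (measurable_funTS (measurable_comb 2 (2 * D1) (mF x) mNpr)).
  - move=> w wS; rewrite -EFinM.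
    apply: (@le_trans _ _ (2 * dotv (Phi x - Phi (facet_proj i w)) (x - facet_proj i w) ^+ 2
        + 2 * D1 * N2 (facet_proj i w))%:E).
      rewrite lee_fin (_ : dotv (Phi x) _ = - dotv (Phi x - Phi (facet_proj i w)) (x - facet_proj i w)
         + - dotv (Phi (facet_proj i w)) (x - facet_proj i w)); last first.
        rewrite -[facet_proj i w - x]opprB dotvNr.
        rewrite [dotv (Phi x - _) _]dotvC dotvBr [dotv _ (Phi x)]dotvC [dotv _ (Phi _)]dotvC; ring.
      apply: le_trans (sqrrD_le _ _) _; rewrite !sqrrN lerD2l -mulrA ler_wpM2l//.
      apply: le_trans (dotv_sqr_le _ _) _; rewrite [leLHS]mulrC; exact: (ler_wpM2r (N2_ge0 _) (D1_ge (Sc w wS) (Bc x xB))).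
    rewrite EFinD leeD2r// EFinM; apply: lee_wpmul2l => //; apply: segment_le.
      exact: Sc.
    exact: Bc.
have mI : measurable_fun setT (fun x : 'rV[R]_d => \int[lam]_(w in S) F x w)%E.
  by apply: (@measurable_integral_snd _ _ _ _ _ lam S (fun z => F z.1 z.2)).
have I0 x : (0 <= \int[lam]_(w in S) F x w)%E by exact: integral_ge0.
rewrite -(ge0_integral_scale lam mB c0 mN2 N2E).
apply: (@le_trans _ _ (\int[lam]_(x in B) (2%:E * \int[lam]_(w in S) F x w + (2 * D1)%:E * IS))%E).
  apply: ge0_le_integral; first by [].
  - by move=> x _; rewrite mule_ge0// lee_fin.
  - by apply: measurable_funTS; apply: measurable_funeM; exact: mN2.
  - by apply: measurable_funTS; exact: (measurable_comb 2 (2 * D1) mI (measurable_cst IS)).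
  - by move=> x xB; exact: hx.
rewrite (ge0_integral_comb lam mB (ler0n _ 2) D2 mI (measurable_cst IS) I0 (fun x => IS0)).
apply: leeD.
  apply: lee_wpmul2l; first by rewrite lee_fin.
  rewrite (@tonelli_in _ _ _ _ _ lam lam B S (fun z => F z.1 z.2))//.
  apply: integral_prism_segments_le => //.
  - exact: dotv_normal.
  - by move=> w [].
  - by move=> w x wS xB; apply: U_ge; [exact: Sc|exact: Bc].
rewrite integral_cst// muleA muleAC; apply: lee_wpmul2l.
  by rewrite mule_ge0// lee_fin mulr_ge0.
by apply: (@ge0_integral_prism_le R d P i GD (fun x => (N2 x)%:E)) => // x; rewrite lee_fin.
Qed.

(** Chains the two stages. The gap [delta] and the coercivity constant [c] are asked for on a small
    box only, as no positive gap exists for points arbitrarily close to the facet. *)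
Lemma smooth_korn_local (i : 'I_(nfacets P)) (GD : set 'rV[R]_d) (x0 : 'rV[R]_d) (r c delta : R) :
  measurable GD -> 0 < r -> 0 < c -> 0 < delta ->
  rV_box (x0 - const_mx r) (x0 + const_mx r) `<=` cOm ->
  (forall x, rV_box (x0 - const_mx r) (x0 + const_mx r) x -> dotv (normal i) x <= offset i - delta) ->
  (forall x e, rV_box (x0 - const_mx r) (x0 + const_mx r) x -> ((c * dotv e e)%:E <=
     \int[lam]_(w in prism i GD) (dotv e (facet_proj i w - x) ^+ 2)%:E)%E) ->
  ((r ^+ 2 * r ^+ d)%:E * \int[lam]_(x in Om) (N2 x)%:E <=
    (4 * d%:R)%:E * (2%:E * (lam U * \int[lam]_x G x) +
      (2 * D1)%:E * lam Om * (c^-1%:E * (2%:E * (lam U * (delta^-1%:E * \int[lam]_x G x)) +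
    (2 * D1)%:E * lam (rV_box (x0 - const_mx r) (x0 + const_mx r)) *
      \int[surface P]_(x in GD) (N2 x)%:E))))%E.
Proof.
move=> mGD r0 c0 delta0 Bc Bdelta hc; set B := rV_box _ _ in Bc Bdelta hc *.
have mB : measurable B by exact: measurable_rV_box.
have h1 := facet_integral_le mGD mB (ltW c0) delta0 Bc Bdelta hc.
apply: (le_trans (ball_integral_le r0 Bc)); rewrite -/B.
apply: lee_wpmul2l; first by rewrite lee_fin mulr_ge0.
apply: leeD => //; apply: lee_wpmul2l; first by rewrite mule_ge0// lee_fin mulr_ge0.
apply: (@le_trans _ _ (c^-1%:E * (c%:E * \int[lam]_(x in B) (N2 x)%:E))%E).
  by rewrite muleA -EFinM mulVf ?gt_eqF// mul1e.
by apply: lee_wpmul2l => //; rewrite lee_fin invr_ge0 ltW.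
Qed.

Lemma integral_strain_field :
  (\int[lam]_x G x = (D1 ^+ 2)%:E * \int[lam]_(x in Om) (strain_sqr phi x)%:E)%E.
Proof.
have ss0 x : 0 <= strain_sqr phi x.
  by apply: sumr_ge0 => k _; apply: sumr_ge0 => j _; exact: sqr_ge0.
have mss : measurable_fun setT (fun x => (strain_sqr phi x)%:E).
  by apply/measurable_EFinP; exact: (continuous_measurable_rV (continuous_strain_sqr sphi)).
rewrite /G -integral_mkcond.
under eq_integral do rewrite EFinM.
rewrite ge0_integralZl//; [|exact: mcOm|exact: measurable_funTS|
  by move=> x _; rewrite lee_fin|by rewrite lee_fin sqr_ge0].
congr (_ * _)%E.
rewrite (@ge0_negligible_integral _ _ _ lam cOm (boundary P))//.
- rewrite boundaryE setDD (setIidr (@domain_sub_closed _ _ P)) //.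
- exact: measurable_boundary.
- exact: mcOm.
- exact: measurable_funTS.
- by move=> x _; rewrite lee_fin.
- exact: lebesgue_boundary.
Qed.

End korn_smooth.

Lemma cvg_sum0 (R : realType) (I : Type) (s : seq I) (f : I -> nat -> R) :
  (forall j, f j n @[n --> \oo] --> (0 : R)) ->
  (\sum_(j <- s) f j n) @[n --> \oo] --> (0 : R).
Proof.
move=> h; elim: s => [|j s IH].
  by under eq_fun do rewrite big_nil; exact: cvg_cst.
under eq_fun do rewrite big_cons.
by have := cvgD (h j) IH; rewrite addr0 => H; exact: H.
Qed.

Lemma half_sum_sub_sqr (R : realType) (a b p q : R) :
  (2^-1 * (a + b) - 2^-1 * (p + q)) ^+ 2 = 4^-1 * (1 * (a - p) + (b - q)) ^+ 2.
Proof. by field. Qed.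

Lemma three_term_le (R : realType) (a z s y w1 w2 : R) :
  a <= 2 * z + 2 * s -> z = 4^-1 * y -> y <= 2 * w1 + 2 * w2 -> a <= 2 * s + (w1 + w2).
Proof. lra. Qed.

Lemma combined_le (R : realType) (C x e p q g s k : R) : 0 <= C ->
  x <= 2 * e + 2 * p -> p <= C * (q + g) -> q <= 2 * s + 2 * k * e ->
  x <= 4 * C * s + ((2 + 4 * C * k) * e + 2 * C * g).
Proof. by move=> C0 h1 h2 h3; have := ler_wpM2l C0 h3; lra. Qed.

Lemma double_le (R : realType) (w e k : R) : 0 <= w -> w <= e -> 1 <= k -> w + w <= 2 * k * e.
Proof. by move=> w0 we k1; have := ler_wpM2r (le_trans w0 we) k1; lra. Qed.

Section korn_poincare.
Context {R : realType} {d : nat} (P : polytopic_domain R d).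
Local Notation Om := (domain_set P).
Local Notation cOm := (closed_domain P).
Local Notation lam := (@lebesgue_rV R d).
Local Notation mOm := (measurable_domain P).

Section anchor.
Variables (i : 'I_(nfacets P)) (GD : set 'rV[R]_d).
Hypothesis mGD : measurable GD.
Let S := prism i GD.
Let mS : measurable S. Proof. exact: measurable_prism. Qed.
Let f (e x w : 'rV[R]_d) := dotv e (facet_proj i w - x).

Lemma lebesgue_prism_fin : (lam S < +oo)%E.
Proof.
have := @surface_fin R d P GD mGD; apply: le_lt_trans.
rewrite /surface (bigD1 i)//= -[leLHS]adde0; apply: leeD => //.
by apply: sume_ge0 => j _; exact: measure_ge0.
Qed.

Let L2_coord x j : L2 lam S (fun w => (facet_proj i w - x) ord0 j).
Proof.
have [M M0 hM] := closed_domain_bounded P.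
apply: (@L2_bounded _ _ _ _ _ mS _ (M + `|x|)).
- exact: lebesgue_prism_fin.
- apply: measurable_funTS; apply: (measurableT_comp (measurable_coord j)).
  by apply: measurable_rV_subf; [exact: measurable_facet_proj|exact: measurable_cst].
- move=> w [_ [_ [_ hw]]]; apply: le_trans (rV_coord_le _ _) _.
  by apply: le_trans (ler_normB _ _) _; rewrite lerD2r; exact: hM.
Qed.

Let L2_f e x : L2 lam S (f e x).
Proof. by apply: (L2_sum mS) => j; exact: (L2Z mS). Qed.

Let Q (x e : 'rV[R]_d) := \int[lam]_(w in S) f e x w ^+ 2.

Let Q_continuous x : continuous (Q x).
Proof.
rewrite (_ : Q x = fun e => \sum_j \sum_k e ord0 j * e ord0 k *
  \int[lam]_(w in S) ((facet_proj i w - x) ord0 j * (facet_proj i w - x) ord0 k)).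
  apply: continuous_sumr => j; apply: continuous_sumr => k.
  apply: continuous_mulr; last exact: cst_continuous.
  by apply: continuous_mulr; exact: coord_continuous.
apply/funext => e; rewrite /Q.
have ip j k : lam.-integrable S (EFin \o (fun w => e ord0 j * e ord0 k *
    ((facet_proj i w - x) ord0 j * (facet_proj i w - x) ord0 k))).
  by apply: (integrable_scaler mS); exact: (L2_mul_integrable mS).
transitivity (\int[lam]_(w in S) \sum_j \sum_k e ord0 j * e ord0 k *
    ((facet_proj i w - x) ord0 j * (facet_proj i w - x) ord0 k)).
  apply: eq_Rintegral => w _; rewrite /f /dotv expr2 mulr_suml.
  apply: eq_bigr => j _; rewrite mulr_sumr; apply: eq_bigr => k _; ring.
rewrite (Rintegral_sumr mS); last by move=> j; exact: (integrable_sumr mS).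
apply: eq_bigr => j _; rewrite (Rintegral_sumr mS)//; apply: eq_bigr => k _.
by rewrite RintegralZl//; exact: (L2_mul_integrable mS).
Qed.

(** If the form vanishes at e, almost all of the prism lies in the set [H] attached to the
    tangential part e' of e. For e' != 0 this is a hyperplane, hence null; for e' = 0 the vector e
    is normal to the facet, and x0 would lie in the plane of the facet. *)
Let Q_pos x0 e : Om x0 -> (0 < lam S)%E -> e != 0 -> 0 < Q x0 e.
Proof.
move=> x0Om S0 e0; rewrite lt_neqAle Rintegral_sqr_ge0 andbT eq_sym.
apply/eqP => Q0; pose nu := normal i.
have isq := L2_sqr_integrable (L2_f e x0).
have int0 : (\int[lam]_(w in S) `|(f e x0 w ^+ 2)%:E| = 0)%E.
  under eq_integral do rewrite gee0_abs ?lee_fin ?sqr_ge0//.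
  rewrite -[LHS]fineK; last exact: integrable_fin_num isq.
  by rewrite -/(Rintegral _ _ _) -/(Q x0 e) Q0.
have [mf _] := L2_f e x0.
have mf2 : measurable_fun S (fun w => (f e x0 w ^+ 2)%:E).
  by apply/measurable_EFinP; exact: measurable_funX.
have [N [mN N0 sN]] := (iffLR (ae_eq_integral_abs lam mS mf2) int0).
pose e' := e - dotv e nu *: nu.
pose H := [set w : 'rV[R]_d | dotv e' w = dotv e x0 - dotv e nu * offset i].
have SNH : S `<=` N `|` H.
  move=> w wS; have [wN|wN] := pselect (N w); [by left|right].
  have : (f e x0 w ^+ 2)%:E = 0%E :> \bar R.
    by apply: contrapT => h; apply: wN; apply: sN => /= h2; apply: h; exact: h2.
  move=> -[/eqP]; rewrite sqrf_eq0 /f => /eqP.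
  rewrite /H /= /e' /facet_proj -/nu dotvBr dotvBr dotvZr => h.
  rewrite dotvC dotvBr dotvZr (dotvC w e) (dotvC w nu).
  have : dotv e w - (dotv nu w - offset i) * dotv e nu - dotv e x0 = 0 by [].
  lra.
have mH : measurable H by exact: measurable_hyperplane.
have [e'0|e'0] := eqVneq e' 0; last first.
  have : (lam S <= lam N + lam H)%E.
    apply: (@le_trans _ _ (lam (N `|` H))); first by apply: le_measure; rewrite ?inE//; exact: measurableU.
    exact: measureU2.
  rewrite N0 lebesgue_rV_hyperplane// adde0 => h.
  by move: S0; rewrite ltNge h.
suff : (lam S <= lam N)%E by rewrite N0 leNgt S0.
apply: le_measure; rewrite ?inE// => w wS; have [//|] := SNH w wS.
rewrite /H/= e'0 /dotv big1 => [h|j _]; last by rewrite mxE mul0r.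
exfalso; have ee : e = dotv e nu *: nu by apply/eqP; rewrite -subr_eq0; exact/eqP.
have c0 : dotv e nu != 0 by apply: contra e0 => /eqP c0; rewrite ee c0 scale0r.
move: h; rewrite -/(dotv e x0) {1}ee (dotvC _ x0) dotvZr -mulrBr => /esym/eqP.
rewrite mulf_eq0 (negbTE c0)/= subr_eq0 dotvC => /eqP h.
by have := x0Om i; rewrite -/nu h ltxx.
Qed.

Lemma anchor_coercive x0 : Om x0 -> (0 < lam S)%E ->
  exists c r0 : R, [/\ 0 < c, 0 < r0 & forall x e : 'rV[R]_d, (forall j, `|x ord0 j - x0 ord0 j| <= r0) ->
    ((c * dotv e e)%:E <= \int[lam]_(w in S) (dotv e (facet_proj i w - x) ^+ 2)%:E)%E].
Proof.
move=> x0Om S0.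
have [|c c0 hc] := @quadratic_coercive R d (Q x0) (@Q_continuous x0) _ (fun e => Q_pos x0Om S0).
  move=> a e; rewrite /Q -RintegralZl//; last exact: L2_sqr_integrable.
  by apply: eq_Rintegral => w _; rewrite /f dotvC dotvZr dotvC exprMn.
pose s := fine (lam S).
have sE : lam S = s%:E.
  by rewrite /s fineK// ge0_fin_numE// ?lebesgue_prism_fin// measure_ge0.
have s0 : 0 <= s by rewrite -lee_fin -sE measure_ge0.
have K0 : 0 < 4 * (s * d%:R + 1).
  by rewrite mulr_gt0// ltr_wpDl// mulr_ge0.
(* Chosen so that s d r0^2 <= c / 4, where r0 <= 1 gives r0^2 <= r0. Then c |e|^2 <= 2 Q x e + c / 2
   |e|^2, which leaves c / 4. *)
pose r0 := Num.min 1 (c / (4 * (s * d%:R + 1))).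
have r00 : 0 < r0 by rewrite /r0 lt_min ltr01 divr_gt0.
exists (c / 4), r0; split => //; first by rewrite divr_gt0.
move=> x e hx.
have h1 : c * dotv e e <= Q x0 e by exact: hc.
have h2 : Q x0 e <= 2 * Q x e + 2 * (s * (dotv e e * (d%:R * r0 ^+ 2))).
  have := @Rintegral_sqr_lin_le _ _ _ lam S mS 1 (f e x) (fun=> dotv e (x - x0)) (L2_f e x).
  have Lc : L2 lam S (fun=> dotv e (x - x0)).
    apply: (@L2_bounded _ _ _ _ _ mS _ `|dotv e (x - x0)|) => //; exact: lebesgue_prism_fin.
  move=> /(_ Lc); rewrite expr1n mulr1 Rintegral_cst// -/s => h.
  have -> : Q x0 e = \int[lam]_(w in S) (1 * f e x w + dotv e (x - x0)) ^+ 2.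
    apply: eq_Rintegral => w _; rewrite mul1r /f -dotvDr; congr (dotv e _ ^+ 2).
    by rewrite addrA subrK.
  apply: (le_trans h); rewrite lerD2l ler_wpM2l// mulrC ler_wpM2l//.
  apply: le_trans (dotv_sqr_le _ _) _; apply: ler_wpM2l; first exact: dotv_ge0.
  by apply: dotv_le => j; rewrite !mxE; exact: hx.
have h3 : s * (d%:R * r0 ^+ 2) <= c / 4.
  have r1 : r0 <= 1 by rewrite /r0 ge_min lexx.
  have r2 : r0 <= c / (4 * (s * d%:R + 1)) by rewrite /r0 ge_min lexx orbT.
  have : r0 ^+ 2 <= r0 by rewrite expr2 ler_piMl// ltW.
  move: r2; rewrite ler_pdivlMr// => r2 r3.
  have sd : 0 <= s * d%:R by rewrite mulr_ge0.
  have := ler_wpM2l sd r3; rewrite -mulrA; lra.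
have h4 : c / 4 * dotv e e <= Q x e.
  have := ler_wpM2r (dotv_ge0 e) h3; lra.
rewrite -[leRHS]fineK.
  by rewrite lee_fin.
exact: integrable_fin_num (L2_sqr_integrable (L2_f e x)).
Qed.

End anchor.

Lemma smooth_korn (GD : set 'rV[R]_d) : measurable GD -> GD `<=` boundary P ->
  (0 < surface P GD)%E ->
  exists2 C, 0 < C & forall phi : 'I_d -> 'rV[R]_d -> R, (forall k, smooth (phi k)) ->
    \int[lam]_(x in Om) (\sum_k phi k x ^+ 2) <=
    C * (\int[lam]_(x in Om) strain_sqr phi x +
         \int[surface P]_(x in GD) (\sum_k phi k x ^+ 2)).
Proof.
move=> mGD GDb GD0.
have [i hi] : exists i : 'I_(nfacets P), (0 < lam (prism i GD))%E.
  apply: contrapT => h; move: GD0; rewrite /surface big1 ?ltxx// => i _.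
  apply/eqP; rewrite eq_le measure_ge0 andbT leNgt; apply/negP => hi; apply: h.
  by exists i.
have [x0 x0Om] := domain_nonempty P.
have [c [r0 [c0 r00 hc]]] := anchor_coercive mGD x0Om hi.
have /nbhs_ballP[e /= e0 He] : nbhs x0 Om by apply: open_nbhs_nbhs; split => //; exact: open_domain.
(* Half of the distance from x0 to the plane of the facet; the other half is left for the size of
   the box. *)
pose delta := (offset i - dotv (normal i) x0) / 2.
have delta0 : 0 < delta by rewrite /delta divr_gt0// subr_gt0; exact: x0Om.
(* [r0] keeps the anchor form coercive on the box, e / 2 keeps the box inside the domain, and d r <=
   delta keeps it at distance [delta] from the plane of the facet. *)
pose r := Num.min r0 (Num.min (e / 2) (delta / (d%:R + 1))).
have d1 : 0 < d%:R + 1 :> R by rewrite ltr_wpDl.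
have rp : 0 < r by rewrite /r !lt_min r00/=; apply/andP; split; apply: divr_gt0.
have rr0 : r <= r0 by rewrite /r ge_min lexx.
have re : r <= e / 2 by rewrite /r !ge_min lexx !orbT.
have rd : r <= delta / (d%:R + 1) by rewrite /r !ge_min lexx !orbT.
have boxr x : rV_box (x0 - const_mx r) (x0 + const_mx r) x -> forall j, `|x ord0 j - x0 ord0 j| <= r.
  by move=> hx j; have := hx j; rewrite !mxE ler_distl.
have Bc : rV_box (x0 - const_mx r) (x0 + const_mx r) `<=` cOm.
  move=> x /boxr hx; apply: domain_sub_closed; apply: He; split => // a j; rewrite ord1.
  by rewrite /ball/= distrC; apply: le_lt_trans (hx j) _; lra.
have Bd x : rV_box (x0 - const_mx r) (x0 + const_mx r) x -> dotv (normal i) x <= offset i - delta.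
  move=> /boxr hx; rewrite -[x](subrK x0) dotvDr.
  have : dotv (normal i) (x - x0) <= d%:R * r.
    rewrite /dotv mulr_natl -[X in _ *+ X]card_ord -sumr_const; apply: ler_sum => j _.
    apply: le_trans (ler_norm _) _; rewrite normrM -[r]mul1r; apply: ler_pM => //.
      exact: normal_coord_le.
    by rewrite !mxE; exact: hx.
  move: rd; rewrite ler_pdivlMr// mulrDr mulr1 => h1 h2; rewrite /delta in h1 *.
  by rewrite mulrC in h2; lra.
have [M M0 hM] := closed_domain_bounded P.
pose U : set 'rV[R]_d := rV_box (const_mx (- (M + M))) (const_mx (M + M)).
have dU x y : cOm x -> cOm y -> forall j, `|(y - x) ord0 j| <= M + M.
  move=> xc yc j; apply: le_trans (rV_coord_le _ _) _.
  by apply: le_trans (ler_normB _ _) _; apply: lerD; exact: hM.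
have U_ge x y : cOm x -> cOm y -> U (y - x).
  by move=> xc yc j; have := dU x y xc yc j; rewrite ler_norml ![const_mx _ _ _]mxE.
pose D1 := d%:R * (M + M) ^+ 2.
have D1_ge x y : cOm x -> cOm y -> dotv (y - x) (y - x) <= D1.
  by move=> xc yc; apply: dotv_le; exact: dU.
have D10 : 0 <= D1 by rewrite mulr_ge0// sqr_ge0.
have mU : measurable U by exact: measurable_rV_box.
have finE (A : set 'rV[R]_d) : (lam A < +oo)%E -> lam A = (fine (lam A))%:E.
  by move=> h; rewrite fineK// ge0_fin_numE// measure_ge0.
set u := fine (lam U); have uE : lam U = u%:E.
  by apply: finE; rewrite lebesgue_rV_box ?ltry// => j; rewrite !mxE; lra.
set l := fine (lam Om); have lE : lam Om = l%:E by apply: finE; exact: lebesgue_domain_fin.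
pose B := rV_box (x0 - const_mx r) (x0 + const_mx r).
set be := fine (lam B); have bE : lam B = be%:E.
  by apply: finE; rewrite lebesgue_rV_box ?ltry// => j; rewrite !mxE; lra.
have u0 : 0 <= u by rewrite fine_ge0// measure_ge0.
have l0 : 0 <= l by rewrite fine_ge0// measure_ge0.
have be0 : 0 <= be by rewrite fine_ge0// measure_ge0.
have rd0 : 0 < r ^+ 2 * r ^+ d by rewrite mulr_gt0// exprn_gt0.
(* [C1] and [C2] are the factors of the strain integral and of the boundary integral in
   [smooth_korn_local]. *)
pose C1 := 4 * d%:R * (2 * u * D1 ^+ 2 + 2 * D1 * l * (c^-1 * (2 * u * delta^-1 * D1 ^+ 2))).
pose C2 := 4 * d%:R * (2 * D1 * l * (c^-1 * (2 * D1 * be))).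
have C10 : 0 <= C1.
  by rewrite /C1 !(mulr_ge0, addr_ge0)// ?invr_ge0 ?sqr_ge0// ltW.
have C20 : 0 <= C2 by rewrite /C2 !(mulr_ge0, addr_ge0)// ?invr_ge0 ?sqr_ge0// ltW.
exists ((C1 + C2 + 1) / (r ^+ 2 * r ^+ d)).
  by rewrite divr_gt0// ltr_wpDl// addr_ge0.
move=> phi sphi.
have mB := @measurable_boundary R d P.
have cN2 : continuous (fun x => \sum_k phi k x ^+ 2).
  by apply: continuous_sumr => k; apply: continuous_sqr; exact: smooth_continuous.
have bdd (D : set 'rV[R]_d) (mD : measurable D) (mu : {measure set 'rV[R]_d -> \bar R}) g :
    D `<=` cOm -> (mu D < +oo)%E -> continuous g -> mu.-integrable D (EFin \o g).
  move=> Dc Doo cg; have [K hK] := continuous_domain_bounded P cg.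
  apply: (L2_integrable mD) => //; apply: (@L2_bounded _ _ _ _ _ mD _ K) => //.
    by apply: measurable_funTS; exact: continuous_measurable_rV.
  by move=> x /Dc; exact: hK.
have i1 : lam.-integrable Om (EFin \o (fun x => \sum_k phi k x ^+ 2)).
  by apply: bdd => //; [exact: mOm|exact: domain_sub_closed|exact: lebesgue_domain_fin].
have i2 : lam.-integrable Om (EFin \o strain_sqr phi).
  apply: bdd => //; [exact: mOm|exact: domain_sub_closed|exact: lebesgue_domain_fin|].
  exact: continuous_strain_sqr.
have i3 : (surface P).-integrable GD (EFin \o (fun x => \sum_k phi k x ^+ 2)).
  apply: bdd => //; last exact: surface_fin.
  by apply: subset_trans GDb _; rewrite boundaryE; exact: subDsetl.
have := @smooth_korn_local R d P D1 U D1_ge mU U_ge phi sphi i GD x0 r c delta mGD rp c0 delta0 Bc Bd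
  (fun x e0 hx => hc x e0 (fun j => le_trans (boxr x hx j) rr0)).
rewrite integral_strain_field// uE lE -/B bE.
have N2E (D : set 'rV[R]_d) (mu : {measure set 'rV[R]_d -> \bar R}) : measurable D ->
    mu.-integrable D (EFin \o (fun x => \sum_k phi k x ^+ 2)) ->
    (\int[mu]_(x in D) (dotv (\row_k phi k x) (\row_k phi k x))%:E =
     (\int[mu]_(x in D) (\sum_k phi k x ^+ 2))%:E)%E.
  move=> mD iD; rewrite /Rintegral fineK; last exact: (integrable_fin_num mD iD).
  by apply: eq_integral => x _; congr EFin; apply: eq_bigr => k _; rewrite !mxE expr2.
rewrite (N2E Om lam mOm i1) (N2E GD (surface P) mGD i3).
have -> : (\int[lam]_(x in Om) (strain_sqr phi x)%:E = (\int[lam]_(x in Om) strain_sqr phi x)%:E)%E.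
  by rewrite /Rintegral fineK//; exact: (integrable_fin_num mOm i2).
set X := \int[lam]_(x in Om) _; set E := \int[lam]_(x in Om) _; set Y := \int[surface P]_(x in _) _.
have E0 : 0 <= E.
  by apply: Rintegral_ge0 => x _; apply: sumr_ge0 => k _; apply: sumr_ge0 => j _; exact: sqr_ge0.
have Y0 : 0 <= Y by apply: Rintegral_ge0 => x _; apply: sumr_ge0 => k _; exact: sqr_ge0.
rewrite -!(EFinM, EFinD) lee_fin => h.
rewrite mulrAC ler_pdivlMr// mulrC; apply: (le_trans h).
apply: (@le_trans _ _ (C1 * E + C2 * Y)).
  by rewrite le_eqVlt /C1 /C2; apply/orP; left; apply/eqP; ring.
have := mulr_ge0 C10 Y0; have := mulr_ge0 C20 E0; lra.
Qed.

Definition strain_energy (v : 'rV[R]_d -> 'rV[R]_d) : R :=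
  \int[lam]_(x in Om) (\sum_k \sum_j strain Om v x k j ^+ 2).

Lemma strain_L2 (GD : set 'rV[R]_d) v k j : Vspace P GD v ->
  L2 lam Om (fun x => strain Om v x k j).
Proof.
move=> hv; rewrite /strain; apply: (L2Z mOm); apply: (L2D mOm);
  by apply: weak_partial_L2; exact: Vspace_H1 hv.
Qed.

(** Each component has its own smooth sequence, given by its trace, converging in H^1 and in L_2 of
    the boundary. As the trace vanishes on [GD], the boundary term of [smooth_korn] tends to zero.
    The factor 4 comes from two uses of (a + b)^2 <= 2 a^2 + 2 b^2, one on v and one on its
    strain. *)
Theorem korn_poincare (GD : set 'rV[R]_d) : measurable GD -> GD `<=` boundary P ->
  (0 < surface P GD)%E ->
  exists2 C, 0 < C & forall v, Vspace P GD v -> 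
    \int[lam]_(x in Om) dotv (v x) (v x) <= C * strain_energy v.
Proof.
move=> mGD GDb GD0; have [C C0 hC] := smooth_korn mGD GDb GD0.
exists (4 * C); first by rewrite mulr_gt0.
move=> v hv.
have [phi hphi] : exists phi : 'I_d -> nat -> 'rV[R]_d -> R, forall j,
   [/\ forall n, smooth (phi j n),
      H1dist2 Om (fun x => v x ord0 j) (phi j n) @[n --> \oo] --> (0 : R) &
      \int[surface P]_(x in GD) (phi j n x ^+ 2) @[n --> \oo] --> (0 : R)].
  have h j : exists ph : nat -> 'rV[R]_d -> R, [/\ forall n, smooth (ph n),
      H1dist2 Om (fun x => v x ord0 j) (ph n) @[n --> \oo] --> (0 : R) &
      \int[surface P]_(x in GD) (ph n x ^+ 2) @[n --> \oo] --> (0 : R)].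
    have [_ [g [[Lg [ph [sph [h1 h2]]]] g0]]] := hv j.
    exists ph; split => //.
    apply: (@squeeze_cvgr _ _ _ _ (fun=> 0)
      (fun n => \int[surface P]_(x in boundary P) ((ph n x - g x) ^+ 2))) => //; last exact: cvg_cst.
    near=> n; rewrite Rintegral_sqr_ge0/=.
    have mB := @measurable_boundary R d P.
    have Ld : L2 (surface P) (boundary P) (fun x => ph n x - g x).
      by apply: (L2B mB) => //; apply: continuous_L2_boundary; exact: smooth_continuous.
    have mphn : measurable_fun setT (ph n) by apply: continuous_measurable_rV; exact: smooth_continuous.
    apply: (@le_trans _ _ (\int[surface P]_(x in GD) ((ph n x - g x) ^+ 2))).
      rewrite le_eqVlt; apply/orP; left; apply/eqP; apply: ae_eq_Rintegral => //.
      - by apply: measurable_funX; exact: measurable_funTS.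
      - apply: measurable_funX; apply: measurable_funS mB GDb _; by case: Ld.
      - by apply: filterS g0 => x h GDx; rewrite h// subr0.
    have iB := L2_sqr_integrable Ld.
    apply: fine_le.
    - by apply: integrable_fin_num => //; exact: (integrableS mB mGD GDb iB).
    - exact: integrable_fin_num iB.
    - apply: ge0_subset_integral => //; first by case/integrableP : iB.
      by move=> x _; rewrite lee_fin sqr_ge0.
  exists (fun j => sval (cid (h j))) => j; exact: svalP (cid (h j)).
have Lv j : L2 lam Om (fun x => v x ord0 j) by case: (Vspace_H1 j hv).
have Lphi j n : L2 lam Om (phi j n) by apply: smooth_L2; case: (hphi j).
have Lst k j := strain_L2 k j hv.
have sm n j : smooth (phi j n) by case: (hphi j).
have Lsm n k j : L2 lam Om (fun x => smooth_strain (fun j => phi j n) x k j).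
  by apply: (L2Z mOm); apply: (L2D mOm); exact: smooth_partial_L2.
pose Eps n := \sum_j H1dist2 Om (fun x => v x ord0 j) (phi j n).
have Eps0 : Eps n @[n --> \oo] --> (0 : R).
  by apply: (@cvg_sum0 R _ _ (fun j n => H1dist2 Om (fun x => v x ord0 j) (phi j n))) => j; case: (hphi j).
pose Gam n := \int[surface P]_(x in GD) (\sum_k phi k n x ^+ 2).
have Gam0 : Gam n @[n --> \oo] --> (0 : R).
  have iG n j : (surface P).-integrable GD (EFin \o (fun x => phi j n x ^+ 2)).
    apply: integrableS (@measurable_boundary R d P) mGD GDb _.
    by apply: L2_sqr_integrable; apply: continuous_L2_boundary; exact: smooth_continuous.
  rewrite (_ : Gam = fun n => \sum_k \int[surface P]_(x in GD) (phi k n x ^+ 2)); last first.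
    by apply/funext => n; rewrite /Gam (Rintegral_sumr mGD).
  by apply: (@cvg_sum0 R _ _ (fun j n => \int[surface P]_(x in GD) (phi j n x ^+ 2))) => j; case: (hphi j).
have key n : \int[lam]_(x in Om) dotv (v x) (v x) <=
    4 * C * strain_energy v + ((2 + 4 * C * d%:R) * Eps n + 2 * C * Gam n).
  have dist_ge0 j i : 0 <= \int[lam]_(x in Om)
      ((weak_partial Om i (fun y => v y ord0 j) x - partial i (phi j n) x) ^+ 2).
    exact: Rintegral_sqr_ge0.
  have E1 : \int[lam]_(x in Om) dotv (v x) (v x) <=
      2 * Eps n + 2 * \int[lam]_(x in Om) (\sum_k phi k n x ^+ 2).
    rewrite (Rintegral_sumr mOm); last by move=> j; exact: (L2_mul_integrable mOm).
    rewrite (Rintegral_sumr mOm); last by move=> j; exact: L2_sqr_integrable.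
    rewrite /Eps !mulr_sumr -big_split/=; apply: ler_sum => j _.
    have := @Rintegral_sqr_lin_le _ _ _ lam Om mOm 1 (fun x => v x ord0 j - phi j n x) (phi j n)
      (L2B mOm (Lv j) (Lphi j n)) (Lphi j n).
    rewrite expr1n mulr1 => h.
    rewrite (_ : \int[lam]_(x in Om) (v x ord0 j * v x ord0 j) =
       \int[lam]_(x in Om) (1 * (v x ord0 j - phi j n x) + phi j n x) ^+ 2); last first.
      by apply: eq_Rintegral => x _; ring.
    apply: (le_trans h); rewrite lerD2r ler_wpM2l// /H1dist2 lerDl.
    exact: sumr_ge0.
  have E2 : \int[lam]_(x in Om) strain_sqr (fun j => phi j n) x <=
      2 * strain_energy v + 2 * d%:R * Eps n.
    rewrite /strain_energy /strain_sqr.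
    have isum (f : 'I_d -> 'I_d -> 'rV[R]_d -> R) : (forall k j, L2 lam Om (f k j)) ->
       \int[lam]_(x in Om) (\sum_k \sum_j f k j x ^+ 2) =
       \sum_k \sum_j \int[lam]_(x in Om) (f k j x ^+ 2).
      move=> Lf; rewrite (Rintegral_sumr mOm); last first.
        by move=> k; apply: (integrable_sumr mOm) => j; exact: L2_sqr_integrable.
      by apply: eq_bigr => k _; rewrite (Rintegral_sumr mOm)// => j; exact: L2_sqr_integrable.
    rewrite (isum (fun k j x => smooth_strain (fun j => phi j n) x k j)); last by move=> *; exact: Lsm.
    rewrite (isum (fun k j x => strain Om v x k j)); last by move=> *; exact: Lst.
    pose W j i := \int[lam]_(x in Om)
      ((weak_partial Om i (fun y => v y ord0 j) x - partial i (phi j n) x) ^+ 2).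
    have Lw j i : L2 lam Om (fun x => weak_partial Om i (fun y => v y ord0 j) x - partial i (phi j n) x).
      apply: (L2B mOm); last exact: smooth_partial_L2.
      by apply: weak_partial_L2; exact: Vspace_H1 hv.
    have hkj k j : \int[lam]_(x in Om) (smooth_strain (fun j => phi j n) x k j ^+ 2) <=
       2 * \int[lam]_(x in Om) (strain Om v x k j ^+ 2) + (W k j + W j k).
      have := @Rintegral_sqr_lin_le _ _ _ lam Om mOm (-1) (fun x => strain Om v x k j -
         smooth_strain (fun j => phi j n) x k j) (fun x => strain Om v x k j)
         (L2B mOm (Lst k j) (Lsm n k j)) (Lst k j).
      rewrite sqrrN expr1n mulr1 => h1.
      have := @Rintegral_sqr_lin_le _ _ _ lam Om mOm 1 
         (fun x => weak_partial Om j (fun y => v y ord0 k) x - partial j (phi k n) x)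
         (fun x => weak_partial Om k (fun y => v y ord0 j) x - partial k (phi j n) x)
         (Lw k j) (Lw j k).
      rewrite expr1n mulr1 -/(W k j) -/(W j k) => h2.
      have h3 : \int[lam]_(x in Om) (strain Om v x k j - smooth_strain (fun j => phi j n) x k j) ^+ 2 =
        4^-1 * \int[lam]_(x in Om) (1 * (weak_partial Om j (fun y => v y ord0 k) x - partial j (phi k n) x)
          + (weak_partial Om k (fun y => v y ord0 j) x - partial k (phi j n) x)) ^+ 2.
        rewrite -RintegralZl//; [|exact: mOm|]; last first.
          by apply: L2_sqr_integrable; exact: (L2_lin mOm).
        by apply: eq_Rintegral => x _; exact: half_sum_sub_sqr.
      have h4 : \int[lam]_(x in Om) (smooth_strain (fun j => phi j n) x k j ^+ 2) =
        \int[lam]_(x in Om) (-1 * (strain Om v x k j -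
         smooth_strain (fun j => phi j n) x k j) + strain Om v x k j) ^+ 2.
        by apply: eq_Rintegral => x _; ring.
      by rewrite h4; exact: (three_term_le h1 h3 h2).
    have hW : \sum_k \sum_j W k j <= Eps n.
      apply: ler_sum => k _; rewrite /H1dist2 -/(W k _) lerDr; exact: Rintegral_sqr_ge0.
    have hW0 : 0 <= \sum_k \sum_j W k j.
      by apply: sumr_ge0 => k _; apply: sumr_ge0 => j _; exact: Rintegral_sqr_ge0.
    have := ler_sum (index_enum 'I_d) (P := predT) (fun k _ =>
      ler_sum (index_enum 'I_d) (P := predT) (fun j _ => hkj k j)).
    under [leRHS]eq_bigr do rewrite big_split/= -mulr_sumr big_split/=.
    rewrite !big_split/= -mulr_sumr [X in _ + (_ + X)]exchange_big/= => h.
    apply: (le_trans h); rewrite lerD2l.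
    have [d0|d0] := posnP d.
      by subst d; rewrite !big_ord0 /= mulr0 mul0r addr0.
    by apply: (double_le hW0 hW); rewrite ler1n.
  exact: (combined_le (ltW C0) E1 (hC (fun j => phi j n) (sm n)) E2).
have : (4 * C * strain_energy v + ((2 + 4 * C * d%:R) * Eps n + 2 * C * Gam n)) @[n --> \oo]
   --> 4 * C * strain_energy v + ((2 + 4 * C * d%:R) * 0 + 2 * C * 0).
  apply: cvgD; first exact: cvg_cst.
  by apply: cvgD; apply: cvgM => //; exact: cvg_cst.
rewrite !mulr0 !addr0 => hl; apply: (ler_cvg_to (cvg_cst _) hl).
by near=> n; exact: key.
Unshelve. all: end_near. Qed.

End korn_poincare.

(** * The elastic energy form *)

Section tensor_coercivity.
Context {R : realType} {d : nat}.

Definition tensor_form (D : tensor4 R d) (e f : 'M[R]_d) : R :=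
  \sum_i \sum_j (\sum_k \sum_l D i j k l * e k l) * f i j.

Lemma tensor_formZ (D : tensor4 R d) a e : tensor_form D (a *: e) (a *: e) = a ^+ 2 * tensor_form D e e.
Proof.
rewrite /tensor_form mulr_sumr; apply: eq_bigr => i _; rewrite mulr_sumr.
apply: eq_bigr => j _; rewrite mxE.
rewrite (_ : \sum_k \sum_l _ = a * \sum_k \sum_l D i j k l * e k l); first by ring.
rewrite mulr_sumr; apply: eq_bigr => k _; rewrite mulr_sumr.
by apply: eq_bigr => l _; rewrite mxE; ring.
Qed.

(** [quadratic_coercive] wants a form that is positive on a whole space. So the tensor is evaluated
    at e + e^T and the squares of the entries of e - e^T are added; at a symmetric e this is the
    form at 2 e, whence c / 4. *)
Lemma tensor_posdef_coercive (D : tensor4 R d) : tensor_posdef D ->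
  exists2 c, 0 < c & forall e : 'M[R]_d, e^T = e ->
    c * \sum_i \sum_j e i j ^+ 2 <= tensor_form D e e.
Proof.
move=> pD.
pose sym (v : 'rV[R]_(d * d)) := vec_mx v + (vec_mx v)^T.
pose asym (v : 'rV[R]_(d * d)) := vec_mx v - (vec_mx v)^T.
pose q v := tensor_form D (sym v) (sym v) + \sum_i \sum_j asym v i j ^+ 2.
have csym i j : continuous (fun v => sym v i j).
  under eq_fun do rewrite !mxE.
  by apply: continuous_addr; exact: coord_continuous.
have casym i j : continuous (fun v => asym v i j).
  under eq_fun do rewrite !mxE -mulN1r.
  apply: continuous_addr; first exact: coord_continuous.
  by apply: continuous_mulr; [exact: cst_continuous|exact: coord_continuous].
have cq : continuous q.
  apply: continuous_addr.
    apply: continuous_sumr => i; apply: continuous_sumr => j; apply: continuous_mulr => //.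
    apply: continuous_sumr => k; apply: continuous_sumr => l; apply: continuous_mulr => //.
    exact: cst_continuous.
  by apply: continuous_sumr => i; apply: continuous_sumr => j; exact: continuous_sqr.
have qZ a v : q (a *: v) = a ^+ 2 * q v.
  rewrite /q mulrDr -tensor_formZ.
  have -> : sym (a *: v) = a *: sym v by apply/matrixP => i j; rewrite !mxE; ring.
  congr (_ + _); rewrite mulr_sumr; apply: eq_bigr => i _; rewrite mulr_sumr.
  by apply: eq_bigr => j _; rewrite !mxE; ring.
have asq v : 0 <= \sum_i \sum_j asym v i j ^+ 2.
  by apply: sumr_ge0 => i _; apply: sumr_ge0 => j _; exact: sqr_ge0.
have symT v : (sym v)^T = sym v by rewrite /sym linearD/= trmxK addrC.
have qp v : v != 0 -> 0 < q v.
  move=> v0; rewrite /q; have [s0|s0] := eqVneq (sym v) 0; last first.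
    by apply: ltr_wpDr => //; exact: pD.
  have -> : tensor_form D (sym v) (sym v) = 0.
    by rewrite s0 /tensor_form big1// => i _; rewrite big1// => j _; rewrite mxE mulr0.
  rewrite add0r lt_neqAle asq andbT eq_sym; apply: contra v0 => /eqP h.
  have a0 i j : asym v i j = 0.
    apply/eqP; rewrite -sqrf_eq0; apply/eqP.
    have h1 := @psumr_eq0P _ _ predT (fun i => \sum_j asym v i j ^+ 2) _ h.
    have h2 : \sum_j asym v i j ^+ 2 = 0.
      by apply: h1 => // k _; apply: sumr_ge0 => l _; exact: sqr_ge0.
    by apply: (@psumr_eq0P _ _ predT (fun j => asym v i j ^+ 2) _ h2) => // k _; exact: sqr_ge0.
  rewrite -[v]vec_mxK (_ : vec_mx v = 0) ?linear0//.
  apply/matrixP => i j; have := a0 i j; move/matrixP : s0 => /(_ i j).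
  rewrite !mxE => h1 h2; lra.
have [c c0 hc] := quadratic_coercive cq qZ qp.
exists (c / 4); first by rewrite divr_gt0.
move=> e eT; have := hc (mxvec e); rewrite /q /asym /sym mxvecK eT subrr.
rewrite (_ : \sum_i \sum_j _ = 0); last first.
  by rewrite big1// => i _; rewrite big1// => j _; rewrite mxE expr0n.
rewrite addr0 (_ : e + e = 2 *: e); last by rewrite scaler_nat.
rewrite tensor_formZ.
rewrite (_ : dotv _ _ = \sum_i \sum_j e i j ^+ 2); first by lra.
rewrite /dotv pair_bigA/= (reindex _ (curry_mxvec_bij d d)) /=.
by apply: eq_bigr => -[i j] _; rewrite mxvecE expr2.
Qed.

End tensor_coercivity.

Section energy_form.
Context {R : realType} {d : nat} (P : polytopic_domain R d).
Local Notation Om := (domain_set P).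
Local Notation lam := (@lebesgue_rV R d).
Local Notation mOm := (measurable_domain P).
Variables (GD : set 'rV[R]_d) (D : 'rV[R]_d -> tensor4 R d).
Hypothesis hsym : forall x, Om x -> tensor_symmetric (D x).
Hypothesis hpos : forall x, Om x -> tensor_posdef (D x).
Hypothesis hpc : piecewise_constant Om D.
Local Notation V := (Vspace P GD).
Local Notation vecf := ('rV[R]_d -> 'rV[R]_d).

(** A sample point for each piece reduces measurability, bounds and coercivity to finitely many
    tensors. A piece that misses the domain gets the point 0. *)
Let tensor_pieces : exists (p : nat) (Q : 'I_p -> set 'rV[R]_d) (x : 'I_p -> 'rV[R]_d),
  [/\ forall a, measurable (Q a), Om `<=` \bigcup_(a in [set: 'I_p]) Q a &
      forall a y, Om y -> Q a y -> Om (x a) /\ D y = D (x a)].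
Proof.
have [p [Q [mQ cQ dQ]]] := hpc.
have h a : exists x, forall y, Om y -> Q a y -> Om x /\ D y = D x.
  have [[x [xOm xQ]]|h] := pselect (exists x, Om x /\ Q a x).
    by exists x => y yOm yQ; split => //; apply: (dQ a); split.
  by exists 0 => y yOm yQ; exfalso; apply: h; exists y.
exists p, Q, (fun a => sval (cid (h a))); split => // a y.
exact: svalP (cid (h a)) y.
Qed.

Lemma tensor_measurable i j k l : measurable_fun Om (fun x => D x i j k l).
Proof.
have [p [Q [x [mQ cQ dQ]]]] := tensor_pieces.
move=> _ Y mY.
rewrite (_ : _ `&` _ = \bigcup_(a in [set a : 'I_p | Y (D (x a) i j k l)]) (Om `&` Q a)).
  by apply: fin_bigcup_measurable => // a _; apply: measurableI => //; exact: mOm.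
apply/seteqP; split => y /=.
  move=> [yOm yY]; have [a _ ya] := cQ y yOm; exists a => //=.
  by have [_ <-] := dQ a y yOm ya.
by move=> [a /= Ya [yOm ya]]; split => //; have [_ ->] := dQ a y yOm ya.
Qed.

Lemma tensor_bounded i j k l : exists M, forall x, Om x -> `|D x i j k l| <= M.
Proof.
have [p [Q [x [mQ cQ dQ]]]] := tensor_pieces.
exists (\sum_a `|D (x a) i j k l|) => y yOm.
have [a _ ya] := cQ y yOm; have [_ ->] := dQ a y yOm ya.
by rewrite (bigD1 a)//= lerDl; exact: sumr_ge0.
Qed.

Lemma tensor_coercive : exists2 c, 0 < c & forall x, Om x ->
  forall e : 'M[R]_d, e^T = e -> c * \sum_i \sum_j e i j ^+ 2 <= tensor_form (D x) e e.
Proof.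
have [p [Q [x [mQ cQ dQ]]]] := tensor_pieces.
have h a : exists2 c, 0 < c & Om (x a) ->
    forall e : 'M[R]_d, e^T = e -> c * \sum_i \sum_j e i j ^+ 2 <= tensor_form (D (x a)) e e.
  have [xOm|h] := pselect (Om (x a)); last by exists 1.
  by have [c c0 hc] := tensor_posdef_coercive (hpos xOm); exists c.
pose c a := sval (cid2 (h a)).
have c0 a : 0 < c a by rewrite /c; case: (cid2 (h a)).
have hc a : Om (x a) -> forall e : 'M[R]_d, e^T = e ->
    c a * \sum_i \sum_j e i j ^+ 2 <= tensor_form (D (x a)) e e.
  by rewrite /c; case: (cid2 (h a)).
exists (\big[Num.min/1]_a c a).
  by elim/big_ind : _ => // u v; rewrite lt_min => -> ->.
move=> y yOm e eT; have [a _ ya] := cQ y yOm; have [xOm ->] := dQ a y yOm ya.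
apply: le_trans (hc a xOm e eT); apply: ler_wpM2r.
  by apply: sumr_ge0 => i _; apply: sumr_ge0 => j _; exact: sqr_ge0.
by rewrite (bigD1 a)//= ge_min lexx.
Qed.

Let stress (w : vecf) x i j := \sum_k \sum_l D x i j k l * strain Om w x k l.

Let stress_L2 w i j : V w -> L2 lam Om (fun x => stress w x i j).
Proof.
move=> hw; apply: (L2_sum mOm) => k; apply: (L2_sum mOm) => l.
have [M hM] := tensor_bounded i j k l.
by apply: (L2_bounded_mul mOm) hM _; [exact: tensor_measurable|exact: strain_L2 hw].
Qed.

Let energy_integrable w v i j : V w -> V v ->
  lam.-integrable Om (EFin \o (fun x => stress w x i j * strain Om v x i j)).
Proof.
by move=> hw hv; apply: (L2_mul_integrable mOm); [exact: stress_L2|exact: strain_L2 hv].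
Qed.

Let aform_integrable w v : V w -> V v ->
  lam.-integrable Om (EFin \o (fun x => \sum_i \sum_j stress w x i j * strain Om v x i j)).
Proof.
by move=> hw hv; apply: (integrable_sumr mOm) => i; apply: (integrable_sumr mOm) => j;
  exact: energy_integrable.
Qed.

Lemma strain_sym v x k j : strain Om v x k j = strain Om v x j k.
Proof.
have e (a b : R) : 2^-1 * (a + b) = 2^-1 * (b + a) by rewrite addrC.
exact: (e (weak_partial Om j (fun y => v y ord0 k) x) (weak_partial Om k (fun y => v y ord0 j) x)).
Qed.

Lemma strain_lin (a : R) w v : V w -> V v ->
  {ae lam, forall x, Om x -> forall k j, strain Om (fun x => a *: w x + v x) x k j =
     a * strain Om w x k j + strain Om v x k j}.
Proof.
move=> hw hv.
have h k j := weak_partial_lin a j (Vspace_H1 k hw) (Vspace_H1 k hv).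
have h1 : {ae lam, forall x, forall k j, Om x ->
   weak_partial Om j (fun x => a * w x ord0 k + v x ord0 k) x =
   a * weak_partial Om j (fun x => w x ord0 k) x + weak_partial Om j (fun x => v x ord0 k) x}.
  by apply: filter_forall => k; apply: filter_forall => j; exact: h.
have half (A B A1 A2 B1 B2 : R) : A = a * A1 + A2 -> B = a * B1 + B2 ->
    2^-1 * (A + B) = a * (2^-1 * (A1 + B1)) + 2^-1 * (A2 + B2) by move=> -> ->; ring.
have e i : (fun y => (a *: w y + v y) ord0 i) = (fun x => a * w x ord0 i + v x ord0 i).
  by apply/funext => y; rewrite !mxE.
have h2 x : (forall k j, Om x ->
     weak_partial Om j (fun x => a * w x ord0 k + v x ord0 k) x =
     a * weak_partial Om j (fun x => w x ord0 k) x + weak_partial Om j (fun x => v x ord0 k) x) ->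
    Om x -> forall k j, weak_partial Om j (fun y => (a *: w y + v y) ord0 k) x =
     a * weak_partial Om j (fun x => w x ord0 k) x + weak_partial Om j (fun x => v x ord0 k) x.
  by move=> hx xOm k j; rewrite -(hx k j xOm); congr (weak_partial _ _ _ _); exact: e.
by apply: filterS h1 => x hx xOm k j; apply: half; exact: (h2 x hx xOm).
Qed.

Lemma aform_sym w v : aform Om D w v = aform Om D v w.
Proof.
apply: eq_Rintegral => x; rewrite inE => xOm.
rewrite !pair_bigA/=.
under eq_bigr do rewrite pair_bigA/= mulr_suml.
under [RHS]eq_bigr do rewrite pair_bigA/= mulr_suml.
rewrite exchange_big/=; apply: eq_bigr => -[i j] _; apply: eq_bigr => -[k l] _ /=.
by have [_ _ ->] := hsym xOm k l i j; exact: mulrAC.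
Qed.

Lemma aform_lin (a : R) w v z : V w -> V v -> V z ->
  aform Om D (fun x => a *: w x + v x) z = a * aform Om D w z + aform Om D v z.
Proof.
move=> hw hv hz; have hwv := Vspace_lin a hw hv.
have i1 := aform_integrable hw hz; have i2 := aform_integrable hv hz.
rewrite /aform -RintegralZl//; last exact: mOm.
rewrite -RintegralD//; [|exact: mOm|by apply: (integrable_scaler mOm)].
have m f : lam.-integrable Om (EFin \o f) -> measurable_fun Om f.
  by move=> /measurable_int /measurable_EFinP.
apply: ae_eq_Rintegral; first exact: mOm.
- by apply: m; exact: aform_integrable.
- by apply: m; apply: (integrable_addr mOm) => //; exact: (integrable_scaler mOm).
apply: filterS (strain_lin a hw hv) => x hx xOm.
rewrite mulr_sumr -big_split/=; apply: eq_bigr => i _.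
rewrite mulr_sumr -big_split/=; apply: eq_bigr => j _.
rewrite mulrA -mulrDl; congr (_ * _).
rewrite mulr_sumr -big_split/=; apply: eq_bigr => k _.
rewrite mulr_sumr -big_split/=; apply: eq_bigr => l _.
by rewrite (hx xOm) mulrDr mulrCA.
Qed.

Lemma aform_coercive : exists2 c, 0 < c & forall w, V w ->
  c * strain_energy P w <= aform Om D w w.
Proof.
have [c c0 hc] := tensor_coercive; exists c => // w hw.
rewrite /strain_energy -RintegralZl//; [|exact: mOm|]; last first.
  apply: (integrable_sumr mOm) => i; apply: (integrable_sumr mOm) => j.
  by apply: L2_sqr_integrable; exact: strain_L2 hw.
apply: le_Rintegral; first exact: mOm.
- apply: (integrable_scaler mOm).
  apply: (integrable_sumr mOm) => i; apply: (integrable_sumr mOm) => j.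
  by apply: L2_sqr_integrable; exact: strain_L2 hw.
- exact: aform_integrable.
- move=> x xOm; have := hc x xOm (\matrix_(i, j) strain Om w x i j).
  have -> : (\matrix_(i, j) strain Om w x i j)^T = \matrix_(i, j) strain Om w x i j.
    by apply/matrixP => i j; rewrite !mxE strain_sym.
  move=> /(_ erefl); rewrite /tensor_form.
  under eq_bigr do under eq_bigr do rewrite mxE.
  under [X in _ <= X -> _]eq_bigr do under eq_bigr do
    (rewrite mxE; under eq_bigr do under eq_bigr do rewrite mxE).
  by [].
Qed.

Lemma strain_energy_ge0 w : 0 <= strain_energy P w.
Proof.
apply: Rintegral_ge0 => x _; apply: sumr_ge0 => k _; apply: sumr_ge0 => j _.
exact: sqr_ge0.
Qed.

Lemma aform_ge0 w : V w -> 0 <= aform Om D w w.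
Proof.
move=> hw; have [c c0 hc] := aform_coercive; apply: le_trans (hc w hw).
by rewrite mulr_ge0 ?strain_energy_ge0// ltW.
Qed.

Lemma aform_cauchy_schwarz w v : V w -> V v ->
  aform Om D w v ^+ 2 <= aform Om D w w * aform Om D v v.
Proof.
move=> hw hv; apply: discriminant_le => t.
have hz := Vspace_lin t hv hw.
have e1 := aform_lin t hv hw hz.
have e2 := etrans (aform_sym v _) (aform_lin t hv hw hv).
have e3 := etrans (aform_sym w _) (aform_lin t hv hw hw).
have e (A B C z1 z2 z3 C' : R) : 0 <= z1 -> z1 = t * z2 + z3 -> z2 = t * B + C -> z3 = t * C' + A ->
    C' = C -> 0 <= A + 2 * t * C + t ^+ 2 * B.
  move=> h E1 E2 E3 E4; suff -> : A + 2 * t * C + t ^+ 2 * B = z1 by [].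
  by rewrite E1 E2 E3 E4; ring.
exact: (e _ _ _ _ _ _ _ (aform_ge0 hz) e1 e2 e3 (aform_sym v w)).
Qed.

(** A genuine equality: both functions have the same set of weak derivatives, so [xget] chooses the
    same element. Fields that agree on the domain can thus be exchanged in the energy form. *)
Lemma eq_weak_partial i (u u' : 'rV[R]_d -> R) : (forall x, Om x -> u x = u' x) ->
  weak_partial Om i u = weak_partial Om i u'.
Proof.
move=> uu; rewrite /weak_partial; congr xget; apply/seteqP.
have e phi : \int[lam]_(x in Om) (u x * partial i phi x) =
    \int[lam]_(x in Om) (u' x * partial i phi x).
  by apply: eq_Rintegral => x; rewrite inE => xOm; rewrite uu.
by split => g [Lg wg]; split => // phi tphi; rewrite -wg// e.
Qed.

Lemma eq_aform w w' v v' : (forall x, Om x -> w x = w' x) ->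
  (forall x, Om x -> v x = v' x) -> aform Om D w v = aform Om D w' v'.
Proof.
move=> ww vv.
have e (z z' : vecf) : (forall x, Om x -> z x = z' x) -> strain Om z = strain Om z'.
  move=> zz; apply/funext => x; apply/funext => k; apply/funext => j; rewrite /strain.
  by rewrite (@eq_weak_partial j _ (fun y => z' y ord0 k)) ?(@eq_weak_partial k _ (fun y => z' y ord0 j))// => y yOm;
    rewrite zz.
by rewrite /aform (e _ _ ww) (e _ _ vv).
Qed.

End energy_form.

Section Vspace_zero.
Context {R : realType} {d : nat} (P : polytopic_domain R d).
Local Notation Om := (domain_set P).
Local Notation lam := (@lebesgue_rV R d).

Lemma smooth0 : smooth (fun _ : 'rV[R]_d => 0 : R).
Proof. by apply: bump_smooth; exact: bump_cst. Qed.

Lemma Vspace0 (GD : set 'rV[R]_d) : Vspace P GD (fun _ => 0).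
Proof.
have mB := @measurable_boundary R d P.
have mOm := @measurable_domain R d P.
have w0 i : is_weak_partial Om i (fun=> 0) (fun=> 0).
  split; first exact: L2_0.
  by move=> phi _; under eq_Rintegral do rewrite mul0r;
    under [in RHS]eq_Rintegral do rewrite mul0r; rewrite /Rintegral integral0 oppr0.
have h0 : H1 Om (fun=> 0 : R).
  by split; [exact: L2_0|move=> i; exists (fun=> 0); exact: w0].
move=> j; rewrite (_ : (fun x => _) = (fun=> 0)); last by apply/funext => x; rewrite mxE.
split => //; exists (fun=> 0); split; last by apply: aeW.
split; first exact: L2_0.
exists (fun _ _ => 0); split; first by move=> n; exact: smooth0.
have z (mu : {measure set 'rV[R]_d -> \bar R}) (A : set 'rV[R]_d) :
    \int[mu]_(x in A) ((0 - 0 : R) ^+ 2) = 0.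
  by under eq_Rintegral do rewrite subrr expr0n; rewrite /Rintegral integral0.
split; last by under eq_fun do rewrite z; exact: cvg_cst.
rewrite (_ : H1dist2 Om (fun=> 0) (fun=> 0) = 0); first exact: cvg_cst.
rewrite /H1dist2 z add0r big1// => i _.
rewrite (_ : partial i (fun=> 0) = fun=> 0); last first.
  by apply/funext => x; apply: derive_val; exact: is_derive_cst.
(* The chosen weak derivative of 0 is known to vanish almost everywhere only. *)
rewrite -[RHS](z lam Om); apply: ae_eq_Rintegral => //.
- apply: measurable_funX; apply: measurable_funB; last exact: measurable_cst.
  by case: (weak_partial_L2 i h0).
- apply: filterS (weak_partial_unique (weak_partial_spec i h0) (w0 i)) => x hx xOm.
  by rewrite hx.
Qed.

End Vspace_zero.

(** * Sign, monotonicity and convexity of the quadrature weights *)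

Section power_differences.
Context {R : realType}.

(** Iterated forward differences with step one; the second one based at m - 1 is the weight
    beta_m. *)
Fixpoint power_diff k (r x : R) : R :=
  if k is k'.+1 then power_diff k' r (x + 1) - power_diff k' r x else x `^ r.

Fixpoint falling_product k (r : R) : R :=
  if k is k'.+1 then r * falling_product k' (r - 1) else 1.

Lemma is_derive_power_diff k (r x : R) : 0 < x ->
  is_derive x 1 (power_diff k r) (r * power_diff k (r - 1) x).
Proof.
elim: k x => [|k IH] x x0 /=; first exact: is_derive1_powR.
have x10 : 0 < x + 1 by rewrite addr_gt0.
have h1 := IH _ x10; have h0 := IH _ x0.
have h2 : is_derive x (1 : R) (fun y : R => y + 1) 1.
  by apply: is_derive_eq; rewrite addr0.
have h3 := @is_derive1_comp _ (power_diff k r) (fun y : R => y + 1) x _ _ h1 h2.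
rewrite mulrBr -[r * power_diff k (r - 1) (x + 1)]mulr1.
by apply: is_deriveB; have := h3; rewrite /GRing.scale/= [1 * _]mulrC.
Qed.

(** The mean value theorem trades one difference for a derivative, which produces the factor r and
    lowers the exponent by one. After k trades only the falling product and a positive power are
    left. *)
Lemma power_diff_sign k (r x : R) : 0 < x ->
  exists2 u, 0 <= u & power_diff k r x = falling_product k r * u.
Proof.
elim: k r x => [|k IH] r x x0 /=; first by exists (x `^ r); rewrite ?powR_ge0 ?mul1r.
have [c] : exists2 c, c \in `]x, (x + 1)[%R & power_diff k r (x + 1) - power_diff k r x =
    (r * power_diff k (r - 1) c) * ((x + 1) - x).
  apply: (@MVT _ _ (fun c => r * power_diff k (r - 1) c)).
  - by rewrite ltrDl.
  - by move=> y; rewrite in_itv/= => /andP[y0 _]; apply: is_derive_power_diff; exact: lt_trans y0.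
  - apply: derivable_within_continuous => y; rewrite in_itv/= => /andP[y0 _].
    by have [] := is_derive_power_diff k r (lt_le_trans x0 y0).
rewrite in_itv/= => /andP[xc _] ->; have [u u0 hu] := IH (r - 1) c (lt_trans x0 xc).
by exists u; rewrite // addrAC subrr add0r mulr1 hu mulrA.
Qed.

Lemma power_diff_cvg0 k (r : R) : 0 < r ->
  power_diff k r x @[x --> 0^'+] --> power_diff k r 0.
Proof.
move=> r0; elim: k => [|k IH] /=; first by rewrite powR0 ?gt_eqF//; exact: powR_cvg0.
apply: cvgB => //; apply: cvg_at_right_filter.
have h : {for (0 + 1 : R), continuous (power_diff k r)}.
  apply/differentiable_continuous/derivable1_diffP.
  by have [] := @is_derive_power_diff k r (0 + 1); rewrite add0r.
apply: (@continuous_comp _ _ _ (fun y : R => y + 1) (power_diff k r) (0 : R)); last exact: h.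
by apply: cvgD; [exact: cvg_id|exact: cvg_cst].
Qed.

(** The weight beta_1 is a difference based at 0, which [power_diff_sign] does not reach; the sign
    passes to it by a limit from the right. The factor [s] treats both signs at once. *)
Lemma power_diff_sign0 k (r s x : R) : 0 < r -> 0 <= s * falling_product k r -> 0 <= x ->
  0 <= s * power_diff k r x.
Proof.
move=> r0 s0; have pos y : 0 < y -> 0 <= s * power_diff k r y.
  by move=> y0; have [u u0 ->] := power_diff_sign k r y0; rewrite mulrA mulr_ge0.
rewrite le_eqVlt => /predU1P[<-|]; last exact: pos.
have h : s * power_diff k r x @[x --> 0^'+] --> s * power_diff k r 0.
  by apply: cvgM; [exact: cvg_cst|exact: power_diff_cvg0].
have <- := cvg_lim (@Rhausdorff R) h.
apply: limr_ge; first by apply/cvg_ex; eexists; exact: h.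
by near=> y; apply: pos; near: y; exact: nbhs_right_gt.
Unshelve. all: by end_near. Qed.

End power_differences.

Section kernel.
Context {R : realType} (p : R).
Hypothesis p12 : 1 < p < 2.
Let p0 : 0 < p. Proof. by case/andP: p12 => p1 _; exact: lt_trans p1. Qed.

Definition frac_kernel m : R :=
  if m is m'.+1 then power_diff 2 p m'%:R else 1.

(** For 1 < p < 2 the products p (p - 1), p (p - 1) (p - 2) and p (p - 1) (p - 2) (p - 3) are
    positive, negative and positive. The differences of order 2, 3 and 4 accordingly make the kernel
    nonnegative, decreasing and convex for m >= 1. *)
Let sign2 x : 0 <= x -> 0 <= power_diff 2 p x.
Proof.
move=> x0; rewrite -[leRHS]mul1r; apply: power_diff_sign0 => //=.
case/andP: p12 => p1 p2; rewrite mul1r mulr1; apply: mulr_ge0; lra.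
Qed.

Let sign3 x : 0 <= x -> power_diff 3 p x <= 0.
Proof.
move=> x0; rewrite -oppr_ge0 -mulN1r; apply: power_diff_sign0 => //=.
case/andP: p12 => p1 p2; rewrite mulr1.
have : 0 <= (p - 1) * (1 + 1 - p) by apply: mulr_ge0; lra.
have := p0; nra.
Qed.

Let sign4 x : 0 <= x -> 0 <= power_diff 4 p x.
Proof.
move=> x0; rewrite -[leRHS]mul1r; apply: power_diff_sign0 => //=.
case/andP: p12 => p1 p2; rewrite mul1r mulr1; apply: mulr_ge0; first exact: ltW.
apply: mulr_ge0; first lra.
by rewrite -mulrNN; apply: mulr_ge0; lra.
Qed.

Lemma frac_kernel_ge0 m : 0 <= frac_kernel m.
Proof. by case: m => // m; exact: sign2. Qed.

Let natS m : m.+1%:R = m%:R + 1 :> R. Proof. by rewrite -natr1. Qed.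

Lemma frac_kernel_decr m : frac_kernel m.+2 <= frac_kernel m.+1.
Proof.
have : power_diff 2 p (m%:R + 1) - power_diff 2 p m%:R <= 0 := sign3 (ler0n _ _).
by rewrite /frac_kernel natS; lra.
Qed.

Lemma frac_kernel_convex m :
  frac_kernel m.+2 - frac_kernel m.+3 <= frac_kernel m.+1 - frac_kernel m.+2.
Proof.
have := @sign4 m%:R (ler0n _ _); rewrite /frac_kernel.
rewrite (_ : power_diff 4 p m%:R = power_diff 2 p (m%:R + 1 + 1) - power_diff 2 p (m%:R + 1)
  - (power_diff 2 p (m%:R + 1) - power_diff 2 p m%:R)) // !natS; lra.
Qed.

(* With z = 2^(-(2 - p)/5) and 3^5 < 2^8, the left-hand side exceeds
   9 z^8 - 16 z^5 + 7, which is positive on ]0, 1[. *)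
Lemma frac_kernel_defect : 0 < 2 - 2 * frac_kernel 1 + frac_kernel 2.
Proof.
case/andP: p12 => p1 p2.
rewrite /frac_kernel /= powR0 ?gt_eqF// !add0r powR1.
rewrite (_ : 1 + 1 + 1 = 3); last by ring.
rewrite (_ : 1 + 1 = 2); last by [].
set z := (2 : R) `^ (- (2 - p) / 5).
have z0 : 0 < z by exact: powR_gt0.
have z1 : z < 1.
  rewrite -(powRr0 (2 : R)) /z /powR gt_eqF// ltr_expR ltr_pM2r ?ln_gt0 ?ltr1n//; lra.
have e2 : (2 : R) `^ p = 4 * z ^+ 5.
  rewrite -powR_mulrn ?powR_ge0// -powRrM.
  rewrite (_ : - (2 - p) / 5 * 5%:R = p - 2); last by field.
  rewrite -[in LHS](subrK 2 p) [LHS]powRD; last by rewrite pnatr_eq0 implybT.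
  by rewrite powR_mulrn// mulrC; congr (_ * _); rewrite -natrX.
have e3 : 9 * z ^+ 8 <= (3 : R) `^ p.
  rewrite -[in leRHS](subrK 2 p) powRD; last by rewrite pnatr_eq0 implybT.
  rewrite powR_mulrn// mulrC (_ : 3 ^+ 2 = 9); last by rewrite -natrX.
  rewrite ler_pM2r//.
  rewrite -powR_mulrn ?powR_ge0// -powRrM.
  have -> : (3 : R) `^ (p - 2) = (3 ^+ 5) `^ (- (2 - p) / 5).
    by rewrite -powR_mulrn// -powRrM; congr (_ `^ _); field.
  have -> : (2 : R) `^ (- (2 - p) / 5 * 8%:R) = (2 ^+ 8) `^ (- (2 - p) / 5).
    by rewrite -powR_mulrn// -powRrM; congr (_ `^ _); ring.
  rewrite mulNr !powRN lef_pV2 ?posrE ?powR_gt0 ?exprn_gt0//.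
  by apply: ge0_ler_powR; rewrite ?nnegrE ?exprn_ge0 -?natrX ?ler_nat//; lra.
suff : 0 < 9 * z ^+ 8 - 16 * z ^+ 5 + 7 by move: e3; rewrite e2; lra.
(* The root z = 1 is the case p = 2, where the defect vanishes; the cofactor is arranged as 7 + z
   plus nonnegative terms. *)
have -> : 9 * z ^+ 8 - 16 * z ^+ 5 + 7 = (1 - z) *
  (7 + z + 7 * z ^+ 4 * (1 - z) + 2 * z ^+ 3 * (1 - z ^+ 2) + 5 * z ^+ 3 * (1 - z ^+ 3)
   + 4 * z ^+ 2 * (1 - z ^+ 4) + 3 * z ^+ 2 * (1 - z ^+ 5) + 6 * z * (1 - z ^+ 6)).
  by ring.
have zn n : 0 <= 1 - z ^+ n by rewrite subr_ge0 exprn_ile1// ltW.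
have zz a n m : 0 <= a -> 0 <= a * z ^+ n * (1 - z ^+ m).
  by move=> a0; rewrite mulr_ge0// mulr_ge0// exprn_ge0// ltW.
have h1 := zz 7 4 1 (ler0n _ _); have h2 := zz 2 3 2 (ler0n _ _); have h3 := zz 5 3 3 (ler0n _ _).
have h4 := zz 4 2 4 (ler0n _ _); have h5 := zz 3 2 5 (ler0n _ _); have h6 := zz 6 1 6 (ler0n _ _).
rewrite expr1 in h1 h6; apply: mulr_gt0; first by rewrite subr_gt0.
by do 6 (apply: ltr_wpDr => //); rewrite addr_gt0.
Qed.

(* The weight of W^0 in the first term of q_n. *)
Definition initial_weight n : R :=
  if n is n'.+1 then n%:R `^ (p - 1) * (p - n%:R) + n'%:R `^ p else 0.

(** For n >= 1 the weight is p n^(p - 1) - (n^p - (n - 1)^p). Two mean values turn it into p (p - 1)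
    c'^(p - 2) (n - c) with n - 1 < c < c' < n. For n >= 2 the power of c' is at most 1; for n = 1
    the weight is just p - 1. *)
Lemma initial_weight_le n : 0 <= initial_weight n <= p.
Proof.
case: n => [|n] /=; first by rewrite lexx ltW.
have p1 : 0 < p - 1 by case/andP: p12 => p1 _; rewrite subr_gt0.
have n1 : 0 < n.+1%:R :> R by rewrite ltr0n.
have n1E : n.+1%:R `^ p = n.+1%:R * n.+1%:R `^ (p - 1) :> R by rewrite mulr_powRB1.
have -> : n.+1%:R `^ (p - 1) * (p - n.+1%:R) + n%:R `^ p =
    p * n.+1%:R `^ (p - 1) - (n.+1%:R `^ p - n%:R `^ p) by rewrite n1E; ring.
case: n n1 n1E => [|n] n1 n1E; first by rewrite powR0 ?gt_eqF// !powR1 subr0 mulr1; case/andP: p12; lra.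
have [c] : exists2 c, c \in `]n.+1%:R, n.+2%:R[%R & (n.+2%:R : R) `^ p - n.+1%:R `^ p =
    (p * c `^ (p - 1)) * (n.+2%:R - n.+1%:R).
  apply: (@MVT _ (fun y => y `^ p) (fun c => p * c `^ (p - 1))).
  - by rewrite ltr_nat.
  - by move=> y; rewrite in_itv/= => /andP[y0 _]; apply: is_derive1_powR; exact: le_lt_trans y0.
  - apply: derivable_within_continuous => y; rewrite in_itv/= => /andP[y0 _].
    have y0' : 0 < y by apply: lt_le_trans y0; rewrite ltr0n.
    by have [] := is_derive1_powR p y0'.
rewrite in_itv/= => /andP[c1 c2] ->.
rewrite (_ : n.+2%:R - n.+1%:R = 1); last by rewrite -natr1 addrAC subrr add0r.
have [c'] : exists2 c', c' \in `]c, n.+2%:R[%R & (n.+2%:R : R) `^ (p - 1) - c `^ (p - 1) =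
    ((p - 1) * c' `^ (p - 1 - 1)) * (n.+2%:R - c).
  have c0 : 0 < c by apply: le_lt_trans c1.
  apply: (@MVT _ (fun y => y `^ (p - 1)) (fun c => (p - 1) * c `^ (p - 1 - 1))) => //.
  - by move=> y; rewrite in_itv/= => /andP[y0 _]; apply: is_derive1_powR; exact: lt_trans y0.
  - apply: derivable_within_continuous => y; rewrite in_itv/= => /andP[y0 _].
    by have [] := is_derive1_powR (p - 1) (lt_le_trans c0 y0).
rewrite in_itv/= => /andP[c'1 c'2] h; rewrite mulr1 -mulrBr h.
have c'p : 0 <= c' `^ (p - 1 - 1) <= 1.
  rewrite powR_ge0/= -[leRHS](powRr0 c'); apply: ler_powR; last by case/andP: p12; lra.
  by apply: le_trans (ltW c'1); apply: le_trans (ltW c1); rewrite ler1n.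
have nc : 0 <= n.+2%:R - c <= 1.
  have e : n.+2%:R = n.+1%:R + 1 :> R by rewrite natr1.
  by move: c1 c2; rewrite e; lra.
have pp : 0 <= p - 1 <= 1 by case/andP: p12; lra.
apply/andP; split.
  case/andP: c'p => ? _; case/andP: nc => ? _; case/andP: pp => ? _.
  by rewrite !mulr_ge0// ltW.
rewrite ger_pMr//; case/andP: c'p => ? ?; case/andP: nc => ? ?; case/andP: pp => ? ?.
by rewrite mulr_ile1// ?mulr_ge0// mulr_ile1.
Qed.

Lemma frac_kernel_le m : frac_kernel m <= 2.
Proof.
case: m => [|m]; first by rewrite /= ler1n.
elim: m => [|m IH]; last exact: le_trans (frac_kernel_decr m) IH.
rewrite /= powR0 ?gt_eqF// !add0r powR1.
have : (2 : R) `^ p <= 2 `^ 2%:R by case/andP: p12 => _ p2; apply: ler_powR; [rewrite ler1n|exact: ltW].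
rewrite powR_mulrn// -natrX => h.
by rewrite [1 + 1](_ : _ = 2) //; move: h; set w := _ `^ p; lra.
Qed.

End kernel.

(** * The discrete energy estimate for abstract bilinear forms *)

Lemma sum_decrements {R : zmodType} (u : nat -> R) n : \sum_(j < n) (u j - u j.+1) = u 0%N - u n.
Proof.
by elim: n => [|n IH]; [rewrite big_ord0 subrr|rewrite big_ord_recr/= IH addrA subrK].
Qed.

Lemma scaler_regroup {R : pzRingType} {V : lmodType R} (b c e : R) (A T Y : V) :
  (A + c *: T) + e *: Y = (e - b) *: Y + (A + (b - c) *: Y) + c *: (T + Y).
Proof.
have E : (e - b) + (b - c) = e - c by rewrite addrA subrK.
by rewrite scalerDr (addrCA ((e - b) *: Y)) -scalerDl E [RHS]addrACA -scalerDl subrK.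
Qed.

Section bilinear_energy.
Context {R : realType} {V : lmodType R} (a : V -> V -> R).
Hypothesis a_lin : forall (s : R) u v w, a (s *: u + v) w = s * a u w + a v w.
Hypothesis a_sym : forall u v, a u v = a v u.
Hypothesis a_ge0 : forall u, 0 <= a u u.

Lemma bilform0l w : a 0 w = 0.
Proof. by have := a_lin 1 0 0 w; rewrite scale1r addr0 mul1r => h; lra. Qed.

Lemma bilformDl u v w : a (u + v) w = a u w + a v w.
Proof. by have := a_lin 1 u v w; rewrite scale1r mul1r. Qed.

Lemma bilformZl s u w : a (s *: u) w = s * a u w.
Proof. by have := a_lin s u 0 w; rewrite addr0 bilform0l addr0. Qed.

Lemma bilformDr u v w : a w (u + v) = a w u + a w v.
Proof. by rewrite a_sym bilformDl !(a_sym w). Qed.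

Lemma bilformZr s u w : a w (s *: u) = s * a w u.
Proof. by rewrite a_sym bilformZl (a_sym w). Qed.

Lemma bilformBl u v w : a (u - v) w = a u w - a v w.
Proof. by rewrite bilformDl -scaleN1r bilformZl mulN1r. Qed.

Lemma bilform_suml I (r : seq I) (Q : pred I) (u : I -> V) w :
  a (\sum_(i <- r | Q i) u i) w = \sum_(i <- r | Q i) a (u i) w.
Proof. by elim/big_rec2 : _ => [|i x y _ <-]; [exact: bilform0l|exact: bilformDl]. Qed.

Lemma bilform_sqrD_le u v : a (u + v) (u + v) <= 2 * (a u u + a v v).
Proof.
have := a_ge0 (u + (-1) *: v).
by rewrite !bilformDl !bilformZl !bilformDr !bilformZr (a_sym v u); lra.
Qed.

Lemma bilform_young (e s : R) u v : 0 < e ->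
  - (e / 4 * a v v + s ^+ 2 / e * a u u) <= s * a u v.
Proof.
move=> e0; have := a_ge0 (s *: u + (e / 2) *: v).
rewrite !bilformDl !bilformZl !bilformDr !bilformZr (a_sym v u) => h.
rewrite -subr_ge0 -(pmulr_rge0 _ e0); apply: le_trans h _.
rewrite le_eqVlt; apply/orP; left; apply/eqP; field.
by rewrite gt_eqF.
Qed.

Variables (t : nat -> R) (Y : nat -> V).
Hypothesis t_ge0 : forall j, 0 <= t j.
Hypothesis t_decr : forall j, t j.+1 <= t j.
Hypothesis t_convex : forall j, t j.+1 - t j.+2 <= t j - t j.+1.

(* The sum of the last j terms of Y_0, ..., Y_(n-1). *)
Fixpoint tail_sum n j : V :=
  match n, j with
  | n'.+1, j'.+1 => tail_sum n' j' + Y n'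
  | _, _ => 0
  end.

(** The weights are those of the summation by parts [sum_by_parts]: decrements of [t], nonnegative
    because [t] decreases, applied to the squares of the tail sums. *)
Definition history_energy n : R :=
  \sum_(j < n) (t j - t j.+1) * a (tail_sum n j.+1) (tail_sum n j.+1) +
  t n * a (tail_sum n n) (tail_sum n n).

Lemma history_energy_ge0 n : 0 <= history_energy n.
Proof.
by apply: addr_ge0; rewrite ?mulr_ge0// sumr_ge0// => j _; rewrite mulr_ge0// subr_ge0.
Qed.

Lemma sum_by_parts (s : nat -> R) n :
  \sum_(i < n.+1) s (n - i)%N *: Y i =
  \sum_(j < n.+1) (s j - s j.+1) *: tail_sum n.+1 j.+1 + s n.+1 *: tail_sum n.+1 n.+1.
Proof.
elim: n s => [|n IH] s.
  by rewrite !big_ord_recl !big_ord0/= !addr0 add0r -scalerDl subrK.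
rewrite big_ord_recr/= subnn.
have -> : \sum_(i < n.+1) s (n.+1 - i)%N *: Y i =
    \sum_(i < n.+1) (s \o S) (n - i)%N *: Y i.
  by apply: eq_bigr => i _; rewrite /= subSn// -ltnS.
rewrite IH [in RHS]big_ord_recl.
have -> : \sum_(i < n.+1) (s (lift ord0 i) - s (lift ord0 i).+1) *: tail_sum n.+2 (lift ord0 i).+1 =
    \sum_(j < n.+1) (s j.+1 - s j.+2) *: tail_sum n.+1 j.+1 + (s 1%N - s n.+2) *: Y n.+1.
  rewrite (_ : s 1%N - s n.+2 = \sum_(j < n.+1) (s j.+1 - s j.+2)); last first.
    by rewrite (sum_decrements (s \o S)).
  by rewrite scaler_suml -big_split/=; apply: eq_bigr => j _; rewrite -scalerDr.
rewrite /= add0r.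
exact: scaler_regroup.
Qed.

(* 2 a(s, y) = |s|^2 + |y|^2 - |s - y|^2 with s - y the previous tail sum. *)
Lemma history_energy_step n :
  history_energy n.+1 - history_energy n + t 0%N * a (Y n) (Y n) <=
  2 * a (\sum_(i < n.+1) t (n - i)%N *: Y i) (Y n).
Proof.
set S := tail_sum; pose q j := a (S n j) (S n j).
have q0 j : 0 <= q j by exact: a_ge0.
have q00 : q 0%N = 0 by rewrite /q /S; case: (n) => [|m] /=; exact: bilform0l.
have e j : 2 * a (S n.+1 j.+1) (Y n) = a (S n.+1 j.+1) (S n.+1 j.+1) + a (Y n) (Y n) - q j.
  by rewrite /q /S /= -/S !bilformDl !bilformDr (a_sym (Y n) (S n j)); ring.
have -> : 2 * a (\sum_(i < n.+1) t (n - i)%N *: Y i) (Y n) =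
    history_energy n.+1 + t 0%N * a (Y n) (Y n) -
    (\sum_(j < n.+1) (t j - t j.+1) * q j + t n.+1 * q n).
  rewrite sum_by_parts bilformDl bilform_suml mulrDr mulr_sumr bilformZl.
  have -> : \sum_(j < n.+1) 2 * a ((t j - t j.+1) *: tail_sum n.+1 j.+1) (Y n) =
      \sum_(j < n.+1) (t j - t j.+1) * a (S n.+1 j.+1) (S n.+1 j.+1) +
      (t 0%N - t n.+1) * a (Y n) (Y n) - \sum_(j < n.+1) (t j - t j.+1) * q j.
    rewrite -(sum_decrements t) mulr_suml -big_split/= -sumrB; apply: eq_bigr => j _.
    by rewrite bilformZl mulrCA e; ring.
  by rewrite mulrCA -/S e /history_energy -/S; ring.
rewrite [X in _ <= X](_ : _ = history_energy n.+1 - (\sum_(j < n.+1) (t j - t j.+1) * q j + t n.+1 * q n)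
  + t 0%N * a (Y n) (Y n)); last by ring.
(* The empty tail contributes nothing, which shifts the index of the decrements by one against
   [history_energy n]; convexity of [t] is exactly what this shift costs. *)
rewrite lerD2r lerD2l lerN2 /history_energy -/S big_ord_recl q00 mulr0 add0r.
apply: lerD; last by rewrite ler_wpM2r.
by apply: ler_sum => j _; apply: ler_wpM2r; [exact: q0|exact: t_convex].
Qed.

End bilinear_energy.

Section discrete_energy.
Context {R : realType} {V : lmodType R} (a m : V -> V -> R).
Hypothesis a_lin : forall (s : R) u v w, a (s *: u + v) w = s * a u w + a v w.
Hypothesis a_sym : forall u v, a u v = a v u.
Hypothesis a_ge0 : forall u, 0 <= a u u.
Hypothesis m_lin : forall (s : R) u v w, m (s *: u + v) w = s * m u w + m v w.
Hypothesis m_sym : forall u v, m u v = m v u.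
Hypothesis m_ge0 : forall u, 0 <= m u u.
Variables (p : R) (N : nat) (tmax rho c rmax : R).
Hypothesis p12 : 1 < p < 2.
Hypothesis N0 : (0 < N)%N.
Hypothesis tmax0 : 0 < tmax.
Hypothesis rho0 : 0 < rho.
Hypothesis c0 : 0 <= c.
Variables (r g : nat -> R) (F : nat -> V -> R) (W : nat -> V).
Hypothesis r_le : forall n, `|r n| <= rmax.
Hypothesis g0 : forall n, 0 <= g n.
(** The loads enter through their dual norm with respect to the mass form only; later [g n] contains
    the 1/h of the trace inequality. *)
Hypothesis F_le : forall n v, (n <= N)%N -> F n v ^+ 2 <= g n * m v v.
Let dt := tmax / N%:R.
Let Y n := W n.+1 + W n.
Let beta := frac_kernel p.
Hypothesis W_eq : forall n v, (n < N)%N ->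
  rho / dt * m (W n.+1 - W n) v +
  c / 2 * a (\sum_(i < n.+1) beta (n - i)%N *: Y i + r n *: W 0%N) v = (F n.+1 v + F n v) / 2.

Let dt0 : 0 < dt. Proof. by rewrite divr_gt0// ltr0n. Qed.

(* The kernel made convex at the origin. *)
Let t j := if j is j'.+1 then beta j else 2 * beta 1%N - beta 2.
Let kappa := 2 - t 0%N.

Let kappa0 : 0 < kappa.
Proof. by have := frac_kernel_defect p12; rewrite /kappa /t /beta; lra. Qed.

Let t_ge0 j : 0 <= t j.
Proof.
case: j => [|j]; last exact: frac_kernel_ge0.
have := frac_kernel_ge0 p12 1; have := frac_kernel_decr p12 0; rewrite /t /beta; lra.
Qed.

Let t_decr j : t j.+1 <= t j.
Proof. by case: j => [|j]; have := frac_kernel_decr p12; [move=> /(_ 0%N)|move=> /(_ j)]; rewrite /t /beta; lra. Qed.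

Let t_convex j : t j.+1 - t j.+2 <= t j - t j.+1.
Proof.
case: j => [|j]; first by rewrite /t /beta; lra.
exact: frac_kernel_convex.
Qed.

Let Phi := history_energy a t Y.

(** Replacing beta_0 = 1 by t_0 leaves 2 (1 - t_0) a(Y_n, Y_n), and [history_energy_step] returns
    t_0 a(Y_n, Y_n); together they give [kappa]. *)
Let conv_ge n : Phi n.+1 - Phi n + kappa * a (Y n) (Y n) <=
  2 * a (\sum_(i < n.+1) beta (n - i)%N *: Y i) (Y n).
Proof.
have := history_energy_step a_lin a_sym a_ge0 Y t_decr t_convex n.
have -> : \sum_(i < n.+1) beta (n - i)%N *: Y i =
    (1 - t 0%N) *: Y n + \sum_(i < n.+1) t (n - i)%N *: Y i.
  rewrite !big_ord_recr/= subnn addrCA -scalerDl subrK; congr (_ + _).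
  apply: eq_bigr => i _; congr (_ *: _); rewrite /t.
  by move: (ltn_ord i); rewrite -subn_gt0; case: (n - i)%N.
rewrite a_lin /Phi /kappa; lra.
Qed.

Let step n : (n < N)%N ->
  rho * m (W n.+1) (W n.+1) + c * dt / 4 * Phi n.+1 + c * dt * kappa / 8 * a (Y n) (Y n) <=
  rho * m (W n) (W n) + c * dt / 4 * Phi n + c * dt * (rmax ^+ 2 / kappa * a (W 0%N) (W 0%N)) / 2
  + dt / 2 * (F n.+1 (Y n) + F n (Y n)).
Proof.
move=> nN; have eW := W_eq (Y n) nN.
have eM : m (W n.+1 - W n) (Y n) = m (W n.+1) (W n.+1) - m (W n) (W n).
  by rewrite (bilformBl m_lin) !(bilformDr m_lin m_sym) (m_sym (W n) (W n.+1)); ring.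
rewrite eM (bilformDl a_lin) (bilformZl a_lin) in eW.
(* After multiplication by dt the diagonal term is c dt kappa / 4. Young's inequality spends half of
   it on the contribution of W^0, and c dt kappa / 8 remains. *)
have h1 := conv_ge n; have h2 := bilform_young a_lin a_sym a_ge0 (r n) (W 0%N) (Y n) kappa0.
have h3 : r n ^+ 2 / kappa * a (W 0%N) (W 0%N) <= rmax ^+ 2 / kappa * a (W 0%N) (W 0%N).
  apply: ler_wpM2r => //; apply: ler_wpM2r; first by rewrite invr_ge0 ltW.
  by rewrite -[r n ^+ 2]real_normK ?num_real// ler_sqr ?nnegrE// (le_trans _ (r_le n)).
have real (A B d P1 P0 Q y w k f e x z : R) : 0 < d -> 0 <= e ->
    rho / d * (A - B) + e / 2 * (Q + x) = f / 2 ->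
    P1 - P0 + k * y <= 2 * Q -> - (k / 4 * y + z) <= x -> z <= w ->
    rho * A + e * d / 4 * P1 + e * d * k / 8 * y <=
    rho * B + e * d / 4 * P0 + e * d * w / 2 + d / 2 * f.
  move=> d0 e0 E H1 H2 H3.
  have E' : d / 2 * f = rho * (A - B) + d * e / 2 * (Q + x).
    rewrite (_ : d / 2 * f = d * (f / 2)); last by ring.
    by rewrite -E; field; rewrite gt_eqF.
  have : 0 <= (e * d) * (2 * Q - (P1 - P0 + k * y)) by rewrite mulr_ge0 ?mulr_ge0 ?subr_ge0// ltW.
  have : 0 <= (e * d) * (x + (k / 4 * y + w)).
    by rewrite mulr_ge0 ?mulr_ge0//; [exact: ltW|lra].
  by rewrite E'; lra.
exact: (real _ _ _ _ _ _ _ _ _ _ _ _ _ dt0 c0 eW h1 h2 h3).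
Qed.

Let w := rmax ^+ 2 / kappa * a (W 0%N) (W 0%N).
Let w0 : 0 <= w.
Proof. by rewrite mulr_ge0// divr_ge0 ?sqr_ge0// ltW. Qed.

Let steps n : (n <= N)%N ->
  rho * m (W n) (W n) + c * dt * kappa / 8 * \sum_(i < n) a (Y i) (Y i) <=
  rho * m (W 0%N) (W 0%N) + c * tmax * w / 2
  + dt / 2 * \sum_(i < n) (F i.+1 (Y i) + F i (Y i)).
Proof.
move=> nN.
have h : rho * m (W n) (W n) + c * dt / 4 * Phi n + c * dt * kappa / 8 * \sum_(i < n) a (Y i) (Y i) <=
    rho * m (W 0%N) (W 0%N) + n%:R * (c * dt * w / 2)
    + dt / 2 * \sum_(i < n) (F i.+1 (Y i) + F i (Y i)).
  elim: n nN => [|n IH] nN.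
    rewrite !big_ord0 !mulr0 mul0r !addr0 /Phi /history_energy big_ord0 add0r.
    by rewrite (bilform0l a_lin) !mulr0 addr0.
  have real (A P0 q S1 B k u h T1 A' P1 y f : R) : A + P0 + q * S1 <= B + k * u + h * T1 ->
      A' + P1 + q * y <= A + P0 + u + h * f ->
      A' + P1 + q * (S1 + y) <= B + (k + 1) * u + h * (T1 + f) by move=> *; lra.
  rewrite !big_ord_recr/= (_ : n.+1%:R = n%:R + 1 :> R); last by rewrite natr1.
  exact: real (IH (ltnW nN)) (step nN).
have h1 : 0 <= c * dt / 4 * Phi n.
  by rewrite mulr_ge0 ?history_energy_ge0// mulr_ge0 ?mulr_ge0 ?invr_ge0// ltW.
have h2 : n%:R * (c * dt * w / 2) <= c * tmax * w / 2.
  rewrite (_ : n%:R * _ = (n%:R * dt) * (c * w / 2)); last by ring.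
  rewrite (_ : c * tmax * w / 2 = tmax * (c * w / 2)); last by ring.
  apply: ler_wpM2r; first by rewrite mulr_ge0// mulr_ge0.
  by rewrite /dt mulrCA ger_pMr// ler_pdivrMr ?ltr0n// mul1r ler_nat.
have real (A Q S1 B k k' T : R) : 0 <= Q -> k <= k' -> A + Q + S1 <= B + k + T ->
  A + S1 <= B + k' + T by move=> *; lra.
exact: real h1 h2 h.
Qed.

Let load_le S i j : 0 <= S -> (forall n, (n <= N)%N -> m (W n) (W n) <= S ^+ 2) ->
  (i <= N)%N -> (j < N)%N -> F i (Y j) <= 2 * S * Num.sqrt (g i).
Proof.
move=> S0 hS iN jN; rewrite leNgt; apply/negP => h.
have h1 : (2 * S * Num.sqrt (g i)) ^+ 2 < F i (Y j) ^+ 2.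
  have p1 : 0 <= 2 * S * Num.sqrt (g i) by rewrite !mulr_ge0.
  by rewrite ltr_sqr ?nnegrE//; exact: le_trans (ltW h).
have h2 := F_le (Y j) iN; have h3 := bilform_sqrD_le m_lin m_sym m_ge0 (W j.+1) (W j).
have h4 : g i * m (Y j) (Y j) <= g i * (4 * S ^+ 2).
  apply: ler_wpM2l => //; apply: le_trans h3 _.
  by have := hS _ jN; have := hS _ (ltnW jN); lra.
move: h1; rewrite !exprMn sqr_sqrtr// => h1.
have real (f y k z : R) : 2 ^+ 2 * z * k < f -> f <= k * y -> k * y <= k * (4 * z) -> False.
  by move=> *; lra.
exact: real h1 h2 h4.
Qed.

(** The load is linear in the largest norm S of the W^n, so it is absorbed at the index where S is
    attained: half of rho S^2 pays for it. The sum of the square roots of the g_n is treated by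
    Cauchy-Schwarz, and dt (N + 1) <= 2 tmax since N >= 1. The bound so found for S is then reused
    for the sum of energies. *)
Lemma discrete_energy_le : exists2 B,
  B = 2 * (rho * m (W 0%N) (W 0%N) + c * tmax * (rmax ^+ 2 / kappa * a (W 0%N) (W 0%N)) / 2)
      + 8 / rho * (tmax * (dt * \sum_(n < N.+1) g n)) &
  (forall n, (n <= N)%N -> rho * m (W n) (W n) <= B) /\
  c * dt * kappa / 8 * \sum_(n < N) a (Y n) (Y n) <= B.
Proof.
eexists; first reflexivity; rewrite -/w; set E0 := rho * _ + _; set G := tmax * _.
pose x n := m (W n) (W n).
have [n0 n0N hn0] : exists2 n0, (n0 <= N)%N & forall n, (n <= N)%N -> x n <= x n0.
  have := @arg_maxP _ _ 'I_N.+1 ord0 predT (fun i => x i) isT.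
  case=> i _ hi; exists i; first by rewrite -ltnS.
  by move=> n nN; have := hi (Ordinal (nN : (n < N.+1)%N)) isT.
pose S := Num.sqrt (x n0); have S0 : 0 <= S by exact: sqrtr_ge0.
have S2 : S ^+ 2 = x n0 by rewrite sqr_sqrtr// /x.
have hS n : (n <= N)%N -> m (W n) (W n) <= S ^+ 2 by move=> nN; rewrite S2; exact: hn0.
pose H := \sum_(i < N.+1) Num.sqrt (g i).
have H0 : 0 <= H by apply: sumr_ge0 => i _; exact: sqrtr_ge0.
have K2 : (dt * H) ^+ 2 <= 2 * G.
  rewrite exprMn.
  have h1 : H ^+ 2 <= N.+1%:R * \sum_(n < N.+1) g n.
    have := sum_cauchy_schwarz (fun _ : 'I_N.+1 => 1 : R) (fun i => Num.sqrt (g i)).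
    under eq_bigr do rewrite mul1r.
    under [X in _ <= X * _ -> _]eq_bigr do rewrite expr1n.
    under [X in _ <= _ * X -> _]eq_bigr do rewrite sqr_sqrtr//.
    by rewrite sumr_const card_ord.
  apply: le_trans (ler_wpM2l (sqr_ge0 _) h1) _.
  rewrite /G (_ : dt ^+ 2 * _ = (dt * N.+1%:R) * (dt * \sum_(n < N.+1) g n)); last by ring.
  rewrite [leRHS]mulrA; apply: ler_wpM2r; first by rewrite mulr_ge0 ?sumr_ge0// ltW.
  rewrite /dt mulrAC ler_pdivrMr ?ltr0n// mulrAC [leRHS]mulrC; apply: ler_wpM2l; first exact: ltW.
  by rewrite -natrM ler_nat mulnC muln2 -addnn -addn1 leq_add2l.
have hF n : (n <= N)%N -> \sum_(i < n) (F i.+1 (Y i) + F i (Y i)) <= 4 * S * H.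
  move=> nN; rewrite big_split/=.
  have hs (A : 'I_N.+1 -> R) : (forall i, 0 <= A i) -> forall (f : 'I_n -> 'I_N.+1), injective f ->
      \sum_(i < n) A (f i) <= \sum_i A i.
    move=> A0 f If; rewrite -(big_imset (h := f) A)/=; last by move=> i j _ _; exact: If.
    by rewrite [leRHS](bigID (mem (f @: 'I_n)))/= lerDl sumr_ge0.
  have s0 (i : 'I_N.+1) : 0 <= Num.sqrt (g i) by exact: sqrtr_ge0.
  have h1 : \sum_(i < n) F i.+1 (Y i) <= 2 * S * H.
    apply: (@le_trans _ _ (\sum_(i < n) 2 * S * Num.sqrt (g i.+1))).
      apply: ler_sum => i _; apply: load_le => //; exact: leq_trans (ltn_ord i) nN.
    rewrite -mulr_sumr ler_wpM2l ?mulr_ge0//.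
    have lt (i : 'I_n) : (i.+1 < N.+1)%N by rewrite ltnS (leq_trans (ltn_ord i)).
    by apply: (hs _ s0 (fun i => Ordinal (lt i))) => i j /(congr1 val)/= [] /val_inj.
  have h2 : \sum_(i < n) F i (Y i) <= 2 * S * H.
    apply: (@le_trans _ _ (\sum_(i < n) 2 * S * Num.sqrt (g i))).
      apply: ler_sum => i _; have iN := leq_trans (ltn_ord i) nN.
      by apply: load_le => //; exact: ltnW.
    rewrite -mulr_sumr ler_wpM2l ?mulr_ge0//.
    have lt (i : 'I_n) : (i < N.+1)%N by rewrite ltnS (leq_trans (ltnW (ltn_ord i))).
    by apply: (hs _ s0 (fun i => Ordinal (lt i))) => i j /(congr1 val)/= /val_inj.
  by rewrite (_ : 4 * S * H = 2 * S * H + 2 * S * H); [exact: lerD|ring].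
have main n : (n <= N)%N ->
    rho * x n + c * dt * kappa / 8 * \sum_(i < n) a (Y i) (Y i) <= E0 + 2 * S * (dt * H).
  move=> nN; apply: le_trans (steps nN) _; rewrite lerD2l.
  apply: le_trans (ler_wpM2l _ (hF n nN)) _; first by rewrite divr_ge0// ltW.
  by rewrite le_eqVlt; apply/orP; left; apply/eqP; field.
have sY n : 0 <= c * dt * kappa / 8 * \sum_(i < n) a (Y i) (Y i).
  apply: mulr_ge0; last by apply: sumr_ge0.
  by rewrite !mulr_ge0// ltW.
have young : 2 * S * (dt * H) <= rho / 2 * S ^+ 2 + 4 / rho * G.
  have : 0 <= (rho * S - 2 * (dt * H)) ^+ 2 by exact: sqr_ge0.
  have e : rho / 2 * S ^+ 2 + 4 / rho * G = (rho ^+ 2 * S ^+ 2 + 8 * G) / (2 * rho).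
    by field; rewrite gt_eqF.
  have real (K U u s : R) : K ^+ 2 <= 2 * U -> 0 <= (u * s - 2 * K) ^+ 2 ->
      2 * s * K * (2 * u) <= u ^+ 2 * s ^+ 2 + 8 * U by move=> *; nra.
  by rewrite e ler_pdivlMr ?mulr_gt0//; exact: real.
have h0 : rho * S ^+ 2 <= 2 * E0 + 8 / rho * G.
  have real (u v s e y q : R) : u * v + s <= e + y -> 0 <= s -> y <= u / 2 * v + q ->
    u * v <= 2 * e + 2 * q by move=> *; lra.
  have := main n0 n0N; rewrite -S2 (_ : 8 / rho * G = 2 * (4 / rho * G)); last by ring.
  by move=> h; exact: real h (sY n0) young.
split=> [n nN|].
  by apply: le_trans h0; rewrite ler_pM2l//; exact: hS.
have := main N (leqnn N).
have xN : 0 <= rho * x N by rewrite mulr_ge0 ?m_ge0// ltW.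
move: young h0 xN; rewrite (_ : 8 / rho * G = 2 * (4 / rho * G)); last by ring.
move: (4 / rho * G) (\sum_(i < N) _) => *; lra.
Qed.

End discrete_energy.

(** * Inverse inequalities for polynomials *)

Lemma finite_roots (R : idomainType) (p : {poly R}) : p != 0 -> finite_set [set x | root p x].
Proof.
move=> p0; apply: contrapT => /(infinite_set_fset (size p))[B hB sB].
have : (size (finmap.enum_fset B) < size p)%N.
  by apply: max_poly_roots p0 _ (finmap.fset_uniq B); apply/allP => x /hB.
by rewrite ltnNge sB.
Qed.

Section polynomial_inverse.
Context {R : realType}.
Local Notation mu := (@lebesgue_measure R).
Local Notation I := (`[-1, 1]%classic : set R).

Let continuous_horner (p : {poly R}) : continuous (fun s : R => p.[s]).
Proof.
have -> : (fun s : R => p.[s]) = (fun s => \sum_(i < size p) p`_i * s ^+ i).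
  by apply/funext => s; rewrite horner_coef.
apply: continuous_sumr => i; apply: continuous_mulr; first exact: cst_continuous.
exact: exprn_continuous.
Qed.

Let poly_integrable (p : {poly R}) : mu.-integrable I (EFin \o (fun s : R => p.[s])).
Proof.
apply: continuous_compact_integrable; first exact: segment_compact.
exact/continuous_subspaceT/continuous_horner.
Qed.

Let poly_sqr_integrable (p : {poly R}) :
  mu.-integrable I (EFin \o (fun s : R => p.[s] ^+ 2)).
Proof.
rewrite (_ : (fun s => _) = (fun s => (p ^+ 2).[s])); first exact: poly_integrable.
by apply/funext => s; rewrite horner_exp.
Qed.

Let monomial_integrable (c : R) n : mu.-integrable I (EFin \o (fun s : R => c * s ^+ n)).
Proof.
rewrite (_ : (fun s => _) = (fun s => (c *: 'X^n).[s])); first exact: poly_integrable.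
by apply/funext => s; rewrite hornerZ hornerXn.
Qed.

(** Otherwise p would vanish almost everywhere on [-1, 1], and this interval would be null up to
    finitely many roots. *)
Lemma poly_sqr_integral_gt0 (p : {poly R}) : p != 0 -> 0 < \int[mu]_(s in I) (p.[s] ^+ 2).
Proof.
move=> p0; rewrite lt_neqAle Rintegral_ge0 ?andbT; last by move=> s _; exact: sqr_ge0.
apply/eqP => h.
have mI : measurable I by [].
have int2 := poly_sqr_integrable p.
have mf : measurable_fun I (EFin \o (fun s : R => p.[s] ^+ 2)) by exact: measurable_int int2.
have h0 : (\int[mu]_(s in I) `|(EFin \o (fun s : R => (p.[s] ^+ 2)%R)) s| = 0)%E.
  rewrite -[RHS]/(0%:E) [in RHS]h /Rintegral fineK; last exact: integrable_fin_num.
  by apply: eq_integral => s _; rewrite gee0_abs// lee_fin sqr_ge0.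
have [N [mN N0 hN]] := (ae_eq_integral_abs mu mI mf).1 h0.
have Z0 : mu [set x | root p x] = 0%E.
  by apply: countable_lebesgue_measure0; apply: finite_set_countable; exact: finite_roots.
have mZ : measurable ([set x | root p x] : set R).
  by apply: countable_measurable; [|apply: finite_set_countable; exact: finite_roots].
have : (mu I <= mu (N `|` [set x | root p x]))%E.
  apply: le_measure; rewrite ?inE//; first exact: measurableU.
  move=> s sI; have [ps|ps] := boolP (root p s); [by right|left; apply: hN => /= hs].
  by have /eqP := hs sI; rewrite eqe sqrf_eq0 -rootE (negbTE ps).
have e11 : (-1 : R) < 1 by lra.
rewrite lebesgue_measure_itv/= lte_fin e11 => h1.
have h2 : (mu (N `|` [set x | root p x]) <= mu N + mu [set x | root p x])%E := measureU2 mu mN mZ.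
rewrite N0 Z0 adde0 in h2; have := le_trans h1 h2; rewrite -EFinD lee_fin.
by rewrite opprK; lra.
Qed.

(** Equivalence of norms in bounded degree: the square integral is a positive form in the
    coefficients, hence coercive, and a value at t is linear in them. An arbitrary [rho] admits
    points outside [-1, 1], as a whole element has to be reached from a small cube inside it. *)
Lemma poly_sup_le_unit k (rho : R) : exists2 C, 0 < C & forall p : {poly R}, (size p <= k.+1)%N ->
  forall t : R, `|t| <= rho -> p.[t] ^+ 2 <= C * \int[mu]_(s in I) (p.[s] ^+ 2).
Proof.
pose P (v : 'rV[R]_k.+1) := \sum_(i < k.+1) v ord0 i *: 'X^i.
have PE v s : (P v).[s] = \sum_(i < k.+1) v ord0 i * s ^+ i.
  by rewrite horner_sum; apply: eq_bigr => i _; rewrite hornerE hornerXn.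
pose q v := \int[mu]_(s in I) ((P v).[s] ^+ 2).
pose G (i j : 'I_k.+1) := \int[mu]_(s in I) (s ^+ (i + j)).
have qE v : q v = \sum_i \sum_j v ord0 i * v ord0 j * G i j.
  have mI : measurable I by [].
  have im1 n : mu.-integrable I (EFin \o (fun s : R => s ^+ n)).
    rewrite (_ : (fun s => _) = (fun s => 1 * s ^+ n)); first exact: monomial_integrable.
    by apply/funext => s; rewrite mul1r.
  transitivity (\int[mu]_(s in I) (\sum_i \sum_j (v ord0 i * v ord0 j) * s ^+ (i + j))).
    apply: eq_Rintegral => s _; rewrite PE expr2 mulr_suml; apply: eq_bigr => i _.
    by rewrite mulr_sumr; apply: eq_bigr => j _; rewrite exprD; ring.
  transitivity (\sum_i \int[mu]_(s in I) (\sum_j (v ord0 i * v ord0 j) * s ^+ (i + j))).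
    have im i : mu.-integrable I (EFin \o (fun s : R => \sum_j (v ord0 i * v ord0 j) * s ^+ (i + j))).
      exact: (@integrable_sumr _ _ _ mu I mI _ (index_enum _) (fun (j : 'I_k.+1) (s : R) =>
        (v ord0 i * v ord0 j) * s ^+ (i + j)) (fun j => monomial_integrable _ _)).
    exact: (@Rintegral_sumr _ _ _ mu I mI _ (index_enum _) (fun (i : 'I_k.+1) (s : R) =>
      \sum_j (v ord0 i * v ord0 j) * s ^+ (i + j)) im).
  apply: eq_bigr => i _.
  transitivity (\sum_j \int[mu]_(s in I) ((v ord0 i * v ord0 j) * s ^+ (i + j))).
    exact: (@Rintegral_sumr _ _ _ mu I mI _ (index_enum _) (fun (j : 'I_k.+1) (s : R) =>
      (v ord0 i * v ord0 j) * s ^+ (i + j)) (fun j => monomial_integrable _ _)).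
  by apply: eq_bigr => j _; rewrite RintegralZl.
have cq : continuous q.
  rewrite (_ : q = fun v => \sum_i \sum_j v ord0 i * v ord0 j * G i j); last exact/funext/qE.
  apply: continuous_sumr => i; apply: continuous_sumr => j; apply: continuous_mulr.
    by apply: continuous_mulr; exact: coord_continuous.
  exact: cst_continuous.
have qZ a v : q (a *: v) = a ^+ 2 * q v.
  rewrite !qE mulr_sumr; apply: eq_bigr => i _; rewrite mulr_sumr; apply: eq_bigr => j _.
  by rewrite !mxE; ring.
have qp v : v != 0 -> 0 < q v.
  move=> v0; apply: poly_sqr_integral_gt0; apply: contra v0 => /eqP Pv; apply/eqP/rowP => i.
  have := congr1 (fun p : {poly R} => p`_i) Pv; rewrite coef0 mxE coef_sum (bigD1 i)//= coefZ coefXn eqxx mulr1.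
  rewrite big1 ?addr0// => j ji; rewrite coefZ coefXn.
  by rewrite (_ : (i : nat) == j = false) ?mulr0//; apply/negbTE; rewrite eq_sym.
have [c c0 hc] := quadratic_coercive cq qZ qp.
pose M := \sum_(i < k.+1) (`|rho| ^+ i) ^+ 2.
have M0 : 0 < M.
  rewrite /M big_ord_recl expr0 expr1n ltr_pwDl// sumr_ge0// => i _; exact: sqr_ge0.
exists (M / c) => [|p sp t tr]; first by rewrite divr_gt0.
pose v := \row_(i < k.+1) p`_i.
have Pv : P v = p.
  apply/polyP => i; rewrite coef_sum; have [ik|ik] := ltnP i k.+1.
    rewrite (bigD1 (Ordinal ik))//= coefZ coefXn eqxx mulr1 mxE big1 ?addr0// => j ji.
    rewrite coefZ coefXn (_ : i == j = false) ?mulr0//; apply/negbTE.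
    by apply: contra ji => /eqP e; apply/eqP/val_inj.
  rewrite nth_default ?(leq_trans sp)// big1// => j _; rewrite coefZ coefXn.
  by rewrite gtn_eqF ?mulr0// (leq_trans (ltn_ord j)).
have h1 : p.[t] ^+ 2 <= dotv v v * M.
  rewrite -[in leLHS]Pv PE; apply: le_trans (sum_cauchy_schwarz _ _) _.
  rewrite (_ : dotv v v = \sum_i v ord0 i ^+ 2); last by apply: eq_bigr => i _; rewrite expr2.
  apply: ler_wpM2l; first by apply: sumr_ge0 => i _; exact: sqr_ge0.
  apply: ler_sum => i _; rewrite -[t ^+ i ^+ 2]real_normK ?num_real// ler_sqr ?nnegrE ?exprn_ge0//.
  rewrite normrX lerXn2r ?nnegrE//; exact: le_trans tr (ler_norm _).
apply: le_trans h1 _; have := hc v; rewrite /q Pv => h2.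
by rewrite mulrC -mulrA ler_pM2l// mulrC ler_pdivlMr// mulrC.
Qed.

(** Rescaling to [a - r, a + r]: composition with an affine polynomial does not raise the degree,
    and the change of variable gives 1/r. *)
Lemma poly_sup_le k (rho : R) : exists2 C, 0 < C & forall p : {poly R}, (size p <= k.+1)%N ->
  forall a r t : R, 0 < r -> `|t - a| <= rho * r ->
  ((p.[t] ^+ 2)%:E <= (C / r)%:E * \int[mu]_(s in `[(a - r)%R, (a + r)%R]) (p.[s] ^+ 2)%:E)%E.
Proof.
have [C C0 hC] := poly_sup_le_unit k rho; exists C => // p sp a r t r0 tr.
pose q := p \Po (a%:P + r *: 'X).
have qE s : q.[s] = p.[r * s + a] by rewrite horner_comp !hornerE addrC.
have sq : (size q <= k.+1)%N.
  apply: leq_trans (size_comp_poly_leq _ _) _; rewrite ltnS.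
  have s2 : ((size (a%:P + r *: 'X)%R).-1 <= 1)%N.
    rewrite -subn1 leq_subLR; apply: leq_trans (size_polyD _ _) _; rewrite geq_max.
    rewrite (leq_trans (size_polyC_leq1 _))//=.
    by apply: leq_trans (size_scale_leq _ _) _; rewrite size_polyX.
  apply: (@leq_trans ((size p).-1 * 1)); first by rewrite leq_mul2l s2 orbT.
  by rewrite muln1 -subn1 leq_subLR.
have := hC q sq ((t - a) / r); rewrite qE (_ : r * ((t - a) / r) + a = t); last by field; rewrite gt_eqF.
rewrite normrM normfV (gtr0_norm r0) ler_pdivrMr// => /(_ tr) h.
apply: (@le_trans _ _ (C * \int[mu]_(s in I) (q.[s] ^+ 2))%:E); first by rewrite lee_fin.
have int2 := poly_sqr_integrable q.
rewrite EFinM /Rintegral fineK; last exact: integrable_fin_num.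
have -> : (\int[mu]_(s in `[(a - r)%R, (a + r)%R]) (p.[s] ^+ 2)%:E = r%:E * \int[mu]_(s in I) (q.[s] ^+ 2)%:E)%E.
  rewrite integral_mkcond (@ge0_integral_affine R r a r0); last 2 first.
  - apply: measurable_patch => //; apply/measurable_EFinP/measurable_funX.
    by apply: continuous_measurable_fun; exact: continuous_horner.
  - by move=> x; rewrite /patch; case: ifP => // _; rewrite lee_fin sqr_ge0.
  congr (_ * _)%E; rewrite [RHS]integral_mkcond; apply: eq_integral => s _.
  rewrite /patch qE; congr (if _ then _ else _).
  apply/idP/idP; rewrite !inE/= !in_itv/= => /andP[h1 h2]; apply/andP; split; nra.
by rewrite muleA -EFinM divfK ?gt_eqF.
Qed.

End polynomial_inverse.

Section coordinate_polynomials.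
Context {R : realType}.
Local Notation lam n := (@lebesgue_rV R n).

(* Polynomials of degree at most k in each coordinate, one coordinate at a time. *)
Fixpoint coord_poly (k n : nat) : ('rV[R]_n -> R) -> Prop :=
  match n with
  | 0%N => fun _ => True
  | n'.+1 => fun p =>
    (forall y : 'rV[R]_n', exists2 q : {poly R}, (size q <= k.+1)%N & forall t, p (rV_cons (t, y)) = q.[t]) /\
    forall t, coord_poly k (fun y : 'rV[R]_n' => p (rV_cons (t, y)))
  end.

Lemma sum_monomials_coord_poly (J : Type) (s : seq J) k n (c : J -> R) (e : J -> 'I_n -> nat) :
  (forall m i, (e m i <= k)%N) ->
  coord_poly k (fun x : 'rV[R]_n => \sum_(m <- s) c m * \prod_i x ord0 i ^+ e m i).
Proof.
elim: n c e => [//|n IH] c e ek /=; split.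
  move=> y; exists (\sum_(m <- s) (c m * \prod_i y ord0 i ^+ e m (lift ord0 i)) *: 'X^(e m ord0)).
    elim/big_rec : _ => [|m q _ hq]; first by rewrite size_poly0.
    apply: leq_trans (size_polyD _ _) _; rewrite geq_max hq andbT.
    by apply: leq_trans (size_scale_leq _ _) _; rewrite size_polyXn ltnS.
  move=> t; rewrite horner_sum; apply: eq_bigr => m _.
  rewrite hornerZ hornerXn big_ord_recl rV_cons0 mulrCA mulrC; congr (_ * _ * _).
  by apply: eq_bigr => i _; rewrite rV_consS.
move=> t.
have -> : (fun y : 'rV[R]_n => \sum_(m <- s) c m * \prod_i rV_cons (t, y) ord0 i ^+ e m i) =
    (fun y => \sum_(m <- s) (c m * t ^+ e m ord0) * \prod_i y ord0 i ^+ e m (lift ord0 i)).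
  apply/funext => y; apply: eq_bigr => m _.
  rewrite big_ord_recl rV_cons0 mulrA; congr (_ * _).
  by apply: eq_bigr => i _; rewrite rV_consS.
by apply: IH.
Qed.

Lemma is_polynomial_sum d k (p : 'rV[R]_d -> R) : is_polynomial k p ->
  exists (s : seq {ffun 'I_d -> 'I_k.+1}) c,
    p = fun x => \sum_(m <- s) c m * \prod_i x ord0 i ^+ m i.
Proof.
move=> [c hc]; exists [seq m : {ffun 'I_d -> 'I_k.+1} <- index_enum _ | (\sum_i m i <= k)%N], c.
by apply/funext => x; rewrite hc big_filter.
Qed.

Lemma is_polynomial_coord_poly d k (p : 'rV[R]_d -> R) : is_polynomial k p -> coord_poly k p.
Proof.
by move=> /is_polynomial_sum[s [c ->]]; apply: sum_monomials_coord_poly => m i; rewrite -ltnS.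
Qed.

Lemma is_polynomial_measurable d k (p : 'rV[R]_d -> R) : is_polynomial k p -> measurable_fun setT p.
Proof.
move=> /is_polynomial_sum[s [c ->]].
apply: measurable_sum => m; apply: measurable_funM; first exact: measurable_cst.
apply: measurable_prod => i _; apply: measurable_funX; exact: measurable_coord.
Qed.

Definition cube n (z : 'rV[R]_n) (r : R) := rV_box (z - const_mx r) (z + const_mx r).

Lemma cubeE n (z x : 'rV[R]_n) r : cube z r x <-> forall i, `|x ord0 i - z ord0 i| <= r.
Proof.
by split=> h i; have := h i; rewrite !mxE ler_distl.
Qed.

Lemma measurable_cube n (z : 'rV[R]_n) r : measurable (cube z r).
Proof. exact: measurable_rV_box. Qed.

(** Tensorization: the one-variable bound in the first coordinate, then the induction hypothesis
    under the integral sign. Each coordinate contributes one factor C / r. *)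
Lemma coord_poly_sup_le k (rho : R) : exists2 C, 0 < C & forall n (p : 'rV[R]_n -> R),
  measurable_fun setT p -> coord_poly k p -> forall z r x, 0 < r -> cube z (rho * r) x ->
  ((p x ^+ 2)%:E <= ((C / r) ^+ n)%:E * \int[lam n]_(y in cube z r) (p y ^+ 2)%:E)%E.
Proof.
have [C C0 hC] := poly_sup_le k rho; exists C => // n.
elim: n => [|n IH] p mp hp z r x r0 xz.
  rewrite expr0 mul1e integral_mkcond ge0_integral_rV0; last first.
    apply: measurable_patch; first exact: measurable_cube.
    by apply/measurable_EFinP; apply: measurable_funX.
  rewrite patchE mem_set; last by move=> -[].
  by rewrite (_ : x = 0)//; apply/rowP => -[].
have mp2 : measurable_fun setT (fun x => (p x ^+ 2)%:E).
  by apply/measurable_EFinP; apply: measurable_funX.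
have [hp1 hp2] := hp; pose x' := (rV_uncons x).2; pose t0 := (rV_uncons x).1.
pose z' := (rV_uncons z).2; pose s0 := (rV_uncons z).1.
have xE : x = rV_cons (t0, x') by rewrite -[LHS]rV_unconsK.
have xz' := (cubeE _ _ _).1 xz.
have [q sq hq] := hp1 x'.
have tz : `|t0 - s0| <= rho * r by have := xz' ord0.
have h1 := hC q sq s0 r t0 r0 tz; rewrite -hq -xE in h1.
apply: (le_trans h1); rewrite [(C / r) ^+ n.+1]exprS (EFinM (C / r)) -muleA; apply: lee_wpmul2l.
  by rewrite lee_fin divr_ge0// ltW.
have mc : measurable_fun setT (fun t : R => \int[lam n]_(y in cube z' r) (p (rV_cons (t, y)) ^+ 2)%:E)%E.
  apply: (@measurable_integral_snd _ _ _ _ _ (lam n) (cube z' r) (fun u => (p (rV_cons u) ^+ 2)%:E)).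
  - exact: measurable_cube.
  - by apply: (measurableT_comp mp2); exact: measurable_rV_cons.
  - by move=> u; rewrite lee_fin sqr_ge0.
have -> : (\int[lam n.+1]_(y in cube z r) (p y ^+ 2)%:E =
   \int[lebesgue_measure]_(t in `[(s0 - r)%R, (s0 + r)%R])
     \int[lam n]_(y in cube z' r) (p (rV_cons (t, y)) ^+ 2)%:E)%E.
  rewrite integral_mkcond ge0_integral_rVS; last 2 first.
  - by apply: measurable_patch => //; exact: measurable_cube.
  - by move=> y; rewrite /patch; case: ifP => // _; rewrite lee_fin sqr_ge0.
  rewrite [RHS]integral_mkcond; apply: eq_integral => t _; rewrite [in RHS]/patch.
  have cE y : (rV_cons (t, y) \in cube z r) = (t \in `[s0 - r, s0 + r]%classic) && (y \in cube z' r).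
    apply/idP/idP; rewrite !inE.
      move=> /cubeE h; apply/andP; rewrite !inE/= in_itv/= -ler_distl; split.
        by have := h ord0; rewrite rV_cons0.
      by apply/cubeE => i; have := h (lift ord0 i); rewrite rV_consS mxE.
    move=> /andP[/set_mem h /set_mem/cubeE h']; rewrite /= in_itv/= -ler_distl in h.
    apply/cubeE => i; case: (unliftP ord0 i) => [j ->|->]; last by rewrite rV_cons0.
    by have := h' j; rewrite rV_consS mxE.
  case: ifPn => tI.
    by rewrite [RHS]integral_mkcond; apply: eq_integral => y _; rewrite /patch cE tI.
  by rewrite -[RHS](integral0 (lam n) setT); apply: eq_integral => y _; rewrite /patch cE (negbTE tI).
rewrite -ge0_integralZl//; last 3 first.
- exact: measurable_funTS mc.
- by move=> t _; apply: integral_ge0 => y _; rewrite lee_fin sqr_ge0.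
- by rewrite lee_fin exprn_ge0// divr_ge0// ltW.
apply: ge0_le_integral => //.
- by move=> t _; rewrite lee_fin sqr_ge0.
- apply: measurable_funTS; under eq_fun do rewrite -hq.
  apply: (measurableT_comp mp2).
  exact: (measurableT_comp (@measurable_rV_cons R n) (@pair2_measurable _ _ _ _ x')).
- by apply: measurable_funTS; apply: measurable_funeM.
- move=> t _; rewrite -hq; apply: (IH (fun y => p (rV_cons (t, y)))) => //.
  + exact: (measurableT_comp mp (measurable_rV_cons_l t)).
  + exact: hp2.
  + by apply/cubeE => i; have := xz' (lift ord0 i); rewrite /x' /z' !mxE.
Qed.

End coordinate_polynomials.

(** * Simplices, meshes and the discrete trace inequality *)

Lemma enorm_coord_le (R : realType) d (x : 'rV[R]_d) i : `|x ord0 i| <= enorm x.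
Proof.
by rewrite -[leLHS]sqrtr_sqr /enorm ler_sqrt ?dotv_ge0// dotv_coord_le.
Qed.

Lemma enorm_le (R : realType) d (x : 'rV[R]_d) r : 0 <= r -> (forall i, `|x ord0 i| <= r) ->
  enorm x <= d%:R * r.
Proof.
move=> r0 xr; have dr0 : 0 <= d%:R * r by rewrite mulr_ge0.
rewrite -[leRHS]ger0_norm// -sqrtr_sqr /enorm ler_sqrt ?sqr_ge0//.
apply: (@le_trans _ _ (\sum_(i < d) r ^+ 2)).
  apply: ler_sum => i _; rewrite -expr2 -[x ord0 i ^+ 2]real_normK ?num_real//.
  by rewrite ler_sqr ?nnegrE.
rewrite sumr_const card_ord -[_ *+ d]mulr_natl exprMn ler_wpM2r ?sqr_ge0//.
by rewrite -natrX ler_nat; case: d {x xr dr0} => // n; rewrite leq_pmulr.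
Qed.

Section simplices.
Context {R : realType} {d : nat}.
Implicit Types K L : 'M[R]_(d.+1, d).

Lemma barycentric_unique K (c c' : 'rV[R]_d.+1) : Defs.nondegenerate K ->
  \sum_i c ord0 i = \sum_i c' ord0 i -> c *m K = c' *m K -> c = c'.
Proof.
move=> nK sc cK; apply: (row_free_inj nK); rewrite !mul_mx_row cK; congr row_mx.
by apply/matrixP => i j; rewrite !mxE; under eq_bigr do rewrite mxE mulr1;
  under [RHS]eq_bigr do rewrite mxE mulr1; rewrite !ord1.
Qed.

Lemma vertex_simplex K i : simplex K (row i K).
Proof.
exists (delta_mx ord0 i); split=> //; last by rewrite -rowE.
- by move=> j; rewrite mxE; case: (_ && _).
- by rewrite (bigD1 i)//= mxE !eqxx big1 ?addr0// => j ji; rewrite mxE (negbTE ji) andbF.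
Qed.

Lemma common_vertices_sub K L : (forall i, common_vertices K L i) -> simplex K `<=` simplex L.
Proof.
move=> KL x [c [c0 c1 _ ->]].
have h i : exists j, row i K = row j L by have /existsP[j /eqP e] := KL i; exists j.
pose f i := sval (cid (h i)); have hf i : row i K = row (f i) L := svalP (cid (h i)).
exists (\sum_i c ord0 i *: delta_mx ord0 (f i)); split=> //.
- by move=> j; rewrite summxE sumr_ge0// => i _; rewrite !mxE mulr_ge0 ?ler0n.
- under eq_bigr do rewrite summxE; rewrite exchange_big/= -[RHS]c1; apply: eq_bigr => i _.
  rewrite (bigD1 (f i))//= !mxE !eqxx mulr1 big1 ?addr0// => j ji.
  by rewrite !mxE (negbTE ji) andbF mulr0.
- rewrite mulmx_sum_row mulmx_suml; apply: eq_bigr => i _.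
  by rewrite -scalemxAl -rowE hf.
Qed.

(* If some vertex K_i were not common, moving from y towards K_i would leave the
   face opposite to K_i while staying in the ball. *)
Lemma overlapping_simplices K L y r : Defs.nondegenerate K -> 0 < r ->
  simplex K `&` simplex L = face K (common_vertices K L) ->
  (forall x, enorm (x - y) <= r -> (simplex K `&` simplex L) x) -> simplex K `<=` simplex L.
Proof.
move=> nK r0 KL hy; apply: common_vertices_sub => i; apply: contrapT => /negP ni.
have y0 : enorm (y - y) <= r by rewrite subrr /enorm /dotv big1 ?sqrtr0 ?ltW// => j _; rewrite mxE mul0r.
have : face K (common_vertices K L) y by rewrite -KL; exact: hy.
move=> [c [c0 c1 cn yE]].
pose v := row i K - y; pose e := Num.min 1 (r / (1 + enorm v)).
have ev : 0 < 1 + enorm v by rewrite ltr_wpDr// /enorm sqrtr_ge0.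
have e0 : 0 < e by rewrite lt_min ltr01 divr_gt0.
have : face K (common_vertices K L) (y + e *: v).
  rewrite -KL; apply: hy; rewrite addrAC subrr add0r.
  have -> : enorm (e *: v) = e * enorm v.
    rewrite /enorm dotvZZ sqrtrM ?sqr_ge0// sqrtr_sqr ger0_norm//; exact: ltW.
  have : e <= r / (1 + enorm v) by rewrite ge_min lexx orbT.
  rewrite ler_pdivlMr// mulrDr mulr1 => h; apply: le_trans h; rewrite lerDr; exact: ltW.
move=> [c' [_ c'1 c'n yE']].
have : c' = (1 - e) *: c + e *: delta_mx ord0 i.
  apply: (barycentric_unique nK).
    rewrite c'1; under [RHS]eq_bigr do rewrite !mxE eqxx/=.
    rewrite big_split/= -!mulr_sumr c1 (bigD1 i)//= eqxx big1 ?addr0 ?mulr1 ?subrK//.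
    by move=> j ji; rewrite (negbTE ji).
  rewrite -yE' mulmxDl -!scalemxAl -yE -rowE /v scalerBr scalerBl scale1r.
  by rewrite [RHS]addrAC -addrA.
move=> /matrixP /(_ ord0 i); rewrite !mxE (cn i ni) (c'n i ni) !eqxx mulr0 mulr1 add0r.
by move=> e0'; rewrite -e0' ltxx in e0.
Qed.

End simplices.

Lemma lebesgue_cube (R : realType) n (z : 'rV[R]_n) r : 0 <= r ->
  lebesgue_rV n (cube z r) = ((2 * r) ^+ n)%:E.
Proof.
move=> r0; rewrite lebesgue_rV_box => [|i]; last by rewrite !mxE lerD2l; lra.
congr EFin; rewrite (eq_bigr (fun=> 2 * r)) => [|i _]; last by rewrite !mxE; lra.
by rewrite prodr_const card_ord.
Qed.

Lemma nat_ceil (R : realType) (x : R) : 0 <= x -> exists2 m : nat, x <= m%:R & m%:R <= x + 1.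
Proof.
move=> x0; exists (Num.truncn x).+1; first by apply/ltW; rewrite -truncn_le_nat.
by rewrite -natr1 lerD2r truncn_le.
Qed.

Section discrete_trace.
Context {R : realType} {d : nat} (P : polytopic_domain R d).
Local Notation Om := (domain_set P).
Local Notation lam := (@lebesgue_rV R d).
Local Notation nu := (normal (p := P)).
Local Notation b := (offset (p := P)).

(* The unit prism over a set of diameter h is cut into about 1 / h prisms of height h. *)
Lemma surface_small_le (H h : R) (z : 'rV[R]_d) (S : set 'rV[R]_d) : measurable S ->
  0 < h -> h <= H -> S `<=` cube z h ->
  (surface P S <= ((nfacets P)%:R * ((1 + H) / h) * (4 * h) ^+ d)%:E)%E.
Proof.
move=> mS h0 hH Sz.
have [m hm mh] := @nat_ceil R (1 / h) (divr_ge0 ler01 (ltW h0)).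
have one (i : 'I_(nfacets P)) : (lam (prism i S) <= ((1 + H) / h * (4 * h) ^+ d)%:E)%E.
  (* Cubes take the place of the prisms of height h. Of the half-side 2 h, one h is for the extent
     of [S] and one for the distance from s to the multiple l h. *)
  pose Q (l : nat) := cube (z + (l%:R * h) *: nu i) (2 * h).
  have sub : prism i S `<=` \big[setU/set0]_(l < m) Q l.
    move=> x [/= /andP[x1 x2] [xS _]]; set s := dotv (nu i) x - b i.
    have s0 : 0 <= s by rewrite subr_ge0.
    have s1 : s <= 1 by rewrite lerBlDl.
    have [l lm ls] : exists2 l, (l < m)%N & `|s - l%:R * h| <= h.
      have m0 : (0 < m)%N by rewrite -(ltr_nat R) (lt_le_trans _ hm)// divr_gt0.
      have mh1 : s <= m%:R * h by apply: le_trans s1 _; rewrite -ler_pdivrMr.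
      have [n nP] := nat_ceil (divr_ge0 s0 (ltW h0)) => nle.
      have sn : s <= n%:R * h by rewrite -ler_pdivrMr.
      have ns : n%:R * h <= s + h by rewrite -ler_pdivlMr// mulrDl divff ?gt_eqF.
      (* The rounded-up index may exceed m - 1; then s still lies within h of the last multiple (m -
         1) h. *)
      have [nm|nm] := leqP n m.-1.
        exists n; first by rewrite (leq_ltn_trans nm)// prednK.
        by rewrite ler_distl; apply/andP; split; lra.
      exists m.-1; first by rewrite prednK.
      have e : m%:R = m.-1%:R + 1 :> R by rewrite natr1 prednK.
      have nm' : m%:R <= n%:R :> R by rewrite ler_nat -(prednK m0).
      have mh2 : m%:R * h <= s + h by apply: le_trans ns; rewrite ler_wpM2r// ltW.
      rewrite ler_distl; apply/andP; split; move: mh1 mh2; rewrite e mulrDl mul1r; lra.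
    rewrite -bigcup_mkord; exists l => //; apply/cubeE => j.
    have := (cubeE _ _ _).1 (Sz _ xS) j; rewrite /facet_proj -/s !mxE => h1.
    have h2 := normal_coord_le i j.
    rewrite (_ : _ - _ = (x ord0 j - s * nu i ord0 j - z ord0 j) + (s - l%:R * h) * nu i ord0 j).
      apply: le_trans (ler_normD _ _) _; rewrite (_ : 2 * h = h + h); last by ring.
      by apply: lerD => //; rewrite normrM -[leRHS]mulr1 ler_pM.
    by ring.
  have mQ l : measurable (Q l) by exact: measurable_cube.
  apply: (@le_trans _ _ (lam (\big[setU/set0]_(l < m) Q l))).
    apply: le_measure; rewrite ?inE//; first exact: measurable_prism.
    by apply: bigsetU_measurable => l _; exact: mQ.
  apply: le_trans (Boole_inequality lam (fun i _ => mQ i)) _.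
  have lQ l : lam (Q l) = ((4 * h) ^+ d)%:E.
    by rewrite lebesgue_cube ?mulr_ge0 ?ltW// mulrA -natrM.
  rewrite (eq_bigr (fun=> ((4 * h) ^+ d)%:E)); last by move=> l _; exact: lQ.
  rewrite sumEFin lee_fin sumr_const card_ord -[leLHS]mulr_natl; apply: ler_wpM2r.
    by rewrite exprn_ge0// mulr_ge0// ltW.
  apply: le_trans mh _; rewrite mulrDl lerD2l ler_pdivlMr// mul1r.
  exact: hH.
apply: (@le_trans _ _ (\sum_(i < nfacets P) ((1 + H) / h * (4 * h) ^+ d)%:E)%E).
  by apply: lee_sum => i _; exact: one.
rewrite sumEFin sumr_const card_ord lee_fin -[leLHS]mulr_natl [leLHS]mulrA. exact: lexx.
Qed.

End discrete_trace.

Section mesh_geometry.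
Context {R : realType} {d : nat} (P : polytopic_domain R d).
Local Notation Om := (domain_set P).
Local Notation lam := (@lebesgue_rV R d).

Lemma enorm_sub_le_diam (A : set 'rV[R]_d) M x y : (forall z, A z -> `|z| <= M) ->
  A x -> A y -> enorm (x - y) <= diam A.
Proof.
move=> hM Ax Ay; apply: ub_le_sup; last by exists (x, y).
have M0 : 0 <= M := le_trans (normr_ge0 _) (hM x Ax).
exists (d%:R * (M + M)) => _ [[u v] [/= Au Av] <-].
apply: enorm_le => [|i]; first exact: addr_ge0.
rewrite !mxE; apply: le_trans (ler_normB _ _) _.
by apply: lerD; [apply: le_trans (rV_coord_le u i) _|apply: le_trans (rV_coord_le v i) _]; exact: hM.
Qed.

Lemma diam_le (A : set 'rV[R]_d) M : A !=set0 -> (forall z, A z -> `|z| <= M) ->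
  diam A <= d%:R * (M + M).
Proof.
move=> [x Ax] hM; have M0 : 0 <= M := le_trans (normr_ge0 _) (hM x Ax).
apply: ge_sup; first by exists (enorm (x - x)), (x, x).
move=> _ [[u v] [/= Au Av] <-].
apply: enorm_le => [|i]; first exact: addr_ge0.
rewrite !mxE; apply: le_trans (ler_normB _ _) _.
by apply: lerD; [apply: le_trans (rV_coord_le u i) _|apply: le_trans (rV_coord_le v i) _]; exact: hM.
Qed.

Lemma mesh_size_le : exists2 H, 0 < H & forall Th, conforming Om Th -> mesh_size Th <= H.
Proof.
have [M M0 hM] := @closed_domain_bounded R d P; exists (1 + d%:R * (M + M)).
  by rewrite ltr_pwDl// mulr_ge0// addr_ge0// ltW.
move=> Th [_ cov _]; rewrite /mesh_size big_seq; apply: bigmax_le => [|K KTh].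
  by rewrite addr_ge0// mulr_ge0// addr_ge0// ltW.
apply: (@le_trans _ _ (d%:R * (M + M))); last by rewrite lerDr.
apply: diam_le; first by exists (row ord0 K); exact: vertex_simplex.
by move=> z zK; apply: hM; rewrite -closure_domain -cov; exists K.
Qed.

Variable Th : mesh R d.
Hypothesis cTh : conforming Om Th.
Let h := mesh_size Th.

Lemma simplex_sub_closed K : K \in Th -> simplex K `<=` closed_domain P.
Proof. by move=> KTh x Kx; have [_ cov _] := cTh; rewrite -closure_domain -cov; exists K. Qed.

Lemma closed_sub_simplices x : closed_domain P x -> exists2 K, K \in Th & simplex K x.
Proof. by rewrite -closure_domain; have [_ <- _] := cTh => -[K KTh Kx]; exists K. Qed.

Lemma simplex_dist_le K x y : K \in Th -> simplex K x -> simplex K y -> enorm (x - y) <= h.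
Proof.
move=> KTh Kx Ky; have [M M0 hM] := @closed_domain_bounded R d P.
apply: (@le_trans _ _ (diam (simplex K))).
  by apply: (enorm_sub_le_diam (M := M)) => // z /(simplex_sub_closed KTh) /hM.
by rewrite /h /mesh_size; exact: (@le_bigmax_seq _ _ _ _ 0 _ predT (fun K => diam (simplex K)) KTh isT).
Qed.

Lemma mesh_size_gt0 : (0 < d)%N -> 0 < h.
Proof.
move=> d0; have [x xOm] := @domain_nonempty R d P.
have [K KTh _] := closed_sub_simplices (domain_sub_closed xOm).
have [nd _ _] := cTh; have nK := nd K KTh.
have d1 : (1 < d.+1)%N by [].
pose i1 := Ordinal d1.
apply: lt_le_trans (simplex_dist_le KTh (vertex_simplex K ord0) (vertex_simplex K i1)).
rewrite /enorm sqrtr_gt0 lt_neqAle dotv_ge0 andbT eq_sym dotv_eq0; apply/eqP => e.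
have e' : delta_mx ord0 ord0 = delta_mx ord0 i1 :> 'rV[R]_d.+1.
  apply: (barycentric_unique nK); last by rewrite -!rowE; apply/subr0_eq.
  have s1 (i : 'I_d.+1) : \sum_j (delta_mx ord0 i : 'rV[R]_d.+1) ord0 j = 1.
    by rewrite (bigD1 i)//= mxE !eqxx big1 ?addr0// => j ji; rewrite mxE (negbTE ji) andbF.
  by rewrite !s1.
by have /matrixP /(_ ord0 ord0) := e'; rewrite !mxE !eqxx/= => /eqP; rewrite oner_eq0.
Qed.

(** Nondegeneracy makes the barycentric coordinates affine functions of the point, and a simplex is
    where all of them are nonnegative. *)
Lemma measurable_simplex K : K \in Th -> measurable (simplex K).
Proof.
have [nd _ _] := cTh => /nd nK.
pose A : 'M[R]_(d.+1) := row_mx (const_mx 1 : 'cV[R]_d.+1) K.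
have Afree : row_free A := nK.
have Afull : row_full A by rewrite row_full_unit -row_free_unit.
pose c (x : 'rV[R]_d) : 'rV[R]_d.+1 := row_mx (const_mx 1 : 'rV[R]_1) x *m pinvmx A.
have cA x : c x *m A = row_mx (const_mx 1 : 'rV[R]_1) x by apply: mulmxKpV; exact: submx_full.
have cE x : \sum_i c x ord0 i = 1 /\ c x *m K = x.
  have : c x *m (row_mx (const_mx 1 : 'cV[R]_d.+1) K : 'M[R]_(d.+1, 1 + d)) =
    row_mx (const_mx 1 : 'rV[R]_1) x := cA x.
  rewrite mul_mx_row => /eq_row_mx[h1 h2]; split => //.
  have /matrixP /(_ ord0 ord0) := h1; rewrite mxE [RHS]mxE => <-.
  by apply: eq_bigr => i _; rewrite [const_mx _ _ _]mxE mulr1.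
rewrite (_ : simplex K = \bigcap_(i in [set: 'I_d.+1]) ((fun x => c x ord0 i) @^-1` `[0, +oo[)).
  apply: fin_bigcap_measurable => // i _.
  rewrite -[X in measurable X]setTI.
  suff mc : measurable_fun setT (fun x => c x ord0 i) by apply: mc.
  rewrite /c; under eq_fun do rewrite mxE.
  apply: measurable_sum => j; apply: measurable_funM; last exact: measurable_cst.
  under eq_fun do rewrite mxE.
  case: (fintype.split j) => k; first exact: measurable_cst.
  exact: measurable_coord.
apply/seteqP; split => x.
  move=> [c' [c'0 c'1 _ xE]] i _ /=; rewrite in_itv/= andbT.
  have [c1 cx] := cE x; rewrite (_ : c x = c')//.
  by apply: (barycentric_unique nK); rewrite ?c1// cx.
move=> hx; have [c1 cx] := cE x; exists (c x); split => // i.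
by have := hx i I; rewrite /= in_itv/= andbT.
Qed.

Lemma piecewise_polynomial_measurable k (u : 'rV[R]_d -> R) :
  (forall K, K \in Th -> exists p, is_polynomial k p /\ {in simplex K, forall x, u x = p x}) ->
  measurable_fun (closed_domain P) u.
Proof.
move=> hu _ Y mY.
rewrite (_ : _ `&` _ = \bigcup_(K in [set` Th]) (simplex K `&` u @^-1` Y)).
  apply: fin_bigcup_measurable; first exact: finite_seq.
  move=> K KTh; have [p [hp up]] := hu K KTh.
  rewrite (_ : _ `&` _ = simplex K `&` p @^-1` Y).
    apply: measurableI; first exact: measurable_simplex.
    by rewrite -[X in measurable X]setTI; apply: (is_polynomial_measurable hp).
  by apply/seteqP; split => x /= [Kx]; rewrite up ?inE.
apply/seteqP; split => x /=.
  by move=> [/closed_sub_simplices[K KTh Kx] xY]; exists K.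
by move=> [K KTh [Kx xY]]; split => //; exact: (simplex_sub_closed KTh).
Qed.

End mesh_geometry.

Section discrete_trace_inequality.
Context {R : realType} {d : nat} (P : polytopic_domain R d).
Local Notation Om := (domain_set P).
Local Notation lam := (@lebesgue_rV R d).
Hypothesis d0 : (0 < d)%N.
Variables (k : nat) (M : set (mesh R d)).
Hypothesis cM : forall Th, M Th -> conforming Om Th.
Hypothesis qM : quasi_uniform M.

(* Inverse inequality on a cube inside each element, then about 1/h prisms of
   height h over its trace on the boundary; the cubes are disjoint. *)
Lemma discrete_trace : exists2 C, 0 < C & forall Th, M Th -> forall u : 'rV[R]_d -> R,
  (forall K, K \in Th -> exists p, is_polynomial k p /\ {in simplex K, forall x, u x = p x}) ->
  (\int[surface P]_(x in boundary P) (u x ^+ 2)%:E <=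
   (C / mesh_size Th)%:E * \int[lam]_(x in Om) (u x ^+ 2)%:E)%E.
Proof.
have [kappa [kap0 hkap]] := qM.
have d1 : 0 < d%:R :> R by rewrite ltr0n.
pose rho := 4 * d%:R / kappa.
have [C0 C00 hC0] := @coord_poly_sup_le R k rho.
have [H H0 hH] := mesh_size_le P.
(* The inverse inequality brings (C0 / r)^d and the area of the trace of an element (4 h)^d / h.
   With r = kappa h / (4 d) the d-th powers of h cancel and 1/h is left. *)
pose C := 1 + (16 * C0 * d%:R / kappa) ^+ d * ((nfacets P)%:R * (1 + H)).
have C1 : 0 <= (16 * C0 * d%:R / kappa) ^+ d * ((nfacets P)%:R * (1 + H)).
  by rewrite mulr_ge0 ?exprn_ge0 ?divr_ge0 ?mulr_ge0// ?addr_ge0// ltW.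
exists C => [|Th MTh u hu]; first by rewrite ltr_pwDl.
have cTh := cM MTh; set h := mesh_size Th.
have h0 : 0 < h := mesh_size_gt0 cTh d0.
have hH' : h <= H := hH Th cTh.
have mu := piecewise_polynomial_measurable cTh hu.
(* The cube of half-side 2 r fits in the ball of radius kappa h, so every point of the cube of
   half-side r has a ball of radius r inside the element. *)
pose r := kappa * h / (4 * d%:R).
have r0 : 0 < r by rewrite divr_gt0 ?mulr_gt0.
have rr : rho * r = h by rewrite /rho /r; field; rewrite !gt_eqF.
(* Elements as sets without repetition: the list may contain one simplex several times, for instance
   with permuted vertices, and its cube must be counted once. *)
pose TT := undup [seq simplex K | K <- Th].
have TTP A : A \in TT -> exists2 K, K \in Th & A = simplex K.
  by rewrite mem_undup => /mapP[K KTh ->]; exists K.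
have zP (A : set 'rV[R]_d) : exists z, A \in TT -> [set x | enorm (x - z) < kappa * h] `<=` A.
  have [AT|AT] := boolP (A \in TT); last by exists 0.
  by have [K KTh ->] := TTP A AT; have [z hz] := hkap Th MTh K KTh; exists z.
pose z A := sval (cid (zP A)).
have hz A : A \in TT -> [set x | enorm (x - z A) < kappa * h] `<=` A := svalP (cid (zP A)).
have ball2 (x : 'rV[R]_d) A : (forall i, `|x ord0 i - z A ord0 i| <= 2 * r) -> enorm (x - z A) < kappa * h.
  move=> hx; have : enorm (x - z A) <= d%:R * (2 * r).
    by apply: enorm_le => [|i]; [rewrite mulr_ge0// ltW|rewrite !mxE; exact: hx].
  move=> h1; apply: (le_lt_trans h1).
  rewrite (_ : d%:R * (2 * r) = kappa * h / 2); last by rewrite /r; field; rewrite gt_eqF.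
  by have : 0 < kappa * h := mulr_gt0 kap0 h0; lra.
have cubeA A : A \in TT -> cube (z A) r `<=` A.
  move=> AT x /cubeE hx; apply: (hz A AT); apply: ball2 => i.
  by apply: le_trans (hx i) _; lra.
have zA A : A \in TT -> A (z A).
  by move=> AT; apply: (cubeA A AT); apply/cubeE => i; rewrite subrr normr0 ltW.
(* A common point of the two cubes has a ball inside both elements, and [overlapping_simplices]
   applies in both directions. *)
have disj A B : A \in TT -> B \in TT -> cube (z A) r `&` cube (z B) r !=set0 -> A = B.
  move=> AT BT [y [/cubeE yA /cubeE yB]].
  have [K KTh AK] := TTP A AT; have [L LTh BL] := TTP B BT.
  have near E : E \in TT -> (forall i, `|y ord0 i - z E ord0 i| <= r) ->
      forall x, enorm (x - y) <= r -> E x.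
    move=> ET hy x hx; apply: (hz E ET); apply: ball2 => i.
    rewrite (_ : x ord0 i - z E ord0 i = (x ord0 i - y ord0 i) + (y ord0 i - z E ord0 i)); last by ring.
    apply: le_trans (ler_normD _ _) _; rewrite (_ : 2 * r = r + r); last by ring.
    apply: lerD; last exact: hy.
    by apply: le_trans hx; have := enorm_coord_le (x - y) i; rewrite !mxE.
  have [nd _ face_] := cTh.
  have nA := near A AT yA; have nB := near B BT yB; rewrite AK in nA; rewrite BL in nB.
  rewrite AK BL; apply/seteqP; split.
    by apply: (overlapping_simplices (y := y) (nd K KTh) r0 (face_ K L KTh LTh)) => x hx; split; [exact: nA|exact: nB].
  by apply: (overlapping_simplices (y := y) (nd L LTh) r0 (face_ L K LTh KTh)) => x hx; split; [exact: nB|exact: nA].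
pose J A := (\int[lam]_(x in cube (z A) r) (u x ^+ 2)%:E)%E.
have J0 A : (0 <= J A)%E by apply: integral_ge0 => x _; rewrite lee_fin sqr_ge0.
pose m A := (((C0 / r) ^+ d)%:E * J A)%E.
have m0 A : (0 <= m A)%E by rewrite mule_ge0// lee_fin exprn_ge0// divr_ge0// ltW.
have umA A (x : 'rV[R]_d) : A \in TT -> A x -> ((u x ^+ 2)%:E <= m A)%E.
  move=> AT Ax; have [K KTh AK] := TTP A AT; have [p [hp up]] := hu K KTh.
  rewrite /m /J (eq_integral (fun y => (p y ^+ 2)%:E)); last first.
    by move=> y; rewrite inE => /(cubeA A AT); rewrite AK => Ky; rewrite up ?inE.
  rewrite up; last by rewrite inE -AK.
  apply: hC0 => //; [exact: is_polynomial_measurable hp|exact: is_polynomial_coord_poly|].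
  apply/cubeE => i; rewrite rr.
  have := simplex_dist_le cTh KTh (x := x) (y := z A); rewrite -AK => /(_ Ax (zA A AT)).
  by apply: le_trans; have := enorm_coord_le (x - z A) i; rewrite !mxE.
have mA A : A \in TT -> measurable A by move=> /TTP[K KTh ->]; exact: (measurable_simplex cTh).
have mB := @measurable_boundary R d P; have mC := @measurable_closed_domain R d P.
have mu2 : measurable_fun (closed_domain P) (fun x => (u x ^+ 2)%:E).
  by apply/measurable_EFinP; apply: measurable_funX.
have bsub : boundary P `<=` closed_domain P by rewrite boundaryE => x [].
pose G (A : set 'rV[R]_d) := if A \in TT then (cst (m A)) \_ A else cst 0%E.
have G0 A x : (0 <= G A x)%E by rewrite /G; case: ifP => // _; rewrite /patch; case: ifP => //= _; exact: m0.
have mG A : measurable_fun (boundary P) (G A).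
  rewrite /G; case: ifPn => [AT|_]; last exact: measurable_cst.
  by apply: measurable_funTS; apply: measurable_patch; [exact: mA|exact: measurable_cst].
have step1 : (\int[surface P]_(x in boundary P) (u x ^+ 2)%:E <=
    \int[surface P]_(x in boundary P) \sum_(A <- TT) G A x)%E.
  apply: ge0_le_integral => //.
  - by move=> x _; rewrite lee_fin sqr_ge0.
  - exact: measurable_funS mu2.
  - exact: emeasurable_sum.
  - move=> x /bsub /(closed_sub_simplices cTh)[K KTh Kx].
    have KT : simplex K \in TT by rewrite mem_undup map_f.
    rewrite (bigD1_seq (simplex K)) ?undup_uniq//=.
    have -> : G (simplex K) x = m (simplex K) by rewrite /G KT patchE mem_set.
    by apply: (le_trans (umA _ _ KT Kx)); apply: leeDl; apply: sume_ge0.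
apply: (le_trans step1).
have step2 : (\int[surface P]_(x in boundary P) \sum_(A <- TT) G A x =
   \sum_(A <- TT) (m A * surface P (boundary P `&` A)))%E.
  rewrite ge0_integral_sum//; rewrite big_seq [RHS]big_seq; apply: eq_bigr => A AT.
  rewrite /G AT -integral_mkcondr integral_cst//.
  by apply: measurableI => //; exact: mA.
rewrite step2.
have step3 A : A \in TT -> (m A * surface P (boundary P `&` A) <= (C / h)%:E * J A)%E.
  move=> AT; have [K KTh AK] := TTP A AT.
  have hS : (surface P (boundary P `&` A) <= ((nfacets P)%:R * ((1 + H) / h) * (4 * h) ^+ d)%:E)%E.
    apply: (@surface_small_le R d P H h (z A)) => //; first by apply: measurableI => //; exact: mA.
    move=> x [_ Ax]; apply/cubeE => i.
    have := simplex_dist_le cTh KTh (x := x) (y := z A); rewrite -AK => /(_ Ax (zA A AT)).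
    by apply: le_trans; have := enorm_coord_le (x - z A) i; rewrite !mxE.
  apply: (le_trans (lee_wpmul2l (m0 A) hS)).
  rewrite /m muleC muleA -EFinM; apply: lee_wpmul2r => //; rewrite lee_fin.
  rewrite [leLHS](_ : _ = (16 * C0 * d%:R / kappa) ^+ d * ((nfacets P)%:R * (1 + H)) / h); last first.
    rewrite (_ : (4 * h) ^+ d = (16 * C0 * d%:R / kappa) ^+ d / (C0 / r) ^+ d); last first.
      rewrite -expr_div_n; congr (_ ^+ d); rewrite /r; field.
      by rewrite !gt_eqF.
    have Y0 : (C0 / r) ^+ d != 0 by rewrite gt_eqF// exprn_gt0// divr_gt0.
    move: Y0; move: ((C0 / r) ^+ d) ((16 * C0 * d%:R / kappa) ^+ d) (_%:R : R) => Y X c Y0.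
    by field; rewrite Y0 gt_eqF.
  by rewrite ler_pM2r ?invr_gt0// /C lerDr.
apply: (@le_trans _ _ (\sum_(A <- TT) ((C / h)%:E * J A))%E).
  by rewrite big_seq [leRHS]big_seq; apply: lee_sum => A AT; exact: step3.
rewrite -ge0_sume_distrr//; apply: lee_wpmul2l; first by rewrite lee_fin divr_ge0 ?addr_ge0// ltW.
have sub : \big[setU/set0]_(A <- TT) cube (z A) r `<=` closed_domain P.
  rewrite -bigcup_seq => x [A AT Ax]; have [K KTh AK] := TTP A AT.
  by apply: (simplex_sub_closed cTh KTh); rewrite -AK; exact: (cubeA A AT).
rewrite /J -(@ge0_integral_bigsetU _ _ _ lam _ (fun A => cube (z A) r) (fun x => (u x ^+ 2)%:E) TT); last 5 first.
- by move=> A; exact: measurable_cube.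
- exact: undup_uniq.
- by move=> A B /= AT BT; exact: disj.
- exact: measurable_funS mu2.
- by move=> x _; rewrite lee_fin sqr_ge0.
apply: (@le_trans _ _ (\int[lam]_(x in closed_domain P) (u x ^+ 2)%:E)%E).
  apply: ge0_subset_integral => //; last by move=> x _; rewrite lee_fin sqr_ge0.
  by apply: bigsetU_measurable => A _; exact: measurable_cube.
rewrite (@ge0_negligible_integral _ _ _ lam _ (boundary P))//; last 2 first.
- by move=> x _; rewrite lee_fin sqr_ge0.
- exact: lebesgue_boundary.
rewrite boundaryE setDD setIC setIidl//; exact: domain_sub_closed.
Qed.

End discrete_trace_inequality.

(** * A basis of the finite element space, and solvability of the time steps *)

(** Among the matrices whose row space lies in [S], one of maximal rank works: a missing vector
    could be added and would raise the rank. *)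
Lemma subspace_matrix (F : fieldType) n (S : 'rV[F]_n -> Prop) : S 0 ->
  (forall a u v, S u -> S v -> S (a *: u + v)) -> exists A : 'M[F]_n, forall u, S u <-> (u <= A)%MS.
Proof.
move=> S0 Slin.
have SD u v : S u -> S v -> S (u + v) by move=> hu hv; rewrite -[u]scale1r; exact: Slin.
pose Q r := `[< exists A : 'M[F]_n, (forall u, (u <= A)%MS -> S u) /\ \rank A = r >].
have Q0 : exists r, Q r.
  exists 0%N; apply/asboolP; exists 0; rewrite mxrank0; split => // u.
  by rewrite submx0 => /eqP ->.
have Qn r : Q r -> (r <= n)%N by move=> /asboolP[A [_ <-]]; exact: rank_leq_col.
case: (ex_maxnP Q0 Qn) => r /asboolP[A [hA rA]] rmax; exists A => u; split; last exact: hA.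
move=> Su; have Au : (\rank (A + u)%MS <= \rank A)%N.
  rewrite rA; apply: rmax; apply/asboolP; exists (A + u)%MS; split => // w.
  move=> /sub_addsmxP[[w1 w2] /= ->]; apply: SD; first by apply: hA; exact: submxMl.
  rewrite [w2]mx11_scalar mul_scalar_mx -[_ *: u]addr0; exact: Slin.
rewrite (geq_leqif (mxrank_leqif_sup (addsmxSl A u))) in Au.
by apply: submx_trans Au; exact: addsmxSr.
Qed.

Section L2prod_form.
Context {disp : measure_display} {T : measurableType disp} {R : realType}.
Variables (mu : {measure set T -> \bar R}) (A : set T).
Hypothesis mA : measurable A.
Context {n : nat}.
Implicit Types u v w : T -> 'rV[R]_n.

Lemma vL2_lin (a : R) u v : vL2 mu A u -> vL2 mu A v -> vL2 mu A (fun x => a *: u x + v x).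
Proof.
move=> hu hv i; rewrite (_ : (fun x => _) = (fun x => a * u x ord0 i + v x ord0 i)).
  exact: (L2_lin mA).
by apply/funext => x; rewrite !mxE.
Qed.

Lemma dotv_integrable u v : vL2 mu A u -> vL2 mu A v ->
  mu.-integrable A (EFin \o (fun x => dotv (u x) (v x))).
Proof. by move=> hu hv; apply: (integrable_sumr mA) => i; exact: (L2_mul_integrable mA). Qed.

Lemma L2prod_sym u v : L2prod mu A u v = L2prod mu A v u.
Proof. by apply: eq_Rintegral => x _; apply: eq_bigr => i _; rewrite mulrC. Qed.

Lemma L2prod_ge0 u : 0 <= L2prod mu A u u.
Proof. by apply: Rintegral_ge0 => x _; exact: dotv_ge0. Qed.

Lemma L2prod_lin (a : R) u v w : vL2 mu A u -> vL2 mu A v -> vL2 mu A w ->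
  L2prod mu A (fun x => a *: u x + v x) w = a * L2prod mu A u w + L2prod mu A v w.
Proof.
move=> hu hv hw; have iu := dotv_integrable hu hw; have iv := dotv_integrable hv hw.
rewrite /L2prod -RintegralZl// -RintegralD//; last exact: (integrable_scaler mA).
apply: eq_Rintegral => x _; rewrite /dotv mulr_sumr -big_split/=; apply: eq_bigr => i _.
by rewrite !mxE mulrDl mulrA.
Qed.

Lemma L2prod_cauchy_schwarz u v : vL2 mu A u -> vL2 mu A v ->
  L2prod mu A u v ^+ 2 <= L2prod mu A u u * L2prod mu A v v.
Proof.
move=> hu hv; apply: discriminant_le => t.
have hz := vL2_lin t hv hu.
have e1 := L2prod_lin t hv hu hz.
have e2 := etrans (L2prod_sym v _) (L2prod_lin t hv hu hv).
have e3 := etrans (L2prod_sym u _) (L2prod_lin t hv hu hu).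
have e (X B C z1 z2 z3 C' : R) : 0 <= z1 -> z1 = t * z2 + z3 -> z2 = t * B + C -> z3 = t * C' + X ->
    C' = C -> 0 <= X + 2 * t * C + t ^+ 2 * B.
  move=> h E1 E2 E3 E4; suff -> : X + 2 * t * C + t ^+ 2 * B = z1 by [].
  by rewrite E1 E2 E3 E4; ring.
exact: (e _ _ _ _ _ _ _ (L2prod_ge0 _) e1 e2 e3 (L2prod_sym v u)).
Qed.

Lemma eq_L2prod u u' v v' : (forall x, A x -> u x = u' x) -> (forall x, A x -> v x = v' x) ->
  L2prod mu A u v = L2prod mu A u' v'.
Proof. by move=> uu vv; apply: eq_Rintegral => x; rewrite inE => Ax; rewrite uu// vv. Qed.

End L2prod_form.

Section finite_element_space.
Context {R : realType} {d : nat} (P : polytopic_domain R d) (GD : set 'rV[R]_d).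
Variables (k : nat) (Th : mesh R d).
Local Notation Om := (domain_set P).
Local Notation vecf := ('rV[R]_d -> 'rV[R]_d).
Hypothesis cTh : conforming Om Th.

Lemma is_polynomial_lin (a : R) (p q : 'rV[R]_d -> R) : is_polynomial k p -> is_polynomial k q ->
  is_polynomial k (fun x => a * p x + q x).
Proof.
move=> [c hc] [c' hc']; exists (fun m => a * c m + c' m) => x.
by rewrite hc hc' mulr_sumr -big_split/=; apply: eq_bigr => m _; rewrite mulrDl mulrA.
Qed.

Lemma Vh0 : Vh P GD k Th (fun=> 0).
Proof.
split; [exact: Vspace0|exact: cst_continuous|move=> K _ j; exists (fun=> 0); split].
  by exists (fun=> 0) => x; rewrite big1// => m _; rewrite mul0r.
by move=> x _; rewrite mxE.
Qed.

Lemma Vh_lin (a : R) (w v : vecf) : Vh P GD k Th w -> Vh P GD k Th v ->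
  Vh P GD k Th (fun x => a *: w x + v x).
Proof.
move=> [Vw cw pw] [Vv cv pv]; split; first exact: Vspace_lin.
  by move=> x; apply: cvgD; [apply: cvgZr; exact: cw|exact: cv].
move=> K KTh j; have [p [hp wp]] := pw K KTh j; have [q [hq vq]] := pv K KTh j.
exists (fun x => a * p x + q x); split; first exact: is_polynomial_lin.
by move=> x Kx; rewrite !mxE wp// vq.
Qed.

Lemma Vh_sum r (y : 'rV[R]_r) (phi : 'I_r -> vecf) : (forall i, Vh P GD k Th (phi i)) ->
  Vh P GD k Th (fun x => \sum_i y ord0 i *: phi i x).
Proof.
move=> hphi; elim: (index_enum _) => [|i s IH].
  by under eq_fun do rewrite big_nil; exact: Vh0.
by under eq_fun do rewrite big_cons; exact: Vh_lin.
Qed.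

(** No nodal basis is built. A field is encoded by its polynomial coefficients for all elements and
    components; the codes [S] of fields of V^h form a subspace, whatever continuity and boundary
    conditions impose on them, and fields behind a spanning set of codes generate. *)
Lemma Vh_span : exists r (phi : 'I_r -> vecf), (forall i, Vh P GD k Th (phi i)) /\
  forall v, Vh P GD k Th v -> exists y : 'rV[R]_r, forall x, closed_domain P x ->
    v x = \sum_i y ord0 i *: phi i x.
Proof.
pose I : finType := ('I_(size Th) * 'I_d * {ffun 'I_d -> 'I_k.+1})%type.
pose pv (c : 'rV[R]_#|I|) (a : 'I_(size Th)) (j : 'I_d) (x : 'rV[R]_d) :=
  \sum_(m : {ffun 'I_d -> 'I_k.+1} | (\sum_i m i <= k)%N)
     c ord0 (enum_rank ((a, j, m) : I)) * \prod_i x ord0 i ^+ m i.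
have pvl (e : R) c c' a j x : pv (e *: c + c') a j x = e * pv c a j x + pv c' a j x.
  by rewrite /pv mulr_sumr -big_split/=; apply: eq_bigr => m _; rewrite !mxE mulrDl mulrA.
have pv0 a j x : pv 0 a j x = 0 by rewrite /pv big1// => m _; rewrite mxE mul0r.
pose el (a : 'I_(size Th)) := simplex (nth 0 Th a).
pose S c := exists2 v, Vh P GD k Th v & forall a j x, el a x -> v x ord0 j = pv c a j x.
have S0 : S 0 by exists (fun=> 0); [exact: Vh0|move=> a j x _; rewrite pv0 mxE].
have Sl e u v : S u -> S v -> S (e *: u + v).
  move=> [w hw wu] [w' hw' wv]; exists (fun x => e *: w x + w' x); first exact: Vh_lin.
  by move=> a j x ax; rewrite !mxE pvl (wu a)// (wv a).
have [A hA] := subspace_matrix S0 Sl.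
have Srow i : S (row i A) by apply/hA; exact: row_sub.
pose phi i := s2val (cid2 (Srow i)).
have hphi i : Vh P GD k Th (phi i) by rewrite /phi; case: (cid2 _).
have ephi i a j x : el a x -> phi i x ord0 j = pv (row i A) a j x.
  by rewrite /phi; case: (cid2 _) => /= v _; exact.
exists #|I|, phi; split => // v hv; have [_ _ pvv] := hv.
have inT (a : 'I_(size Th)) : nth 0 Th a \in Th by exact: mem_nth.
have pc a j : exists c : {ffun 'I_d -> 'I_k.+1} -> R, forall x, el a x -> v x ord0 j =
    \sum_(m : {ffun 'I_d -> 'I_k.+1} | (\sum_i m i <= k)%N) c m * \prod_i x ord0 i ^+ m i.
  have [p [[c hc] vp]] := pvv _ (inT a) j; exists c => x ax; rewrite -hc; apply: vp.
  by rewrite inE.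
pose cc : 'rV[R]_#|I| := \row_(i < #|I|) (let: (a, j, m) := (enum_val i : I) in sval (cid (pc a j)) m).
have vE a j x : el a x -> v x ord0 j = pv cc a j x.
  move=> ax; rewrite (svalP (cid (pc a j)) x ax); apply: eq_bigr => m _.
  by rewrite mxE enum_rankK.
have /hA/submxP[y hy] : S cc by exists v.
exists y => x xc; have [K KTh Kx] := closed_sub_simplices cTh xc.
have aK : (index K Th < size Th)%N by rewrite index_mem.
pose a := Ordinal aK; have ax : el a x by rewrite /el /= nth_index.
apply/rowP => j; rewrite (vE a)// hy mulmx_sum_row summxE.
have : pv (\sum_i y ord0 i *: row i A) a j x = \sum_i y ord0 i * pv (row i A) a j x.
  by elim/big_rec2 : _ => [|i c c' _ <-]; [exact: pv0|exact: pvl].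
by move=> ->; apply: eq_bigr => i _; rewrite mxE (ephi _ a).
Qed.

(** A generating family of minimal size is independent. All equalities are on the closed domain,
    outside which the values of a field of V^h are arbitrary. *)
Lemma Vh_basis : exists r (phi : 'I_r -> vecf), [/\ forall i, Vh P GD k Th (phi i),
  forall v, Vh P GD k Th v -> exists y : 'rV[R]_r, forall x, closed_domain P x ->
    v x = \sum_i y ord0 i *: phi i x &
  forall y : 'rV[R]_r, (forall x, closed_domain P x -> \sum_i y ord0 i *: phi i x = 0) -> y = 0].
Proof.
pose Q r := `[< exists phi : 'I_r -> vecf, (forall i, Vh P GD k Th (phi i)) /\
  forall v, Vh P GD k Th v -> exists y : 'rV[R]_r, forall x, closed_domain P x ->
    v x = \sum_i y ord0 i *: phi i x >].
have Qe : exists r, Q r by have [r hr] := Vh_span; exists r; apply/asboolP.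
case: (ex_minnP Qe) => r /asboolP[phi [hphi span]] rmin; exists r, phi; split => // y hy.
apply/rowP => j; rewrite mxE; apply/eqP/negP => /negP yj.
case: r phi hphi span rmin y hy j yj => [|r] phi hphi span rmin y hy j yj; first by case: j {yj}.
suff : Q r by move=> /rmin; rewrite ltnn.
apply/asboolP; exists (fun i => phi (lift j i)); split => // v /span[z hz].
exists (\row_i (z ord0 (lift j i) - z ord0 j / y ord0 j * y ord0 (lift j i))) => x xc.
have := hy x xc; rewrite hz// !(bigD1_ord j)//= => e.
rewrite (_ : phi j x = - (y ord0 j)^-1 *: \sum_(i < r) y ord0 (lift j i) *: phi (lift j i) x); last first.
  have -> : \sum_(i < r) y ord0 (lift j i) *: phi (lift j i) x = - (y ord0 j *: phi j x).
    by apply/eqP; rewrite -addr_eq0 addrC e.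
  by rewrite scalerN scaleNr opprK scalerA mulVf// scale1r.
rewrite scalerA scaler_sumr -big_split/=; apply: eq_bigr => i _.
by rewrite mxE scalerA -scalerDl; congr (_ *: _); ring.
Qed.

End finite_element_space.

(** A vector in the kernel of the Gram matrix has [A u u = 0], hence vanishes, and the matrix is
    invertible. *)
Lemma bilform_solve (R : fieldType) r (A : 'rV[R]_r -> 'rV[R]_r -> R) (l : 'rV[R]_r -> R) :
  (forall s u v w, A (s *: u + v) w = s * A u w + A v w) ->
  (forall u v, A u v = A v u) -> (forall u, A u u = 0 -> u = 0) ->
  (forall s u v, l (s *: u + v) = s * l u + l v) -> exists u, forall y, A u y = l y.
Proof.
move=> Alin Asym Adef llin.
have lin_sum (f : 'rV[R]_r -> R) (y : 'rV[R]_r) : (forall s u v, f (s *: u + v) = s * f u + f v) ->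
    f y = \sum_i y ord0 i * f (delta_mx ord0 i).
  move=> fl; have f0 : f 0 = 0.
    by have := fl (-1) 0 0; rewrite scaler0 addr0 mulN1r addNr.
  rewrite [y in LHS]row_sum_delta.
  by elim/big_rec2 : _ => [//|i u w _ <-]; exact: fl.
pose G := \matrix_(i < r, j < r) A (delta_mx ord0 i) (delta_mx ord0 j).
have GE u j : (u *m G) ord0 j = A u (delta_mx ord0 j).
  rewrite (lin_sum (fun u => A u (delta_mx ord0 j)) u) => [|s v w]; last exact: Alin.
  by rewrite mxE; apply: eq_bigr => i _; rewrite mxE.
have AE u y : A u y = \sum_j y ord0 j * (u *m G) ord0 j.
  rewrite (lin_sum (A u) y) => [|s v w]; last by rewrite !(Asym u) Alin.
  by apply: eq_bigr => j _; rewrite GE.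
have Gu : G \in unitmx.
  rewrite -row_free_unit -kermx_eq0; apply/eqP/row_matrixP => i; rewrite row0.
  apply: Adef; rewrite AE big1// => j _.
  by rewrite -row_mul mulmx_ker row0 [X in _ * X]mxE mulr0.
exists (\row_j l (delta_mx ord0 j) *m invmx G) => y.
rewrite AE mulmxKV// (lin_sum l y)//; apply: eq_bigr => j _.
by rewrite mxE.
Qed.

Section abstract_scheme.
Context {R : realType} {r : nat}.
Local Notation V := 'rV[R]_r.
Variables (a m : V -> V -> R).
Hypothesis a_lin : forall (s : R) u v w, a (s *: u + v) w = s * a u w + a v w.
Hypothesis a_sym : forall u v, a u v = a v u.
Hypothesis a_ge0 : forall u, 0 <= a u u.
Hypothesis a_def : forall u, a u u = 0 -> u = 0.
Hypothesis m_lin : forall (s : R) u v w, m (s *: u + v) w = s * m u w + m v w.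
Hypothesis m_sym : forall u v, m u v = m v u.
Hypothesis m_ge0 : forall u, 0 <= m u u.
Hypothesis m_def : forall u, m u u = 0 -> u = 0.
Variables (s e : R) (beta wt : nat -> R) (F : nat -> V -> R) (l0 : V -> R).
Hypothesis s0 : 0 < s.
Hypothesis e0 : 0 <= e.
Hypothesis beta0 : beta 0%N = 1.
Hypothesis F_lin : forall n (c : R) u v, F n (c *: u + v) = c * F n u + F n v.
Hypothesis l0_lin : forall (c : R) u v, l0 (c *: u + v) = c * l0 u + l0 v.

(** The scheme in coordinates of a basis of V^h, with q_(n+1) + q_n already written as a convolution
    of the sums of consecutive values. *)
Definition scheme_solution N (y : nat -> V) : Prop :=
  (forall z, a (y 0%N) z = l0 z) /\
  forall n z, (n < N)%N -> s * m (y n.+1 - y n) z +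
    e * a (\sum_(i < n.+1) beta (n - i)%N *: (y i.+1 + y i) + wt n *: y 0%N) z =
    (F n.+1 z + F n z) / 2.

(** The form to invert at each step: by [beta0] the unknown enters the convolution with weight one.
    The mass term alone makes it definite. *)
Let A u v := s * m u v + e * a u v.
Let A_lin (c : R) u v w : A (c *: u + v) w = c * A u w + A v w.
Proof. by rewrite /A m_lin a_lin; ring. Qed.
Let A_sym u v : A u v = A v u.
Proof. by rewrite /A m_sym a_sym. Qed.
Let A_def u : A u u = 0 -> u = 0.
Proof.
move=> h; apply: m_def; apply/eqP; rewrite eq_le m_ge0 andbT.
rewrite -(pmulr_rle0 _ s0); have : 0 <= e * a u u by rewrite mulr_ge0.
by move: h; rewrite /A; lra.
Qed.

(** What the argument of [a] contains besides the unknown [y n.+1]. It depends on y_0, ..., y_n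
    only, which drives both inductions on n. *)
Let hist n (y : nat -> V) : V :=
  \sum_(i < n) beta (n - i)%N *: (y i.+1 + y i) + wt n *: y 0%N + y n.

Let eq_hist n y y' : (forall i, (i <= n)%N -> y i = y' i) -> hist n y = hist n y'.
Proof.
move=> yy; rewrite /hist (yy n)// (yy 0%N)//; congr (_ + _ + _); apply: eq_bigr => i _.
by rewrite !yy// ltnW.
Qed.

Let lhsE n y z : s * m (y n.+1 - y n) z +
    e * a (\sum_(i < n.+1) beta (n - i)%N *: (y i.+1 + y i) + wt n *: y 0%N) z =
  A (y n.+1) z - (s * m (y n) z - e * a (hist n y) z).
Proof.
have -> : \sum_(i < n.+1) beta (n - i)%N *: (y i.+1 + y i) + wt n *: y 0%N = y n.+1 + hist n y.
  by rewrite big_ord_recr/= subnn beta0 scale1r addrCA -addrA; congr (_ + _); rewrite addrAC.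
by rewrite (bilformBl m_lin) (bilformDl a_lin) /A; ring.
Qed.

Lemma scheme_solvable N : exists y, scheme_solution N y.
Proof.
elim: N => [|n [y [y0 hy]]].
  have [u hu] := bilform_solve a_lin a_sym a_def l0_lin.
  by exists (fun=> u); split.
pose l z := (F n.+1 z + F n z) / 2 + (s * m (y n) z - e * a (hist n y) z).
have ll (c : R) u v : l (c *: u + v) = c * l u + l v.
  rewrite /l !F_lin !(bilformDr a_lin a_sym) !(bilformDr m_lin m_sym) !(bilformZr a_lin a_sym) !(bilformZr m_lin m_sym).
  by ring.
have [u hu] := bilform_solve A_lin A_sym A_def ll.
pose y' i := if (i <= n)%N then y i else u.
have yy i : (i <= n)%N -> y' i = y i by rewrite /y' => ->.
exists y'; split; first by move=> z; rewrite yy.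
move=> j z; rewrite ltnS leq_eqVlt => /predU1P[->|jn].
  rewrite lhsE (eq_hist yy) (yy n)// (_ : y' n.+1 = u); last by rewrite /y' ltnn.
  by rewrite hu /l addrK.
have hj i : (i <= j)%N -> y' i = y i by move=> ij; rewrite yy// (leq_trans ij)// ltnW.
by rewrite lhsE (eq_hist hj) !yy ?(ltnW jn)// -hy// lhsE.
Qed.

Lemma scheme_unique N y y' : scheme_solution N y -> scheme_solution N y' ->
  forall n, (n <= N)%N -> y' n = y n.
Proof.
move=> [y0 hy] [y'0 hy'].
suff h n : (n <= N)%N -> forall i, (i <= n)%N -> y' i = y i by move=> n nN; exact: (h n).
elim: n => [_ i|n IH nN i].
  rewrite leqn0 => /eqP ->; apply/subr0_eq/a_def.
  by rewrite (bilformBl a_lin) y0 y'0 subrr.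
rewrite leq_eqVlt => /predU1P[->|]; last by rewrite ltnS => /(IH (ltnW nN)).
have hn := IH (ltnW nN); apply/subr0_eq/A_def.
set z := _ - _; rewrite (bilformBl A_lin).
have := hy n z nN; have := hy' n z nN; rewrite !lhsE (eq_hist hn) (hn n)//.
by move=> <- /addIr ->; rewrite subrr.
Qed.

End abstract_scheme.

(** * The quadrature as a convolution *)

(** This sign is all that the scheme asks of the factor dt^(1 - alpha) / Gamma(3 - alpha): the mass
    form ensures definiteness and the energy estimate takes any c >= 0. *)
Lemma Gamma_ge0 (R : realType) (z : R) : 0 <= Gamma z.
Proof. by apply: Rintegral_ge0 => t _; rewrite mulr_ge0 ?powR_ge0 ?expR_ge0. Qed.

Section quadrature.
Context {R : realType} {d : nat}.
Variables (alpha dt : R) (W : nat -> 'rV[R]_d -> 'rV[R]_d).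
Let p := 2 - alpha.
Let c := dt `^ (1 - alpha) / Gamma (3 - alpha).

Let pE : p - 1 = 1 - alpha. Proof. by rewrite /p; ring. Qed.

Lemma Bcoef0 n : Bcoef alpha n.+1 0 = initial_weight p n.+1.
Proof. by rewrite /Bcoef/= /p -/p pE. Qed.

Lemma BcoefS n i : (i <= n)%N -> Bcoef alpha n.+1 i.+1 = frac_kernel p (n - i).
Proof.
rewrite leq_eqVlt => /predU1P[->|ni]; first by rewrite /Bcoef/= ltnn subnn.
rewrite /Bcoef/= ltnS ni subSS -[(n - i)%N]prednK ?subn_gt0//=.
set j := (n - i).-1; rewrite subn1 addn1/=.
have -> : j%:R + 1 + 1 = j.+2%:R :> R by rewrite !natr1.
have -> : j%:R + 1 = j.+1%:R :> R by rewrite natr1.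
by rewrite /p; ring.
Qed.

Lemma qopS n x : qop alpha dt n.+1 W x = c *: (initial_weight p n.+1 *: W 0%N x +
  \sum_(i < n.+1) frac_kernel p (n - i) *: W i.+1 x).
Proof.
rewrite /qop /= big_ord_recl Bcoef0; congr (_ *: (_ + _)).
by apply: eq_bigr => i _; rewrite BcoefS// -ltnS.
Qed.

(** W^0 is given the kernel weight like every other value, and the difference to its true weight is
    added back. At n = 0 the two contributions cancel, in accordance with q_0 = 0. *)
Lemma qopE n x : qop alpha dt n W x = c *: (\sum_(i < n.+1) frac_kernel p (n - i) *: W i x +
  (initial_weight p n - frac_kernel p n) *: W 0%N x).
Proof.
case: n => [|n].
  rewrite big_ord1 (_ : frac_kernel p (0 - @ord0 0) = 1)//.
  by rewrite sub0r scaleN1r scale1r subrr scaler0.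
rewrite qopS; congr (_ *: _).
have -> : \sum_(i < n.+2) frac_kernel p (n.+1 - i) *: W i x = frac_kernel p n.+1 *: W 0%N x +
    \sum_(i < n.+1) frac_kernel p (n - i) *: W i.+1 x by rewrite big_ord_recl.
by rewrite [RHS]addrC scalerBl addrA subrK.
Qed.

(** The expansion of q_(n+1) over W^(i+1) and that of q_n over W^i carry the same kernel index n -
    i, so consecutive values pair up. *)
Lemma qop_pair n x : qop alpha dt n.+1 W x + qop alpha dt n W x =
  c *: (\sum_(i < n.+1) frac_kernel p (n - i) *: (W i.+1 x + W i x) +
    (initial_weight p n.+1 + initial_weight p n - frac_kernel p n) *: W 0%N x).
Proof.
rewrite qopS qopE -scalerDr; congr (_ *: _).
under [in RHS]eq_bigr do rewrite scalerDr.
rewrite big_split/= -(addrA (initial_weight p n.+1)) (scalerDl _ (initial_weight p n.+1)).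
by rewrite (addrC (_ *: W 0%N x) (\sum_(i < n.+1) frac_kernel p (n - i) *: W i.+1 x)) addrACA.
Qed.

End quadrature.

(** * Discrete fields: traces, definiteness of the L_2 product, loads *)

Lemma Rintegral_sqr_fin {disp : measure_display} {T : measurableType disp} {R : realType}
    (mu : {measure set T -> \bar R}) (A : set T) (u : T -> R) : measurable A -> L2 mu A u ->
  ((\int[mu]_(x in A) (u x ^+ 2))%:E = \int[mu]_(x in A) (u x ^+ 2)%:E)%E.
Proof.
move=> mA Lu; rewrite /Rintegral fineK//; apply: integrable_fin_num => //.
exact: L2_sqr_integrable.
Qed.

Lemma L2prod_sqr_sum {disp : measure_display} {T : measurableType disp} {R : realType}
    (mu : {measure set T -> \bar R}) (A : set T) n (u : T -> 'rV[R]_n) : measurable A ->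
  vL2 mu A u -> L2prod mu A u u = \sum_j \int[mu]_(x in A) (u x ord0 j ^+ 2).
Proof.
move=> mA hu; rewrite -(Rintegral_sumr mA (index_enum _) (f := fun j x => u x ord0 j ^+ 2)) => [|j].
  by apply: eq_Rintegral => x _; apply: eq_bigr => j _; rewrite expr2.
exact: L2_sqr_integrable.
Qed.

Section discrete_functions.
Context {R : realType} {d : nat} (P : polytopic_domain R d) (GD : set 'rV[R]_d).
Local Notation Om := (domain_set P).
Local Notation lam := (@lebesgue_rV R d).
Hypothesis d0 : (0 < d)%N.
Variables (k : nat) (M : set (mesh R d)).
Hypothesis cM : forall Th, M Th -> conforming Om Th.
Hypothesis qM : quasi_uniform M.

Lemma Vspace_vL2 v : Vspace P GD v -> vL2 lam Om v.
Proof. by move=> hv j; case: (Vspace_H1 j hv). Qed.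

Lemma Vh_trace : exists2 C, 0 < C & forall Th, M Th -> forall v, Vh P GD k Th v ->
  forall G, measurable G -> G `<=` boundary P ->
  vL2 (surface P) G v /\ L2prod (surface P) G v v <= C / mesh_size Th * L2prod lam Om v v.
Proof.
have [C C0 hC] := @discrete_trace R d P d0 k M cM qM; exists C => // Th MTh v [Vv cv pv] G mG GB.
have mOm := @measurable_domain R d P.
have vL := Vspace_vL2 Vv.
have pj j K : K \in Th -> exists p, is_polynomial k p /\ {in simplex K, forall x, v x ord0 j = p x}.
  by move=> KTh; exact: pv.
have mv j := piecewise_polynomial_measurable (cM MTh) (pj j).
have bsub : boundary P `<=` closed_domain P by rewrite boundaryE => x [].
have mGv j : measurable_fun G (fun x => v x ord0 j).
  by apply: measurable_funS (mv j); [exact: measurable_closed_domain|exact: subset_trans bsub].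
have bound j : (\int[surface P]_(x in G) (v x ord0 j ^+ 2)%:E <=
    (C / mesh_size Th)%:E * \int[lam]_(x in Om) (v x ord0 j ^+ 2)%:E)%E.
  apply: le_trans (hC Th MTh _ (pj j)); apply: ge0_subset_integral => //.
  - exact: measurable_boundary.
  - apply/measurable_EFinP; apply: measurable_funX.
    by apply: measurable_funS (mv j) => //; exact: measurable_closed_domain.
  - by move=> x _; rewrite lee_fin sqr_ge0.
have LG : vL2 (surface P) G v.
  move=> j; split; first exact: mGv.
  apply: (le_lt_trans (bound j)); rewrite -Rintegral_sqr_fin//.
  by rewrite -EFinM ltry.
split=> //; rewrite !L2prod_sqr_sum// mulr_sumr; apply: ler_sum => j _.
by have := bound j; rewrite -!Rintegral_sqr_fin// -EFinM lee_fin.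
Qed.

(** The inverse inequality bounds v at any point of an element by its L_2 norm on a cube inside this
    element. So v vanishes at every point of the closed domain and not just almost everywhere, as
    independence in [Vh_basis] requires. *)
Lemma Vh_definite Th v : M Th -> Vh P GD k Th v -> L2prod lam Om v v = 0 ->
  forall x, closed_domain P x -> v x = 0.
Proof.
move=> MTh [Vv cv pv] v0 x xc; have cTh := cM MTh.
have mOm := @measurable_domain R d P; have mC := @measurable_closed_domain R d P.
have vL := Vspace_vL2 Vv.
have [kappa [kap0 hkap]] := qM.
have d1 : 0 < d%:R :> R by rewrite ltr0n.
set h := mesh_size Th; have h0 : 0 < h := mesh_size_gt0 cTh d0.
pose r := kappa * h / (2 * d%:R).
have r0 : 0 < r by rewrite divr_gt0 ?mulr_gt0.
have [C C0 hC] := @coord_poly_sup_le R k (h / r).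
have [K KTh Kx] := closed_sub_simplices cTh xc.
have [z hz] := hkap Th MTh K KTh.
have cubeK : cube z r `<=` simplex K.
  move=> y /cubeE yz; apply: hz => /=; apply: (@le_lt_trans _ _ (d%:R * r)).
    by apply: enorm_le => [|i]; [exact: ltW|rewrite !mxE; exact: yz].
  rewrite (_ : d%:R * r = kappa * h / 2); last by rewrite /r; field; rewrite gt_eqF.
  by have : 0 < kappa * h := mulr_gt0 kap0 h0; rewrite -/h; lra.
have zK : simplex K z by apply: cubeK; apply/cubeE => i; rewrite subrr normr0 ltW.
apply/rowP => j; rewrite mxE.
have [p [hp vp]] := pv K KTh j.
have mv : measurable_fun (closed_domain P) (fun x => v x ord0 j).
  by apply: (piecewise_polynomial_measurable cTh (k := k)) => L LTh; exact: pv.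
have mv2 : measurable_fun (closed_domain P) (fun x => (v x ord0 j ^+ 2)%:E).
  by apply/measurable_EFinP; apply: measurable_funX.
have I0 : (\int[lam]_(x in closed_domain P) (v x ord0 j ^+ 2)%:E = 0)%E.
  rewrite (@ge0_negligible_integral _ _ _ lam _ (boundary P))//; last 3 first.
  - exact: measurable_boundary.
  - by move=> y _; rewrite lee_fin sqr_ge0.
  - exact: lebesgue_boundary.
  rewrite boundaryE setDD setIC setIidl; last exact: domain_sub_closed.
  rewrite -Rintegral_sqr_fin//; congr EFin.
  have := v0; rewrite L2prod_sqr_sum// => /psumr_eq0P; apply => // i _.
  by apply: Rintegral_ge0 => y _; exact: sqr_ge0.
have xz : cube z (h / r * r) x.
  apply/cubeE => i; rewrite divfK ?gt_eqF//; apply: le_trans (simplex_dist_le cTh KTh Kx zK).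
  by have := enorm_coord_le (x - z) i; rewrite !mxE.
have := hC d p (is_polynomial_measurable hp) (is_polynomial_coord_poly hp) z r x r0 xz.
rewrite (eq_integral (fun y => (v y ord0 j ^+ 2)%:E)); last first.
  by move=> y; rewrite inE => /cubeK Ky; rewrite vp ?inE.
have -> : (\int[lam]_(y in cube z r) (v y ord0 j ^+ 2)%:E = 0)%E.
  apply/eqP; rewrite eq_le -{1}I0; apply/andP; split; last first.
    by apply: integral_ge0 => y _; rewrite lee_fin sqr_ge0.
  apply: ge0_subset_integral => //; first exact: measurable_cube.
    by move=> y _; rewrite lee_fin sqr_ge0.
  by move=> y /cubeK; exact: (simplex_sub_closed cTh KTh).
rewrite mule0 lee_fin -vp ?inE// => h2; apply/eqP.
by rewrite -sqrf_eq0 eq_le h2 sqr_ge0.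
Qed.

End discrete_functions.

Lemma sqr_sum_le (R : realType) (x y a b C n : R) : x ^+ 2 <= a * n -> y ^+ 2 <= b * (C * n) ->
  (x + y) ^+ 2 <= 2 * (a + C * b) * n.
Proof.
move=> hx hy; apply: le_trans (sqrrD_le x y) _.
rewrite (_ : 2 * (a + C * b) * n = 2 * (a * n) + 2 * (b * (C * n))); last by ring.
by lra.
Qed.

Section load_form.
Context {R : realType} {d : nat} (P : polytopic_domain R d) (G : set 'rV[R]_d).
Local Notation Om := (domain_set P).
Local Notation lam := (@lebesgue_rV R d).
Hypothesis mG : measurable G.
Variables f g : 'rV[R]_d -> 'rV[R]_d.
Hypothesis Lf : vL2 lam Om f.
Hypothesis Lg : vL2 (surface P) G g.

Lemma load_lin (a : R) w v : vL2 lam Om w -> vL2 (surface P) G w -> vL2 lam Om v ->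
  vL2 (surface P) G v ->
  load P G f g (fun x => a *: w x + v x) = a * load P G f g w + load P G f g v.
Proof.
move=> w1 w2 v1 v2; have mOm := @measurable_domain R d P.
rewrite /load !(L2prod_sym _ _ f) !(L2prod_sym _ _ g) L2prod_lin// L2prod_lin//.
by rewrite mulrDr addrACA.
Qed.

Lemma load_sqr_le (C : R) v : 0 <= C -> vL2 lam Om v -> vL2 (surface P) G v ->
  L2prod (surface P) G v v <= C * L2prod lam Om v v ->
  load P G f g v ^+ 2 <=
    2 * (L2prod lam Om f f + C * L2prod (surface P) G g g) * L2prod lam Om v v.
Proof.
move=> C0 v1 v2 hv; have mOm := @measurable_domain R d P.
have h1 := L2prod_cauchy_schwarz mOm Lf v1.
have h2 := L2prod_cauchy_schwarz mG Lg v2.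
have h3 := ler_wpM2l (L2prod_ge0 (surface P) G g) hv.
exact: sqr_sum_le h1 (le_trans h2 h3).
Qed.

End load_form.

(** * Constants, and assembly of the theorem *)

Lemma quadrature_weight_le (R : realType) (p : R) n : 1 < p < 2 ->
  `|initial_weight p n.+1 + initial_weight p n - frac_kernel p n| <= 4.
Proof.
move=> p12; have /andP[i1 i2] := initial_weight_le p12 n; have /andP[j1 j2] := initial_weight_le p12 n.+1.
have b1 := frac_kernel_ge0 p12 n; have b2 := frac_kernel_le p12 n.
by case/andP: p12 => _ p2; rewrite ler_norml; apply/andP; split; lra.
Qed.

(** The load part of B carries a factor T, the initial part need not; writing both as a multiple of
    T (w + X) is what puts the division by T into the constant. The number 16 is the square of the
    bound 4 of [quadrature_weight_le]. *)
Lemma energy_constant_le (R : realType) (rho kap T K c cT Ct m0 a0 w X S B : R) :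
  0 < rho -> 0 < kap -> 0 < T -> 0 <= K -> 0 <= c -> c <= cT -> m0 <= K * a0 -> 0 <= a0 -> a0 <= w ->
  S <= 2 * (1 + Ct) * X ->
  0 <= X -> 0 <= Ct -> B = 2 * (rho * m0 + c * T * (4 ^+ 2 / kap * a0) / 2) + 8 / rho * (T * S) ->
  B <= (2 * (rho * K + cT * T * (16 / kap) / 2) / T + 16 / rho * (1 + Ct)) * (T * (w + X)).
Proof.
move=> rho0 kap0 T0 K0 c0 cT0 hm a00 aw hS X0 Ct0 ->.
have w0 : 0 <= w := le_trans a00 aw.
have h1 : rho * m0 <= rho * K * w.
  by rewrite -mulrA ler_pM2l//; apply: le_trans hm _; rewrite ler_wpM2l.
have h2 : c * T * (4 ^+ 2 / kap * a0) <= cT * T * (16 / kap) * w.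
  rewrite (_ : 4 ^+ 2 = 16 :> R); last by rewrite -natrX.
  rewrite mulrA; apply: ler_pM => //; first by apply: mulr_ge0; [exact: mulr_ge0 c0 (ltW T0)|exact: ltW (divr_gt0 _ _)].
  by rewrite ler_pM2r ?divr_gt0// ler_pM2r.
have h3 : 8 / rho * (T * S) <= 16 / rho * (1 + Ct) * (T * X).
  rewrite (_ : 16 / rho * (1 + Ct) * (T * X) = 8 / rho * (T * (2 * (1 + Ct) * X))); last by ring.
  by rewrite ler_pM2l ?divr_gt0// ler_pM2l.
have h4 : 0 <= 2 * (rho * K + cT * T * (16 / kap) / 2) * X.
  have c1 := le_trans c0 cT0; have k1 : 0 <= 16 / kap by rewrite divr_ge0// ltW.
  have T1 := ltW T0; have r1 := ltW rho0.
  have q1 : 0 <= rho * K := mulr_ge0 r1 K0.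
  have q2 : 0 <= cT * T * (16 / kap) / 2 := divr_ge0 (mulr_ge0 (mulr_ge0 c1 T1) k1) (ler0n _ 2).
  exact: mulr_ge0 (mulr_ge0 (ler0n _ 2) (addr_ge0 q1 q2)) X0.
have h5 : 0 <= 16 / rho * (1 + Ct) * (T * w).
  have T1 := ltW T0; have r1 := ltW rho0.
  exact: mulr_ge0 (mulr_ge0 (divr_ge0 (ler0n _ 16) r1) (addr_ge0 ler01 Ct0)) (mulr_ge0 T1 w0).
rewrite [leRHS]mulrDl (_ : 2 * (rho * K + cT * T * (16 / kap) / 2) / T * (T * (w + X)) =
  2 * (rho * K * w) + cT * T * (16 / kap) * w + 2 * (rho * K + cT * T * (16 / kap) / 2) * X); last first.
  by field; rewrite !gt_eqF.
rewrite (_ : 16 / rho * (1 + Ct) * (T * (w + X)) =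
  16 / rho * (1 + Ct) * (T * X) + 16 / rho * (1 + Ct) * (T * w)); last by ring.
move: h1 h2 h3 h4 h5.
move: (rho * m0) (rho * K * w) (c * T * _) (cT * T * (16 / kap) * w) (8 / rho * _)
  (16 / rho * (1 + Ct) * (T * X)) (2 * _ * X) (16 / rho * (1 + Ct) * (T * w)) => *.
lra.
Qed.

Theorem theorem4p3 (R : realType) (d k : nat) (P : polytopic_domain R d)
    (GD : set 'rV[R]_d) (tmax rho alpha : R)
    (D : 'rV[R]_d -> tensor4 R d) (M : set (mesh R d)) :
  (0 < d <= 3)%N ->
  (0 < k)%N ->
  measurable GD ->
  GD `<=` boundary P ->
  (0 < surface P GD)%E ->
  0 < tmax ->
  0 < rho ->
  0 < alpha < 1 ->
  (forall x, domain_set P x -> tensor_symmetric (D x)) ->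
  (forall x, domain_set P x -> tensor_posdef (D x)) ->
  piecewise_constant (domain_set P) D ->
  (forall Th, M Th -> conforming (domain_set P) Th) ->
  quasi_uniform M ->
  let Om := domain_set P in
  let GN := boundary P `\` GD in
  let lam := @lebesgue_rV R d in
  exists C : R, 0 < C /\
    forall (f g : R -> 'rV[R]_d -> 'rV[R]_d) (w0 : 'rV[R]_d -> 'rV[R]_d)
      (N : nat) (Th : mesh R d),
    (0 < N)%N ->
    M Th ->
    let dt := tmax / N%:R in
    let t (n : nat) : R := n%:R * dt in
    let h := mesh_size Th in
    bochner_L2 lam Om tmax f ->
    bochner_L2 (surface P) GN tmax g ->
    (forall n, (n <= N)%N -> vL2 lam Om (f (t n))) ->
    (forall n, (n <= N)%N -> vL2 (surface P) GN (g (t n))) ->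
    Vspace P GD w0 ->
    exists W : nat -> 'rV[R]_d -> 'rV[R]_d,
    [/\ fully_discrete_solution P GN D rho alpha tmax f g w0 N (Vh P GD k Th) W,
        forall W' : nat -> 'rV[R]_d -> 'rV[R]_d,
          fully_discrete_solution P GN D rho alpha tmax f g w0 N
            (Vh P GD k Th) W' ->
          forall n, (n <= N)%N -> {in closure Om, W' n =1 W n} &
        \big[Num.max/0]_(n < N.+1) (L2norm lam Om (W n) ^+ 2)
        + dt `^ (2 - alpha) / Gamma (3 - alpha)
          * \sum_(n < N) Vnorm Om D (fun x => W n.+1 x + W n x) ^+ 2
        <= C * tmax *
           (Vnorm Om D w0 ^+ 2
            + dt * \sum_(n < N.+1) L2norm lam Om (f (t n)) ^+ 2
            + dt * \sum_(n < N.+1)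
                h^-1 * L2norm (surface P) GN (g (t n)) ^+ 2)].
Proof.
move=> /andP[d0 _] _ mGD GDB GD0 T0 rho0 /andP[al0 al1] Dsym Dpos Dpc cM qM Om GN lam.
have mOm : measurable Om := @measurable_domain R d P.
have mGN : measurable GN by apply: measurableD => //; exact: measurable_boundary.
have GNB : GN `<=` boundary P by move=> x [].
have Omc : Om `<=` closed_domain P := @domain_sub_closed R d P.
have GNc : GN `<=` closed_domain P by move=> x /GNB; rewrite boundaryE => -[].
have [CK CK0 hK] := korn_poincare mGD GDB GD0.
have [cD cD0 hD] := aform_coercive GD Dpos Dpc.
have [Ct Ct0 hCt] := Vh_trace GD d0 k cM qM.
pose p := 2 - alpha.
have p12 : 1 < p < 2 by rewrite /p; apply/andP; split; lra.
pose beta := frac_kernel p.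
pose kap := 2 - (2 * beta 1%N - beta 2).
have kap0 : 0 < kap by have := frac_kernel_defect p12; rewrite /kap /beta; lra.
have G0 := @Gamma_ge0 R (3 - alpha).
(* Bounds the factor [c] of the quadrature uniformly in the time step, since dt <= tmax and 1 -
   alpha > 0. *)
pose cT := tmax `^ (1 - alpha) / Gamma (3 - alpha).
have cT0 : 0 <= cT by rewrite divr_ge0// powR_ge0.
pose K := CK / cD; have K0 : 0 <= K by rewrite divr_ge0// ltW.
pose C1 := 2 * (rho * K + cT * tmax * (16 / kap) / 2) / tmax + 16 / rho * (1 + Ct).
have C10 : 0 <= C1.
  have T1 := ltW T0; have r1 := ltW rho0; have k1 : 0 <= 16 / kap by rewrite divr_ge0// ltW.
  have q1 : 0 <= rho * K := mulr_ge0 r1 K0.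
  have q2 : 0 <= cT * tmax * (16 / kap) / 2 := divr_ge0 (mulr_ge0 (mulr_ge0 cT0 T1) k1) (ler0n _ 2).
  exact: addr_ge0 (divr_ge0 (mulr_ge0 (ler0n _ 2) (addr_ge0 q1 q2)) T1)
    (mulr_ge0 (divr_ge0 (ler0n _ 16) r1) (addr_ge0 ler01 (ltW Ct0))).
have rk0 : 0 <= 1 / rho + 8 / kap by rewrite addr_ge0// divr_ge0// ltW.
(* From the bound B of [discrete_energy_le], the factor 1 / rho recovers the L_2 norms and 8 / kap
   the sum of energies; the leading 1 makes the constant positive. *)
exists (1 + (1 / rho + 8 / kap) * C1); split; first by rewrite ltr_pwDl// mulr_ge0.
move=> f g w0 N Th N0 MTh dt t h _ _ Lf Lg Vw0.
have dt0 : 0 < dt by rewrite divr_gt0// ltr0n.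
have dtT : dt <= tmax by rewrite ler_pdivrMr ?ltr0n// ler_peMr ?ler1n// ltW.
have h0 : 0 < h := mesh_size_gt0 (cM Th MTh) d0.
have [r [phi [hphi span indep]]] := @Vh_basis R d P GD k Th (cM Th MTh).
pose ph (y : 'rV[R]_r) (x : 'rV[R]_d) := \sum_i y ord0 i *: phi i x.
have phV y : Vh P GD k Th (ph y) := Vh_sum y hphi.
have VhV v : Vh P GD k Th v -> Vspace P GD v by case.
have phl s y z : ph (s *: y + z) = fun x => s *: ph y x + ph z x.
  apply/funext => x; rewrite /ph scaler_sumr -big_split/=; apply: eq_bigr => i _.
  by rewrite !mxE scalerDl scalerA.
have phZ s y x : ph (s *: y) x = s *: ph y x.
  by rewrite /ph scaler_sumr; apply: eq_bigr => i _; rewrite mxE scalerA.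
have phD y z x : ph (y + z) x = ph y x + ph z x by rewrite -[y in LHS]scale1r phl scale1r.
have phB y z x : ph (y - z) x = ph y x - ph z x by rewrite phD -scaleN1r phZ scaleN1r.
have ph0 x : ph 0 x = 0 by rewrite -(scale0r 0) phZ scale0r.
have VL v : Vspace P GD v -> vL2 lam Om v := @Vspace_vL2 R d P GD v.
have phS y := VhV _ (phV y); have phL y := VL _ (phS y).
have phG y : vL2 (surface P) GN (ph y) by case: (hCt Th MTh _ (phV y) GN mGN GNB).
pose a y z := aform Om D (ph y) (ph z).
pose m y z := L2prod lam Om (ph y) (ph z).
have a_lin s u v w : a (s *: u + v) w = s * a u w + a v w by rewrite /a phl; exact: aform_lin (phS _) (phS _) (phS _).
have a_sym u v : a u v = a v u by exact: aform_sym.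
have a_ge0 u : 0 <= a u u by exact: aform_ge0 (phS _).
have m_lin s u v w : m (s *: u + v) w = s * m u w + m v w by rewrite /m phl; exact: L2prod_lin.
have m_sym u v : m u v = m v u by exact: L2prod_sym.
have m_ge0 u : 0 <= m u u by exact: L2prod_ge0.
have m_def u : m u u = 0 -> u = 0.
  by move=> mu; apply: indep => x xc; exact: (Vh_definite d0 cM qM MTh (phV u) mu).
have m_le_a u : m u u <= K * a u u.
  apply: le_trans (hK _ (phS u)) _; rewrite /K -mulrA ler_pM2l// mulrC ler_pdivlMr// mulrC.
  exact: hD (phS u).
have a_def u : a u u = 0 -> u = 0.
  move=> au; apply: m_def; apply/eqP; rewrite eq_le m_ge0 andbT.
  by apply: le_trans (m_le_a u) _; rewrite au mulr0.
pose c := dt `^ (1 - alpha) / Gamma (3 - alpha).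
have c0 : 0 <= c by rewrite divr_ge0// powR_ge0.
have ccT : c <= cT.
  rewrite ler_wpM2r ?invr_ge0//; apply: ge0_ler_powR => //; rewrite ?nnegrE; [lra|exact: ltW|exact: ltW].
pose wt n := initial_weight p n.+1 + initial_weight p n - beta n.
have wt_le n : `|wt n| <= 4 := quadrature_weight_le n p12.
(* The abstract scheme wants linear loads for all n, while the data are square-integrable at the
   grid points up to N; the default is zero. *)
pose F n z := if (n <= N)%N then load P GN (f (t n)) (g (t n)) (ph z) else 0.
have F_lin n s u v : F n (s *: u + v) = s * F n u + F n v.
  rewrite /F; case: ifPn => nN; last by rewrite mulr0 addr0.
  by rewrite phl; apply: load_lin => //; [exact: Lf|exact: Lg].
(* The 2 separates volume and Neumann loads; Ct / h is the price of measuring the trace of a test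
   field by its L_2 norm on the domain. *)
pose gg n := 2 * (L2norm lam Om (f (t n)) ^+ 2 + Ct / h * L2norm (surface P) GN (g (t n)) ^+ 2).
have Cth : 0 <= Ct / h by rewrite divr_ge0// ltW.
have gg0 n : 0 <= gg n.
  by rewrite mulr_ge0// addr_ge0 ?sqr_ge0// mulr_ge0// sqr_ge0.
have F_le n z : (n <= N)%N -> F n z ^+ 2 <= gg n * m z z.
  move=> nN; rewrite /F nN /gg !sqr_sqrtr ?L2prod_ge0//.
  apply: load_sqr_le => //; [exact: Lf|exact: Lg|].
  by case: (hCt Th MTh _ (phV z) GN mGN GNB).
pose l0 z := aform Om D w0 (ph z).
have l0_lin s u v : l0 (s *: u + v) = s * l0 u + l0 v.
  have e z : l0 z = aform Om D (ph z) w0 := aform_sym Dsym w0 (ph z).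
  by rewrite !e phl; exact: aform_lin (phS _) (phS _) Vw0.
pose Sol := scheme_solution a m (rho / dt) (c / 2) beta wt F l0 N.
(* Agreement of fields and coordinates on the closed domain is enough, because every integral in the
   scheme is over [Om] or over [GN], and weak derivatives depend on the values in [Om] only. *)
have equiv W y : (forall n, (n <= N)%N -> Vh P GD k Th (W n)) ->
    (forall n, (n <= N)%N -> forall x, closed_domain P x -> W n x = ph (y n) x) ->
    fully_discrete_solution P GN D rho alpha tmax f g w0 N (Vh P GD k Th) W <-> Sol y.
  move=> WV Wy.
  have e0 v z : (forall x, closed_domain P x -> v x = ph z x) ->
      (aform Om D (W 0%N) v = aform Om D w0 v) <-> (a (y 0%N) z = l0 z).
    move=> vz; rewrite /a /l0 (eq_aform D (w := W 0%N) (w' := ph (y 0%N)) (v := v) (v' := ph z)).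
    - by rewrite (eq_aform D (w := w0) (w' := w0) (v := v) (v' := ph z))// => x /Omc; exact: vz.
    - by move=> x /Omc; exact: Wy.
    - by move=> x /Omc; exact: vz.
  have eL n v z : (n < N)%N -> (forall x, closed_domain P x -> v x = ph z x) ->
      L2prod lam Om (fun x => rho *: (dt^-1 *: (W n.+1 x - W n x))) v =
      rho / dt * m (y n.+1 - y n) z.
    move=> nN vz; rewrite -(bilformZl m_lin) /m; apply: eq_L2prod => x /Omc xc; last exact: vz.
    by rewrite (Wy n.+1 nN x xc) (Wy n (ltnW nN) x xc) scalerA phZ phB.
  have eA n v z : (n < N)%N -> (forall x, closed_domain P x -> v x = ph z x) ->
      aform Om D (fun x => 2^-1 *: (qop alpha dt n.+1 W x + qop alpha dt n W x)) v =
      c / 2 * a (\sum_(i < n.+1) beta (n - i)%N *: (y i.+1 + y i) + wt n *: y 0%N) z.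
    move=> nN vz; rewrite -(bilformZl a_lin) /a; apply: eq_aform => x xOm; last exact: vz (Omc x xOm).
    rewrite qop_pair scalerA phZ phD phZ (mulrC 2^-1) (Wy 0%N (leq0n N) x (Omc x xOm)).
    congr (_ *: (_ + _)); rewrite (big_morph (ph^~ x) (fun u v => phD u v x) (ph0 x)).
    apply: eq_bigr => i _; have iN : (i < N)%N := leq_trans (ltn_ord i) nN.
    by rewrite phZ phD (Wy i.+1 iN x (Omc x xOm)) (Wy i (ltnW iN) x (Omc x xOm)).
  have eF n v z : (n <= N)%N -> (forall x, closed_domain P x -> v x = ph z x) ->
      load P GN (f (t n)) (g (t n)) v = F n z.
    move=> nN vz; rewrite /F nN /load; congr (_ + _); apply: eq_L2prod => // x.
      by move=> /Omc; exact: vz.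
    by move=> /GNc; exact: vz.
  have tr (L A f1 f2 L' A' f1' f2' : R) : L = L' -> A = A' -> f1 = f1' -> f2 = f2' ->
    (L + A = 2^-1 * (f1 + f2)) <-> (L' + A' = (f1' + f2') / 2).
    by move=> -> -> -> ->; rewrite mulrC.
  have eqn n v z (nN : (n < N)%N) (vz : forall x, closed_domain P x -> v x = ph z x) :=
    tr _ _ _ _ _ _ _ _ (eL n v z nN vz) (eA n v z nN vz) (eF n.+1 v z nN vz) (eF n v z (ltnW nN) vz).
  have refl z x (_ : closed_domain P x) := erefl (ph z x).
  split=> hS.
    have [_ h1 h2] := hS; split.
      by move=> z; exact: iffLR (e0 (ph z) z (refl z)) (h2 (ph z) (phV z)).
    by move=> n z nN; exact: iffLR (eqn n (ph z) z nN (refl z)) (h1 n nN (ph z) (phV z)).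
  have [h1 h2] := hS; split; first exact: WV.
    move=> n nN v vV; have [z vz] := span v vV.
    exact: iffRL (eqn n v z nN vz) (h2 n z nN).
  move=> v vV; have [z vz] := span v vV.
  exact: iffRL (e0 v z vz) (h1 z).
have rdt : 0 < rho / dt by rewrite divr_gt0.
have b0 : beta 0%N = 1 by [].
have c20 : 0 <= c / 2 by rewrite divr_ge0.
have [y Soly] := scheme_solvable a_lin a_sym a_ge0 a_def m_lin m_sym m_ge0 m_def wt rdt c20 b0 F_lin l0_lin N.
exists (fun n => ph (y n)); split.
- by apply/(equiv _ y).
- move=> W' solW'; have [W'V _ _] := solW'.
  have cW n : exists z, (n <= N)%N -> forall x, closed_domain P x -> W' n x = ph z x.
    (* [W' n] is a discrete field for n <= N only; beyond, the coordinates are set to 0. *)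
    have [nN|nN] := boolP (n <= N)%N; last by exists 0.
    by have [z hz] := span _ (W'V n nN); exists z.
  pose y' n := sval (cid (cW n)).
  have hy' n : (n <= N)%N -> forall x, closed_domain P x -> W' n x = ph (y' n) x := svalP (cid (cW n)).
  have Soly' : Sol y' by apply/(equiv W' y').
  move=> n nN x; rewrite inE closure_domain => xc; rewrite hy'//.
  by rewrite (scheme_unique a_lin a_ge0 a_def m_lin m_ge0 m_def rdt c20 b0 Soly Soly' nN).
have [y0 ys] := Soly.
have [B BE [Bm Ba]] := discrete_energy_le a_lin a_sym a_ge0 m_lin m_sym m_ge0 p12 N0 T0 rho0 c0 wt_le gg0 F_le ys.
pose w := aform Om D w0 w0.
(* W^0 is the Ritz projection of w_0, so a(W^0, W^0) = a(w_0, W^0); Cauchy-Schwarz and a division by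
   a(W^0, W^0), if it is not zero, give the bound. *)
have a0w : a (y 0%N) (y 0%N) <= w.
  have [a00|a00] := eqVneq (a (y 0%N) (y 0%N)) 0; first by rewrite a00; exact: aform_ge0 Vw0.
  have ap : 0 < a (y 0%N) (y 0%N) by rewrite lt_neqAle eq_sym a00 a_ge0.
  have := aform_cauchy_schwarz Dsym Dpos Dpc Vw0 (phS (y 0%N)).
  by rewrite -[aform Om D w0 (ph _)]/(l0 (y 0%N)) -y0 expr2 -/(a _ _) ler_pM2r.
pose SF := dt * \sum_(n < N.+1) L2norm lam Om (f (t n)) ^+ 2.
pose SG := dt * \sum_(n < N.+1) h^-1 * L2norm (surface P) GN (g (t n)) ^+ 2.
have SF0 : 0 <= SF by rewrite mulr_ge0 ?sumr_ge0// ?ltW// => n _; exact: sqr_ge0.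
have SG0 : 0 <= SG.
  by rewrite mulr_ge0 ?sumr_ge0// ?ltW// => n _; rewrite mulr_ge0 ?sqr_ge0// invr_ge0 ltW.
have SE : dt * \sum_(n < N.+1) gg n = 2 * (SF + Ct * SG).
  have e : \sum_(n < N.+1) gg n = 2 * (\sum_(n < N.+1) L2norm lam Om (f (t n)) ^+ 2 +
      Ct * \sum_(n < N.+1) h^-1 * L2norm (surface P) GN (g (t n)) ^+ 2).
    rewrite [Ct * _]mulr_sumr -big_split/= mulr_sumr; apply: eq_bigr => n _.
    by rewrite /gg -[Ct / h * _]mulrA.
  by rewrite e mulrCA mulrDr [dt * (Ct * _)]mulrCA.
have hB : B <= C1 * (tmax * (w + (SF + SG))).
  apply: energy_constant_le rho0 kap0 T0 K0 c0 ccT (m_le_a _) (a_ge0 _) a0w _ _ (ltW Ct0) BE.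
    rewrite -/dt SE -mulrA ler_pM2l// mulrDl mul1r.
    have : 0 <= SG + Ct * SF by rewrite addr_ge0// mulr_ge0// ltW.
    by rewrite mulrDr; lra.
  exact: addr_ge0.
have B0 : 0 <= B by apply: le_trans (Bm 0%N (leq0n _)); rewrite mulr_ge0// ltW.
rewrite /Vnorm [in leRHS]sqr_sqrtr ?(aform_ge0 Dpos Dpc Vw0)// -/w -/SF -/SG -(addrA w).
apply: (@le_trans _ _ ((1 / rho + 8 / kap) * B)).
  rewrite mulrDl; apply: lerD.
    apply: bigmax_le => [|n _]; first by rewrite mulr_ge0// divr_ge0// ltW.
    rewrite /L2norm sqr_sqrtr ?L2prod_ge0// mul1r mulrC ler_pdivlMr// mulrC.
    by apply: Bm; rewrite -ltnS.
  rewrite (_ : dt `^ (2 - alpha) / Gamma (3 - alpha) = c * dt); last first.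
    rewrite /c mulrAC; congr (_ / _).
    rewrite (_ : 1 - alpha = p - 1); last by rewrite /p; ring.
    by rewrite mulrC mulr_powRB1// ?ltW//; case/andP: p12 => p1 _; exact: lt_trans p1.
  under eq_bigr => n _.
    rewrite (_ : (fun x => ph (y n.+1) x + ph (y n) x) = ph (y n.+1 + y n)); last first.
      by apply/funext => x; rewrite phD.
    rewrite sqr_sqrtr; last exact: a_ge0.
    over.
  have real (u v b : R) : u * kap / 8 * v <= b -> u * v <= 8 / kap * b.
    move=> hu; rewrite (_ : u * v = 8 / kap * (u * kap / 8 * v)); last by field; rewrite gt_eqF.
    by rewrite ler_pM2l// divr_gt0.
  exact: real _ _ _ Ba.
have T1 : 0 <= tmax * (w + (SF + SG)).
  exact: mulr_ge0 (ltW T0) (addr_ge0 (le_trans (a_ge0 _) a0w) (addr_ge0 SF0 SG0)).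
apply: (@le_trans _ _ ((1 / rho + 8 / kap) * (C1 * (tmax * (w + (SF + SG)))))).
  by rewrite ler_wpM2l.
have fin (u v x q : R) : 0 <= x * q -> u * (v * (x * q)) <= (1 + u * v) * x * q.
  by move=> xq; rewrite -subr_ge0 (_ : _ - _ = x * q)//; ring.
exact: fin T1.
Qed.
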